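(* Let $\mathbf{k}$ be an algebraically closed field, let $m,n\ge 0$ be integers, and let $S=\mathbf{k}[x_1,\ldots,x_m,y_1,\ldots,y_n]$ be the standard $\mathbb{Z}^2$-graded polynomial ring with $\deg(x_i)=(1,0)$ and $\deg(y_j)=(0,1)$. Then every Cartwright--Sturmfels Hilbert scheme of $S$ is smooth and irreducible. That is: if $\mathfrak{h}:\mathbb{Z}^2\to\mathbb{N}$ is a function such that the multigraded Hilbert scheme $\mathcal{H}^{\mathfrak{h}}_{\mathbf{k}}(S)$ is non-empty and every ideal of $S$ that it parameterizes (i.e. every homogeneous ideal $I\subseteq S$ with Hilbert function $\mathrm{HF}_I=\mathfrak{h}$) is radical, then $\mathcal{H}^{\mathfrak{h}}_{\mathbf{k}}(S)$ is a smooth and irreducible $\mathbf{k}$-scheme.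
   Context: Homogeneous means homogeneous for the $\mathbb{Z}^2$-grading. For a homogeneous ideal $I\subseteq S$, its Hilbert function is $\mathrm{HF}_I(\delta)=\dim_{\mathbf{k}}[S/I]_\delta$ for $\delta\in\mathbb{Z}^2$. For a function $\mathfrak{h}:\mathbb{Z}^2\to\mathbb{N}$, the multigraded Hilbert scheme $\mathcal{H}^{\mathfrak{h}}_{\mathbf{k}}(S)$ (Haiman--Sturmfels) is the (projective) $\mathbf{k}$-scheme representing the functor that sends a $\mathbf{k}$-scheme $Z'$ to the set of homogeneous sheaves of ideals $\mathscr{I}\subseteq S\otimes_{\mathbf{k}}\mathscr{O}_{Z'}$ such that, for each $\delta\in\mathbb{Z}^2$, the quotient $[S]_\delta\otimes_{\mathbf{k}}\mathscr{O}_{Z'}/[\mathscr{I}]_\delta$ is locally free on $Z'$ of rank $\mathfrak{h}(\delta)$ (functorial by pullback). Its $\mathbf{k}$-points are the homogeneous ideals $I\subseteq S$ with $\mathrm{HF}_I=\mathfrak{h}$; these are the ideals it parameterizes. A multigraded Hilbert scheme is called Cartwright--Sturmfels if it only parameterizes radical ideals. *)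

(* Defs.v *)
From HB Require Import structures.
From mathcomp Require Import all_boot all_order all_algebra.
From mathcomp Require Import boolp classical_sets functions topology.
From mathcomp Require Import mpoly.

Set Implicit Arguments.
Unset Strict Implicit.
Unset Printing Implicit Defensive.

Import Order.TTheory GRing.Theory.
Local Open Scope classical_set_scope.
Local Open Scope ring_scope.

(** Schemes over a field [k] are locally ringed spaces covered by affine opens.
    Sections live in [comPzRingType], so that the empty open set may have the
    zero ring of sections. *)

Record open_set (X : topologicalType) :=
  OpenSet { oset :> set X; oset_open : open oset }.

Definition open_pred (X : topologicalType) (U : open_set X) (x : X) : Prop :=
  oset U x.
Coercion open_pred : open_set >-> Funclass.

Definition open_setT (X : topologicalType) : open_set X := OpenSet (@openT X).

Record ringed_space (k : fieldType) := RingedSpace {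
  points :> topologicalType;
  sections : open_set points -> comPzRingType;
  res : forall U V : open_set points,
    V `<=` U -> {rmorphism sections U -> sections V};
  scalar : forall U : open_set points, {rmorphism k -> sections U};
  res_id : forall (U : open_set points) (hU : U `<=` U) (s : sections U),
    res hU s = s;
  res_comp : forall (U V W : open_set points)
    (hVU : V `<=` U) (hWV : W `<=` V) (hWU : W `<=` U) (s : sections U),
    res hWV (res hVU s) = res hWU s;
  res_scalar : forall (U V : open_set points) (hVU : V `<=` U) (a : k),
    res hVU (scalar U a) = scalar V a;
  glue : forall (U : open_set points) (J : Type) (V : J -> open_set points)
    (hV : forall j, V j `<=` U) (s : forall j, sections (V j)),
    (forall x, U x -> exists j, V j x) ->
    (forall i j (W : open_set points) (hi : W `<=` V i) (hj : W `<=` V j),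
       res hi (s i) = res hj (s j)) ->
    exists! t : sections U, forall j, res (hV j) t = s j
}.

Section LocallyRinged.
Context (k : fieldType) (X : ringed_space k).

(* The germ of [s] at [x] is a unit of the stalk at [x]. *)
Definition unit_at (x : X) (U : open_set X) (s : sections U) : Prop :=
  exists (V : open_set X) (hV : V `<=` U) (t : sections V),
    V x /\ res hV s * t = 1.

(* Every stalk is a local ring: it is nonzero, and if a sum of two elements is a
   unit then so is one of the two. *)
Definition locally_ringed : Prop :=
  forall (x : X) (U : open_set X), U x ->
    (1 : sections U) <> 0 /\
    forall s t : sections U,
      unit_at x (s + t) -> unit_at x s \/ unit_at x t.

Definition prime_ideal (A : comPzRingType) (P : set A) : Prop :=
  [/\ P 0, (forall a b, P a -> P b -> P (a + b)),
      (forall a b, P b -> P (a * b)), ~ P 1 &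
      forall a b, P (a * b) -> P a \/ P b].

Definition is_localization (A B : comPzRingType) (f : {rmorphism A -> B})
    (s : A) : Prop :=
  [/\ exists t, f s * t = 1,
      (forall b, exists a r, b * f s ^+ r = f a) &
      (forall a, f a = 0 -> exists r, s ^+ r * a = 0)].

(* The canonical morphism from [U] to the spectrum of [A := sections U], sending
   [x] to the prime of those [s] that are not units at [x], is an isomorphism:
   it is bijective, the basic opens [D(s)] pull back to a basis of the topology
   of [U], and the sections over [D(s)] are the localization [A_s]. *)
Definition affine_open (U : open_set X) : Prop :=
  [/\ (forall x y : X, U x -> U y ->
         (forall s : sections U, unit_at x s <-> unit_at y s) -> x = y),
      (forall P : set (sections U), prime_ideal P ->
         exists2 x : X, U x & forall s : sections U, P s <-> ~ unit_at x s),
      (forall (x : X) (V : open_set X), U x -> V x ->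
         exists2 s : sections U, unit_at x s &
           forall y, U y -> unit_at y s -> V y) &
      (forall (s : sections U) (W : open_set X) (hW : W `<=` U),
         (forall x, U x -> (W x <-> unit_at x s)) ->
         is_localization (res hW) s)].

End LocallyRinged.

Record scheme (k : fieldType) := Scheme {
  space :> ringed_space k;
  scheme_local : locally_ringed space;
  scheme_affine : forall x : space,
    exists2 U : open_set space, U x & affine_open U
}.

Definition affine (k : fieldType) (X : scheme k) : Prop :=
  affine_open (open_setT X).

(* Morphisms of [k]-schemes.  The map on sections is given from [U] to every
   open [W] contained in the preimage of [U]; by [comor_res] this is the same
   datum as a map of sheaves to the direct image. *)
Record morphism (k : fieldType) (Z X : scheme k) := Morphism {
  base :> Z -> X;
  base_cont : continuous base;
  comor : forall (U : open_set X) (W : open_set Z),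
    W `<=` base @^-1` U -> {rmorphism sections U -> sections W};
  comor_res : forall (U U' : open_set X) (W W' : open_set Z)
    (hW : W `<=` base @^-1` U) (hW' : W' `<=` base @^-1` U')
    (hU'U : U' `<=` U) (hW'W : W' `<=` W) (s : sections U),
    res hW'W (comor hW s) = comor hW' (res hU'U s);
  comor_scalar : forall (U : open_set X) (W : open_set Z)
    (hW : W `<=` base @^-1` U) (a : k),
    comor hW (scalar U a) = scalar W a;
  comor_local : forall (U : open_set X) (W : open_set Z)
    (hW : W `<=` base @^-1` U) (z : Z) (s : sections U),
    W z -> unit_at z (comor hW s) -> unit_at (base z) s
}.

Section Morphisms.
Context (k : fieldType).

Definition same_morphism (Z X : scheme k) (f g : morphism Z X) : Prop :=
  (forall z, f z = g z) /\
  forall (U : open_set X) (W : open_set Z)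
    (hf : W `<=` f @^-1` U) (hg : W `<=` g @^-1` U) (s : sections U),
    comor hf s = comor hg s.

(* [g] composed with [f] is [e]. *)
Definition is_comp (Y Z X : scheme k) (g : morphism Z X) (f : morphism Y Z)
    (e : morphism Y X) : Prop :=
  (forall y, g (f y) = e y) /\
  forall (U : open_set X) (V : open_set Z) (W : open_set Y)
    (hg : V `<=` g @^-1` U) (hf : W `<=` f @^-1` V) (he : W `<=` e @^-1` U)
    (s : sections U),
    comor hf (comor hg s) = comor he s.

Definition comorT (Z X : scheme k) (f : morphism Z X) :
    {rmorphism sections (open_setT X) -> sections (open_setT Z)} :=
  @comor k Z X f (open_setT X) (open_setT Z) (fun _ _ => I).

(* A closed immersion of affine schemes with ideal of square zero. *)
Definition affine_thickening (Y0 Y : scheme k) (i : morphism Y0 Y) : Prop :=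
  [/\ affine Y0, affine Y, (forall t, exists s, comorT i s = t) &
      (forall a b, comorT i a = 0 -> comorT i b = 0 -> a * b = 0)].

Definition formally_smooth (X : scheme k) : Prop :=
  forall (Y0 Y : scheme k) (i : morphism Y0 Y) (f0 : morphism Y0 X),
    affine_thickening i -> exists f : morphism Y X, is_comp f i f0.

(* [mmap] does not apply, as it requires the target ring to be nonzero. *)
Definition peval (r : nat) (A : comPzRingType) (c : {rmorphism k -> A})
    (t : 'I_r -> A) (p : {mpoly k[r]}) : A :=
  \sum_(u <- msupp p) c p@_u * \prod_(i < r) t i ^+ u i.

Definition finitely_presented (A : comPzRingType) (c : {rmorphism k -> A}) :
    Prop :=
  exists (r : nat) (t : 'I_r -> A),
    (forall a, exists p, peval c t p = a) /\
    exists (q : nat) (g : 'I_q -> {mpoly k[r]}), forall p : {mpoly k[r]},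
      peval c t p = 0 <->
      exists d : 'I_q -> {mpoly k[r]}, p = \sum_(j < q) d j * g j.

Definition locally_finitely_presented (X : scheme k) : Prop :=
  forall x : X, exists U : open_set X,
    [/\ U x, affine_open U & finitely_presented (scalar U)].

(* This is the definition of smoothness in EGA IV, 17.3.1. *)
Definition smooth (X : scheme k) : Prop :=
  locally_finitely_presented X /\ formally_smooth X.

End Morphisms.

Definition irreducible_space (X : topologicalType) : Prop :=
  [set: X] !=set0 /\
  forall U V : set X, open U -> open V ->
    U !=set0 -> V !=set0 -> U `&` V !=set0.

(* The first [m] variables are the [x_i], the last [n] are the [y_j]. *)
Definition bideg (m n : nat) (u : 'X_{1..m + n}) : int * int :=
  ((\sum_(i < m) u (lshift n i))%N%:Z, (\sum_(j < n) u (rshift m j))%N%:Z).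

Section Ideals.
Context (k : fieldType) (m n : nat).
Notation S := {mpoly k[m + n]}.

Definition bihomog (d : int * int) (f : S) : Prop :=
  forall u, u \in msupp f -> bideg u = d.

Definition component (d : int * int) (f : S) : S :=
  \sum_(u <- msupp f | bideg u == d) f@_u *: 'X_[u].

Definition is_ideal (I : set S) : Prop :=
  [/\ I 0, (forall f g, I f -> I g -> I (f + g)) &
      (forall f g, I g -> I (f * g))].

Definition homogeneous_ideal (I : set S) : Prop :=
  is_ideal I /\ forall f d, I f -> I (component d f).

(* For every [d], the quotient of the degree [d] part of [S] by that of [I] has
   a [k]-basis with [h d] elements. *)
Definition has_hilbert_function (I : set S) (h : int * int -> nat) : Prop :=
  forall d, exists b : 'I_(h d) -> S,
    (forall i, bihomog d (b i)) /\
    forall f, bihomog d f ->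
      exists! a : {ffun 'I_(h d) -> k}, I (f - \sum_i a i *: b i).

Definition radical (I : set S) : Prop := forall f r, I (f ^+ r) -> I f.

Definition cartwright_sturmfels (h : int * int -> nat) : Prop :=
  forall I : set S,
    homogeneous_ideal I -> has_hilbert_function I h -> radical I.

End Ideals.

Section HilbertScheme.
Context (k : fieldType) (m n : nat) (h : int * int -> nat).
Local Notation coefs U := ('X_{1..m + n} -> sections U).

(* The module of sections over [U] of the degree [d] part of [S (x) O_Z] is free
   on the monomials of bidegree [d]; its elements are encoded as coefficient
   functions on all monomials that vanish off bidegree [d]. *)
Definition homog_section (Z : scheme k) (U : open_set Z) (d : int * int)
    (c : coefs U) : Prop :=
  forall u, bideg u <> d -> c u = 0.

Definition mulmon (A : comPzRingType) (v : 'X_{1..m + n})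
    (c : 'X_{1..m + n} -> A) : 'X_{1..m + n} -> A :=
  fun u => if [forall i, (v i <= u i)%N] then c (u - v)%MM else 0.

(* Homogeneous sheaves of ideals of [S (x) O_Z], given by their graded pieces
   [fam d], with locally free quotients of rank [h d]. *)
Record hilb_family (Z : scheme k) := HilbFamily {
  fam :> forall (d : int * int) (U : open_set Z), set (coefs U);
  fam_homog : forall d U (c : coefs U), fam d c -> homog_section d c;
  fam0 : forall d (U : open_set Z), fam d (fun=> 0 : sections U);
  famD : forall d U (c c' : coefs U), fam d c -> fam d c' ->
    fam d (fun u => c u + c' u);
  famZ : forall d U (a : sections U) (c : coefs U), fam d c ->
    fam d (fun u => a * c u);
  famM : forall d U v (c : coefs U), fam d c ->
    fam (d + bideg v) (mulmon v c);
  fam_res : forall d (U V : open_set Z) (hVU : V `<=` U) (c : coefs U),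
    fam d c -> fam d (fun u => res hVU (c u));
  fam_local : forall d U (c : coefs U), homog_section d c ->
    (forall z, U z -> exists (V : open_set Z) (hVU : V `<=` U),
       V z /\ fam d (fun u => res hVU (c u))) ->
    fam d c;
  fam_locally_free : forall d (z : Z),
    exists (U : open_set Z) (b : 'I_(h d) -> coefs U),
      [/\ U z, (forall i, homog_section d (b i)) &
        forall (W : open_set Z) (hWU : W `<=` U) (c : coefs W),
          homog_section d c ->
          exists! a : {ffun 'I_(h d) -> sections W},
            fam d (fun u => c u - \sum_i a i * res hWU (b i u))]
}.

(* [J] is the pullback of [I] along [f]: its sections are those that are locally
   combinations of pulled back sections of [I].  (The quotient by [I] being
   locally free, [f^* I] injects into [S (x) O_Z].) *)
Definition is_pullback (Z X : scheme k) (f : morphism Z X)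
    (I : hilb_family X) (J : hilb_family Z) : Prop :=
  forall (d : int * int) (W : open_set Z) (c : coefs W),
    J d W c <->
    homog_section d c /\
    forall z, W z ->
      exists (U : open_set X) (V : open_set Z)
        (hVW : V `<=` W) (hVU : V `<=` f @^-1` U)
        (r : nat) (a : 'I_r -> sections V) (g : 'I_r -> coefs U),
      [/\ V z, (forall i, I d U (g i)) &
          forall u, res hVW (c u) = \sum_(i < r) a i * comor hVU (g i u)].

(* [H] represents the functor of families: it carries a universal family. *)
Definition multigraded_hilbert_scheme (H : scheme k) : Prop :=
  exists I : hilb_family H,
    forall (Z : scheme k) (J : hilb_family Z),
      exists f : morphism Z H,
        is_pullback f I J /\
        forall g : morphism Z H, is_pullback g I J -> same_morphism f g.

End HilbertScheme.

(* Main.v *)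
(* An ideal with Hilbert function [h] over a field degenerates, after a generic
   block change of coordinates, to a Borel-fixed ideal.  Being radical, that
   ideal is generated by monomials of bidegrees (1,0), (0,1) and (1,1), and it is
   determined by [h].  Every family is then, locally on the base, carried by a
   block-diagonal change of coordinates to a member of an explicit flat family
   of ideals with free parameters.  Hence there is a morphism [phi] from a
   nonempty basic open set of an affine space to [H] that has sections locally
   on [H]: [phi] is surjective, so [H] is irreducible, and [H] is locally a
   retract of a localised polynomial ring, so it is locally of finite
   presentation.  For formal smoothness, local lifts of a family across a
   square-zero thickening exist because the parameters are free.  A lift amounts
   to an idempotent matrix [p + w] on the monomials of degree at most 4, where
   [p] lifts a projector onto the given family and [w] has square-zero entries;
   stability under the variables is an affine linear condition on [w], so local
   solutions are glued by a partition of unity. *)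
From HB Require Import structures.
From mathcomp Require Import all_boot all_order all_algebra.
From mathcomp Require Import boolp classical_sets functions topology.
From mathcomp Require Import zify ring.
From mathcomp Require Import mpoly.
Require Import Defs.
Set Implicit Arguments.
Unset Strict Implicit.
Unset Printing Implicit Defensive.
Import Order.TTheory GRing.Theory.
Local Open Scope ring_scope.

(** Radicality is used for monomial ideals only: those with Hilbert function [h], among them the
    initial ideals of their shears. The parameters of the explicit family are free because its
    coefficients [tau] are products of corner parameters along staircases with unit steps, and this
    multiplicativity makes every S-pair reduce to zero identically. Three devices make arbitrary
    families tractable. A containment of ideals whose quotients are free of the same finite rank is
    an equality, so only generators and a few low bidegrees have to be examined. The generic
    coordinates are taken over [k], which is infinite, even for an ideal over a residue field; being
    constant they extend to a neighbourhood. Normal forms are compared by induction on the drop in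
    weight, where the first possible difference obeys linear equations, so that tangent space
    arguments work over any ring. Since the diagram depends on [h] alone, one parameter space serves
    all points of [H]. *)

Section LinearExtension.
Context (N : nat) (A : nzRingType) (V : lmodType A).

Definition lext (f : 'X_{1..N} -> V) (p : {mpoly A[N]}) : V :=
  \sum_(u <- msupp p) p@_u *: f u.

Lemma lextE f p (r : seq 'X_{1..N}) :
  uniq r -> {subset msupp p <= r} -> lext f p = \sum_(u <- r) p@_u *: f u.
Proof.
move=> Ur sub; rewrite /lext (bigID (mem (msupp p))) /=.
rewrite [X in _ = X](bigID (mem (msupp p))) /= [X in _ + X]big1 ?addr0; last first.
  by move=> u; rewrite -mcoeff_eq0 => /eqP->; rewrite scale0r.
rewrite [X in _ = _ + X]big1 ?addr0; last first.
  by move=> u; rewrite -mcoeff_eq0 => /eqP->; rewrite scale0r.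
rewrite -[LHS]big_filter -[RHS]big_filter; apply/perm_big/uniq_perm; rewrite ?filter_uniq ?msupp_uniq //.
move=> u; rewrite !mem_filter andbb; apply/idP/andP => [h|[] //].
by split=> //; apply: sub.
Qed.

Lemma lext_is_linear f : linear (lext f).
Proof.
move=> a p q; pose r := undup (msupp p ++ msupp q ++ msupp (a *: p + q)).
have Ur : uniq r by apply: undup_uniq.
rewrite !(@lextE _ _ r) //; try by
  move=> u hu; rewrite mem_undup !mem_cat hu ?orbT.
rewrite scaler_sumr -big_split /=; apply: eq_bigr => u _.
by rewrite mcoeffD mcoeffZ scalerDl scalerA.
Qed.
HB.instance Definition _ f :=
  GRing.isLinear.Build A {mpoly A[N]} V _ (lext f) (lext_is_linear f).

Lemma lextX f u : lext f 'X_[u] = f u.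
Proof. by rewrite /lext msuppX big_seq1 mcoeffX eqxx scale1r. Qed.

End LinearExtension.

(** * The bigrading and its monomials *)

Section Grading.
Context (m n : nat).
Local Notation N := (m + n)%N.
Implicit Types u v : 'X_{1..N}.

Lemma bidegD u v : bideg (u + v)%MM = bideg u + bideg v.
Proof.
rewrite /bideg; congr (_, _); rewrite /= -PoszD; congr Posz; rewrite -big_split;
by apply: eq_bigr => i _; rewrite mnmDE.
Qed.

Lemma bideg0 : bideg (0%MM : 'X_{1..N}) = 0.
Proof.
by rewrite /bideg; congr (_, _); rewrite big1 // => i _; rewrite mnm0E.
Qed.

Definition vx (i : 'I_m) : 'I_N := lshift n i.
Definition vy (j : 'I_n) : 'I_N := rshift m j.

Lemma bideg_vx i : bideg U_(vx i)%MM = (1, 0).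
Proof.
rewrite /bideg; congr (_, _).
  rewrite (bigD1 i) //= mnm1E eqxx big1 ?addn0 // => l li.
  by rewrite mnm1E eq_lshift eq_sym (negPf li).
by rewrite big1 // => l _; rewrite mnm1E eq_lrshift.
Qed.

Lemma bideg_vy j : bideg U_(vy j)%MM = (0, 1).
Proof.
rewrite /bideg; congr (_, _).
  by rewrite big1 // => l _; rewrite mnm1E eq_rlshift.
rewrite (bigD1 j) //= mnm1E eqxx big1 ?addn0 // => l li.
by rewrite mnm1E eq_rshift eq_sym (negPf li).
Qed.

Lemma var_cases (P : 'I_N -> Prop) :
  (forall i, P (vx i)) -> (forall j, P (vy j)) -> forall i, P i.
Proof. by move=> hx hy i; case: (split_ordP i) => l ->. Qed.

Lemma bideg_mdeg u : bideg u = ((bideg u).1, (bideg u).2) /\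
  (mdeg u)%:Z = (bideg u).1 + (bideg u).2.
Proof.
split; first by case: (bideg u).
by rewrite mdegE big_split_ord /= PoszD.
Qed.

(** A degree bound turns the monomials of bidegree [d] into a finite enumeration. The absolute
    values are there because [d] ranges over all pairs of integers; [mons d] is empty if a
    coordinate is negative. *)
Definition monb (d : int * int) : nat := (`|d.1| + `|d.2|).+1.
Definition mons (d : int * int) : seq 'X_{1..N} :=
  map val (seq.filter (fun u : 'X_{1..N < monb d} => bideg (val u) == d)
                  (enum {: 'X_{1..N < monb d}})).

Lemma mem_mons d u : (u \in mons d) = (bideg u == d).
Proof.
apply/mapP/idP => [[v]|/eqP hd].
  by rewrite mem_filter => /andP[+ _] ->.
have hb : (mdeg u < monb d)%N.
  have [_] := bideg_mdeg u; rewrite hd /monb => e.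
  by have := lez_abs (d.1 + d.2)%R; lia.
by exists (BMultinom hb) => //; rewrite mem_filter /= hd eqxx mem_enum.
Qed.

Lemma mons_uniq d : uniq (mons d).
Proof.
rewrite map_inj_uniq; last exact: val_inj.
by apply: filter_uniq; apply: enum_uniq.
Qed.

Section Ring.
Context (A : nzRingType).
Local Notation S := {mpoly A[N]}.

Definition bihom (d : int * int) (p : S) : Prop :=
  forall u, u \in msupp p -> bideg u = d.

Lemma bihomP d (p : S) : bihom d p <-> (forall u, bideg u <> d -> p@_u = 0).
Proof.
split=> [h u hu|h u]; first by apply: memN_msupp_eq0; apply/negP => /h.
by rewrite mcoeff_msupp => hu; apply: contrapT => /h /eqP; rewrite (negPf hu).
Qed.

Lemma bihom0 d : bihom d 0. Proof. by apply/bihomP => u _; rewrite mcoeff0. Qed.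
Lemma bihomD d p q : bihom d p -> bihom d q -> bihom d (p + q).
Proof.
move=> /bihomP hp /bihomP hq; apply/bihomP => u hu.
by rewrite mcoeffD hp // hq // addr0.
Qed.
Lemma bihomZ d a p : bihom d p -> bihom d (a *: p).
Proof. by move=> /bihomP hp; apply/bihomP => u hu; rewrite mcoeffZ hp // mulr0. Qed.
Lemma bihomN d p : bihom d p -> bihom d (- p).
Proof. by move=> hp; rewrite -scaleN1r; apply: bihomZ. Qed.
Lemma bihomB d p q : bihom d p -> bihom d q -> bihom d (p - q).
Proof. by move=> hp hq; apply/bihomD/bihomN. Qed.
Lemma bihom_sum d (I : Type) (r : seq I) (P : pred I) (F : I -> S) :
  (forall i, P i -> bihom d (F i)) -> bihom d (\sum_(i <- r | P i) F i).
Proof.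
by move=> h; elim/big_ind: _ => //; [apply: bihom0 | apply: bihomD].
Qed.
Lemma bihomX u : bihom (bideg u) 'X_[u].
Proof. by move=> v; rewrite msuppX mem_seq1 => /eqP->. Qed.
Lemma bihomX' d u : bideg u = d -> bihom d 'X_[u].
Proof. by move=> <-; apply: bihomX. Qed.

Lemma bihomM d e p q : bihom d p -> bihom e q -> bihom (d + e) (p * q).
Proof.
move=> hp hq u /msuppM_le /allpairsP[[v w] /= [/hp hv /hq hw ->]].
by rewrite bidegD hv hw.
Qed.

Lemma bihomE d p : bihom d p -> p = \sum_(u <- mons d) p@_u *: 'X_[u].
Proof.
move=> hp; rewrite -(@lextE _ _ _ (fun u => 'X_[u] : S)) ?mons_uniq //.
  by rewrite {1}[p]mpolyE.
by move=> u /hp hu; rewrite mem_mons hu.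
Qed.

Lemma mpoly_sum_mons d (c : 'X_{1..N} -> A) u :
  (\sum_(v <- mons d) c v *: 'X_[v])@_u = if bideg u == d then c u else 0.
Proof.
rewrite raddf_sum /=; case: ifP => hu.
  rewrite (bigD1_seq u) ?mem_mons ?mons_uniq //= mcoeffZ mcoeffX eqxx mulr1.
  rewrite big1 ?addr0 // => v /negPf vu.
  by rewrite mcoeffZ mcoeffX vu mulr0.
rewrite big_seq big1 // => v; rewrite mem_mons => hv.
rewrite mcoeffZ mcoeffX; case: eqP => [e|]; last by rewrite mulr0.
by rewrite -e hv in hu.
Qed.

Lemma mpoly_ind_X (P : S -> Prop) :
  P 0 -> (forall a p q, P p -> P q -> P (a *: p + q)) -> (forall u, P 'X_[u]) ->
  forall p, P p.
Proof.
move=> h0 hD hX p; rewrite [p]mpolyE; elim/big_rec: _ => // u q _ hq.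
exact: hD.
Qed.

End Ring.
End Grading.

(** * Block-diagonal linear substitutions *)

Section Substitution.
Context (m n : nat).
Local Notation N := (m + n)%N.

Definition blk (A : pzRingType) (G : 'M[A]_N) : Prop :=
  forall i j, bideg (U_(i)%MM : 'X_{1..N}) <> bideg (U_(j)%MM : 'X_{1..N}) -> G i j = 0.

Section Act.
Context (A : comNzRingType).
Local Notation S := {mpoly A[N]}.
Implicit Types (G : 'M[A]_N) (p q : S).

Definition linf G (i : 'I_N) : S := \sum_j G i j *: 'X_j.
(** Substitution is contravariant: [act G] after [act G'] is [act (G' *m G)], which explains the
    order of the factors in [trM]. *)
Definition act G p : S := p \mPo [tuple linf G i | i < N].

HB.instance Definition _ G := GRing.RMorphism.copy (act G)
  (comp_mpoly [tuple linf G i | i < N]).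
HB.instance Definition _ G := GRing.Linear.copy (act G)
  (comp_mpoly [tuple linf G i | i < N]).

Lemma actX G i : act G 'X_i = linf G i.
Proof. by rewrite /act comp_mpolyXU -tnth_nth tnth_mktuple. Qed.

Lemma act_ext (f g : {lrmorphism S -> S}) : (forall i, f 'X_i = g 'X_i) -> f =1 g.
Proof.
move=> h; apply: mpoly_ind_X => [|a p q hp hq|u]; first by rewrite !linear0.
  by rewrite !linearD !linearZ /= hp hq.
by rewrite mpolyXE_id !rmorph_prod; apply: eq_bigr => i _; rewrite !rmorphXn /= h.
Qed.

Lemma act_linf G G' i : act G (linf G' i) = linf (G' *m G) i.
Proof.
rewrite /linf linear_sum /=.
under eq_bigr => j _ do rewrite linearZ /= actX /linf scaler_sumr.
rewrite exchange_big; apply: eq_bigr => l _.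
rewrite mxE scaler_suml; apply: eq_bigr => j _.
by rewrite scalerA.
Qed.

Lemma actM G G' p : act G (act G' p) = act (G' *m G) p.
Proof.
move: p; apply: (@act_ext (act G \o act G') (act (G' *m G))) => i /=.
by rewrite !actX act_linf.
Qed.

Lemma act1 p : act 1%:M p = p.
Proof.
move: p; apply: (@act_ext (act 1%:M) idfun) => i /=.
rewrite actX /linf (bigD1 i) //= mxE eqxx scale1r big1 ?addr0 // => j ji.
by rewrite mxE eq_sym (negPf ji) scale0r.
Qed.

Lemma bihom_linf G i : blk G -> bihom (bideg U_(i)%MM) (linf G i).
Proof.
move=> hG; apply: bihom_sum => j _.
case: (eqVneq (bideg (U_(j)%MM : 'X_{1..N})) (bideg U_(i)%MM)) => [e|/eqP ne].
  by apply/bihomZ/bihomX'.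
by rewrite hG ?scale0r; [apply: bihom0 | move=> e; apply: ne].
Qed.

Lemma bihom_actX G u : blk G -> bihom (bideg u) (act G 'X_[u]).
Proof.
move=> hG; rewrite /act comp_mpolyX.
have -> : bideg u = \sum_(i < N) (bideg U_(i)%MM) *+ u i.
  rewrite {1}[u]multinomUE_id (big_morph _ (@bidegD m n) (@bideg0 m n)).
  apply: eq_bigr => i _; elim: (u i) => [|l IH]; first by rewrite mulm0n bideg0.
  by rewrite mulmS bidegD IH mulrS.
elim/big_rec2: _ => [|i d q _ IH]; first by rewrite -mpolyX0; apply: bihomX'; rewrite bideg0.
apply: bihomM => //; rewrite tnth_mktuple.
elim: (u i) => [|l IH']; first by rewrite expr0 -mpolyX0; apply: bihomX'; rewrite bideg0.
by rewrite exprS mulrS; apply: bihomM => //; apply: bihom_linf.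
Qed.

Lemma bihom_act G d p : blk G -> bihom d p -> bihom d (act G p).
Proof.
move=> hG hp; rewrite [p]mpolyE linear_sum /= big_seq.
apply: bihom_sum => u /hp <-.
by rewrite linearZ; apply/bihomZ/bihom_actX.
Qed.

Lemma blk1 : blk (1%:M : 'M[A]_N).
Proof. by move=> i j hij; rewrite mxE; case: eqP => // e; rewrite e in hij. Qed.

Lemma blkM G G' : blk G -> blk G' -> blk (G *m G').
Proof.
move=> h h' i j hij; rewrite mxE big1 // => l _.
case: (eqVneq (bideg (U_(i)%MM : 'X_{1..N})) (bideg (U_(l)%MM : 'X_{1..N}))) => [e|/eqP ne].
  by rewrite h' ?mulr0 // -e.
by rewrite h ?mul0r.
Qed.

End Act.

Lemma map_act (A B : comNzRingType) (f : {rmorphism A -> B}) (G : 'M[A]_N) p :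
  map_mpoly f (act G p) = act (map_mx f G) (map_mpoly f p).
Proof.
move: p; apply: mpoly_ind_X => [|a p q hp hq|u]; first by rewrite !raddf0.
  by rewrite !linearP /= !raddfD /= !map_mpolyZ !linearZ /= hp hq.
rewrite map_mpolyX [RHS]/act [act G _]/act !comp_mpolyX rmorph_prod.
apply: eq_bigr => i _; rewrite rmorphXn !tnth_mktuple /linf rmorph_sum /=.
congr (_ ^+ _); apply: eq_bigr => j _.
by rewrite map_mpolyZ map_mpolyX mxE.
Qed.

End Substitution.

(** * The flat families over the cells of Borel-fixed ideals *)

(** The shape of a radical Borel-fixed ideal: [x_i] lies in it for [i < ba], [y_j] for [j < bb], and
    [x_i y_j] exactly for [j < lam i]. The function [lam] is total, with value 0 from [m] on, so
    that [lam i.+1] makes sense in the last row and equal data give equal records. *)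
Record borel (m n : nat) := Borel {
  ba : nat; bb : nat; lam : nat -> nat;
  lam_mono : forall i i', (i <= i')%N -> (lam i' <= lam i)%N;
  lam_le : forall i, (lam i <= n)%N;
  lam_dead : forall i, (i < ba)%N -> lam i = n;
  lam_bb : forall i, (i < m)%N -> (bb <= lam i)%N;
  lam_out : forall i, (m <= i)%N -> lam i = 0%N;
  ba_le : (ba <= m)%N;
  bb_le : (bb <= n)%N }.

Section Tau.
Context (m n : nat) (J : borel m n) (A : comPzRingType).
Context (t : nat -> nat -> nat -> nat -> A).
Local Notation lam := (lam J).

(* The pair [(i, j)] is a corner of the diagram whose row and column are both
   the only ones of their length, and [p], [q] lie in the next row and column
   blocks. *)
Definition mixed (i j p q : nat) : bool :=
  [&& lam i == j.+1, (lam i.+1 <= j)%N, lam p == j, (lam i <= q)%N &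
      (i == 0) || (q < lam i.-1)]%N.

Definition tcoef i j p q : A := if mixed i j p q then t i j p q else 0.

(** The coefficient of [x_p y_q] in the reduction of [x_i y_j]: the product of the corner parameters
    along the staircase [(i + s, lam i - s.+1)], entered from column [q] and left at row [p]. It
    vanishes unless the rows from [i] on lose one box at each step. For [m = n = 3],
    [lam = (2, 1, 0)], no dead variables and all parameters 1, the rules are the 2-minors of the
    matrix with rows [x_0 x_1 x_2] and [y_2 y_1 y_0]. For [lam i <= j] the product is empty, hence
    1; this is why [j < lam i] is assumed below. *)
Definition tau i j p q : A :=
  \prod_(s < lam i - j)
    tcoef (i + s)%N (lam i - s.+1)%N
      (if s.+1 == (lam i - j)%N then p else (i + s).+1)%N
      (if s == 0%N :> nat then q else (lam i - s)%N).

Lemma prod_neq0 (l : nat) (F : nat -> A) (s : nat) :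
  \prod_(s < l) F s <> 0 -> (s < l)%N -> F s <> 0.
Proof.
by move=> h sl e; apply: h; rewrite (bigD1 (Ordinal sl)) //= e mul0r.
Qed.

Lemma tcoef_neq0 i j p q : tcoef i j p q <> 0 -> mixed i j p q.
Proof. by rewrite /tcoef; case: ifP. Qed.

Lemma tau_neq0 i j p q s : tau i j p q <> 0 -> (s < lam i - j)%N ->
  mixed (i + s)%N (lam i - s.+1)%N
      (if s.+1 == (lam i - j)%N then p else (i + s).+1)%N
      (if s == 0%N :> nat then q else (lam i - s)%N).
Proof.
move=> h sl; apply: tcoef_neq0.
exact: (@prod_neq0 _ (fun s => tcoef (i + s)%N (lam i - s.+1)%N
      (if s.+1 == (lam i - j)%N then p else (i + s).+1)%N
      (if s == 0%N :> nat then q else (lam i - s)%N)) s h).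
Qed.

(** The first factor places [q] between the length of row [i] and those of the rows above it; the
    last one, in [tau_last], places [p] among the rows of length [j]. Together they make [x_p y_q]
    lighter than [x_i y_j] and not a redex. *)
Lemma tau_first i j p q : tau i j p q <> 0 -> (j < lam i)%N ->
  [/\ (lam i.+1 < lam i)%N, (lam i <= q)%N &
      forall i', (i' < i)%N -> (q < lam i')%N].
Proof.
move=> h ji; have := tau_neq0 (s := 0) h; rewrite subn_gt0 addn0 => /(_ ji).
move=> /and5P[_ h2 _ h4 h5]; split=> // [|i' ii']; first by lia.
case/orP: h5 => [|h5]; first by lia.
apply: (leq_trans h5); apply: lam_mono; lia.
Qed.

Lemma tau_last i j p q : tau i j p q <> 0 -> (j < lam i)%N ->
  [/\ lam (i + (lam i - j).-1) = j.+1, (lam (i + (lam i - j)) <= j)%N & lam p = j].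
Proof.
move=> h ji; have := tau_neq0 (s := (lam i - j).-1) h.
have -> : ((lam i - j).-1.+1 == (lam i - j)%N) by apply/eqP; lia.
have -> : (lam i - (lam i - j).-1.+1 = j)%N by lia.
move=> /(_ ltac:(lia))/and5P[/eqP h1 h2 /eqP h3 _ _]; split=> //.
by rewrite -[X in lam X]/(_) (_ : (i + (lam i - j) = (i + (lam i - j).-1).+1)%N) //; lia.
Qed.

Lemma tau_chain i j p q s : tau i j p q <> 0 -> (s < lam i - j)%N ->
  lam (i + s) = (lam i - s)%N.
Proof. by move=> h sl; have /and5P[/eqP h1 _ _ _ _] := tau_neq0 h sl; lia. Qed.

(** A staircase can be cut at any row it visits. The two cancellation rules [tau_col] and [tau_row]
    rest on this. *)
Lemma tau_split i j p q d : (0 < d)%N -> (d < lam i - j)%N ->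
  lam (i + d) = (lam i - d)%N ->
  tau i j p q = tau i (lam i - d)%N (i + d)%N q * tau (i + d)%N j p (lam i - d)%N.
Proof.
move=> d0 dl hd; rewrite /tau hd.
pose F s := tcoef (i + s)%N (lam i - s.+1)%N
      (if s.+1 == (lam i - j)%N then p else (i + s).+1)%N
      (if s == 0%N :> nat then q else (lam i - s)%N).
rewrite -(big_mkord xpredT F) (@big_cat_nat _ _ _ d) /= ?(ltnW dl) //.
congr (_ * _).
  rewrite (_ : (lam i - (lam i - d) = d)%N); last by lia.
  rewrite big_mkord; apply: eq_bigr => s _; rewrite /F; congr tcoef.
  have := ltn_ord s; case: eqP => [|_ sd]; first by lia.
  by case: eqP => [e|_]; lia.
rewrite -{1}[d]add0n big_addn big_mkord (_ : (lam i - j - d = lam i - d - j)%N); last by lia.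
apply: eq_bigr => s _; have sl := ltn_ord s; rewrite /F; congr tcoef; first by lia.
- by lia.
- by do 2!case: eqP => ?; lia.
- by do 2!case: eqP => ?; lia.
Qed.

(** The S-pair of [x_i y_j] and [x_i' y_j]: reducing [x_i' y_j] and continuing with [x_i y_q] must
    give [x_i'] times the reduction of [x_i y_j]. Only [q = lam i'] contributes, and only if the
    staircase from row [i] passes through row [i'], so the sum is one instance of [tau_split]. *)
Lemma tau_col i i' j p p' q' : (i < i')%N -> (j < lam i')%N ->
  \sum_(q < n) tau i' j p q * tau i q p' q' =
    if p' == i' then tau i j p q' else 0.
Proof.
move=> ii' ji'; have li : (lam i' <= lam i)%N by apply: lam_mono; lia.
have key q : (q < lam i)%N -> tau i' j p q <> 0 -> tau i q p' q' <> 0 ->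
    [/\ q = lam i', p' = i', (lam i' + (i' - i) = lam i)%N & (i' - i < lam i - j)%N].
  move=> qi h1 h2; have [a1 a2 a3] := tau_first h1 ji'.
  have [b1 b2 b3] := tau_last h2 qi.
  have p'i' : (i' <= p')%N.
    by case: ltnP => // /a3; rewrite b3 ltnn.
  have e1 : lam i' = q.
    by apply/eqP; rewrite eqn_leq a2 -b3 lam_mono.
  have e2 : p' = i'.
    apply/eqP; rewrite eqn_leq p'i' andbT leqNgt; apply/negP => lt.
    by have := lam_mono J lt; lia.
  have i1 : (i + (lam i - q).-1 < i')%N.
    rewrite ltnNge; apply/negP => /(lam_mono J); lia.
  have i2 : (i' <= i + (lam i - q))%N.
    rewrite leqNgt; apply/negP => /a3; lia.
  by split=> //; lia.
have zero q : (q < lam i)%N -> ~ [/\ q = lam i', p' = i', (lam i' + (i' - i) = lam i)%N & (i' - i < lam i - j)%N] ->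
    tau i' j p q * tau i q p' q' = 0.
  move=> qi hn; case: (pselect (tau i' j p q = 0)) => [->|h1]; first by rewrite mul0r.
  case: (pselect (tau i q p' q' = 0)) => [->|h2]; first by rewrite mulr0.
  by case: hn; apply: key.
have big q : (lam i <= q)%N -> tau i' j p q = 0.
  move=> iq; apply: contrapT => /tau_first/(_ ji')[_ _ /(_ _ ii')]; lia.
case: (pselect (lam i' + (i' - i) = lam i)%N) => [good|bad].
  have d1 : (i' - i < lam i - j)%N by lia.
  case: eqP => [p'i'|ne]; last first.
    rewrite big1 // => q _; case: (ltnP q (lam i)) => [qi|/big->]; last by rewrite mul0r.
    by apply: zero => // -[_ /ne].
  have li'n : (lam i' < n)%N by have := lam_le J i; lia.
  rewrite (bigD1 (Ordinal li'n)) //= big1 ?addr0; last first.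
    move=> q /eqP qne; case: (ltnP q (lam i)) => [qi|/big->]; last by rewrite mul0r.
    by apply: zero => // -[e _ _ _]; apply: qne; apply: val_inj.
  rewrite p'i'; have e : (i + (i' - i) = i')%N by lia.
  rewrite (@tau_split i j p q' (i' - i)) ?e; try lia.
  by rewrite mulrC; congr (tau _ _ _ _ * tau _ _ _ _); lia.
rewrite big1; last first.
  move=> q _; case: (ltnP q (lam i)) => [qi|/big->]; last by rewrite mul0r.
  by apply: zero => // -[].
(* The staircase misses row [i'], and the right-hand side vanishes as well: a nonzero [tau i j p q']
   would either pass through row [i'] at the proper length or have ended before it, leaving
   [lam i' <= j]. *)
case: ifP => // _; apply/esym; apply: contrapT => h.
have jl : (j < lam i)%N by lia.
case: (ltnP (i' - i) (lam i - j)) => dl.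
  by have := tau_chain h dl; rewrite (_ : (i + (i' - i) = i')%N); lia.
have [_ l2 _] := tau_last h jl.
have := @lam_mono _ _ J (i + (lam i - j)) i'; lia.
Qed.

(** The transposed S-pair, in one row and two columns. The single contributing row is
    [p = i + (lam i - j')], where the staircase has come down to length [j']. *)
Lemma tau_row i j j' p' q q' : (j < j')%N -> (j' < lam i)%N ->
  \sum_(p < m) tau i j' p q * tau p j p' q' =
    if q' == j' then tau i j p' q else 0.
Proof.
move=> jj' j'i.
pose d := (lam i - j')%N.
have key p : tau i j' p q <> 0 -> tau p j p' q' <> 0 ->
    [/\ p = (i + d)%N, q' = j' & lam (i + d) = j'].
  move=> h1 h2; have [a1 a2 a3] := tau_last h1 j'i.
  have jp : (j < lam p)%N by rewrite a3.
  have [b1 b2 b3] := tau_first h2 jp.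
  have i1 : (i + d <= p)%N.
    rewrite leqNgt; apply/negP => lt.
    have := @lam_mono _ _ J p (i + d.-1); rewrite /d in lt *; lia.
  have i2 : (p <= i + d)%N.
    rewrite leqNgt; apply/negP => /b3; rewrite -/d in a2; lia.
  have e : p = (i + d)%N by lia.
  split=> //; last by rewrite -e.
  have := b3 (i + d.-1)%N; rewrite a1 /d in i1 i2 e *; lia.
have zero p : ~ [/\ p = (i + d)%N, q' = j' & lam (i + d) = j'] ->
    tau i j' p q * tau p j p' q' = 0.
  move=> hn; case: (pselect (tau i j' p q = 0)) => [->|h1]; first by rewrite mul0r.
  case: (pselect (tau p j p' q' = 0)) => [->|h2]; first by rewrite mulr0.
  by case: hn; apply: key.
case: (pselect (lam (i + d) = j')) => [good|bad]; last first.
  rewrite big1; last by move=> p _; apply: zero => -[].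
  case: ifP => // _; apply/esym; apply: contrapT => h.
  have jl : (j < lam i)%N by lia.
  by have := @tau_chain _ _ _ _ d h; rewrite /d in bad *; lia.
case: eqP => [q'j'|ne]; last by rewrite big1 // => p _; apply: zero => -[_ /ne].
have dm : (i + d < m)%N by rewrite ltnNge; apply/negP => /(lam_out J); lia.
rewrite (bigD1 (Ordinal dm)) //= big1 ?addr0; last first.
  move=> p /eqP pne; apply: zero => -[e _ _]; apply: pne; exact: val_inj.
rewrite q'j' (@tau_split i j p' q d) /d; try lia.
  by congr (tau _ _ _ _ * tau _ _ _ _); lia.
by rewrite -/d good /d; lia.
Qed.

End Tau.

Lemma tau_corner (m n : nat) (J : borel m n) (A : comPzRingType) t i j p q :
  lam J i = j.+1 -> tau J t i j p q = tcoef J t i j p q :> A.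
Proof. by move=> e; rewrite /tau e subSnn big_ord1 addn0 subSS subn0. Qed.

(** * Confluence of the rewriting system of the diagram *)

Section NormalForm.
Context (m n : nat) (J : borel m n).
Local Notation N := (m + n)%N.
Local Notation lam := (lam J).
Local Notation vx := (@vx m n).
Local Notation vy := (@vy m n).
Implicit Types (u v : 'X_{1..N}) (i : 'I_m) (j : 'I_n).

Definition dead u : bool :=
  [exists i : 'I_m, (i < ba J) && (0 < u (vx i))]%N ||
  [exists j : 'I_n, (j < bb J) && (0 < u (vy j))]%N.

Definition redex u (i : 'I_m) (j : 'I_n) : bool :=
  [&& j < lam i, 0 < u (vx i) & 0 < u (vy j)]%N.

Definition std u : bool := ~~ dead u && ~~ [exists i, exists j, redex u i j].

(* Decreases under [x_i y_j -> x_p y_q] whenever [tau i j p q] is nonzero. *)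
Definition wt u : nat :=
  (\sum_(i < m) u (vx i) * lam i + \sum_(j < n) u (vy j) * (n - j))%N.

Definition mxy v (i : 'I_m) (j : 'I_n) : 'X_{1..N} := (v + U_(vx i) + U_(vy j))%MM.

Lemma wtD u v : wt (u + v)%MM = (wt u + wt v)%N.
Proof.
rewrite /wt addnACA -!big_split /=; congr (_ + _)%N; apply: eq_bigr => i _;
by rewrite mnmDE mulnDl.
Qed.

Lemma wt_vx i : wt U_(vx i)%MM = lam i.
Proof.
rewrite /wt (bigD1 i) //= mnm1E eqxx mul1n !big1 ?addn0 //.
  by move=> j _; rewrite mnm1E eq_lrshift.
by move=> j ji; rewrite mnm1E eq_lshift eq_sym (negPf ji).
Qed.

Lemma wt_vy j : wt U_(vy j)%MM = (n - j)%N.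
Proof.
rewrite /wt (bigD1 (P := xpredT) j) //= mnm1E eqxx mul1n !big1 ?addn0 //.
  by move=> l lj; rewrite mnm1E eq_rshift eq_sym (negPf lj).
by move=> l _; rewrite mnm1E eq_rlshift.
Qed.

Lemma wt_mxy v i j : wt (mxy v i j) = (wt v + (lam i + (n - j)))%N.
Proof. by rewrite !wtD wt_vx wt_vy addnA. Qed.

Lemma bideg_mxy v i j : bideg (mxy v i j) = bideg v + (1, 1).
Proof. by rewrite !bidegD bideg_vx bideg_vy -addrA. Qed.

Lemma mxy_vx v i j l : mxy v i j (vx l) = (v (vx l) + (i == l))%N.
Proof.
rewrite !mnmDE !mnm1E eq_lshift -[vy j]/(rshift m j) -[vx l]/(lshift n l).
by rewrite eq_rlshift addn0.
Qed.

Lemma mxy_vy v i j l : mxy v i j (vy l) = (v (vy l) + (j == l))%N.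
Proof.
rewrite !mnmDE !mnm1E eq_rshift -[vx i]/(lshift n i) -[vy l]/(rshift m l).
by rewrite eq_lrshift addn0.
Qed.

Lemma mnm_xyP u v : (forall i, u (vx i) = v (vx i)) ->
  (forall j, u (vy j) = v (vy j)) -> u = v.
Proof. by move=> h1 h2; apply/mnmP; apply: var_cases. Qed.

Definition unxy u (i : 'I_m) (j : 'I_n) : 'X_{1..N} := (u - U_(vx i) - U_(vy j))%MM.

Lemma unxy_vx u i j l : unxy u i j (vx l) = (u (vx l) - (i == l))%N.
Proof.
rewrite !mnmBE !mnm1E eq_lshift -[vy j]/(rshift m j) -[vx l]/(lshift n l).
by rewrite eq_rlshift subn0.
Qed.

Lemma unxy_vy u i j l : unxy u i j (vy l) = (u (vy l) - (j == l))%N.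
Proof.
rewrite !mnmBE !mnm1E eq_rshift -[vx i]/(lshift n i) -[vy l]/(rshift m l).
by rewrite eq_lrshift subn0.
Qed.

Lemma mxyK u i j : (0 < u (vx i))%N -> (0 < u (vy j))%N ->
  u = mxy (unxy u i j) i j.
Proof.
move=> hi hj; apply: mnm_xyP => l.
  by rewrite mxy_vx unxy_vx; case: eqP => [<-|]; lia.
by rewrite mxy_vy unxy_vy; case: eqP => [<-|]; lia.
Qed.

Lemma unxyK v i j : unxy (mxy v i j) i j = v.
Proof.
by apply: mnm_xyP => l; rewrite (unxy_vx, unxy_vy) (mxy_vx, mxy_vy) addnK.
Qed.

Lemma redex_mxy v i j : (j < lam i)%N -> redex (mxy v i j) i j.
Proof. by move=> h; rewrite /redex h mxy_vx mxy_vy !eqxx !addn1. Qed.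

Lemma redexE u i j : redex u i j -> u = mxy (unxy u i j) i j.
Proof. by case/and3P => _; apply: mxyK. Qed.

Section Rewriting.
Context (A : comNzRingType) (t : nat -> nat -> nat -> nat -> A).
Local Notation S := {mpoly A[N]}.
Local Notation tau := (@tau m n J A t).

Definition rhs v i j : S :=
  \sum_(p < m) \sum_(q < n) tau i j p q *: 'X_[mxy v p q].

(** The redex is an arbitrary choice of [pick]. With fuel [wt u] the default 0 is never met in a
    term with nonzero coefficient: a monomial with a redex [x_i y_j] has weight at least
    [n - j > 0], and each rewriting lowers the weight. *)
Fixpoint nfk (k : nat) u : S :=
  if dead u then 0 else
  if [pick ij : 'I_m * 'I_n | redex u ij.1 ij.2] is Some (i, j) then
    if k is k'.+1 then
      \sum_(p < m) \sum_(q < n) tau i j p q *: nfk k' (mxy (unxy u i j) p q)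
    else 0
  else 'X_[u].

Definition nfu u : S := nfk (wt u) u.
Definition nf : S -> S := lext nfu.
HB.instance Definition _ := GRing.Linear.copy nf (lext nfu).

Lemma tau_wt v (i : 'I_m) (j : 'I_n) (p : 'I_m) (q : 'I_n) : (j < lam i)%N ->
  tau i j p q <> 0 -> (wt (mxy v p q) < wt (mxy v i j))%N.
Proof.
move=> ji h; have [_ a2 _] := tau_first h ji; have [_ _ b3] := tau_last h ji.
by rewrite !wt_mxy ltn_add2l b3; have := ltn_ord q; have := lam_le J i; lia.
Qed.

Lemma nfk_fuel k u : (wt u <= k)%N -> nfk k u = nfu u.
Proof.
rewrite /nfu; have [w] := ubnP (wt u); elim: w u k => // w IH u k uw uk.
case: k uk => [|k] uk; first by move: uk; rewrite leqn0 => /eqP->.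
case ul: (wt u) => [|l] /=.
  case: ifP => // _; case: pickP => // -[i j] /=; move/[dup]/redexE => e /and3P[h _ _].
  by move: ul; rewrite e wt_mxy; lia.
case: ifP => // _; case: pickP => // -[i j] /=; move/[dup]/redexE => e /and3P[h _ _].
apply: eq_bigr => p _; apply: eq_bigr => q _.
case: (pselect (tau i j p q = 0)) => [->|ne]; first by rewrite !scale0r.
have := tau_wt (unxy u i j) h ne; rewrite -e => lt.
by rewrite !IH //; lia.
Qed.

Lemma nfu_dead u : dead u -> nfu u = 0.
Proof. by move=> h; rewrite /nfu; case: (wt u) => [|k] /=; rewrite h. Qed.

Lemma nfu_std u : std u -> nfu u = 'X_[u].
Proof.
case/andP => /negPf h1 h2; rewrite /nfu.
case: (wt u) => [|k] /=; rewrite h1; case: pickP => // -[i j] /= h;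
by case/negP: h2; apply/existsP; exists i; apply/existsP; exists j.
Qed.

Lemma nfu_step u : ~~ dead u -> ~~ std u -> exists i j, redex u i j /\
  nfu u = nf (rhs (unxy u i j) i j).
Proof.
move=> h1 h2; rewrite /nfu.
have : [exists i, exists j, redex u i j] by move: h2; rewrite /std h1 negbK.
move=> /existsP[i0 /existsP[j0 r0]].
have e0 := redexE r0.
have : (0 < wt u)%N by rewrite e0 wt_mxy; have := ltn_ord j0; lia.
case uk: (wt u) => [//|k] _ /=; rewrite (negPf h1).
case: pickP => [[i j] /= r|]; last by move/(_ (i0, j0)); rewrite /= r0.
exists i, j; split=> //; have e := redexE r; have /and3P[h _ _] := r.
rewrite /rhs linear_sum; apply: eq_bigr => p _; rewrite linear_sum; apply: eq_bigr => q _.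
rewrite linearZ /= /nf lextX.
case: (pselect (tau i j p q = 0)) => [->|ne]; first by rewrite !scale0r.
have := tau_wt (unxy u i j) h ne; rewrite -e => lt.
by rewrite nfk_fuel //; lia.
Qed.

Lemma nf_rhs v i j : nf (rhs v i j) =
  \sum_(p < m) \sum_(q < n) tau i j p q *: nfu (mxy v p q).
Proof.
rewrite /rhs linear_sum; apply: eq_bigr => p _; rewrite linear_sum.
by apply: eq_bigr => q _; rewrite linearZ /= /nf lextX.
Qed.

Lemma dead_tau v (i : 'I_m) (j : 'I_n) (p : 'I_m) (q : 'I_n) :
  dead (mxy v i j) -> (j < lam i)%N -> tau i j p q <> 0 -> dead (mxy v p q).
Proof.
move=> + ji h; have [_ a2 _] := tau_first h ji; have [_ _ b3] := tau_last h ji.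
case/orP => /existsP[l /andP[ll]]; rewrite (mxy_vx, mxy_vy) => hl.
  apply/orP; left; apply/existsP; exists l; rewrite ll mxy_vx.
  case: eqP hl => [il _|]; last by lia.
  by have := lam_dead ll; rewrite -il; have := ltn_ord q; lia.
apply/orP; right; apply/existsP; exists l; rewrite ll mxy_vy.
case: eqP hl => [jl _|]; last by lia.
by have := lam_bb J (ltn_ord p); rewrite -jl in ll; lia.
Qed.

(* Buchberger's criterion: all rewritings of [u] agree because the syzygies
   between the leading terms are generated by those of adjacent redexes. *)
Lemma nfu_redex u i j : redex u i j -> nfu u = nf (rhs (unxy u i j) i j).
Proof.
have [w] := ubnP (wt u); elim: w u i j => // w IH u i j uw r.
have [d|nd] := boolP (dead u).
  rewrite nfu_dead // nf_rhs; apply/esym; rewrite big1 // => p _.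
  rewrite big1 // => q _; case: (pselect (tau i j p q = 0)) => [->|ne]; first by rewrite scale0r.
  rewrite nfu_dead ?scaler0 //; have /and3P[h _ _] := r.
  by apply: dead_tau ne => //; rewrite -redexE.
have nstd : ~~ std u.
  by rewrite /std negb_and !negbK; apply/orP; right; apply/existsP; exists i; apply/existsP; exists j.
have IHm v (a : 'I_m) (b : 'I_n) : (b < lam a)%N -> (wt (mxy v a b) < w)%N ->
    nfu (mxy v a b) = nf (rhs v a b).
  by move=> h1 h2; rewrite (IH _ a b) ?unxyK ?redex_mxy.
have swapx v (a b : 'I_m) (c : 'I_n) : mxy (v + U_(vx a)) b c = mxy (v + U_(vx b)) a c.
  by apply/mnmP => l; rewrite /mxy !mnmDE; lia.
have swapy v (a b : 'I_n) (c : 'I_m) : mxy (v + U_(vy a)) c b = mxy (v + U_(vy b)) c a.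
  by apply/mnmP => l; rewrite /mxy !mnmDE; lia.
have col (a b : 'I_m) (c : 'I_n) : (a < b)%N -> redex u a c -> redex u b c ->
    nf (rhs (unxy u a c) a c) = nf (rhs (unxy u b c) b c).
  move=> ab ra rb; have /and3P[h1 h2 h3] := ra; have /and3P[h4 h5 h6] := rb.
  have [v ev] : exists v, u = mxy (v + U_(vx b)) a c.
    exists (unxy u a c - U_(vx b))%MM; rewrite submK; first exact: redexE.
    rewrite lep1mP unxy_vx (_ : (a == b) = false) ?subn0 -?lt0n //.
    by apply/negP => /eqP e; rewrite e ltnn in ab.
  have ev' : u = mxy (v + U_(vx a)) b c by rewrite ev swapx.
  have -> : unxy u a c = (v + U_(vx b))%MM by rewrite ev unxyK.
  have -> : unxy u b c = (v + U_(vx a))%MM by rewrite ev' unxyK.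
  rewrite !nf_rhs.
  (* By the bound on [q] in [tau_first], the pairs [x_a y_q] that appear are again redexes, and the
     induction hypothesis allows reducing there. Summing over [q] with [tau_col] leaves only
     [p' = b]. *)
  transitivity (\sum_(p < m) \sum_(q < n) tau b c p q *:
     \sum_(p' < m) \sum_(q' < n) tau a q p' q' *: nfu (mxy (v + U_(vx p)) p' q')); last first.
    apply: eq_bigr => p _; apply: eq_bigr => q _.
    case: (pselect (tau b c p q = 0)) => [->|ne]; first by rewrite !scale0r.
    congr (_ *: _); have [_ _ /(_ _ ab) a3] := tau_first ne h4.
    rewrite swapx IHm ?nf_rhs //.
    rewrite -swapx; apply: (@leq_trans (wt u)) => //; rewrite ev'.
    exact: tau_wt ne.
  transitivity (\sum_(p < m) \sum_(p' < m) \sum_(q' < n)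
      (\sum_(q < n) tau b c p q * tau a q p' q') *: nfu (mxy (v + U_(vx p)) p' q')).
    apply: eq_bigr => p _; rewrite (bigD1 b) //= [X in _ + X]big1 ?addr0.
      by apply: eq_bigr => q' _; rewrite tau_col // eqxx swapx.
    move=> p' p'b; rewrite big1 // => q' _; rewrite tau_col //.
    have -> : (p' == b :> nat) = false by exact: (negPf p'b).
    by rewrite scale0r.
  apply: eq_bigr => p _; rewrite [RHS](eq_bigr (fun q : 'I_n => \sum_(p' < m) \sum_(q' < n)
      (tau b c p q * tau a q p' q') *: nfu (mxy (v + U_(vx p)) p' q'))); last first.
    move=> q _; rewrite scaler_sumr; apply: eq_bigr => p' _; rewrite scaler_sumr.
    by apply: eq_bigr => q' _; rewrite scalerA.
  rewrite [RHS]exchange_big; apply: eq_bigr => p' _; rewrite [RHS]exchange_big; apply: eq_bigr => q' _.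
  by rewrite scaler_suml.
have row (c : 'I_m) (a b : 'I_n) : (a < b)%N -> redex u c a -> redex u c b ->
    nf (rhs (unxy u c a) c a) = nf (rhs (unxy u c b) c b).
  move=> ab ra rb; have /and3P[h1 h2 h3] := ra; have /and3P[h4 h5 h6] := rb.
  have [v ev] : exists v, u = mxy (v + U_(vy b)) c a.
    exists (unxy u c a - U_(vy b))%MM; rewrite submK; first exact: redexE.
    rewrite lep1mP unxy_vy (_ : (a == b) = false) ?subn0 -?lt0n //.
    by apply/negP => /eqP e; rewrite e ltnn in ab.
  have ev' : u = mxy (v + U_(vy a)) c b by rewrite ev swapy.
  have -> : unxy u c a = (v + U_(vy b))%MM by rewrite ev unxyK.
  have -> : unxy u c b = (v + U_(vy a))%MM by rewrite ev' unxyK.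
  rewrite !nf_rhs.
  transitivity (\sum_(p < m) \sum_(q < n) tau c b p q *:
     \sum_(p' < m) \sum_(q' < n) tau p a p' q' *: nfu (mxy (v + U_(vy q)) p' q')); last first.
    apply: eq_bigr => p _; apply: eq_bigr => q _.
    case: (pselect (tau c b p q = 0)) => [->|ne]; first by rewrite !scale0r.
    congr (_ *: _); have [_ _ a3] := tau_last ne h4.
    rewrite swapy IHm ?nf_rhs // ?a3 //.
    rewrite -swapy; apply: (@leq_trans (wt u)) => //; rewrite ev'.
    exact: tau_wt ne.
  transitivity (\sum_(q < n) \sum_(p' < m) \sum_(q' < n)
      (\sum_(p < m) tau c b p q * tau p a p' q') *: nfu (mxy (v + U_(vy q)) p' q')).
    rewrite exchange_big; apply: eq_bigr => q _; apply: eq_bigr => p' _.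
    rewrite (bigD1 b) //= [X in _ + X]big1 ?addr0.
      by rewrite tau_row // eqxx swapy.
    move=> q' q'b; rewrite tau_row //.
    have -> : (q' == b :> nat) = false by exact: (negPf q'b).
    by rewrite scale0r.
  rewrite [RHS]exchange_big; apply: eq_bigr => q _.
  rewrite [RHS](eq_bigr (fun p : 'I_m => \sum_(p' < m) \sum_(q' < n)
      (tau c b p q * tau p a p' q') *: nfu (mxy (v + U_(vy q)) p' q'))); last first.
    move=> p _; rewrite scaler_sumr; apply: eq_bigr => p' _; rewrite scaler_sumr.
    by apply: eq_bigr => q' _; rewrite scalerA.
  rewrite [RHS]exchange_big; apply: eq_bigr => p' _; rewrite [RHS]exchange_big; apply: eq_bigr => q' _.
  by rewrite scaler_suml.
have colw (a b : 'I_m) (c : 'I_n) : redex u a c -> redex u b c ->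
    nf (rhs (unxy u a c) a c) = nf (rhs (unxy u b c) b c).
  by case: (ltngtP a b) => ab ra rb; [exact: col | exact/esym/col | move/val_inj: ab => ->].
have roww (c : 'I_m) (a b : 'I_n) : redex u c a -> redex u c b ->
    nf (rhs (unxy u c a) c a) = nf (rhs (unxy u c b) c b).
  by case: (ltngtP a b) => ab ra rb; [exact: row | exact/esym/row | move/val_inj: ab => ->].
have [i0 [j0 [r0 ->]]] := nfu_step nd nstd.
have /and3P[h1 h2 h3] := r; have /and3P[h4 h5 h6] := r0.
(* Two redexes are joined through a third one that shares a row with one and a column with the
   other; it exists because [lam] is decreasing. *)
case: (leqP i i0) => ii0.
  have r1 : redex u i j0 by apply/and3P; split=> //; have := lam_mono J ii0; lia.
  by rewrite (colw i0 i j0 r0 r1); apply: roww.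
have r1 : redex u i0 j by apply/and3P; split=> //; have := lam_mono J (ltnW ii0); lia.
by rewrite (roww i0 j0 j r0 r1); apply: colw.
Qed.

Lemma nf_rule v i j : (j < lam i)%N -> nf ('X_[mxy v i j] - rhs v i j) = 0.
Proof.
by move=> h; rewrite linearB /= {1}/nf lextX (@nfu_redex _ i j) ?unxyK ?subrr ?redex_mxy.
Qed.

Definition stdpoly (p : S) : Prop := forall u, u \in msupp p -> std u.

Lemma stdpolyP p : stdpoly p <-> (forall u, ~~ std u -> p@_u = 0).
Proof.
split=> [h u hu|h u]; first by apply: memN_msupp_eq0; apply: contra hu; apply: h.
by rewrite mcoeff_msupp; apply: contraNT => /h->.
Qed.

Lemma stdpolyB p q : stdpoly p -> stdpoly q -> stdpoly (p - q).
Proof.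
move=> /stdpolyP hp /stdpolyP hq; apply/stdpolyP => u hu.
by rewrite mcoeffB hp // hq // subrr.
Qed.

Lemma stdpoly_lin a p q : stdpoly p -> stdpoly q -> stdpoly (a *: p + q).
Proof.
move=> /stdpolyP hp /stdpolyP hq; apply/stdpolyP => u hu.
by rewrite mcoeffD mcoeffZ hp // hq // mulr0 addr0.
Qed.

Lemma stdpoly0 : stdpoly 0.
Proof. by move=> u; rewrite msupp0. Qed.

(** Induction along the rewriting. The hypothesis is available only for targets with nonzero
    coefficient, since only these are known to be lighter. *)
Lemma nf_ind (P : 'X_{1..N} -> S -> Prop) :
  (forall u, dead u -> P u 0) -> (forall u, std u -> P u 'X_[u]) ->
  (forall v i j, (j < lam i)%N ->
     (forall (p : 'I_m) (q : 'I_n), tau i j p q <> 0 -> P (mxy v p q) (nfu (mxy v p q))) ->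
     P (mxy v i j) (nf (rhs v i j))) ->
  forall u, P u (nfu u).
Proof.
move=> h1 h2 h3 u; have [w] := ubnP (wt u); elim: w u => // w IH u uw.
have [d|nd] := boolP (dead u); first by rewrite nfu_dead //; apply: h1.
have [s|ns] := boolP (std u); first by rewrite nfu_std //; apply: h2.
have [i [j [r ->]]] := nfu_step nd ns; have e := redexE r.
rewrite {1}e; have /and3P[h _ _] := r; apply: h3 => // p q ne; apply: IH.
by have := tau_wt (unxy u i j) h ne; rewrite -e; lia.
Qed.

Lemma nfu_prop (Q : 'X_{1..N} -> S -> Prop) :
  (forall u, Q u 0) -> (forall u a p q, Q u p -> Q u q -> Q u (a *: p + q)) ->
  (forall u, std u -> Q u 'X_[u]) ->
  (forall v i j i' j' p, Q (mxy v i j) p -> (wt (mxy v i j) < wt (mxy v i' j'))%N ->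
      Q (mxy v i' j') p) ->
  forall u, Q u (nfu u).
Proof.
move=> h0 hl hs hm; apply: nf_ind => // v i j ji IH; rewrite nf_rhs.
have hD u p q : Q u p -> Q u q -> Q u (p + q) by move=> hp hq; rewrite -[p]scale1r; apply: hl.
elim/big_ind: _ => //; first exact: hD.
move=> p _; elim/big_ind: _ => //; first exact: hD.
move=> q _; case: (pselect (tau i j p q = 0)) => [->|ne]; first by rewrite scale0r.
rewrite -[_ *: _]addr0; apply: (hl) => //; apply: (hm _ p q); first exact: IH.
exact: tau_wt ne.
Qed.

Lemma nfu_stdpoly u : stdpoly (nfu u).
Proof.
move: u; apply: (nfu_prop (Q := fun _ => stdpoly)) => // [u|u a p q|u su].
- exact: stdpoly0.
- exact: stdpoly_lin.
- by move=> v; rewrite msuppX mem_seq1 => /eqP->.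
Qed.

Lemma bihom_nfu u : bihom (bideg u) (nfu u).
Proof.
move: u; apply: (nfu_prop (Q := fun u p => bihom (bideg u) p)) => [u|u a p q hp hq|u su|v i j i' j' p].
- exact: bihom0.
- by apply: bihomD => //; apply: bihomZ.
- exact: bihomX.
- by rewrite !bideg_mxy.
Qed.

Lemma nf_stdpoly p : stdpoly (nf p).
Proof.
by elim/mpoly_ind_X: p => [|a p q hp hq|u]; rewrite ?linear0 ?linearP /=;
  [apply: stdpoly0 | apply: stdpoly_lin | rewrite /nf lextX; apply: nfu_stdpoly].
Qed.

Lemma bihom_nf d p : bihom d p -> bihom d (nf p).
Proof.
move=> hp; rewrite [p]mpolyE linear_sum /= big_seq; apply: bihom_sum => u /hp <-.
by rewrite linearZ /= /nf lextX; apply/bihomZ/bihom_nfu.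
Qed.

Lemma nf_id p : stdpoly p -> nf p = p.
Proof.
move=> hp; transitivity (\sum_(u <- msupp p) p@_u *: ('X_[u] : S)); last by rewrite -mpolyE.
rewrite {1}[p]mpolyE linear_sum /=; apply: eq_big_seq => u /hp su.
by rewrite linearZ /= /nf lextX nfu_std.
Qed.

Lemma nf_idem p : nf (nf p) = nf p.
Proof. exact/nf_id/nf_stdpoly. Qed.

Lemma dead_add v u : dead u -> dead (v + u)%MM.
Proof.
case/orP => /existsP[l /andP[ll hl]]; apply/orP; [left|right]; apply/existsP; exists l;
by rewrite ll mnmDE; lia.
Qed.

Lemma mxy_add v w i j : (v + mxy w i j)%MM = mxy (v + w) i j.
Proof. by rewrite /mxy !addmA. Qed.

Lemma nf_mulX v p : nf ('X_[v] * p) = nf ('X_[v] * nf p).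
Proof.
elim/mpoly_ind_X: p => [|a p q hp hq|u]; first by rewrite !(linear0, mulr0).
  by rewrite linearP /= !mulrDr -!scalerAr !linearP /= hp hq.
rewrite -mpolyXD [nf 'X_[u]]/nf lextX; move: u.
apply: (nf_ind (P := fun u p => nf 'X_[v + u] = nf ('X_[v] * p))) => [u du|u su|w i j ji IH].
- by rewrite mulr0 linear0 /nf lextX nfu_dead //; apply: dead_add.
- by rewrite mpolyXD.
rewrite mxy_add {1}/nf lextX (@nfu_redex _ i j) ?unxyK ?redex_mxy // !nf_rhs.
rewrite mulr_sumr linear_sum; apply: eq_bigr => p _ /=.
rewrite mulr_sumr linear_sum; apply: eq_bigr => q _ /=.
rewrite -scalerAr linearZ /=.
case: (pselect (tau i j p q = 0)) => [->|ne]; first by rewrite !scale0r.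
by rewrite -IH // mxy_add /nf lextX.
Qed.

(** This is what makes the kernel of [nf] an ideal. *)
Lemma nf_mul p q : nf (p * q) = nf (p * nf q).
Proof.
elim/mpoly_ind_X: p => [|a p p' hp hp'|u]; first by rewrite !mul0r.
  by rewrite !mulrDl -!scalerAl !linearP /= hp hp'.
exact: nf_mulX.
Qed.

End Rewriting.

Lemma map_tau (A B : comPzRingType) (f : {rmorphism A -> B})
    (t : nat -> nat -> nat -> nat -> A) (a b c d : nat) :
  f (tau J t a b c d) = tau J (fun a b c d => f (t a b c d)) a b c d.
Proof.
rewrite rmorph_prod; apply: eq_bigr => s _; rewrite /tcoef; case: ifP => //.
by rewrite rmorph0.
Qed.

(** Behind the flatness of the family: the quotient by the kernel of [nf] stays free on the standard
    monomials after every base change. *)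
Lemma map_nf (A B : comNzRingType) (f : {rmorphism A -> B})
    (t : nat -> nat -> nat -> nat -> A) p :
  map_mpoly f (nf t p) = nf (fun a b c d => f (t a b c d)) (map_mpoly f p).
Proof.
elim/mpoly_ind_X: p => [|a p q hp hq|u]; first by rewrite !raddf0.
  by rewrite !linearP /= !raddfD /= !map_mpolyZ !linearZ /= hp hq.
rewrite map_mpolyX /nf !lextX; move: u; apply: (nf_ind (P := fun u p => map_mpoly f p =
  nfu (fun a b c d => f (t a b c d)) u)) => [u du|u su|v i j ji IH].
- by rewrite nfu_dead ?raddf0.
- by rewrite nfu_std ?map_mpolyX.
rewrite (@nfu_redex B _ _ i j) ?unxyK ?redex_mxy // !nf_rhs rmorph_sum.
apply: eq_bigr => p _; rewrite rmorph_sum; apply: eq_bigr => q _.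
rewrite /= map_mpolyZ map_tau.
case: (pselect (tau J t i j p q = 0)) => [e|ne]; last by rewrite IH.
by rewrite -map_tau e rmorph0 !scale0r.
Qed.

End NormalForm.

(** * Graded pieces of quotients and their bases *)

Section Bases.
Context (m n : nat) (A : comNzRingType).
Local Notation N := (m + n)%N.
Local Notation S := {mpoly A[N]}.
Implicit Types (I : S -> Prop) (d : int * int).

Definition lin I : Prop := I 0 /\ forall a p q, I p -> I q -> I (a *: p + q).
Definition ideal I : Prop :=
  [/\ I 0, (forall p q, I p -> I q -> I (p + q)) & (forall p q, I q -> I (p * q))].

Lemma ideal_lin I : ideal I -> lin I.
Proof.
case=> h0 hD hM; split=> // a p q hp hq; apply: hD => //.
by rewrite -mul_mpolyC; apply: hM.
Qed.

Lemma linD I p q : lin I -> I p -> I q -> I (p + q).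
Proof. by case=> _ h hp hq; rewrite -[p]scale1r; apply: h. Qed.
Lemma linZ I a p : lin I -> I p -> I (a *: p).
Proof. by case=> h0 h hp; rewrite -[_ *: _]addr0; apply: h. Qed.
Lemma linN I p : lin I -> I p -> I (- p).
Proof. by move=> hI hp; rewrite -scaleN1r; apply: linZ. Qed.
Lemma linB I p q : lin I -> I p -> I q -> I (p - q).
Proof. by move=> hI hp hq; apply: linD => //; apply: linN. Qed.
Lemma lin_sum I (T : Type) (r : seq T) (P : pred T) (F : T -> S) : lin I ->
  (forall i, P i -> I (F i)) -> I (\sum_(i <- r | P i) F i).
Proof. by move=> hI h; elim/big_ind: _ => //; [case: hI | move=> *; apply: linD]. Qed.
Lemma linBK I p q : lin I -> I (p - q) -> I q -> I p.
Proof. by move=> hI h1 h2; rewrite -[p](subrK q); apply: linD. Qed.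
Lemma linBC I p q : lin I -> I (p - q) -> I (q - p).
Proof. by move=> hI h1; rewrite -opprB; apply: linN. Qed.
Lemma lin_trans I p q r : lin I -> I (p - q) -> I (q - r) -> I (p - r).
Proof. by move=> hI h1 h2; rewrite -[p](subrK q) -addrA; apply: linD. Qed.

Definition comb r (b : 'I_r -> S) (a : {ffun 'I_r -> A}) : S := \sum_i a i *: b i.

Definition basis I d r (b : 'I_r -> S) : Prop :=
  (forall i, bihom d (b i)) /\
  forall p, bihom d p -> exists! a : {ffun 'I_r -> A}, I (p - comb b a).

Definition hilb I (h : int * int -> nat) : Prop :=
  forall d, exists b : 'I_(h d) -> S, basis I d b.

Lemma comb_bihom d r (b : 'I_r -> S) a : (forall i, bihom d (b i)) -> bihom d (comb b a).
Proof. by move=> h; apply: bihom_sum => i _; apply: bihomZ. Qed.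

Lemma comb0 r (b : 'I_r -> S) : comb b 0 = 0.
Proof. by rewrite /comb big1 // => i _; rewrite ffunE scale0r. Qed.

Lemma combB r (b : 'I_r -> S) a a' : comb b (a - a') = comb b a - comb b a'.
Proof. by rewrite -sumrB; apply: eq_bigr => i _; rewrite !ffunE scalerBl. Qed.

Lemma basis0 I d r (b : 'I_r -> S) a : lin I -> basis I d b -> I (comb b a) -> a = 0.
Proof.
move=> hI [h1 h2] ha; have [a' [_ ua]] := h2 0 (@bihom0 m n A d).
rewrite -(ua a); last by rewrite sub0r; apply: linN.
by apply: ua; rewrite comb0 subrr; case: hI.
Qed.

Lemma basisI I d r (b : 'I_r -> S) : lin I ->
  (forall i, bihom d (b i)) ->
  (forall p, bihom d p -> exists a, I (p - comb b a)) ->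
  (forall a, I (comb b a) -> a = 0) -> basis I d b.
Proof.
move=> hI h1 h2 h3; split=> // p /h2[a ha]; exists a; split=> // a' ha'.
apply/eqP; rewrite -subr_eq0; apply/eqP/h3; rewrite combB.
by have := linB hI ha' ha; rewrite opprB addrC addrA subrK.
Qed.

(** Over a commutative ring a one-sided inverse of a square matrix is two-sided, so [r] elements
    that span a free module of rank [r] are independent. *)
Lemma span_basis I d r (b s : 'I_r -> S) : lin I -> basis I d b ->
  (forall i, bihom d (s i)) ->
  (forall p, bihom d p -> exists a, I (p - comb s a)) -> basis I d s.
Proof.
move=> hI hb hs sp; apply: basisI => // a ha.
have /choice[K hK] : forall j, exists a, I (b j - comb s a).
  by move=> j; apply: sp; case: hb.
have /choice[M hM] : forall j, exists a, I (s j - comb b a).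
  by move=> j; case: hb => _ /(_ _ (hs j))[x [hx _]]; exists x.
pose KM : 'M[A]_r := \matrix_(i, j) K i j; pose MM : 'M[A]_r := \matrix_(i, j) M i j.
have subst (x : {ffun 'I_r -> A}) (F G : 'I_r -> S) :
    (forall i, I (F i - G i)) -> I (\sum_i x i *: F i - \sum_i x i *: G i).
  move=> hFG; rewrite -sumrB; apply: lin_sum => // i _.
  by rewrite -scalerBr; apply: linZ.
have comp (x : {ffun 'I_r -> A}) (L : 'I_r -> {ffun 'I_r -> A}) (F : 'I_r -> S) :
    \sum_i x i *: comb F (L i) = comb F [ffun j => \sum_i x i * L i j].
  rewrite /comb; under eq_bigr => i _ do rewrite scaler_sumr.
  rewrite exchange_big; apply: eq_bigr => j _; rewrite ffunE scaler_suml.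
  by apply: eq_bigr => i _; rewrite scalerA.
have KM1 : KM *m MM = 1%:M.
  apply/matrixP => i j; rewrite !mxE.
  have h : I (comb b [ffun l => \sum_j K i j * M j l] - b i).
    apply: (@linBC _ _ _ hI); apply: lin_trans (hK i) _ => //.
    by rewrite -(comp (K i) M b); apply: subst.
  have h' : I (comb b ([ffun l => \sum_j K i j * M j l] - [ffun l => (i == l)%:R])).
    rewrite combB; move: h; congr (I (_ - _)); rewrite /comb (bigD1 i) //= ffunE eqxx scale1r.
    by rewrite big1 ?addr0 // => l li; rewrite ffunE eq_sym (negPf li) scale0r.
  have := basis0 hI hb h' => /ffunP/(_ j); rewrite !ffunE => /eqP; rewrite subr_eq0 => /eqP <-.
  by apply: eq_bigr => l _; rewrite !mxE.
have MK1 := mulmx1C KM1.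
have aM : (\row_i a i) *m MM = 0.
  have h : I (comb b [ffun j => \sum_i a i * M i j]).
    rewrite -(comp a M b); apply: (@linBK _ _ (comb s a)) => //.
    by apply: (@linBC _ _ _ hI); apply: subst.
  apply/rowP => j; rewrite [RHS]mxE; have := basis0 hI hb h => /ffunP/(_ j); rewrite !ffunE => <-.
  by rewrite mxE; apply: eq_bigr => l _; rewrite !mxE.
have : \row_i a i = 0 by rewrite -[LHS]mulmx1 -MK1 mulmxA aM mul0mx.
by move=> /rowP e; apply/ffunP => i; have := e i; rewrite !mxE ffunE.
Qed.

(** A surjection between free modules of the same finite rank is injective. Equality of ideals is
    obtained from an inclusion in this way wherever the ranks are known. *)
Lemma basis_sub I1 I2 d r (b1 b2 : 'I_r -> S) : lin I1 -> lin I2 ->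
  basis I1 d b1 -> basis I2 d b2 ->
  (forall p, bihom d p -> I1 p -> I2 p) -> forall p, bihom d p -> I2 p -> I1 p.
Proof.
move=> l1 l2 hb1 hb2 sub p hp h2.
have sp q : bihom d q -> exists a, I2 (q - comb b1 a).
  move=> hq; have [h1 /(_ q hq)[a [ha _]]] := hb1; exists a; apply: sub => //.
  by apply: bihomB => //; apply: comb_bihom.
have hb : basis I2 d b1 by apply: span_basis hb2 _ sp => //; case: hb1.
have [h1 /(_ p hp)[a [ha _]]] := hb1.
have : I2 (comb b1 a).
  apply: linBK h2 => //; apply: (@linBC _ _ _ l2); apply: sub => //.
  by apply: bihomB => //; apply: comb_bihom.
by move/(basis0 l2 hb) => e; rewrite e comb0 subr0 in ha.
Qed.

Section Standard.
Context (J : borel m n).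

Definition stds d : seq 'X_{1..N} := [seq u <- mons m n d | std J u].
Definition stdb d (i : 'I_(size (stds d))) : S := 'X_[nth 0%MM (stds d) i].

Lemma mem_stds d u : (u \in stds d) = std J u && (bideg u == d).
Proof. by rewrite mem_filter mem_mons. Qed.

Lemma stds_uniq d : uniq (stds d).
Proof. by apply/filter_uniq/mons_uniq. Qed.

(** Freeness of the quotient on the standard monomials, phrased with unique representatives so that
    no numbering of the monomials intervenes. *)
Definition good I d : Prop := forall p, bihom d p ->
  exists! r, [/\ stdpoly J r, bihom d r & I (p - r)].

Lemma stdb_coef d a (i : 'I_(size (stds d))) : (comb (@stdb d) a)@_(nth 0%MM (stds d) i) = a i.
Proof.
rewrite raddf_sum (bigD1 i) //= mcoeffZ mcoeffX eqxx mulr1 big1 ?addr0 // => j ji.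
rewrite mcoeffZ mcoeffX nth_uniq ?stds_uniq // (_ : (_ == _ :> nat) = false) ?mulr0 //.
exact: negPf ji.
Qed.

Lemma bihom_stdb d i : bihom d (@stdb d i).
Proof.
have : nth 0%MM (stds d) i \in stds d by rewrite mem_nth.
by rewrite mem_stds => /andP[_ /eqP]; apply: bihomX'.
Qed.

Lemma stdpoly_stdb d i : stdpoly J (@stdb d i).
Proof.
have : nth 0%MM (stds d) i \in stds d by rewrite mem_nth.
by rewrite mem_stds => /andP[h _] u; rewrite msuppX mem_seq1 => /eqP->.
Qed.

Lemma stdpoly_comb d a : stdpoly J (comb (@stdb d) a).
Proof.
rewrite /comb; elim/big_rec: _ => [|i p _ hp]; first exact: stdpoly0.
by apply: stdpoly_lin => //; apply: stdpoly_stdb.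
Qed.

Definition stdc d (r : S) : {ffun 'I_(size (stds d)) -> A} :=
  [ffun i : 'I_(size (stds d)) => r@_(nth 0%MM (stds d) i)].

Lemma stdpolyE d (r : S) : stdpoly J r -> bihom d r ->
  r = comb (@stdb d) (stdc d r).
Proof.
move=> /stdpolyP hr /bihomP hd; apply/mpolyP => u.
have [us|us] := boolP (u \in stds d).
  have il : (index u (stds d) < size (stds d))%N by rewrite index_mem.
  by have := stdb_coef (stdc d r) (Ordinal il);
    rewrite [stdc _ _ _]ffunE /= nth_index // => ->.
transitivity (0 : A).
  by move: us; rewrite mem_stds negb_and => /orP[/hr|/eqP/hd].
apply/esym/memN_msupp_eq0; apply: contra us => hu.
rewrite mem_stds (stdpoly_comb hu) /=; apply/eqP.
by have := @comb_bihom d _ (@stdb d) _ (@bihom_stdb d); apply; exact: hu.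
Qed.

Lemma good_basis I d : lin I -> good I d -> basis I d (@stdb d).
Proof.
move=> hI hg; apply: basisI => // [i|p hp|a ha]; first exact: bihom_stdb.
  have [r [[h1 h2 h3] _]] := hg p hp.
  by exists (stdc d r); rewrite -stdpolyE.
have [r [_ ur]] := hg 0 (@bihom0 m n A d).
have e : comb (@stdb d) a = 0.
  rewrite -(ur (comb (@stdb d) a)); last first.
    split; [exact: stdpoly_comb | apply: comb_bihom; exact: bihom_stdb |].
    by rewrite sub0r; apply: linN.
  apply: ur; split; [exact: stdpoly0 | exact: bihom0 |].
  by rewrite subrr; case: hI.
by apply/ffunP => i; rewrite -stdb_coef e mcoeff0 ffunE.
Qed.

Lemma basis_good I d : lin I -> basis I d (@stdb d) -> good I d.
Proof.
move=> hI hb p hp; have [h1 /(_ p hp)[a [ha ua]]] := hb.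
exists (comb (@stdb d) a); split=> [|r [r1 r2 r3]].
  by split=> //; [exact: stdpoly_comb | exact: comb_bihom].
by rewrite (stdpolyE r1 r2); congr comb; apply: ua; rewrite -stdpolyE.
Qed.

Lemma span_good I d (b : 'I_(size (stds d)) -> S) : lin I -> basis I d b ->
  (forall p, bihom d p -> exists r, [/\ stdpoly J r, bihom d r & I (p - r)]) ->
  good I d.
Proof.
move=> hI hb sp; apply: basis_good => //; apply: span_basis hb _ _ => //.
  exact: bihom_stdb.
move=> p /sp[r [h1 h2 h3]].
by exists (stdc d r); rewrite -stdpolyE.
Qed.

Lemma good_uniq I d r : lin I -> good I d -> stdpoly J r -> bihom d r -> I r -> r = 0.
Proof.
move=> hI /good_basis hb hs hd; rewrite (stdpolyE hs hd) => /(basis0 hI (hb hI)) ->.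
exact: comb0.
Qed.

End Standard.
End Bases.

(** * The ideals of the explicit family *)

Section Datum.
Context (m n : nat) (J : borel m n).
Local Notation N := (m + n)%N.
Local Notation vx := (@vx m n).
Local Notation vy := (@vy m n).

(** A point of the parameter space with values in [A]. Keeping the inverse matrix in the record lets
    ring maps act on it entrywise. *)
Record datum (A : comPzRingType) := Datum {
  dG : 'M[A]_N; dH : 'M[A]_N; dt : nat -> nat -> nat -> nat -> A;
  dG_blk : blk dG; dH_blk : blk dH;
  dGH : dG *m dH = 1%:M; dHG : dH *m dG = 1%:M }.

Lemma blk_map (A B : comPzRingType) (f : {rmorphism A -> B}) (G : 'M[A]_N) :
  blk G -> blk (map_mx f G).
Proof. by move=> h i j /h e; rewrite mxE e rmorph0. Qed.

Lemma map_inv (A B : comPzRingType) (f : {rmorphism A -> B}) (G H : 'M[A]_N) :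
  G *m H = 1%:M -> map_mx f G *m map_mx f H = 1%:M.
Proof. by move=> e; rewrite -map_mxM e map_mx1. Qed.

Definition map_datum (A B : comPzRingType) (f : {rmorphism A -> B}) (D : datum A) :
    datum B :=
  Datum (fun a b c d => f (dt D a b c d)) (blk_map f (dG_blk D)) (blk_map f (dH_blk D))
    (map_inv f (dGH D)) (map_inv f (dHG D)).

Section CI.
Context (A : comNzRingType).
Local Notation S := {mpoly A[N]}.
Implicit Types (D : datum A) (p q : S).

Definition cnf D p : S := nf J (dt D) (act (dG D) p).
HB.instance Definition _ D := GRing.Linear.copy (cnf D) (nf J (dt D) \o act (dG D)).

Definition CI D p : Prop := cnf D p = 0.

Lemma actGH D p : act (dG D) (act (dH D) p) = p.
Proof. by rewrite actM dHG act1. Qed.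
Lemma actHG D p : act (dH D) (act (dG D) p) = p.
Proof. by rewrite actM dGH act1. Qed.

Lemma CI_ideal D : ideal (CI D).
Proof.
rewrite /CI /cnf; split=> [|p q hp hq|p q hq].
- by rewrite !linear0.
- by rewrite !linearD /= hp hq addr0.
- by rewrite rmorphM /= nf_mul hq mulr0 linear0.
Qed.
Lemma CI_lin D : lin (CI D). Proof. exact/ideal_lin/CI_ideal. Qed.

Definition cstdb D d (i : 'I_(size (stds J d))) : S := act (dH D) (stdb A i).

Lemma CI_basis D d : basis (CI D) d (@cstdb D d).
Proof.
have hc a : comb (@cstdb D d) a = act (dH D) (comb (@stdb m n A J d) a).
  by rewrite /comb linear_sum; apply: eq_bigr => i _; rewrite linearZ.
apply: basisI; first exact: CI_lin.
- by move=> i; apply: bihom_act; [apply: dH_blk | apply: bihom_stdb].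
- move=> p hp; have hn : bihom d (cnf D p).
    by apply: bihom_nf; apply: bihom_act => //; apply: dG_blk.
  exists (stdc J d (cnf D p)); rewrite hc.
  rewrite -stdpolyE //; last exact: nf_stdpoly.
  by rewrite /CI /cnf !linearB /= actGH nf_idem subrr.
- move=> a; rewrite hc /CI /cnf actGH nf_id; last exact: stdpoly_comb.
  by move=> e; apply/ffunP => i; rewrite -stdb_coef e mcoeff0 ffunE.
Qed.

Inductive cgen D : S -> Prop :=
| cgen_x (i : 'I_m) : (i < ba J)%N -> cgen D (act (dH D) 'X_(vx i))
| cgen_y (j : 'I_n) : (j < bb J)%N -> cgen D (act (dH D) 'X_(vy j))
| cgen_xy (i : 'I_m) (j : 'I_n) : (j < lam J i)%N ->
    cgen D (act (dH D) ('X_[mxy 0 i j] - rhs J (dt D) 0 i j)).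

Lemma nf_dead_var (t : nat -> nat -> nat -> nat -> A) l u : dead J U_(l)%MM ->
  nf J t ('X_[u] * 'X_l) = 0.
Proof. by move=> h; rewrite -mpolyXD /nf lextX nfu_dead //; apply: dead_add. Qed.

Lemma dead_vx (i : 'I_m) : (i < ba J)%N -> dead J U_(vx i)%MM.
Proof.
move=> h; apply/orP; left; apply/existsP; exists i; rewrite h.
by rewrite mnm1E eqxx.
Qed.

Lemma dead_vy (j : 'I_n) : (j < bb J)%N -> dead J U_(vy j)%MM.
Proof.
move=> h; apply/orP; right; apply/existsP; exists j; rewrite h.
by rewrite mnm1E eqxx.
Qed.

Lemma CI_cgen D p : cgen D p -> CI D p.
Proof.
by case=> [i h|j h|i j h]; rewrite /CI /cnf actGH ?nf_rule //;
  rewrite -[X in nf _ _ X]mul1r -mpolyX0 nf_dead_var ?dead_vx ?dead_vy.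
Qed.

(** Modulo an ideal that contains the generators, every polynomial is congruent to its normal form,
    by induction along the rewriting; members of [CI D] have normal form 0. *)
Lemma CI_gen D (I : S -> Prop) : ideal I -> (forall p, cgen D p -> I p) ->
  forall p, CI D p -> I p.
Proof.
move=> hI hg p hp; have hl := ideal_lin hI.
have [_ _ hM] := hI.
suff key q : I (act (dH D) (q - nf J (dt D) q)).
  by have := key (act (dG D) p); rewrite (hp : nf _ _ _ = 0) subr0 actHG.
elim/mpoly_ind_X: q => [|a p' q hp' hq|u]; first by rewrite !linear0 addr0 linear0; case: hl.
  rewrite linearP opprD addrACA -scalerBr linearP /=.
  by case: hl => _; apply.
rewrite /nf lextX; move: u.
apply: (nf_ind (P := fun u p => I (act (dH D) ('X_[u] - p)))) => [u du|u su|v i j ji IH].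
- rewrite subr0; case/orP: du => /existsP[l /andP[ll hl0]].
    have -> : u = (u - U_(vx l) + U_(vx l))%MM by rewrite submK // lep1mP -lt0n.
    by rewrite mpolyXD rmorphM; apply/hM/hg/cgen_x.
  have -> : u = (u - U_(vy l) + U_(vy l))%MM by rewrite submK // lep1mP -lt0n.
  by rewrite mpolyXD rmorphM; apply/hM/hg/cgen_y.
- by rewrite subrr linear0; case: hl.
have -> : 'X_[mxy v i j] - nf J (dt D) (rhs J (dt D) v i j) =
    'X_[v] * ('X_[mxy 0 i j] - rhs J (dt D) 0 i j) +
    (rhs J (dt D) v i j - nf J (dt D) (rhs J (dt D) v i j)).
  rewrite addrA; congr (_ - _); rewrite mulrBr -mpolyXD mxy_add addm0 [X in _ - X + _](_ : _ = rhs J (dt D) v i j) ?subrK //.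
  rewrite /rhs mulr_sumr; apply: eq_bigr => a _; rewrite mulr_sumr; apply: eq_bigr => b _.
  by rewrite -scalerAr -mpolyXD mxy_add addm0.
rewrite linearD; apply: linD => //.
  by rewrite /= rmorphM; apply/hM/hg/cgen_xy.
rewrite nf_rhs /rhs -sumrB linear_sum; apply: lin_sum => // a _.
rewrite -sumrB linear_sum; apply: lin_sum => // b _; rewrite -scalerBr linearZ /=.
case: (pselect (tau J (dt D) i j a b = 0)) => [->|ne]; first by rewrite scale0r; case: hl.
by apply: linZ => //; apply: IH.
Qed.

Lemma bihom_cgen D p : cgen D p ->
  exists2 d, d \in [:: (1, 0); (0, 1); (1, 1)] & bihom d p.
Proof.
case=> [i h|j h|i j h]; [exists (1, 0)|exists (0, 1)|exists (1, 1)] => //;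
  apply: bihom_act; rewrite ?dH_blk //; try exact: dH_blk.
- exact/bihomX'/bideg_vx.
- exact/bihomX'/bideg_vy.
- have e a b : bideg (mxy (0%MM : 'X_{1..N}) a b) = (1, 1).
    by rewrite bideg_mxy bideg0 add0r.
  apply: bihomB; first exact/bihomX'/e.
  by do 2!apply: bihom_sum => ? _; apply/bihomZ/bihomX'/e.
Qed.

End CI.

Lemma map_cnf (A B : comNzRingType) (f : {rmorphism A -> B}) (D : datum A) p :
  map_mpoly f (cnf D p) = cnf (map_datum f D) (map_mpoly f p).
Proof. by rewrite /cnf map_nf map_act. Qed.

(** Together with [CI_gen] this makes inclusions between explicit ideals stable under ring maps. *)
Lemma map_cgen (A B : comNzRingType) (f : {rmorphism A -> B}) (D : datum A) p :
  cgen (map_datum f D) p -> exists2 q, cgen D q & p = map_mpoly f q.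
Proof.
case=> [i h|j h|i j h].
- by exists (act (dH D) 'X_(vx i)); [exact: cgen_x | rewrite map_act map_mpolyX].
- by exists (act (dH D) 'X_(vy j)); [exact: cgen_y | rewrite map_act map_mpolyX].
exists (act (dH D) ('X_[mxy 0 i j] - rhs J (dt D) 0 i j)); first exact: cgen_xy.
rewrite map_act [map_mpoly f (_ - _)]raddfB /= map_mpolyX; congr (act _ (_ - _)).
rewrite rmorph_sum; apply: eq_bigr => a _; rewrite rmorph_sum; apply: eq_bigr => b _.
by rewrite /= map_mpolyZ map_mpolyX map_tau.
Qed.

Lemma map_CI (A B : comNzRingType) (f : {rmorphism A -> B}) (D : datum A) p :
  CI D p -> CI (map_datum f D) (map_mpoly f p).
Proof. by move=> h; rewrite /CI -map_cnf h raddf0. Qed.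

End Datum.

(** * Normalising a family of ideals near a Borel-fixed one *)

Section Weights.
Context (m n : nat) (J : borel m n).
Local Notation N := (m + n)%N.
Local Notation vx := (@vx m n).
Local Notation vy := (@vy m n).
Local Notation mxy0 := (mxy (0%MM : 'X_{1..N})).
Implicit Types (u v r : 'X_{1..N}).

(** The weight [wt] does not separate a dead [x_i] from a live [x_l] whose row is full, as both have
    weight [n]. The extra unit on dead variables makes [W_drop] true. *)
Definition W u : nat := (wt J u + \sum_(i < m) u (vx i) * (i < ba J))%N.

Lemma WD u v : W (u + v)%MM = (W u + W v)%N.
Proof.
rewrite /W wtD addnACA -big_split /=; congr (_ + _)%N; apply: eq_bigr => i _.
by rewrite mnmDE mulnDl.
Qed.

Lemma W_vx i : W U_(vx i)%MM = (lam J i + (i < ba J))%N.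
Proof.
rewrite /W wt_vx (bigD1 i) //= mnm1E eqxx mul1n big1 ?addn0 // => l li.
by rewrite mnm1E eq_lshift eq_sym (negPf li).
Qed.

Lemma W_vy j : W U_(vy j)%MM = (n - j)%N.
Proof. by rewrite /W wt_vy big1 ?addn0 // => l _; rewrite mnm1E eq_rlshift. Qed.

Lemma mxy0E i j : mxy0 i j = (U_(vx i) + U_(vy j))%MM.
Proof. by rewrite /mxy add0m. Qed.

Lemma W_mxy0 i j : W (mxy0 i j) = (lam J i + (i < ba J) + (n - j))%N.
Proof. by rewrite mxy0E WD W_vx W_vy. Qed.

Lemma sum1_ex (k : nat) (f : 'I_k -> nat) : (\sum_i f i = 1)%N ->
  exists i, forall l, f l = (i == l).
Proof.
move=> e; have [i hi] : exists i, (0 < f i)%N.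
  apply: contrapT => h; have : (\sum_i f i = 0)%N.
    rewrite big1 // => i _; apply/eqP; rewrite -leqn0 leqNgt; apply/negP => hi.
    by apply: h; exists i.
  by rewrite e.
exists i => l; move: e; rewrite (bigD1 i) //=.
case: eqP => [<-|/eqP ne]; first by lia.
by rewrite (bigD1 l) /=; [lia | rewrite eq_sym].
Qed.

Lemma sum0_all (k : nat) (f : 'I_k -> nat) : (\sum_i f i = 0)%N -> forall l, f l = 0%N.
Proof. by move=> e l; move: e; rewrite (bigD1 l) //=; lia. Qed.

Lemma bideg10P u : bideg u = (1, 0) -> exists i, u = U_(vx i)%MM.
Proof.
case=> /sum1_ex[i hi] /sum0_all h0; exists i; apply: mnm_xyP => l.
  by rewrite [LHS]hi mnm1E eq_lshift.
by rewrite [LHS]h0 mnm1E eq_lrshift.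
Qed.

Lemma bideg01P u : bideg u = (0, 1) -> exists j, u = U_(vy j)%MM.
Proof.
case=> /sum0_all h0 /sum1_ex[i hi]; exists i; apply: mnm_xyP => l.
  by rewrite [LHS]h0 mnm1E eq_rlshift.
by rewrite [LHS]hi mnm1E eq_rshift.
Qed.

Lemma bideg11P u : bideg u = (1, 1) -> exists i j, u = mxy0 i j.
Proof.
case=> /sum1_ex[i hi] /sum1_ex[j hj]; exists i, j; apply: mnm_xyP => l.
  by rewrite mxy_vx mnm0E [LHS]hi.
by rewrite mxy_vy mnm0E [LHS]hj.
Qed.

Lemma dead_vxE i : dead J U_(vx i)%MM = (i < ba J)%N.
Proof.
apply/idP/idP => [|h]; last exact: dead_vx.
case/orP => /existsP[l /andP[ll]]; rewrite mnm1E.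
  by rewrite eq_lshift; case: eqP ll => // ->.
by rewrite eq_lrshift.
Qed.

Lemma dead_vyE j : dead J U_(vy j)%MM = (j < bb J)%N.
Proof.
apply/idP/idP => [|h]; last exact: dead_vy.
case/orP => /existsP[l /andP[ll]]; rewrite mnm1E.
  by rewrite eq_rlshift.
by rewrite eq_rshift; case: eqP ll => // ->.
Qed.

Lemma dead_D u v : dead J (u + v)%MM = dead J u || dead J v.
Proof.
apply/idP/orP => [|[h|h]]; last 2 first.
- by rewrite addmC; apply: dead_add.
- exact: dead_add.
case/orP => /existsP[l /andP[ll]]; rewrite mnmDE addn_gt0 => /orP[h|h].
- by left; apply/orP; left; apply/existsP; exists l; rewrite ll.
- by right; apply/orP; left; apply/existsP; exists l; rewrite ll.
- by left; apply/orP; right; apply/existsP; exists l; rewrite ll.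
- by right; apply/orP; right; apply/existsP; exists l; rewrite ll.
Qed.

Lemma std_vx i : std J U_(vx i)%MM = (ba J <= i)%N.
Proof.
rewrite /std dead_vxE -leqNgt; case: leqP => //= _; apply/existsP => -[a /existsP[b]].
by rewrite /redex !mnm1E eq_lrshift !andbF.
Qed.

Lemma std_vy j : std J U_(vy j)%MM = (bb J <= j)%N.
Proof.
rewrite /std dead_vyE -leqNgt; case: leqP => //= _; apply/existsP => -[a /existsP[b]].
by rewrite /redex !mnm1E eq_rlshift !andbF.
Qed.

Lemma std_mxy0 i j : std J (mxy0 i j) = [&& ba J <= i, bb J <= j & lam J i <= j]%N.
Proof.
rewrite /std mxy0E dead_D dead_vxE dead_vyE negb_or -!leqNgt -andbA -mxy0E.
congr [&& _, _ & _]; apply/idP/idP => [|h].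
  apply: contraR; rewrite -ltnNge => h; apply/existsP; exists i; apply/existsP; exists j.
  exact: redex_mxy.
apply/existsP => -[a /existsP[b /and3P[ab]]].
rewrite mxy_vx mxy_vy !mnm0E !add0n !lt0b => /eqP ea /eqP eb.
by move: ab; rewrite -ea -eb ltnNge h.
Qed.

Definition D1 : seq (int * int) := [:: (1, 0); (0, 1); (1, 1)].

(** The nonstandard monomials form an ideal generated in the bidegrees of [D1], so reductions known
    there propagate by multiplication. *)
Lemma nonstd_split u : ~~ std J u ->
  exists v u0, [/\ u = (v + u0)%MM, ~~ std J u0 & bideg u0 \in D1].
Proof.
move=> h; have : dead J u || [exists i, exists j, redex J u i j].
  by move: h; rewrite /std negb_and !negbK.
case/orP => [/orP[]|] /existsP[l].
- move=> /andP[ll hl]; exists (u - U_(vx l))%MM, U_(vx l)%MM.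
  rewrite submK ?lep1mP -?lt0n //; split=> //; last by rewrite bideg_vx.
  by rewrite std_vx -ltnNge.
- move=> /andP[ll hl]; exists (u - U_(vy l))%MM, U_(vy l)%MM.
  rewrite submK ?lep1mP -?lt0n //; split=> //; last by rewrite bideg_vy.
  by rewrite std_vy -ltnNge.
move=> /existsP[j r]; exists (unxy u l j), (mxy0 l j); split.
- by rewrite mxy_add addm0; apply: redexE r.
- by case/and3P: r => jl _ _; rewrite std_mxy0 [(lam _ _ <= _)%N]leqNgt jl !andbF.
- by rewrite bideg_mxy bideg0.
Qed.

Lemma W_drop u r : bideg u \in D1 -> bideg r = bideg u -> ~~ std J u -> std J r ->
  (W r < W u)%N.
Proof.
rewrite !inE => /or3P[] /eqP e; rewrite e.
- move=> /bideg10P[i ->]; have [l ->] := bideg10P e; rewrite !std_vx !W_vx -ltnNge.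
  move=> h1 h2; rewrite h1 (lam_dead h1) (leq_gtF h2); have := lam_le J i; lia.
- move=> /bideg01P[i ->]; have [l ->] := bideg01P e; rewrite !std_vy !W_vy -ltnNge.
  by have := ltn_ord i; lia.
move=> /bideg11P[i [j ->]]; have [p [q ->]] := bideg11P e.
rewrite !W_mxy0 !std_mxy0 => h1 /and3P[h2 h3 h4]; rewrite (leq_gtF h2).
have h5 := ltn_ord j; have h6 := ltn_ord q.
move: h1; rewrite !negb_and -!ltnNge => /or3P[] h; last by lia.
  by rewrite h (lam_dead h); lia.
by have := lam_bb J (ltn_ord p); lia.
Qed.

Section Low.
Context (A : comNzRingType).
Local Notation S := {mpoly A[N]}.

Definition low (w : nat) (p : S) : Prop := forall v, v \in msupp p -> (W v < w)%N.

Lemma lowP w p : low w p <-> (forall v, (w <= W v)%N -> p@_v = 0).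
Proof.
split=> [h v hv|h v]; first by apply: memN_msupp_eq0; apply/negP => /h; lia.
by rewrite mcoeff_msupp ltnNge; apply: contraNN => /h ->.
Qed.
Lemma low0 w : low w 0. Proof. by move=> v; rewrite msupp0. Qed.
Lemma lowD w p q : low w p -> low w q -> low w (p + q).
Proof.
by move=> /lowP hp /lowP hq; apply/lowP => v hv; rewrite mcoeffD hp // hq // addr0.
Qed.
Lemma lowZ w a p : low w p -> low w (a *: p).
Proof. by move=> /lowP hp; apply/lowP => v hv; rewrite mcoeffZ hp // mulr0. Qed.
Lemma low_sum w (T : eqType) (r : seq T) (F : T -> S) :
  (forall i, i \in r -> low w (F i)) -> low w (\sum_(i <- r) F i).
Proof.
move=> h; rewrite big_seq; elim/big_ind: _ => //; [exact: low0 | exact: lowD].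
Qed.
Lemma low_le w w' p : (w <= w')%N -> low w p -> low w' p.
Proof. by move=> h hp v /hp; lia. Qed.
Lemma lowX w u : (W u < w)%N -> low w 'X_[u].
Proof. by move=> h v; rewrite msuppX mem_seq1 => /eqP->. Qed.
Lemma low_mulX w u p : low w p -> low (W u + w) ('X_[u] * p).
Proof.
move=> hp v; rewrite mulrC => /msuppM_le/allpairsP[[a b] /= [/hp ha]].
by rewrite msuppX mem_seq1 => /eqP -> ->; rewrite WD; lia.
Qed.
Lemma lowM w w' p q : low w p -> low w' q -> low (w + w') (p * q).
Proof.
move=> hp hq v /msuppM_le/allpairsP[[a b] /= [/hp ha /hq hb ->]].
by rewrite WD; lia.
Qed.

Definition lowering (G : 'M[A]_N) : Prop := forall l l', l != l' ->
  G l l' <> 0 -> (W U_(l')%MM < W U_(l)%MM)%N.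
Definition unip (G : 'M[A]_N) : Prop := (forall l, G l l = 1) /\ lowering G.

Lemma act_unip (G : 'M[A]_N) u : unip G -> low (W u) (act G 'X_[u] - 'X_[u]).
Proof.
case=> G1 Gl.
have hU l : low (W U_(l)%MM) (act G 'X_l - 'X_l).
  rewrite actX /linf (bigD1 l) //= G1 scale1r addrAC subrr add0r.
  rewrite -big_filter; apply: low_sum => l'; rewrite mem_filter => /andP[ll' _].
  case: (pselect (G l l' = 0)) => [->|ne]; first by rewrite scale0r; apply: low0.
  by apply/lowZ/lowX/Gl => //; rewrite eq_sym.
have [k] := ubnP (mdeg u); elim: k u => // k IH u uk.
have [/eqP|u0] := boolP (mdeg u == 0%N).
  by move/eqP; rewrite mdeg_eq0 => /eqP ->; rewrite mpolyX0 rmorph1 subrr; apply: low0.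
have [l hl] : exists l, (0 < u l)%N.
  apply: contrapT => h; case/negP: u0; rewrite mdeg_eq0; apply/eqP/mnmP => l.
  by rewrite mnm0E; apply/eqP; rewrite -leqn0 leqNgt; apply/negP => hl; apply: h; exists l.
have e : u = (U_(l) + (u - U_(l)))%MM by rewrite addmC submK // lep1mP -lt0n.
have /IH : (mdeg (u - U_(l))%MM < k)%N by move: uk; rewrite {1}e mdegD mdeg1; lia.
move: (u - U_(l))%MM e => v -> hv; rewrite mpolyXD rmorphM /=.
have -> : act G 'X_l * act G 'X_[v] - 'X_l * 'X_[v] =
  (act G 'X_l - 'X_l) * (act G 'X_[v] - 'X_[v]) + ('X_l * (act G 'X_[v] - 'X_[v]) +
   'X_[v] * (act G 'X_l - 'X_l)).
  by move: (act G _) (act G _) => a b; ring.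
rewrite WD; apply: lowD; first exact: lowM.
apply: lowD; first exact: low_mulX.
by rewrite addnC; apply: low_mulX.
Qed.

(** Generators live in [D1]; in bidegrees (2,1) and (1,2) the reductions of a common multiple of two
    of them are compared. *)
Definition D2 : seq (int * int) := D1 ++ [:: (2, 1); (1, 2)].

(** Outside [D1] only the rank of the quotient is prescribed; [near_good] recovers freeness on the
    standard monomials. *)
Definition near (I : S -> Prop) : Prop :=
  [/\ ideal I,
      (forall d, d \in D2 -> exists b : 'I_(size (stds J d)) -> S, basis I d b) &
      (forall d, d \in D1 -> good J I d)].

Definition nform (I : S -> Prop) (F : 'X_{1..N} -> S) : Prop := forall u,
  [/\ stdpoly J (F u), bihom (bideg u) (F u), I ('X_[u] - F u),
      (std J u -> F u = 'X_[u]) & (~~ std J u -> low (W u) (F u))].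

Lemma near_nform I : near I -> exists F, nform I F.
Proof.
case=> hI _ hg; have hl := ideal_lin hI.
suff /choice[F hF] : forall u, exists r : S, [/\ stdpoly J r, bihom (bideg u) r,
    I ('X_[u] - r), (std J u -> r = 'X_[u]) & (~~ std J u -> low (W u) r)] by exists F.
move=> u.
have [k] := ubnP (W u); elim: k u => // k IH u uk.
have [su|nsu] := boolP (std J u).
  exists 'X_[u]; split=> //; first by move=> v; rewrite msuppX mem_seq1 => /eqP->.
    exact: bihomX.
  by rewrite subrr; case: hl.
have [v [u0 [e ns0 hd]]] := nonstd_split nsu.
have [r0 [[r1 r2 r3] _]] := hg _ hd 'X_[u0] (@bihomX _ _ _ _).
have r4 s : s \in msupp r0 -> (W s < W u0)%N.
  by move=> hs; apply: W_drop => //; [apply: r2 | apply: r1].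
have /choice[F hF] : forall s, exists r : S, (W (v + s)%MM < k)%N ->
  [/\ stdpoly J r, bihom (bideg (v + s)%MM) r, I ('X_[v + s] - r),
      (std J (v + s)%MM -> r = 'X_[v + s]) & (~~ std J (v + s)%MM -> low (W (v + s)%MM) r)].
  move=> s; case: (ltnP (W (v + s)%MM) k) => h; last by exists 0.
  by have [r hr] := IH _ h; exists r.
have Wk s : s \in msupp r0 -> (W (v + s)%MM < k)%N.
  by move=> /r4; move: uk; rewrite e !WD; lia.
exists (\sum_(s <- msupp r0) r0@_s *: F s); split=> //.
- rewrite big_seq; elim/big_rec: _ => [|s p hs hp]; first exact: stdpoly0.
  by apply: stdpoly_lin => //; have [] := hF s (Wk s hs).
- rewrite big_seq; apply: bihom_sum => s hs; apply: bihomZ.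
  by have [_ + _ _ _] := hF s (Wk s hs); rewrite e !bidegD (r2 s hs).
- rewrite e mpolyXD; apply: (@lin_trans _ _ _ _ _ ('X_[v] * r0)) => //.
    by rewrite -mulrBr; case: hI => _ _; apply.
  rewrite {1}[r0]mpolyE mulr_sumr -sumrB big_seq; apply: lin_sum => // s hs.
  rewrite -scalerAr -scalerBr -mpolyXD; apply: linZ => //.
  by have [] := hF s (Wk s hs).
move=> _; apply: low_sum => s hs; apply: lowZ.
have [_ _ _ h4 h5] := hF s (Wk s hs).
have lt : (W (v + s)%MM < W u)%N by rewrite e !WD ltn_add2l r4.
have [/h4 ->|/h5] := boolP (std J (v + s)%MM); first exact: lowX.
by apply: low_le; apply: ltnW.
Qed.

Lemma nform_lext I F d p : lin I -> nform I F -> bihom d p ->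
  [/\ stdpoly J (lext F p), bihom d (lext F p) & I (p - lext F p)].
Proof.
move=> hl hF hp; split.
- rewrite /lext; elim/big_rec: _ => [|s q _ hq]; first exact: stdpoly0.
  by apply: stdpoly_lin => //; have [] := hF s.
- rewrite /lext big_seq; apply: bihom_sum => s hs; apply: bihomZ.
  by have [_ + _ _ _] := hF s; rewrite (hp s hs).
rewrite {1}[p]mpolyE /lext -sumrB; apply: lin_sum => // s _.
by rewrite -scalerBr; apply: linZ => //; have [] := hF s.
Qed.

(** Reduction by the rules of [D1] shows that the standard monomials span, and there are as many of
    them as the rank. *)
Lemma near_good I d : near I -> d \in D2 -> good J I d.
Proof.
move=> hn hd; have [F hF] := near_nform hn; case: hn => hI hb _.
have [b hbb] := hb d hd; have hl := ideal_lin hI.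
apply: (span_good hl hbb) => p hp; exists (lext F p).
exact: nform_lext.
Qed.

Lemma basis_act (I : S -> Prop) (G H : 'M[A]_N) d (r : nat) (b : 'I_r -> S) : lin I ->
  blk G -> blk H -> G *m H = 1%:M -> H *m G = 1%:M ->
  basis I d b -> basis (fun p => I (act H p)) d (fun i => act G (b i)).
Proof.
move=> hI bG bH GH HG [h1 h2]; split=> [i|p hp]; first exact: bihom_act.
have e (p' : S) a : act H (p' - comb (fun i => act G (b i)) a) = act H p' - comb b a.
  rewrite linearB /=; congr (_ - _); rewrite /comb linear_sum; apply: eq_bigr => i _.
  by rewrite linearZ /= actM GH act1.
have [a [ha ua]] := h2 _ (bihom_act bH hp).
by exists a; split=> [|a']; rewrite e // => /ua.
Qed.

Lemma ideal_act (I : S -> Prop) (H : 'M[A]_N) : ideal I -> ideal (fun p => I (act H p)).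
Proof.
case=> h1 h2 h3; split=> [|p q hp hq|p q hq].
- by rewrite linear0.
- by rewrite linearD; apply: h2.
- by rewrite rmorphM; apply: h3.
Qed.

(** A lowering substitution alters a monomial by lighter terms only, so every nonstandard monomial
    still reduces to lighter ones and the standard monomials still span. *)
Lemma near_act I (G H : 'M[A]_N) : blk G -> blk H -> G *m H = 1%:M -> H *m G = 1%:M ->
  unip G -> near I -> near (fun p => I (act H p)).
Proof.
move=> bG bH GH HG uG hn; have [F hF] := near_nform hn; have [hI hb hg] := hn.
have hI' := ideal_act H hI; have hl := ideal_lin hI'.
have hb' d : d \in D2 -> exists b : 'I_(size (stds J d)) -> S,
    basis (fun p => I (act H p)) d b.
  move=> /hb[b hbb]; exists (fun i => act G (b i)); apply: basis_act => //.
  exact: ideal_lin.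
split=> // d hd; have [|b hbb] := hb' d; first by rewrite mem_cat hd.
apply: (span_good hl hbb) => p hp.
have /choice[R hR] : forall u, exists r : S, bideg u = d ->
    [/\ stdpoly J r, bihom d r & I (act H ('X_[u] - r))].
  move=> u; have [k] := ubnP (W u); elim: k u => // k IH u uk.
  case: (pselect (bideg u = d)) => [ud|]; last by exists 0.
  have [su|nsu] := boolP (std J u).
    exists 'X_[u]; split; first by move=> v; rewrite msuppX mem_seq1 => /eqP->.
      exact: bihomX'.
    by rewrite subrr linear0; case: (ideal_lin hI).
  have [f1 f2 f3 _ f5] := hF u.
  (* Congruent to ['X_[u]] modulo the moved ideal, with all terms lighter than [u]. *)
  pose q := 'X_[u] - act G ('X_[u] - F u).
  have hq : low (W u) q.
    have -> : q = - (act G 'X_[u] - 'X_[u]) + act G (F u).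
      by rewrite /q linearB /= !opprB [act G (F u) - _]addrC addrA.
    apply: lowD; first by rewrite -scaleN1r; apply/lowZ/act_unip.
    rewrite [F u]mpolyE linear_sum; apply: low_sum => s hs; rewrite linearZ /=; apply: lowZ.
    have := f5 nsu s hs; move=> hW.
    rewrite -(subrK 'X_[s] (act G 'X_[s])); apply: lowD; last exact: lowX.
    by apply: (low_le (ltnW hW)); apply: act_unip.
  have hqd : bihom d q.
    by apply: bihomB; [exact: bihomX' | apply: bihom_act => //; rewrite -ud; apply: bihomB => //; exact: bihomX].
  have hqI : I (act H ('X_[u] - q)).
    by rewrite /q opprB addrCA subrr addr0 actM GH act1.
  have /choice[R hR] : forall s, exists r : S, s \in msupp q ->
      [/\ stdpoly J r, bihom d r & I (act H ('X_[s] - r))].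
    move=> s; case: (boolP (s \in msupp q)) => hs; last by exists 0.
    have [|r hr] := IH s; first by have := hq s hs; lia.
    by exists r => _; apply: hr; apply: hqd.
  exists (\sum_(s <- msupp q) q@_s *: R s) => _; split.
  - rewrite big_seq; elim/big_rec: _ => [|s p' hs hp']; first exact: stdpoly0.
    by apply: stdpoly_lin => //; have [] := hR s hs.
  - by rewrite big_seq; apply: bihom_sum => s hs; apply: bihomZ; have [] := hR s hs.
  apply: (lin_trans hl hqI); rewrite {1}[q]mpolyE -sumrB big_seq.
  apply: (@lin_sum _ _ _ (fun p => I (act H p)) _ _ _ _ hl) => s hs; rewrite -scalerBr; apply: (@linZ _ _ _ (fun p => I (act H p)) _ _ hl).
  by have [] := hR s hs.
exists (\sum_(s <- msupp p) p@_s *: R s); split.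
- rewrite big_seq; elim/big_rec: _ => [|s p' hs hp']; first exact: stdpoly0.
  by apply: stdpoly_lin => //; have [] := hR s (hp s hs).
- by rewrite big_seq; apply: bihom_sum => s hs; apply: bihomZ; have [] := hR s (hp s hs).
rewrite {1}[p]mpolyE -sumrB big_seq; apply: (@lin_sum _ _ _ (fun p => I (act H p)) _ _ _ _ hl) => s hs.
by rewrite -scalerBr; apply: (@linZ _ _ _ (fun p => I (act H p)) _ _ hl); have [] := hR s (hp s hs).
Qed.

End Low.
End Weights.

(** * Which coefficients determine a normal form *)

Section Chart.
Context (m n : nat) (J : borel m n) (A : comNzRingType).
Local Notation N := (m + n)%N.
Local Notation vx := (@vx m n).
Local Notation vy := (@vy m n).
Local Notation mxy0 := (mxy (0%MM : 'X_{1..N})).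
Local Notation S := {mpoly A[N]}.
Local Notation W := (W J).
Local Notation std := (std J).
Local Notation lam := (lam J).
Implicit Types (u v r : 'X_{1..N}) (F : 'X_{1..N} -> S) (I : S -> Prop).

Definition D3 : seq (int * int) := [:: (1, 1); (2, 1); (1, 2)].

Lemma D3D2 d : d \in D3 -> d \in D2.
Proof. by rewrite !inE => /or3P[] /eqP ->. Qed.

Lemma near_uniq I d (p q : S) : near J I -> d \in D2 ->
  stdpoly J p -> bihom d p -> stdpoly J q -> bihom d q -> I (p - q) -> p = q.
Proof.
move=> hn hd p1 p2 q1 q2 h; apply/eqP; rewrite -subr_eq0; apply/eqP.
have hl := ideal_lin (let: And3 x _ _ := hn in x).
apply: (good_uniq hl (near_good hn hd)) h; [exact: stdpolyB | exact: bihomB].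
Qed.

Lemma nform_eq I F u (p : S) : near J I -> nform J I F -> bideg u \in D2 ->
  stdpoly J p -> bihom (bideg u) p -> I ('X_[u] - p) -> F u = p.
Proof.
move=> hn hF hd h1 h2 h3; have [f1 f2 f3 _ _] := hF u.
have hl := ideal_lin (let: And3 x _ _ := hn in x).
apply: (near_uniq hn hd) => //.
by apply: lin_trans (_ : I (_ - 'X_[u])) _ => //; apply: linBC.
Qed.

Lemma nform_step I F l u0 : near J I -> nform J I F ->
  bideg (U_(l) + u0)%MM \in D2 ->
  F (U_(l) + u0)%MM = \sum_(s <- mons m n (bideg u0)) (F u0)@_s *: F (U_(l) + s)%MM.
Proof.
move=> hn hF hd; have [_ f2 f3 _ _] := hF u0.
have hI := let: And3 x _ _ := hn in x; have hl := ideal_lin hI.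
have hX : bihom (bideg (U_(l) + u0)%MM) ('X_l * F u0).
  by rewrite bidegD; apply: bihomM => //; apply: bihomX.
have [g1 g2 g3] := nform_lext hl hF hX.
have -> : \sum_(s <- mons m n (bideg u0)) (F u0)@_s *: F (U_(l) + s)%MM = lext F ('X_l * F u0).
  rewrite {2}[F u0](bihomE f2) mulr_sumr linear_sum /=; apply: eq_bigr => s _.
  by rewrite -scalerAr linearZ /= -mpolyXD lextX.
apply: (nform_eq hn hF) => //; apply: lin_trans (_ : I (_ - 'X_l * F u0)) _ => //.
by rewrite mpolyXD -mulrBr; case: hI => _ _; apply.
Qed.

Lemma nform_std F I u r : nform J I F -> ~~ std r -> (F u)@_r = 0.
Proof. by move=> hF hr; have [/stdpolyP h _ _ _ _] := hF u; apply: h. Qed.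

Lemma nform_deg F I u r : nform J I F -> bideg r <> bideg u -> (F u)@_r = 0.
Proof. by move=> hF hr; have [_ /bihomP h _ _ _] := hF u; apply: h. Qed.

Lemma nform_gt F I u r : nform J I F -> (W u <= W r)%N -> u != r -> (F u)@_r = 0.
Proof.
move=> hF hr ur; have [_ _ _ h1 h2] := hF u.
have [/h1->|/h2/lowP] := boolP (std u); first by rewrite mcoeffX (negPf ur).
by apply.
Qed.

Lemma nform_self F I u : nform J I F -> std u -> (F u)@_u = 1.
Proof. by move=> hF su; have [_ _ _ -> // _] := hF u; rewrite mcoeffX eqxx. Qed.

Definition deadin I : Prop := forall l, dead J U_(l)%MM -> I 'X_l.

Lemma nform_dead I F u : near J I -> nform J I F -> deadin I -> bideg u \in D2 ->
  dead J u -> F u = 0.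
Proof.
move=> hn hF hdd hd du; have [_ _ hM] := let: And3 x _ _ := hn in x.
apply: (nform_eq hn hF) => //; [exact: stdpoly0 | exact: bihom0 |].
rewrite subr0; case/orP: du => /existsP[l /andP[ll hl]].
  have -> : u = (u - U_(vx l) + U_(vx l))%MM by rewrite submK // lep1mP -lt0n.
  by rewrite mpolyXD; apply/hM/hdd; rewrite dead_vxE.
have -> : u = (u - U_(vy l) + U_(vy l))%MM by rewrite submK // lep1mP -lt0n.
by rewrite mpolyXD; apply/hM/hdd; rewrite dead_vyE.
Qed.

Lemma bideg_mxy0 i j : bideg (mxy0 i j) = (1, 1).
Proof. by rewrite bideg_mxy bideg0 add0r. Qed.

Lemma std_xmxy a p q : std (mxy0 a q) -> std (mxy0 p q) -> std (U_(vx a) + mxy0 p q)%MM.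
Proof.
rewrite !std_mxy0 => /and3P[a1 a2 a3] /and3P[p1 p2 p3].
rewrite /std mxy0E !dead_D !dead_vxE !dead_vyE !ltnNge a1 p1 a2 /=.
apply/existsP => -[i /existsP[j /and3P[ij]]].
rewrite !mnmDE !mnm1E !eq_lrshift !eq_lshift !eq_rlshift !eq_rshift !add0n !addn0.
case: (eqVneq q j) ij => // <- ij + _.
by case: (eqVneq a i) => [e|_]; [rewrite -e in ij; lia|]; case: (eqVneq p i) => // e; rewrite -e in ij; lia.
Qed.

Lemma std_ymxy b p q : std (mxy0 p b) -> std (mxy0 p q) -> std (U_(vy b) + mxy0 p q)%MM.
Proof.
rewrite !std_mxy0 => /and3P[a1 a2 a3] /and3P[p1 p2 p3].
rewrite /std mxy0E !dead_D !dead_vxE !dead_vyE !ltnNge a2 p2 a1 /=.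
apply/existsP => -[i /existsP[j /and3P[ij]]].
rewrite !mnmDE !mnm1E !eq_lrshift !eq_lshift !eq_rlshift !eq_rshift !add0n !addn0.
case: (eqVneq p i) ij => // <- ij _.
by case: (eqVneq b j) => [e|_]; [rewrite -e in ij; lia|]; case: (eqVneq q j) => // e; rewrite -e in ij; lia.
Qed.

(* [l -> l'] is a direction in which a substitution of variables moves the
   coefficient of [l' w] in the normal form of [l w]. *)
Definition isroot (l l' w : 'I_N) : bool :=
  [&& bideg (U_(l)%MM : 'X_{1..N}) == bideg (U_(l')%MM : 'X_{1..N}),
      bideg (U_(l) + U_(w) : 'X_{1..N})%MM == (1, 1),
      ~~ dead J U_(l)%MM, ~~ dead J U_(w)%MM,
      ~~ std (U_(l) + U_(w))%MM & std (U_(l') + U_(w))%MM].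

(** The witness depends on [J], [l] and [l'] only, so two families are read at the same place.
    Coefficients at other witnesses are tied to this one by the syzygies in [nform_unique]. *)
Definition rootcoef F (l l' : 'I_N) : A :=
  if [pick w | isroot l l' w] is Some w then (F (U_(l) + U_(w))%MM)@_(U_(l') + U_(w))%MM
  else 0.

Lemma isroot_W l l' w : isroot l l' w -> (W U_(l')%MM < W U_(l)%MM)%N.
Proof.
case/and5P => /eqP h1 /eqP h2 _ _ /andP[h3 h4].
have := @W_drop _ _ J (U_(l) + U_(w))%MM (U_(l') + U_(w))%MM.
by rewrite h2 !WD ltn_add2r; apply=> //; rewrite bidegD -h1 -bidegD.
Qed.

Section Comparison.
Context (I I' : S -> Prop) (F F' : 'X_{1..N} -> S).
Context (hn : near J I) (hn' : near J I') (hF : nform J I F) (hF' : nform J I' F').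

(** Agreement of all coefficients whose drop [W u - W r] is less than [w], with the subtraction
    avoided. The comparison is an induction on this drop. *)
Let ag (w : nat) : Prop := forall u r, bideg u \in D3 -> (W u < W r + w)%N ->
  (F u)@_r = (F' u)@_r.
Let dl u r : A := (F u)@_r - (F' u)@_r.

(** The coefficient is a sum of products whose two drops add up to at most [w]. If both drops are
    positive, each is less than [w] and the families agree on both factors; hence the difference
    comes from the one term whose second factor is 1. *)
Lemma delta_step w l u0 r : ag w -> bideg u0 = (1, 1) -> ~~ std u0 ->
  bideg (U_(l) + u0)%MM \in D3 -> std r -> (W (U_(l) + u0)%MM <= W r + w)%N ->
  dl (U_(l) + u0)%MM r = if (U_(l) <= r)%MM then dl u0 (r - U_(l))%MM else 0.
Proof.
move=> hag hd ns hd3 sr hw; have hd2 := D3D2 hd3.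
rewrite {1}/dl (nform_step hn hF hd2) (nform_step hn' hF' hd2).
rewrite [X in X - _]raddf_sum [X in _ - X]raddf_sum -[LHS]sumrB /=.
have key s : s \in mons m n (bideg u0) ->
    ((F u0)@_s *: F (U_(l) + s)%MM)@_r - ((F' u0)@_s *: F' (U_(l) + s)%MM)@_r =
    if (U_(l) + s)%MM == r then dl u0 s else 0.
  rewrite mem_mons => /eqP hs; rewrite !mcoeffZ.
  case: eqP => [e|/eqP ne]; first by rewrite e (nform_self hF) // (nform_self hF') // !mulr1.
  case: (leqP (W (U_(l) + s)%MM) (W r)) => h1.
    by rewrite (nform_gt hF h1 ne) (nform_gt hF' h1 ne) !mulr0 subrr.
  case: (leqP (W u0) (W s)) => h2.
    case: (eqVneq u0 s) => [<-|us].
      by rewrite (nform_std _ hF ns) (nform_std _ hF' ns) !mul0r subrr.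
    by rewrite (nform_gt hF h2) // (nform_gt hF' h2) // !mul0r subrr.
  move: hw h1 h2; rewrite !WD => hw h1 h2.
  rewrite (hag (U_(l) + s)%MM r); last 2 first.
  - by rewrite bidegD hs -bidegD.
  - by rewrite WD; lia.
  rewrite (hag u0 s) ?subrr //; first by rewrite hd.
  by lia.
rewrite (eq_big_seq _ key) -big_mkcond /=.
case: ifP => lr; last first.
  by rewrite big1 // => s /eqP e; case/negP: lr; apply/negP; rewrite -e lem_addr.
have [rm|rm] := boolP ((r - U_(l))%MM \in mons m n (bideg u0)).
  rewrite -big_filter (_ : [seq s <- mons m n (bideg u0) | (U_(l) + s)%MM == r] = [:: (r - U_(l))%MM]).
    by rewrite big_seq1.
  apply: perm_small_eq => //; apply: uniq_perm; rewrite ?filter_uniq ?mons_uniq // => s.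
  rewrite mem_filter inE; apply/andP/eqP => [[/eqP <- _]|->]; first by rewrite addmC addmK.
  by rewrite addmC submK.
have nd : bideg (r - U_(l))%MM <> bideg u0 by move=> e; rewrite mem_mons e eqxx in rm.
rewrite /dl (nform_deg hF nd) (nform_deg hF' nd) subrr big_seq_cond big1 // => s /andP[hs /eqP e].
by case/negP: rm; rewrite -e addmC addmK.
Qed.

Context (hdd : deadin I) (hdd' : deadin I').
Context (hroot : forall l l', rootcoef F l l' = rootcoef F' l l').
Context (hmix : forall (i p : 'I_m) (j q : 'I_n), mixed J i j p q ->
  (F (mxy0 i j))@_(mxy0 p q) = (F' (mxy0 i j))@_(mxy0 p q)).

(** The first two alternatives supply a row or a column whose syzygy forces the coefficient. When
    neither exists, the position carries a free parameter. *)
Lemma mixed_cases (i p : 'I_m) (j q : 'I_n) : (j < lam i)%N -> (lam p <= q)%N ->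
  p != i -> q != j ->
  [\/ exists2 i' : 'I_m, i' != i & (j < lam i')%N && (lam i' <= q)%N,
      exists2 j' : 'I_n, j' != j & (j' < lam i)%N && (lam p <= j')%N |
      mixed J i j p q].
Proof.
move=> ji pq pi qj.
case: (pselect (exists2 i' : 'I_m, i' != i & (j < lam i')%N && (lam i' <= q)%N)) => [|H1]; first by constructor 1.
case: (pselect (exists2 j' : 'I_n, j' != j & (j' < lam i)%N && (lam p <= j')%N)) => [|H2]; first by constructor 2.
constructor 3.
have h1 (i' : nat) : i' <> i -> (j < lam i')%N -> (q < lam i')%N.
  move=> ne h; rewrite ltnNge; apply/negP => h'; apply: H1.
  have i'm : (i' < m)%N by rewrite ltnNge; apply/negP => /(lam_out J); lia.
  exists (Ordinal i'm); last by rewrite h h'.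
  by apply/eqP => e; apply: ne; rewrite -e.
have h2 (j' : nat) : j' <> j -> (j' < lam i)%N -> (j' < lam p)%N.
  move=> ne h; rewrite ltnNge; apply/negP => h'; apply: H2.
  have j'n : (j' < n)%N by have := lam_le J i; lia.
  exists (Ordinal j'n); last by rewrite h h'.
  by apply/eqP => e; apply: ne; rewrite -e.
have pi' : p <> i :> nat by move=> e; case/eqP: pi; apply: val_inj.
have qj' : q <> j :> nat by move=> e; case/eqP: qj; apply: val_inj.
have ip : (i < p)%N.
  case: (ltnP i p) => // h; have := @lam_mono _ _ J p i h; have := h1 p pi'; lia.
have jq : (j < q)%N by case: (ltnP j q) => // h; have := h2 q qj'; lia.
have c1 : (lam i.+1 <= j)%N.
  rewrite leqNgt; apply/negP => h; have := h1 i.+1 ltac:(lia) h => h'.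
  have := @lam_mono _ _ J i i.+1 (leqnSn i); have := h2 q qj'; lia.
have c0 : (lam p <= lam i.+1)%N by apply: lam_mono.
have c2 : lam i = j.+1.
  apply/eqP; rewrite eqn_leq ji andbT leqNgt; apply/negP => h.
  by have := h2 j.+1 ltac:(lia) h; lia.
apply/and5P; split; rewrite ?c2 //.
- rewrite eqn_leq (leq_trans c0 c1) /=; case j0: (val j) => [//|l].
  by apply: h2; rewrite ?j0 ?c2 ?j0; lia.
- case: (val i =P 0%N) => //= i0; apply: h1; first by lia.
  by rewrite (leq_trans ji) // lam_mono // leq_pred.
Qed.

(** At the first drop where the families could differ, the syzygies act linearly on the difference
    and leave only the root and the mixed coefficients undetermined; these agree by hypothesis. *)
Lemma nform_unique u : bideg u \in D3 -> F u = F' u.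
Proof.
move=> hu; apply/mpolyP => r.
suff H w : ag w by apply: (H (W u).+1) => //; rewrite addnS ltnS leq_addl.
elim: w {u hu r} => [|w IH] u r hu.
  rewrite addn0 => h; have ur : u != r by apply/eqP => e; rewrite e ltnn in h.
  by rewrite (nform_gt hF (ltnW h) ur) (nform_gt hF' (ltnW h) ur).
rewrite addnS ltnS.
(* Bidegree (1,1) is enough: a monomial of bidegree (2,1) or (1,2) that is neither standard nor dead
   is a variable times a redex, and [delta_step] hands its difference down. *)
suff C11 u0 r0 : bideg u0 = (1, 1) -> (W u0 <= W r0 + w)%N -> (F u0)@_r0 = (F' u0)@_r0.
  move=> hw; case: (eqVneq (bideg u) (1, 1)) => [/C11|ne]; first exact.
  have [su|ns] := boolP (std u).
    by have [_ _ _ -> // _] := hF u; have [_ _ _ -> // _] := hF' u.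
  have [du|nd] := boolP (dead J u).
    by rewrite (nform_dead hn hF hdd (D3D2 hu) du) (nform_dead hn' hF' hdd' (D3D2 hu) du).
  have [sr|nsr] := boolP (std r); last by rewrite (nform_std _ hF) // (nform_std _ hF').
  have : [exists i, exists j, redex J u i j] by move: ns; rewrite /std nd negbK.
  move=> /existsP[i /existsP[j rd]]; have e : u = (unxy u i j + mxy0 i j)%MM.
    by rewrite mxy_add addm0; apply: redexE rd.
  have ns0 : ~~ std (mxy0 i j).
    by rewrite std_mxy0 [(lam _ <= _)%N]leqNgt; case/and3P: rd => ->; rewrite !andbF.
  have [l el] : exists l, unxy u i j = U_(l)%MM.
    have hv : bideg (unxy u i j) = (1, 0) \/ bideg (unxy u i j) = (0, 1).
      have : bideg (unxy u i j) = bideg u - (1, 1) by rewrite {2}e bidegD bideg_mxy0 addrK.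
      by move=> ->; move: hu ne; rewrite !inE => /or3P[] /eqP ->; rewrite ?eqxx //; [left|right].
    by case: hv => [/bideg10P[a ->]|/bideg01P[a ->]]; [exists (vx a)|exists (vy a)].
  rewrite {}el in e.
  apply/eqP; rewrite -subr_eq0; apply/eqP; move: hu hw; rewrite e => hu hw.
  have := @delta_step w l (mxy0 i j) r IH (bideg_mxy0 i j) ns0 hu sr hw; rewrite /dl => ->.
  case: ifP => // lr; rewrite C11 ?subrr ?bideg_mxy0 //.
  have er : r = (U_(l) + (r - U_(l)))%MM by rewrite addmC submK.
  by move: hw; rewrite {1}er !WD; lia.
move=> hd hw.
have [su|ns] := boolP (std u0).
  by have [_ _ _ -> // _] := hF u0; have [_ _ _ -> // _] := hF' u0.
have hd2 : bideg u0 \in D2 by rewrite hd.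
have [du|nd] := boolP (dead J u0).
  by rewrite (nform_dead hn hF hdd hd2 du) (nform_dead hn' hF' hdd' hd2 du).
have [sr|nsr] := boolP (std r0); last by rewrite (nform_std _ hF) // (nform_std _ hF').
case: (eqVneq (bideg r0) (1, 1)) => [hr|/eqP ne]; last first.
  by rewrite (nform_deg hF) ?(nform_deg hF') ?hd.
have [i [j eu]] := bideg11P hd; have [p [q er]] := bideg11P hr.
have [ai aj] : (ba J <= i)%N /\ (bb J <= j)%N.
  by move: nd; rewrite eu mxy0E dead_D dead_vxE dead_vyE negb_or -!leqNgt => /andP.
have ji : (j < lam i)%N.
  by move: ns; rewrite eu std_mxy0 ai aj /= -ltnNge.
have /and3P[ap aq pq] : [&& ba J <= p, bb J <= q & lam p <= q]%N.
  by rewrite -std_mxy0 -er.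
have nsl (i2 : 'I_m) (j2 : 'I_n) : (j2 < lam i2)%N -> ~~ std (mxy0 i2 j2).
  by move=> h; rewrite std_mxy0 [(lam _ <= _)%N]leqNgt h !andbF.
have lamn (a : 'I_m) : (lam a <= q)%N -> (ba J <= a)%N.
  by move=> h; rewrite leqNgt; apply/negP => /lam_dead; have := ltn_ord q; lia.
have lamb (a : 'I_m) (b : 'I_n) : (lam a <= b)%N -> (bb J <= b)%N.
  by move=> h; apply: leq_trans h; apply: lam_bb.
have swx (a b : 'I_m) (c : 'I_n) : (U_(vx a) + mxy0 b c = U_(vx b) + mxy0 a c)%MM.
  by apply/mnmP => z; rewrite !mnmDE; lia.
have swy (c : 'I_m) (a b : 'I_n) : (U_(vy a) + mxy0 c b = U_(vy b) + mxy0 c a)%MM.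
  by apply/mnmP => z; rewrite !mnmDE; lia.
have aK (a b : 'X_{1..N}) : (a + b - a = b)%MM by rewrite addmC addmK.
(* Both relations below compare the two reductions of a common multiple. *)
have relx (i' : 'I_m) : i' != i -> (j < lam i')%N -> (lam i' <= q)%N ->
    dl u0 r0 = if p == i then dl (mxy0 i' j) (mxy0 i' q) else 0.
  move=> ne h1 h2.
  have d3 a : bideg (U_(vx a) + mxy0 i j)%MM \in D3 by rewrite bidegD bideg_vx bideg_mxy0.
  have sr2 : std (U_(vx i') + mxy0 p q)%MM.
    by apply: std_xmxy; rewrite std_mxy0 ?lamn ?aq ?h2 ?ap ?pq.
  have hw' : (W (U_(vx i') + mxy0 i j)%MM <= W (U_(vx i') + mxy0 p q)%MM + w)%N.
    by move: hw; rewrite eu er !(WD _ (U_(vx i'))); lia.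
  have := delta_step IH (bideg_mxy0 i j) (nsl _ _ ji) (d3 i') sr2 hw'.
  rewrite lem_addr aK => e1; rewrite eu er -e1.
  have := @delta_step w (vx i) (mxy0 i' j) (U_(vx i') + mxy0 p q)%MM IH (bideg_mxy0 i' j) (nsl _ _ h1).
  rewrite -swx => /(_ (d3 i') sr2 hw') ->.
  rewrite lep1mP mnmDE mxy_vx mnm0E mnm1E eq_lshift (negPf ne) !add0n.
  by case: (eqVneq p i) => [->|_] /=; [rewrite swx aK | reflexivity].
have rely (j' : 'I_n) : j' != j -> (j' < lam i)%N -> (lam p <= j')%N ->
    dl u0 r0 = if q == j then dl (mxy0 i j') (mxy0 p j') else 0.
  move=> ne h1 h2.
  have d3 a : bideg (U_(vy a) + mxy0 i j)%MM \in D3 by rewrite bidegD bideg_vy bideg_mxy0.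
  have sr2 : std (U_(vy j') + mxy0 p q)%MM.
    by apply: std_ymxy; rewrite std_mxy0 ?(lamb p) ?ap ?h2 ?aq ?pq.
  have hw' : (W (U_(vy j') + mxy0 i j)%MM <= W (U_(vy j') + mxy0 p q)%MM + w)%N.
    by move: hw; rewrite eu er !(WD _ (U_(vy j'))); lia.
  have := delta_step IH (bideg_mxy0 i j) (nsl _ _ ji) (d3 j') sr2 hw'.
  rewrite lem_addr aK => e1; rewrite eu er -e1.
  have := @delta_step w (vy j) (mxy0 i j') (U_(vy j') + mxy0 p q)%MM IH (bideg_mxy0 i j') (nsl _ _ h1).
  rewrite -swy => /(_ (d3 j') sr2 hw') ->.
  rewrite lep1mP mnmDE mxy_vy mnm0E mnm1E eq_rshift (negPf ne) !add0n.
  by case: (eqVneq q j) => [->|_] /=; [rewrite swy aK | reflexivity].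
suff e0 : dl u0 r0 = 0 by exact: (subr0_eq e0).
(* If only one of the two variables changes, the pair is a root direction, and the syzygy carries
   the difference to the witness used by [rootcoef]. If both change, [mixed_cases] decides. *)
case: (eqVneq p i) => [pi|pi].
  case: (eqVneq q j) => [qj|qj]; first by move: pq; rewrite pi qj; lia.
  have [w0 hw0] : exists w0, isroot (vy j) (vy q) w0.
    exists (vx i); apply/and5P; split; rewrite ?bidegD ?bideg_vy ?bideg_vx ?dead_vyE ?dead_vxE -?leqNgt //.
    by rewrite ![(U_(vy _) + _)%MM]addmC -!mxy0E nsl // std_mxy0 ai aq -pi pq.
  have := hroot (vy j) (vy q); rewrite /rootcoef; case: pickP => [w1|/(_ w0)]; last by rewrite hw0.
  move: w1; apply: var_cases => [i2|j2]; last first.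
    by case/and5P => _; rewrite bidegD !bideg_vy.
  case/and5P => _ _ _ da /andP[]; rewrite ![(U_(vy _) + _)%MM]addmC -!mxy0E => ns2 s2 hc.
  move: (s2); rewrite std_mxy0 => /and3P[a2 _ b2].
  have c2 : (j < lam i2)%N by move: ns2; rewrite std_mxy0 a2 aj /= -ltnNge.
  case: (eqVneq i2 i) => [e|ne].
    by rewrite /dl eu er pi -e hc subrr.
  by rewrite (relx i2 ne c2 b2) pi eqxx /dl hc subrr.
case: (eqVneq q j) => [qj|qj].
  have [w0 hw0] : exists w0, isroot (vx i) (vx p) w0.
    exists (vy j); apply/and5P; split; rewrite ?bidegD ?bideg_vy ?bideg_vx ?dead_vyE ?dead_vxE -?leqNgt //.
    by rewrite -!mxy0E nsl // std_mxy0 ap -qj aq pq.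
  have := hroot (vx i) (vx p); rewrite /rootcoef; case: pickP => [w1|/(_ w0)]; last by rewrite hw0.
  move: w1; apply: var_cases => [i2|j2].
    by case/and5P => _; rewrite bidegD !bideg_vx.
  case/and5P => _ _ _ da /andP[]; rewrite -!mxy0E => ns2 s2 hc.
  move: (s2); rewrite std_mxy0 => /and3P[_ a2 b2].
  have c2 : (j2 < lam i)%N by move: ns2; rewrite std_mxy0 a2 ai /= -ltnNge.
  case: (eqVneq j2 j) => [e|ne].
    by rewrite /dl eu er qj -e hc subrr.
  by rewrite (rely j2 ne c2 b2) qj eqxx /dl hc subrr.
have [[i' ne /andP[h1 h2]]|[j' ne /andP[h1 h2]]|hm] := mixed_cases ji pq pi qj.
- by rewrite (relx i' ne h1 h2) (negPf pi).
- by rewrite (rely j' ne h1 h2) (negPf qj).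
by rewrite /dl eu er hmix ?subrr.
Qed.

End Comparison.
End Chart.

(** * Killing root coefficients by elementary substitutions *)

Section Normalisation.
Context (m n : nat) (J : borel m n) (A : comNzRingType).
Local Notation N := (m + n)%N.
Local Notation vx := (@vx m n).
Local Notation vy := (@vy m n).
Local Notation mxy0 := (mxy (0%MM : 'X_{1..N})).
Local Notation S := {mpoly A[N]}.
Local Notation W := (W J).
Local Notation std := (std J).
Implicit Types (u v : 'X_{1..N}) (F : 'X_{1..N} -> S) (I : S -> Prop).

Lemma bideg11_vars u : bideg u = (1, 1) -> exists b c : 'I_N,
  [/\ b != c, u = (U_(b) + U_(c))%MM & bideg (U_(b)%MM : 'X_{1..N}) <> bideg (U_(c)%MM : 'X_{1..N})].
Proof.
move=> /bideg11P[i [j ->]]; exists (vx i), (vy j).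
by rewrite mxy0E bideg_vx bideg_vy; split=> //; rewrite eq_lrshift.
Qed.

Section Root.
Context (l l' : 'I_N) (a : A).
Hypothesis (lb : bideg (U_(l)%MM : 'X_{1..N}) = bideg (U_(l')%MM : 'X_{1..N})).
Hypothesis (lW : (W U_(l')%MM < W U_(l)%MM)%N).

Definition elem (c : A) : 'M[A]_N := 1%:M + c *: delta_mx l l'.

Lemma ll' : l != l'.
Proof. by apply/eqP => e; move: lW; rewrite e ltnn. Qed.

Lemma elemE c i j : elem c i j = (i == j)%:R + c * ((i == l) && (j == l'))%:R.
Proof. by rewrite !mxE. Qed.

Lemma elem_blk c : blk (elem c).
Proof.
move=> i j hij; rewrite elemE; case: eqP => [e|_]; first by rewrite e in hij.
case: eqP => [ei|]; last by rewrite mulr0 addr0.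
by case: eqP => [ej|]; [rewrite ei ej lb in hij | rewrite mulr0 addr0].
Qed.

Lemma elem_mul c : elem c *m elem (- c) = 1%:M.
Proof.
rewrite /elem mulmxDl mul1mx mulmxDr mulmx1 -scalemxAl -scalemxAr mul_delta_mx_0; last first.
  by rewrite eq_sym ll'.
by rewrite !scaler0 addr0 scaleNr subrK.
Qed.

Lemma elem_unip c : unip J (elem c).
Proof.
split=> [i|i j ij]; rewrite elemE.
  rewrite eqxx; case: (eqVneq i l) => [->|_]; last by rewrite mulr0 addr0.
  by rewrite (negPf ll') mulr0 addr0.
rewrite (negPf ij) add0r; case: (eqVneq i l) => [->|_]; last by rewrite mulr0.
by case: (eqVneq j l') => [->|_]; [move=> _|rewrite mulr0].
Qed.

Lemma act_elem c b : act (elem c) 'X_b = 'X_b + (c * (b == l)%:R) *: 'X_l' :> S.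
Proof.
rewrite actX /linf (eq_bigr (fun j : 'I_N => (b == j)%:R *: 'X_j +
   (c * ((b == l) && (j == l'))%:R) *: ('X_j : S))); last first.
  by move=> j _; rewrite elemE scalerDl.
rewrite big_split /=; congr (_ + _).
  rewrite (bigD1 b) //= eqxx scale1r big1 ?addr0 // => j jb.
  by rewrite eq_sym (negPf jb) scale0r.
rewrite (bigD1 l') //= eqxx andbT big1 ?addr0 // => j jb.
by rewrite (negPf jb) andbF mulr0 scale0r.
Qed.

Definition shift u : 'X_{1..N} := (u - U_(l) + U_(l'))%MM.

Lemma act_elem11 u c : bideg u = (1, 1) ->
  act (elem c) 'X_[u] = 'X_[u] + (c * (u l)%:R) *: 'X_[shift u] :> S.
Proof.
move=> /bideg11_vars[b [d [bd -> hbd]]].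
rewrite mpolyXD rmorphM /= !act_elem !mulrDl !mulrDr addrA mnmDE !mnm1E /shift.
have hf : (false%:R : A) = 0 by []; have ht : (true%:R : A) = 1 by [].
have h10 : ((true + false)%N%:R : A) = 1 by [].
have h01 : ((false + true)%N%:R : A) = 1 by [].
have h00 : ((false + false)%N%:R : A) = 0 by [].
case: (eqVneq b l) => [e|bl]; case: (eqVneq d l) => [e'|dl].
- by case: hbd; rewrite e e'.
- rewrite ?h10 ?hf ?ht !mulr0 !scale0r !mulr0 !addr0; congr (_ + _).
  rewrite -scalerAl -mpolyXD; congr (_ *: 'X_[_]).
  by rewrite e; apply/mnmP => z; rewrite !mnmDE !mnmBE !mnmDE; clear; lia.
- rewrite ?h01 ?hf ?ht !mulr0 !scale0r !mul0r !addr0; congr (_ + _).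
  rewrite -scalerAr -mpolyXD; congr (_ *: 'X_[_]).
  by rewrite e'; apply/mnmP => z; rewrite !mnmDE !mnmBE !mnmDE; clear; lia.
by rewrite ?h00 ?hf ?mulr0 ?scale0r ?mulr0 ?mul0r ?addr0.
Qed.

Lemma bideg_shift u : (0 < u l)%N -> bideg (shift u) = bideg u.
Proof.
by move=> ul; rewrite /shift bidegD -lb -bidegD submK // lep1mP -lt0n.
Qed.

Lemma W_shift u : (0 < u l)%N -> (W (shift u) + W U_(l)%MM = W u + W U_(l')%MM)%N.
Proof.
move=> ul; have e : u = (u - U_(l) + U_(l))%MM by rewrite submK // lep1mP; lia.
by rewrite {2}e /shift !WD addnAC.
Qed.

(** Moving the ideal by [x_l -> x_l + a x_l'] translates the coefficients whose drop is at most that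
    of [(l, l')], at the position [shift u = r] only: any other correction combines the drop of the
    root with a further positive one. *)
Lemma root_effect I F F' u r : near J I -> nform J I F ->
  nform J (fun p => I (act (elem (- a)) p)) F' ->
  bideg u = (1, 1) -> ~~ std u -> std r ->
  (W u + W U_(l')%MM <= W r + W U_(l)%MM)%N ->
  (F' u)@_r = (F u)@_r - a * (u l)%:R * (shift u == r)%:R.
Proof.
move=> hn hF hF' hd ns sr hw; have hI := let: And3 x _ _ := hn in x.
pose I' p := I (act (elem (- a)) p).
have HG : elem (- a) *m elem a = 1%:M by have := elem_mul (- a); rewrite opprK.
have hn' : near J I'.
  by apply: (near_act (G := elem a)) => //; try exact: elem_blk; [exact: elem_mul | exact: elem_unip].
have hl' := ideal_lin (let: And3 x _ _ := hn' in x).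
have [f1 f2 f3 _ f5] := hF u; rewrite hd in f2.
have hd2 : bideg u \in D2 by rewrite hd.
pose T v : S := 'X_[v] + (a * (v l)%:R) *: 'X_[shift v].
have Td v : bideg v = (1, 1) -> bihom (1, 1) (T v).
  move=> vd; apply: bihomD; first exact: bihomX'.
  case: (posnP (v l)) => [->|vl]; first by rewrite mulr0 scale0r; apply: bihom0.
  by apply/bihomZ/bihomX'; rewrite bideg_shift.
have hT : I' (T u - \sum_(s <- msupp (F u)) (F u)@_s *: T s).
  have -> : T u - \sum_(s <- msupp (F u)) (F u)@_s *: T s = act (elem a) ('X_[u] - F u).
    rewrite linearB /= act_elem11 //; congr (_ - _); rewrite {3}[F u]mpolyE linear_sum /=.
    apply: eq_big_seq => s /f2 hs; by rewrite linearZ /= act_elem11.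
  by rewrite /I' actM elem_mul act1.
have hd' : bihom (1, 1) (T u - \sum_(s <- msupp (F u)) (F u)@_s *: T s).
  apply: bihomB; first exact: Td.
  by rewrite big_seq; apply: bihom_sum => s /f2 hs; apply/bihomZ/Td.
have [g1 g2 g3] := nform_lext hl' hF' hd'.
have : lext F' (T u - \sum_(s <- msupp (F u)) (F u)@_s *: T s) = 0.
  apply: (near_uniq hn' hd2) => //; rewrite ?hd //; [exact: stdpoly0 | exact: bihom0 |].
  rewrite subr0; have := linB hl' hT g3; by rewrite opprB addrC subrK.
have lT v : lext F' (T v) = F' v + (a * (v l)%:R) *: F' (shift v).
  by rewrite /T linearD linearZ /= !lextX.
move=> h0; have : lext F' (T u) = lext F' (\sum_(s <- msupp (F u)) (F u)@_s *: T s).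
  by apply: subr0_eq; rewrite -linearB.
rewrite linear_sum lT => /(congr1 (mcoeff r)).
rewrite mcoeffD mcoeffZ raddf_sum /=.
under eq_big_seq => s hs.
  rewrite linearZ /= lT mcoeffZ mcoeffD mcoeffZ.
  have -> : F' s = 'X_[s] by have [_ _ _ -> //] := hF' s; apply: f1.
  have -> : a * (s l)%:R * (F' (shift s))@_r = 0.
    case: (posnP (s l)) => [->|sl]; first by rewrite mulr0 mul0r.
    have hs2 := f5 ns s hs.
    rewrite (nform_gt hF') ?mulr0 //; have := W_shift sl; first by lia.
    by move=> h; apply/eqP => e; rewrite e in h; lia.
  rewrite addr0 mcoeffX.
  over.
rewrite /= => e.
have -> : (F u)@_r = \sum_(s <- msupp (F u)) (F u)@_s * (s == r)%:R.
  rewrite {1}[F u]mpolyE raddf_sum; apply: eq_bigr => s _ /=.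
  by rewrite mcoeffZ mcoeffX.
rewrite -e; case: (posnP (u l)) => [->|ul]; first by rewrite !mulr0 !mul0r addr0 subr0.
have hs := W_shift ul.
case: eqP => [->|/eqP ne]; first by rewrite (nform_self hF') // addrK.
have hz : (F' (shift u))@_r = 0 by apply: (nform_gt hF') => //; lia.
by rewrite hz !mulr0 addr0 subr0.
Qed.

End Root.

Definition tr I (H : 'M[A]_N) : S -> Prop := fun p => I (act H p).

Definition invp (G H : 'M[A]_N) : Prop :=
  [/\ blk G, blk H, G *m H = 1%:M & H *m G = 1%:M].

Lemma invp1 : invp 1%:M 1%:M.
Proof. by split; rewrite ?mulmx1 //; apply: blk1. Qed.

Lemma invpM G H G' H' : invp G H -> invp G' H' -> invp (G *m G') (H' *m H).
Proof.
case=> a1 a2 a3 a4 [b1 b2 b3 b4]; split; try exact: blkM.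
  by rewrite mulmxA -(mulmxA G) b3 mulmx1.
by rewrite mulmxA -(mulmxA H') a4 mulmx1.
Qed.

Lemma trM I H H' p : tr (tr I H) H' p = tr I (H' *m H) p.
Proof. by rewrite /tr actM. Qed.

Lemma tr1 I p : tr I 1%:M p = I p.
Proof. by rewrite /tr act1. Qed.

(** Root coefficients are killed in the order of their drop: [w] is the drop in progress and [L]
    lists the directions already treated at that drop. *)
Definition clean I (w : nat) (L : seq ('I_N * 'I_N)) : Prop :=
  forall F, nform J I F -> forall l l',
    (W U_(l)%MM < W U_(l')%MM + w)%N \/
    ((l, l') \in L /\ W U_(l)%MM = (W U_(l')%MM + w)%N) ->
  rootcoef J F l l' = 0.

Definition norm I (w : nat) (L : seq ('I_N * 'I_N)) : Prop :=
  exists G H, [/\ invp G H, near J (tr I H), deadin J (tr I H) & clean (tr I H) w L].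

(** The elementary substitution whose parameter is the root coefficient itself annihilates it, and
    by [root_effect] it leaves alone the zeros obtained so far. *)
Lemma norm_root I w l l' L : near J I -> deadin J I -> clean I w L ->
  norm I w ((l, l') :: L).
Proof.
move=> hn hdd hc.
have triv : (forall F, nform J I F -> W U_(l)%MM = (W U_(l')%MM + w)%N -> rootcoef J F l l' = 0) ->
    norm I w ((l, l') :: L).
  move=> h; exists 1%:M, 1%:M; have e : tr I 1%:M = I by apply/funext => p; rewrite tr1.
  rewrite e; split=> //; first exact: invp1.
  move=> F hF b b' [hb|[]]; first by apply: hc => //; left.
  rewrite inE => /orP[/eqP[-> ->] hb|hL hb]; first exact: h.
  by apply: hc => //; right.
case: (pselect (W U_(l)%MM = (W U_(l')%MM + w)%N)) => [hw|hw]; last by apply: triv.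
case E: [pick x | isroot J l l' x] => [x|]; last first.
  by apply: triv => F hF _; rewrite /rootcoef E.
have hx : isroot J l l' x by move: E; case: pickP => // y hy [<-].
have lW := isroot_W hx; have /and5P[/eqP lb /eqP lx dl dx /andP[ns s]] := hx.
have [F hF] := near_nform hn.
pose a := rootcoef J F l l'.
have HG : elem l l' (- a) *m elem l l' a = 1%:M.
  by have := elem_mul lW (- a); rewrite opprK.
have hn' : near J (tr I (elem l l' (- a))).
  apply: (near_act (G := elem l l' a)) => //; try exact: elem_blk.
    exact: elem_mul.
  exact: elem_unip.
exists (elem l l' a), (elem l l' (- a)); split=> //.
- by split=> //; try exact: elem_blk; apply: elem_mul.
- move=> b db; rewrite /tr act_elem.
  have -> : (b == l) = false by apply/eqP => e; rewrite e (negPf dl) in db.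
  by rewrite mulr0 scale0r addr0; apply: hdd.
move=> F' hF' b b' hb; rewrite /rootcoef; case E': [pick y | isroot J b b' y] => [y|//].
have hy : isroot J b b' y by move: E'; case: pickP => // z hz [<-].
have /and5P[/eqP bb' /eqP bdy dl' dy /andP[ns' s']] := hy.
have bW : (W U_(b)%MM <= W U_(b')%MM + w)%N by case: hb => [/ltnW|[_ ->]].
have hw2 : (W (U_(b) + U_(y))%MM + W U_(l')%MM <= W (U_(b') + U_(y))%MM + W U_(l)%MM)%N.
  by rewrite !WD hw; move: bW; clear; lia.
have := @root_effect l l' a lb lW I F F' _ _ hn hF hF' bdy ns' s' hw2.
move=> ->.
have bne : b != b' by apply/eqP => e; have := isroot_W hy; rewrite e ltnn.
case: (eqVneq (b, b') (l, l')) => [[eb eb']|ne].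
  have -> : (U_(b) + U_(y) : 'X_{1..N})%MM l = 1%N.
    rewrite mnmDE !mnm1E eb eqxx; case: eqP => // e.
    by move: bdy; rewrite eb e bidegD; case: (bideg _) => c d [] + _; clear; lia.
  rewrite /shift -eb -eb' addmC [(U_(b) + U_(y))%MM]addmC addmK eqxx !mulr1.
  by rewrite /a /rootcoef -eb -eb' E' ![(U_(y) + _)%MM]addmC subrr.
have -> : (F (U_(b) + U_(y))%MM)@_(U_(b') + U_(y))%MM = 0.
  have := hc F hF b b'; rewrite /rootcoef E'; apply.
  case: hb => [|[]]; first by left.
  by rewrite inE (negPf ne) /=; right.
case: eqP => [e|_]; last by rewrite mulr0 subr0.
case: (posnP ((U_(b) + U_(y))%MM l)) => [->|hl]; first by rewrite mulr0 mul0r subr0.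
case/eqP: ne.
(* A further direction [(b, b')] is affected only if the shift turns [b y] into [b' y]; comparing
   exponents at [b] and [b'] then gives [(b, b') = (l, l')]. *)
have e2 z : ((U_(b) + U_(y))%MM z + U_(l')%MM z = (U_(b') + U_(y))%MM z + U_(l)%MM z)%N.
  rewrite -e /shift [in RHS]mnmDE [in RHS]mnmBE; case: (eqVneq z l) => [->|zl].
    by rewrite [U_(l)%MM l]mnm1E eqxx; move: hl; clear; lia.
  by rewrite [U_(l)%MM z]mnm1E eq_sym (negPf zl); clear; lia.
have bne' : (b' == b) = false by rewrite eq_sym (negPf bne).
have := e2 b; have := e2 b'; rewrite !mnmDE !mnm1E !eqxx (negPf bne) bne' => h1 h2.
have -> : b = l.
  by apply/eqP; rewrite eq_sym; move: h2; case: (eqVneq l b) => // _; clear; lia.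
have -> // : b' = l'.
by apply/eqP; rewrite eq_sym; move: h1; case: (eqVneq l' b') => // _; clear; lia.
Qed.

Lemma norm_trans I G H w' L' : invp G H -> norm (tr I H) w' L' -> norm I w' L'.
Proof.
move=> hGH [G' [H' [hGH' h1 h2 h3]]]; exists (G *m G'), (H' *m H).
have e : tr I (H' *m H) = tr (tr I H) H' by apply/funext => p; rewrite trM.
by split; [exact: invpM | rewrite e ..].
Qed.

Lemma norm_list I w L : near J I -> deadin J I -> clean I w [::] -> norm I w L.
Proof.
move=> hn hdd hc; elim: L => [|[l l'] L [G [H [h1 h2 h3 h4]]]].
  exists 1%:M, 1%:M; have e : tr I 1%:M = I by apply/funext => p; rewrite tr1.
  by rewrite e; split=> //; exact: invp1.
apply: (@norm_trans _ G H) => //; exact: norm_root.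
Qed.

Lemma norm_all I w : near J I -> deadin J I -> norm I w [::].
Proof.
move=> hn hdd; elim: w => [|w [G [H [h1 h2 h3 h4]]]].
  exists 1%:M, 1%:M; have e : tr I 1%:M = I by apply/funext => p; rewrite tr1.
  rewrite e; split=> //; first exact: invp1.
  move=> F hF l l'; rewrite addn0 => -[h|[]//]; rewrite /rootcoef; case: pickP => // x /isroot_W.
  by lia.
have [G' [H' [k1 k2 k3 k4]]] := norm_list (enum {: 'I_N * 'I_N}) h2 h3 h4.
apply: (@norm_trans _ G H) => //; exists G', H'; split=> // F hF l l'.
rewrite addnS ltnS => -[h|[]//]; apply: k4 => //.
by case: ltngtP h => // h _; [left|right; rewrite mem_enum].
Qed.

(* The substitution that turns the linear forms of [I] into variables. *)
Lemma linear_normalisation I : near J I ->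
  exists G H, [/\ invp G H, near J (tr I H) & deadin J (tr I H)].
Proof.
move=> hn; have [F hF] := near_nform hn.
(* [E] has rows at dead variables and columns at live ones, so [E *m E = 0] and [1 + E] has inverse
   [1 - E]. The scalar [x] below treats both signs at once. *)
pose E : 'M[A]_N := \matrix_(b, c) if dead J U_(b)%MM then (F U_(b)%MM)@_(U_(c)%MM) else 0.
have Edead b c : dead J U_(c)%MM -> E b c = 0.
  by move=> dc; rewrite mxE; case: ifP => // _; rewrite (nform_std _ hF) // /std dc.
have EE : E *m E = 0.
  apply/matrixP => b c; rewrite !mxE big1 // => d _.
  by case: (boolP (dead J U_(d)%MM)) => dd; [rewrite Edead ?mul0r | rewrite [E d c]mxE (negPf dd) mulr0].
have Eblk : blk E.
  move=> b c hbc; rewrite mxE; case: ifP => // _.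
  by rewrite (nform_deg hF) // => e; apply: hbc.
have blkpm x : blk (1%:M + x *: E).
  move=> b c hbc; rewrite !mxE; have := Eblk b c hbc; rewrite mxE => ->.
  by rewrite mulr0 addr0; case: eqP => // e; rewrite e in hbc.
have mulpm x : (1%:M + x *: E) *m (1%:M + (- x) *: E) = 1%:M.
  rewrite mulmxDl mul1mx mulmxDr mulmx1 -scalemxAl -scalemxAr EE !scaler0 addr0.
  by rewrite scaleNr subrK.
have hGH : invp (1%:M + 1 *: E) (1%:M + (- 1) *: E).
  by split=> //; have := mulpm (- 1); rewrite opprK.
have [h1 h2 h3 h4] := hGH.
have U : unip J (1%:M + 1 *: E).
  split=> [l|l l' ne]; rewrite !mxE.
    rewrite eqxx; case: ifP => [dl|_]; last by rewrite mulr0 addr0.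
    by rewrite (nform_std _ hF) ?mulr0 ?addr0 // /std dl.
  rewrite (negPf ne) add0r mul1r; case: ifP => [dl|_] // h.
  have ns : ~~ std U_(l)%MM by rewrite /std dl.
  have [_ _ _ _ /(_ ns) lo] := hF U_(l)%MM; apply: lo.
  by rewrite mcoeff_msupp; apply/eqP.
have hn' := near_act h1 h2 h3 h4 U hn.
exists (1%:M + 1 *: E), (1%:M + (- 1) *: E); split=> // b db.
have aG c : act (1%:M + 1 *: E) 'X_c = 'X_c + (if dead J U_(c)%MM then F U_(c)%MM else 0) :> S.
  rewrite actX /linf; under eq_bigr => j _ do rewrite mxE scalerDl.
  rewrite big_split /=; congr (_ + _).
    rewrite (bigD1 c) //= mxE eqxx scale1r big1 ?addr0 // => j jb.
    by rewrite mxE eq_sym (negPf jb) scale0r.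
  case: ifP => dc; last by rewrite big1 // => j _; rewrite !mxE dc mulr0 scale0r.
  have [_ f2 _ _ _] := hF U_(c)%MM.
  rewrite [RHS](bihomE f2) [RHS](_ : _ = \sum_(v <- [seq U_(j)%MM | j <- enum 'I_N]) (F U_(c)%MM)@_v *: 'X_[v]).
    by rewrite big_map big_enum; apply: eq_bigr => j _; rewrite !mxE dc mul1r.
  rewrite -(bihomE f2) -(@lextE _ _ _ (fun v => 'X_[v] : S)).
  - by rewrite {1}[F _]mpolyE.
  - by rewrite map_inj_uniq ?enum_uniq // => x y /eqP; rewrite eq_mnm1 => /eqP.
  move=> v /f2 hv; have : mdeg v == 1%N.
    have [_ e1] := bideg_mdeg v; have [_ e2] := bideg_mdeg (U_(c)%MM : 'X_{1..N}).
    by move: e1; rewrite hv -e2 mdeg1 => -[->].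
  by move/mdeg1P => [j /eqP ->]; apply: map_f; rewrite mem_enum.
have fixstd p : (forall v, v \in msupp p -> exists2 c, v = U_(c)%MM & ~~ dead J U_(c)%MM) ->
    act (1%:M + 1 *: E) p = p.
  move=> hp; transitivity (\sum_(v <- msupp p) p@_v *: ('X_[v] : S)); last by rewrite -mpolyE.
  rewrite {1}[p]mpolyE linear_sum; apply: eq_big_seq => v /hp[c -> dc].
  by rewrite /= linearZ /= aG (negPf dc) addr0.
have [f1 f2 f3 _ _] := hF U_(b)%MM.
have <- : act (1%:M + 1 *: E) ('X_b - F U_(b)%MM) = 'X_b.
  rewrite linearB /= aG db fixstd ?addrK // => v hv; have sv := f1 v hv; have dv := f2 v hv.
  have : mdeg v == 1%N.
    have [_ e1] := bideg_mdeg v; have [_ e2] := bideg_mdeg (U_(b)%MM : 'X_{1..N}).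
    by move: e1; rewrite dv -e2 mdeg1 => -[->].
  by move/mdeg1P => [j /eqP e]; exists j => //; move: sv; rewrite e /std => /andP[].
by rewrite /tr actM h3 act1.
Qed.

Lemma rhs_std (t : nat -> nat -> nat -> nat -> A) (i : 'I_m) (j : 'I_n) :
  (j < lam J i)%N -> stdpoly J (rhs J t 0 i j).
Proof.
move=> ji; rewrite /rhs; elim/big_ind: _ => [|p q|p _].
- exact: stdpoly0.
- by rewrite -[p in p + q]scale1r; apply: stdpoly_lin.
elim/big_ind: _ => [|x y|q _].
- exact: stdpoly0.
- by rewrite -[x in x + y]scale1r; apply: stdpoly_lin.
case: (pselect (tau J t i j p q = 0)) => [->|ne]; first by rewrite scale0r; apply: stdpoly0.
rewrite -[_ *: _]addr0; apply: stdpoly_lin; last exact: stdpoly0.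
move=> v; rewrite msuppX mem_seq1 => /eqP ->; rewrite std_mxy0.
have [_ a2 _] := tau_first ne ji; have [_ _ b3] := tau_last ne ji.
have jn := ltn_ord j; have li := lam_le J i; have qn := ltn_ord q.
apply/and3P; split; last by rewrite b3; lia.
  by rewrite leqNgt; apply/negP => /lam_dead; lia.
by apply: leq_trans a2; apply: lam_bb.
Qed.

Lemma bihom_rhs (t : nat -> nat -> nat -> nat -> A) i j : bihom (1, 1) (rhs J t 0 i j).
Proof. by do 2!apply: bihom_sum => ? _; apply/bihomZ/bihomX'/bideg_mxy0. Qed.

Lemma rhs_coef (t : nat -> nat -> nat -> nat -> A) i j p q :
  (rhs J t 0 i j)@_(mxy0 p q) = tau J t i j p q.
Proof.
have inj (a c : 'I_m) (b d : 'I_n) : (mxy0 a b == mxy0 c d) = (a == c) && (b == d).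
  apply/eqP/andP => [e|[/eqP -> /eqP ->]] //; split.
    have := congr1 (fun v : 'X_{1..N} => v (vx c)) e; rewrite !mxy_vx mnm0E eqxx !add0n.
    by case: eqP.
  have := congr1 (fun v : 'X_{1..N} => v (vy d)) e; rewrite !mxy_vy mnm0E eqxx !add0n.
  by case: eqP.
rewrite /rhs raddf_sum (bigD1 p) //= raddf_sum (bigD1 q) //= mcoeffZ mcoeffX inj !eqxx mulr1.
rewrite big1 ?addr0 => [|b bq]; last by rewrite mcoeffZ mcoeffX inj (negPf bq) andbF mulr0.
rewrite big1 ?addr0 // => a ap; rewrite raddf_sum big1 // => b _.
by rewrite /= mcoeffZ mcoeffX inj (negPf ap) mulr0.
Qed.

Lemma CI_near (t : nat -> nat -> nat -> nat -> A) (D : datum m n A) :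
  dG D = 1%:M -> dH D = 1%:M -> near J (CI J D) /\ deadin J (CI J D).
Proof.
move=> e1 e2.
have b d : basis (CI J D) d (@stdb m n A J d).
  by have := CI_basis J D d; congr basis; apply/funext => i; rewrite /cstdb e2 act1.
have hl := CI_lin J D; split.
  split; first exact: CI_ideal.
    by move=> d _; exists (@stdb m n A J d).
  by move=> d _; apply: basis_good.
move=> l; elim/var_cases: l => l.
  by rewrite dead_vxE => /(cgen_x D)/CI_cgen; rewrite e2 act1.
by rewrite dead_vyE => /(cgen_y D)/CI_cgen; rewrite e2 act1.
Qed.

(* Every family of ideals whose quotient is free on the standard monomials of
   [J] in low degrees is an explicit one up to a substitution. *)
Theorem near_datum I : near J I -> exists D : datum m n A, forall p, cgen J D p -> I p.
Proof.
move=> hn0; have [G [H [hGH hn hdd]]] := linear_normalisation hn0.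
(* Larger than every possible drop, so cleanness up to [w] means that all root coefficients
   vanish. *)
pose w := (\max_(l < N) W U_(l)%MM).+1.
have [G' [H' [hGH' hn' hdd' hc]]] := norm_all w hn hdd.
set I1 := tr (tr I H) H' in hn' hdd' hc.
have [F hF] := near_nform hn'.
(* The parameters are read off the family itself; the value 0 out of range makes [t] total. *)
pose t (a b c d : nat) : A :=
  if (insub a, insub b, insub c, insub d) is (Some i, Some j, Some p, Some q)
  then (F (mxy0 (i : 'I_m) (j : 'I_n)))@_(mxy0 (p : 'I_m) (q : 'I_n)) else 0.
have tE (i p : 'I_m) (j q : 'I_n) : t i j p q = (F (mxy0 i j))@_(mxy0 p q).
  by rewrite /t !valK.
have [b1 b2 b3 b4] := invp1.
pose D0 : datum m n A := Datum t b1 b2 b3 b4.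
have [cn cdd] := CI_near t (erefl : dG D0 = 1%:M) (erefl : dH D0 = 1%:M).
have [F' hF'] := near_nform cn.
have F'E (i : 'I_m) (j : 'I_n) : (j < lam J i)%N -> F' (mxy0 i j) = rhs J t 0 i j.
  move=> ji; apply: (nform_eq cn hF'); rewrite ?bideg_mxy0 //.
  - exact: rhs_std.
  - exact: bihom_rhs.
  by have := CI_cgen (cgen_xy D0 ji); rewrite /= act1.
have key u : bideg u \in D3 -> F u = F' u.
  apply: (nform_unique hn' cn hF hF' hdd' cdd) => [l l'|i p j q hm]; last first.
    have /and5P[/eqP h1 _ _ _ _] := hm.
    by rewrite F'E ?h1 // rhs_coef tau_corner // /tcoef hm tE.
  have -> : rootcoef J F l l' = 0.
    apply: hc => //; left; rewrite /w ltn_addl // ltnS.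
    exact: (leq_bigmax_cond (F := fun l : 'I_N => W U_(l)%MM)).
  (* The explicit family has no root coefficients either, because a nonzero [tau] changes both the
     row and the column. *)
  rewrite /rootcoef; case: pickP => // x; move: l l' x.
  apply: var_cases => [i|j]; apply: var_cases => [p|q]; apply: var_cases => [i'|j'];
    case/and5P; rewrite ?bidegD ?bideg_vx ?bideg_vy // => _ _ _ da /andP[].
    rewrite -!mxy0E => ns /[dup] s; rewrite std_mxy0 => /and3P[_ h1 h2].
    have j'i : (j' < lam J i)%N.
      rewrite ltnNge; apply/negP => h; case/negP: ns; rewrite std_mxy0 h1 h andbT /= andbT.
      by rewrite leqNgt; apply/negP => /lam_dead; have := ltn_ord j'; lia.
    rewrite F'E // rhs_coef; apply/esym; apply: contrapT => ne.
    by have [_ h3 _] := tau_first ne j'i; lia.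
  rewrite ![(U_(vy _) + _)%MM]addmC -!mxy0E => ns /[dup] s; rewrite std_mxy0 => /and3P[h1 _ h2].
  have j'i : (j < lam J i')%N.
    rewrite ltnNge; apply/negP => h; case/negP: ns; rewrite std_mxy0 h1 h andbT /=.
    by apply: leq_trans h; apply: lam_bb.
  rewrite F'E // rhs_coef; apply/esym; apply: contrapT => ne.
  by have [_ _ h3] := tau_last ne j'i; lia.
have [c1 c2 c3 c4] := invpM hGH hGH'.
exists (Datum t c1 c2 c3 c4) => p; case=> [i h|j h|i j h] /=.
- by have := hdd' (vx i); rewrite dead_vxE /I1 trM; apply.
- by have := hdd' (vy j); rewrite dead_vyE /I1 trM; apply.
have [_ _ f3 _ _] := hF (mxy0 i j).
by move: f3; rewrite key ?bideg_mxy0 // F'E // /I1 trM.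
Qed.

End Normalisation.

(** * Initial ideals and generic coordinates *)

Section BasisMatrix.
Context (m n : nat) (A : comNzRingType).
Local Notation N := (m + n)%N.
Local Notation S := {mpoly A[N]}.
Implicit Types (I : S -> Prop) (d : int * int).

Definition mcomb r s (b : 'I_s -> S) (M : 'M[A]_(r, s)) (i : 'I_r) : S :=
  \sum_j M i j *: b j.

Lemma mcombM I r s t (b : 'I_r -> S) (c : 'I_s -> S) (e : 'I_t -> S) M L : lin I ->
  (forall i, I (b i - mcomb c M i)) -> (forall i, I (c i - mcomb e L i)) ->
  forall i, I (b i - mcomb e (M *m L) i).
Proof.
move=> hI h1 h2 i; apply: lin_trans (h1 i) _ => //.
have -> : mcomb e (M *m L) i = \sum_j M i j *: mcomb e L j.
  rewrite /mcomb; under [RHS]eq_bigr => j _ do rewrite scaler_sumr.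
  rewrite exchange_big; apply: eq_bigr => l _; rewrite mxE scaler_suml.
  by apply: eq_bigr => j _; rewrite scalerA.
rewrite /mcomb -sumrB; apply: lin_sum => // j _; rewrite -scalerBr.
exact: linZ.
Qed.

Lemma basis_mx I d r s (b : 'I_r -> S) (c : 'I_s -> S) : basis I d b ->
  (forall i, bihom d (c i)) -> exists M : 'M[A]_(s, r), forall i, I (c i - mcomb b M i).
Proof.
move=> [_ hb] hc; have /choice[M hM] : forall i, exists a, I (c i - comb b a).
  by move=> i; have [a [ha _]] := hb _ (hc i); exists a.
exists (\matrix_(i, j) M i j) => i; have := hM i; congr (I (_ - _)).
by apply: eq_bigr => j _; rewrite mxE.
Qed.

Lemma basis_mx_uniq I d r s (b : 'I_r -> S) (M L : 'M[A]_(s, r)) : lin I -> basis I d b ->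
  (forall i, I (mcomb b M i - mcomb b L i)) -> M = L.
Proof.
move=> hI hb h; apply/matrixP => i j.
have : I (comb b [ffun j => M i j - L i j]).
  have := h i; congr (I _); rewrite /mcomb -sumrB; apply: eq_bigr => l _.
  by rewrite ffunE scalerBl.
move/(basis0 hI hb) => /ffunP/(_ j); rewrite !ffunE => /eqP.
by rewrite subr_eq0 => /eqP.
Qed.

Lemma mcomb1 r (b : 'I_r -> S) i : mcomb b 1%:M i = b i.
Proof.
rewrite /mcomb (bigD1 i) //= mxE eqxx scale1r big1 ?addr0 // => j ji.
by rewrite mxE eq_sym (negPf ji) scale0r.
Qed.

Lemma basis_mx_inv I d r s (b : 'I_r -> S) (c : 'I_s -> S) M L : lin I ->
  basis I d b -> (forall i, I (b i - mcomb c M i)) -> (forall i, I (c i - mcomb b L i)) ->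
  M *m L = 1%:M.
Proof.
move=> hI hb h1 h2; apply: (basis_mx_uniq hI hb) => i; rewrite mcomb1.
by apply: linBC => //; apply: (mcombM hI h1 h2).
Qed.

Lemma basis_size I d r s (b : 'I_r -> S) (c : 'I_s -> S) : lin I ->
  basis I d b -> basis I d c -> r = s.
Proof.
move=> hI hb hc; have [M hM] := basis_mx hc (proj1 hb); have [L hL] := basis_mx hb (proj1 hc).
apply/eqP; rewrite eqn_leq; apply/andP; split.
  exact: mulmx1_min (basis_mx_inv hI hb hM hL).
exact: mulmx1_min (basis_mx_inv hI hc hL hM).
Qed.

Lemma basis_of_inv I d r (b c : 'I_r -> S) M L : lin I -> basis I d b ->
  (forall i, bihom d (c i)) -> (forall i, I (c i - mcomb b M i)) -> L *m M = 1%:M ->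
  basis I d c.
Proof.
move=> hI hb hc hM LM; apply: (span_basis hI hb hc) => p hp.
have [a [ha _]] := (proj2 hb) p hp.
exists [ffun i => ((\row_j a j) *m L) 0 i].
apply: lin_trans ha _ => //; apply: linBC => //.
have -> : comb b a = \sum_i [ffun i => ((\row_j a j) *m L) 0 i] i *: mcomb b M i.
  rewrite /comb /mcomb; under [RHS]eq_bigr => j _ do rewrite scaler_sumr.
  rewrite exchange_big; apply: eq_bigr => l _ /=.
  have -> : a l = ((\row_j a j) *m L *m M) 0 l by rewrite -mulmxA LM mulmx1 mxE.
  rewrite mxE scaler_suml; apply: eq_bigr => j _.
  by rewrite ffunE scalerA.
rewrite /comb -sumrB; apply: lin_sum => // i _; rewrite -scalerBr; exact: linZ.
Qed.

End BasisMatrix.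

(** * Initial ideals and monomial ideals *)

Section Initial.
Context (m n : nat).
Local Notation N := (m + n)%N.
Local Notation mons := (mons m n).
Implicit Types (u v w : 'X_{1..N}) (M : 'X_{1..N} -> Prop).

Definition sset M d : seq 'X_{1..N} := [seq u <- mons d | ~~ `[< M u >]].

Lemma mem_sset M d u : (u \in sset M d) = (bideg u == d) && ~~ `[< M u >].
Proof. by rewrite mem_filter mem_mons andbC. Qed.

Lemma sset_uniq M d : uniq (sset M d). Proof. exact/filter_uniq/mons_uniq. Qed.

Definition upclosed M : Prop := forall u v, M u -> M (v + u)%MM.

Section InitialIdeal.
Context (K : fieldType).
Local Notation S := {mpoly K[N]}.
Implicit Types (I : S -> Prop).

(** Leading monomials are taken of bihomogeneous members only, which keeps each reduction inside one
    bidegree. *)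
Definition init I u : Prop :=
  exists f, [/\ I f, bihom (bideg u) f, f != 0 & mlead f = u].

Lemma init_up I : ideal I -> upclosed (init I).
Proof.
move=> [_ _ hM] u v [f [f1 f2 f3 f4]]; exists ('X_[v] * f); split.
- exact: hM.
- by rewrite bidegD; apply: bihomM => //; apply: bihomX.
- rewrite mulf_neq0 //; apply/eqP => /(congr1 (mcoeff v)).
  by rewrite mcoeffX eqxx mcoeff0 => /eqP; rewrite oner_eq0.
rewrite mleadM ?mleadXm ?f4 //; apply/eqP => /(congr1 (mcoeff v)).
by rewrite mcoeffX eqxx mcoeff0 => /eqP; rewrite oner_eq0.
Qed.

Definition avoids M (p : S) : Prop := forall v, v \in msupp p -> ~ M v.

Lemma avoids0 M : avoids M 0. Proof. by move=> v; rewrite msupp0. Qed.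
Lemma avoids_lin M a p q : avoids M p -> avoids M q -> avoids M (a *: p + q).
Proof.
move=> hp hq v; rewrite mcoeff_msupp => h /[dup] Mv h'.
have e r : avoids M r -> r@_v = 0.
  by move=> hr; apply: memN_msupp_eq0; apply/negP => /hr.
by move: h; rewrite mcoeffD mcoeffZ !e // mulr0 addr0 eqxx.
Qed.

Definition iform I (F : 'X_{1..N} -> S) : Prop := forall u,
  [/\ avoids (init I) (F u), bihom (bideg u) (F u), I ('X_[u] - F u),
      (~ init I u -> F u = 'X_[u]) &
      (init I u -> forall v, v \in msupp (F u) -> (v < u)%O)].

Lemma iform_ex I : ideal I -> exists F, iform I F.
Proof.
move=> hI; have hl := ideal_lin hI.
suff /choice[F hF] : forall u, exists r : S,
  [/\ avoids (init I) r, bihom (bideg u) r, I ('X_[u] - r),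
      (~ init I u -> r = 'X_[u]) &
      (init I u -> forall v, v \in msupp r -> (v < u)%O)] by exists F.
apply: (well_founded_ind (@ltom_wf N)) => u IH.
case: (pselect (init I u)) => [iu|niu]; last first.
  exists 'X_[u]; split=> //; first by move=> v; rewrite msuppX mem_seq1 => /eqP->.
    exact: bihomX.
  by rewrite subrr; case: hl.
have [f [f1 f2 f3 f4]] := iu.
have c0 : f@_u != 0 by rewrite -f4 mleadc_eq0.
pose q := 'X_[u] - (f@_u)^-1 *: f.
have qlt v : v \in msupp q -> (v < u)%O.
  rewrite mcoeff_msupp mcoeffB mcoeffZ mcoeffX => hv.
  have vu : (v <= u)%O.
    rewrite leNgt; apply/negP => h; move: hv.
    have fv : f@_v = 0 by apply: mcoeff_gt_mlead; rewrite f4.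
    rewrite fv mulr0 subr0.
    by rewrite (negPf (_ : u != v)) ?eqxx //; move: h; rewrite lt_neqAle => /andP[].
  rewrite lt_neqAle vu andbT; apply: contraNneq hv => ->.
  by rewrite eqxx mulVf // subrr.
have qd : bihom (bideg u) q by apply: bihomB; [exact: bihomX | exact: bihomZ].
have /choice[R hR] : forall v, exists r : S, (v < u)%O ->
  [/\ avoids (init I) r, bihom (bideg v) r, I ('X_[v] - r),
      (~ init I v -> r = 'X_[v]) &
      (init I v -> forall z, z \in msupp r -> (z < v)%O)].
  move=> v; case: (boolP (v < u)%O) => h; last by exists 0.
  by have [r hr] := IH v h; exists r.
exists (\sum_(v <- msupp q) q@_v *: R v); split=> //.
- rewrite big_seq; elim/big_rec: _ => [|s p hs hp]; first exact: avoids0.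
  by apply: avoids_lin => //; have [] := hR s (qlt s hs).
- rewrite big_seq; apply: bihom_sum => s hs; apply: bihomZ.
  by have [_ + _ _ _] := hR s (qlt s hs); rewrite (qd s hs).
- apply: (@lin_trans _ _ _ _ _ q) => //.
    by rewrite /q opprB addrCA subrr addr0; apply: linZ.
  rewrite {1}[q]mpolyE -sumrB big_seq; apply: lin_sum => // s hs.
  by rewrite -scalerBr; apply: linZ => //; have [] := hR s (qlt s hs).
move=> _ z; rewrite mcoeff_msupp raddf_sum /= => hz.
have [s hs h1] : exists2 s, s \in msupp q & (R s)@_z != 0.
  apply: contrapT => h; move: hz; rewrite big_seq big1 ?eqxx // => s hs.
  rewrite mcoeffZ; apply/eqP; rewrite mulf_eq0; apply/orP; right.
  by apply/negPn/negP => h1; apply: h; exists s.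
have sl := qlt s hs; have [_ _ _ h4 h5] := hR s sl.
case: (pselect (init I s)) => [/h5/(_ z)|/h4 e].
  by rewrite mcoeff_msupp => /(_ h1) zs; apply: lt_trans zs sl.
by move: h1; rewrite e mcoeffX; case: (eqVneq s z) => [<-|_]; rewrite ?eqxx.
Qed.

Lemma avoids_uniq I d p : avoids (init I) p -> bihom d p -> I p -> p = 0.
Proof.
move=> h1 h2 h3; apply/eqP/negPn/negP => p0; have hm := mlead_supp p0.
by apply: (h1 _ hm); exists p; split=> //; rewrite (h2 _ hm).
Qed.

Lemma iform_lext I F d p : lin I -> iform I F -> bihom d p ->
  [/\ avoids (init I) (lext F p), bihom d (lext F p) & I (p - lext F p)].
Proof.
move=> hl hF hp; split.
- rewrite /lext; elim/big_rec: _ => [|s q _ hq]; first exact: avoids0.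
  by apply: avoids_lin => //; have [] := hF s.
- rewrite /lext big_seq; apply: bihom_sum => s hs; apply: bihomZ.
  by have [_ + _ _ _] := hF s; rewrite (hp s hs).
rewrite {1}[p]mpolyE /lext -sumrB; apply: lin_sum => // s _.
by rewrite -scalerBr; apply: linZ => //; have [] := hF s.
Qed.

Definition sbasis M d r (i : 'I_r) : S := 'X_[nth 0%MM (sset M d) i].

Lemma avoidsE M d p r : size (sset M d) = r -> avoids M p -> bihom d p ->
  p = comb (@sbasis M d r) [ffun i : 'I_r => p@_(nth 0%MM (sset M d) i)].
Proof.
move=> hr hp hd; rewrite {1}(bihomE hd) (bigID (mem (sset M d))) /= [X in _ + X]big1 ?addr0.
  rewrite -big_filter (perm_big (sset M d)).
    rewrite (big_nth 0%MM) hr big_mkord; apply: eq_bigr => i _.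
    by rewrite ffunE.
  apply: uniq_perm; rewrite ?filter_uniq ?mons_uniq ?sset_uniq // => u.
  by rewrite mem_filter mem_mons mem_sset andbAC andbb.
move=> u hu; suff -> : p@_u = 0 by rewrite scale0r.
case: (eqVneq (bideg u) d) => [ud|/eqP ne]; last by move/bihomP: hd => ->.
apply: memN_msupp_eq0; apply/negP => /hp h; move: hu.
by rewrite mem_sset ud eqxx /= negbK => /asboolP.
Qed.

Lemma nth_sset M d r (i : 'I_r) : size (sset M d) = r ->
  bideg (nth 0%MM (sset M d) i) = d /\ ~ M (nth 0%MM (sset M d) i).
Proof.
move=> hr; have : nth 0%MM (sset M d) i \in sset M d by rewrite mem_nth // hr.
by rewrite mem_sset => /andP[/eqP -> /asboolP].
Qed.

Lemma sbasis_coef M d r a (i : 'I_r) : size (sset M d) = r ->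
  (comb (@sbasis M d r) a)@_(nth 0%MM (sset M d) i) = a i.
Proof.
move=> hr; rewrite raddf_sum (bigD1 i) //= mcoeffZ mcoeffX eqxx mulr1 big1 ?addr0 // => j ji.
rewrite mcoeffZ mcoeffX nth_uniq ?sset_uniq ?hr // (_ : (_ == _ :> nat) = false) ?mulr0 //.
exact: negPf ji.
Qed.

Lemma avoids_comb M d r a : size (sset M d) = r -> avoids M (comb (@sbasis M d r) a).
Proof.
move=> hr; rewrite /comb; elim/big_rec: _ => [|i p _ hp]; first exact: avoids0.
apply: avoids_lin => // v; rewrite msuppX mem_seq1 => /eqP ->.
by have [] := nth_sset i hr.
Qed.

Lemma bihom_sbasis M d r (i : 'I_r) : size (sset M d) = r -> bihom d (@sbasis M d r i).
Proof. by move=> hr; apply: bihomX'; have [] := nth_sset i hr. Qed.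

Lemma sbasis_basis_gen I M d r : lin I -> size (sset M d) = r ->
  (forall p, bihom d p -> exists q, [/\ avoids M q, bihom d q & I (p - q)]) ->
  (forall p, avoids M p -> bihom d p -> I p -> p = 0) -> basis I d (@sbasis M d r).
Proof.
move=> hl hr h1 h2; apply: basisI => // [i|p /h1[q [q1 q2 q3]]|a ha].
- exact: bihom_sbasis.
- by exists [ffun i : 'I_r => q@_(nth 0%MM (sset M d) i)]; rewrite -avoidsE.
have e : comb (@sbasis M d r) a = 0.
  apply: h2 => //; first exact: avoids_comb.
  by apply: comb_bihom => j; apply: bihom_sbasis.
by apply/ffunP => i; rewrite -(sbasis_coef a i hr) e mcoeff0 ffunE.
Qed.

Lemma init_basis I d r : ideal I -> size (sset (init I) d) = r ->
  basis I d (@sbasis (init I) d r).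
Proof.
move=> hI hr; have hl := ideal_lin hI; have [F hF] := iform_ex hI.
apply: sbasis_basis_gen => // p hp; last exact: avoids_uniq.
by exists (lext F p); apply: iform_lext.
Qed.

Lemma init_size I d r (b : 'I_r -> S) : ideal I -> basis I d b ->
  size (sset (init I) d) = r.
Proof.
move=> hI hb; apply/esym/(basis_size (ideal_lin hI) hb).
exact: init_basis.
Qed.

Definition monI M (p : S) : Prop := forall u, u \in msupp p -> M u.

Lemma monIP M p : monI M p <-> (forall u, ~ M u -> p@_u = 0).
Proof.
split=> [h u hu|h u]; first by apply: memN_msupp_eq0; apply/negP => /h.
by rewrite mcoeff_msupp => hu; apply: contrapT => /h e; rewrite e eqxx in hu.
Qed.

Lemma monI_ideal M : upclosed M -> ideal (monI M).
Proof.
move=> hM; split=> [u|p q /monIP hp /monIP hq|p q hq u].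
- by rewrite msupp0.
- by apply/monIP => u hu; rewrite mcoeffD hp // hq // addr0.
by move=> /msuppM_le/allpairsP[[a b] /= [_ /hq hb ->]]; apply: hM.
Qed.

Lemma monI_X M u : M u -> monI M 'X_[u].
Proof. by move=> h v; rewrite msuppX mem_seq1 => /eqP->. Qed.

Lemma monI_basis M d r : upclosed M -> size (sset M d) = r ->
  basis (monI M) d (@sbasis M d r).
Proof.
move=> hM hr; have hl := ideal_lin (monI_ideal hM).
apply: sbasis_basis_gen => // [p hp|p h1 h2 h3].
  exists (\sum_(u <- msupp p | ~~ `[< M u >]) p@_u *: 'X_[u]); split.
  - elim/big_rec: _ => [|s q /asboolP hs hq]; first exact: avoids0.
    by apply: avoids_lin => // v; rewrite msuppX mem_seq1 => /eqP->.
  - rewrite big_seq_cond; apply: bihom_sum => u /andP[/hp <- _].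
    by apply/bihomZ/bihomX.
  rewrite {1}[p]mpolyE (bigID (fun u => ~~ `[< M u >])) /= addrAC subrr add0r.
  apply: lin_sum => // u; rewrite negbK => /asboolP hu.
  exact: (linZ _ hl (monI_X hu)).
apply/eqP/negPn/negP => p0; have hm := mlead_supp p0.
exact: h1 _ hm (h3 _ hm).
Qed.

End InitialIdeal.
End Initial.

(** * Shears of monomial ideals *)

Section Generic.
Context (m n : nat).
Local Notation N := (m + n)%N.
Local Notation mons := (mons m n).
Local Notation vx := (@vx m n).
Local Notation vy := (@vy m n).
Local Notation mxy0 := (mxy (0%MM : 'X_{1..N})).
Implicit Types (u v w : 'X_{1..N}) (M : 'X_{1..N} -> Prop).

Lemma elem_inv (A : comNzRingType) (l l' : 'I_N) : l != l' ->
  bideg (U_(l)%MM : 'X_{1..N}) = bideg (U_(l')%MM : 'X_{1..N}) ->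
  invp (elem l l' (1 : A)) (elem l l' (- 1)).
Proof.
move=> ne lb.
have mul (c : A) : elem l l' c *m elem l l' (- c) = 1%:M.
  rewrite /elem mulmxDl mul1mx mulmxDr mulmx1 -scalemxAl -scalemxAr mul_delta_mx_0; last first.
    by rewrite eq_sym.
  by rewrite !scaler0 addr0 scaleNr subrK.
split; try exact: elem_blk; first exact: mul.
by have := mul (- 1); rewrite opprK.
Qed.

Lemma shiftU (l l' : 'I_N) : shift l l' U_(l)%MM = U_(l')%MM.
Proof. by apply/mnmP => z; rewrite mnmDE mnmBE subnn add0n. Qed.

Lemma act_elemD1 (A : comNzRingType) l l' (c : A) u : bideg u \in D1 ->
  act (elem l l' c) 'X_[u] = 'X_[u] + (c * (u l)%:R) *: 'X_[shift l l' u].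
Proof.
rewrite !inE => /or3P[] /eqP; last exact: act_elem11.
  move=> /bideg10P[i ->]; rewrite act_elem mnm1E; case: eqVneq => [->|_].
    by rewrite shiftU.
  by rewrite !mulr0 !scale0r.
move=> /bideg01P[i ->]; rewrite act_elem mnm1E; case: eqVneq => [->|_].
  by rewrite shiftU.
by rewrite !mulr0 !scale0r.
Qed.

Lemma shiftE (l l' : 'I_N) u z : shift l l' u z = (u z - (l == z) + (l' == z))%N.
Proof. by rewrite mnmDE mnmBE !mnm1E. Qed.

(** In this order a variable of smaller index is larger, so the moves that define [stable] go
    upwards. *)
Lemma shift_gt (l l' : 'I_N) u : (l' < l)%N -> (0 < u l)%N -> (u < shift l l' u)%O.
Proof.
move=> ll ul; apply/ltmcP.
  by rewrite /shift mdegD mdeg1 -(mdeg1 l) -mdegD submK // lep1mP -lt0n.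
exists l' => [j jl|]; rewrite shiftE.
  have -> : (l == j) = false by apply/eqP => e; move: jl; rewrite -e; lia.
  by have -> : (l' == j) = false; [apply/eqP => e; move: jl; rewrite -e ltnn | lia].
have -> : (l == l') = false by apply/eqP => e; move: ll; rewrite e ltnn.
by rewrite eqxx; lia.
Qed.

Lemma D1_le1 u l : bideg u \in D1 -> (u l <= 1)%N.
Proof.
rewrite !inE => /or3P[] /eqP.
- by move=> /bideg10P[i ->]; rewrite mnm1E leq_b1.
- by move=> /bideg01P[i ->]; rewrite mnm1E leq_b1.
move=> /bideg11P[i [j ->]]; move: l; apply: var_cases => a.
  by rewrite mxy_vx mnm0E add0n leq_b1.
by rewrite mxy_vy mnm0E add0n leq_b1.
Qed.

(* The weights realise the monomial order in the low bidegrees. *)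
Definition om u : nat := (\sum_(i < m) u (vx i) * ((m - i) * n.+1) + \sum_(j < n) u (vy j) * (n - j))%N.

Lemma omD u v : om (u + v)%MM = (om u + om v)%N.
Proof.
rewrite /om addnACA -!big_split /=; congr (_ + _)%N; apply: eq_bigr => i _;
by rewrite mnmDE mulnDl.
Qed.
Lemma om_vx i : om U_(vx i)%MM = ((m - i) * n.+1)%N.
Proof.
rewrite /om (bigD1 i) //= mnm1E eqxx mul1n !big1 ?addn0 //.
  by move=> j _; rewrite mnm1E eq_lrshift.
by move=> j ji; rewrite mnm1E eq_lshift eq_sym (negPf ji).
Qed.
Lemma om_vy j : om U_(vy j)%MM = (n - j)%N.
Proof.
rewrite /om (bigD1 (P := xpredT) j) //= mnm1E eqxx mul1n !big1 ?addn0 //.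
  by move=> l lj; rewrite mnm1E eq_rshift eq_sym (negPf lj).
by move=> l _; rewrite mnm1E eq_rlshift.
Qed.

(** The weights [n - j] of the [y_j] lie between 1 and [n], so with the factor [n.+1] one step among
    the [x_i] outweighs any change among the [y_j]. *)
Lemma om_lt u v : bideg u \in D1 -> bideg v = bideg u -> (v < u)%O -> (om v < om u)%N.
Proof.
rewrite !inE => /or3P[] /eqP hu; rewrite hu.
- move=> /bideg10P[p ->]; have [i ->] := bideg10P hu.
  move=> /ltmcP; rewrite !mdeg1 => /(_ erefl)[z hz]; rewrite !mnm1E.
  case: (eqVneq (vx i) z) => [e|//]; case: (eqVneq (vx p) z) => // ne _.
  have ip : (i < p)%N.
    rewrite ltnNge; apply/negP => pi; have := hz (vx p); rewrite -e !mnm1E eqxx.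
    rewrite eq_lshift; case: (eqVneq i p) => [e'|_]; first by rewrite -e' e eqxx in ne.
    have pni : (p != i :> nat) by apply/eqP => /val_inj e'; rewrite e' e eqxx in ne.
    have lt' : (vx p < vx i)%N by rewrite /= ltn_neqAle pni pi.
    by move=> /(_ lt').
  by rewrite !om_vx ltn_pmul2r //; have := ltn_ord p; lia.
- move=> /bideg01P[p ->]; have [i ->] := bideg01P hu.
  move=> /ltmcP; rewrite !mdeg1 => /(_ erefl)[z hz]; rewrite !mnm1E.
  case: (eqVneq (vy i) z) => [e|//]; case: (eqVneq (vy p) z) => // ne _.
  have ip : (i < p)%N.
    rewrite ltnNge; apply/negP => pi; have := hz (vy p); rewrite -e !mnm1E eqxx.
    rewrite eq_rshift; case: (eqVneq i p) => [e'|_]; first by rewrite -e' e eqxx in ne.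
    have pni : (p != i :> nat) by apply/eqP => /val_inj e'; rewrite e' e eqxx in ne.
    have lt' : (vy p < vy i)%N by rewrite /= ltn_add2l ltn_neqAle pni pi.
    by move=> /(_ lt').
  by rewrite !om_vy; have := ltn_ord p; lia.
move=> /bideg11P[p [q ->]]; have [i [j ->]] := bideg11P hu.
move=> /ltmcP; rewrite !mxy0E !mdegD !mdeg1 => /(_ erefl)[z hz]; rewrite -!mxy0E in hz *.
have -> : (om (mxy0 p q) < om (mxy0 i j))%N =
    ((m - p) * n.+1 + (n - q) < (m - i) * n.+1 + (n - j))%N.
  by rewrite !mxy0E !omD !om_vx !om_vy.
have jn := ltn_ord j; have qn := ltn_ord q; have pm := ltn_ord p; have im := ltn_ord i.
move: z hz; apply: var_cases => z hz.
  rewrite !mxy_vx !mnm0E !add0n; case: (eqVneq i z) => [e|//]; case: (eqVneq p z) => // ne _.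
  have ip : (i < p)%N.
    rewrite ltnNge; apply/negP => pi; have := hz (vx p); rewrite !mxy_vx !mnm0E eqxx.
    case: (eqVneq i p) => [e'|_]; first by rewrite -e' e eqxx in ne.
    have pni : (p != i :> nat) by apply/eqP => /val_inj e'; rewrite e' e eqxx in ne.
    have lt' : (vx p < vx z)%N by rewrite /= -e ltn_neqAle pni pi.
    by move=> /(_ lt').
  have : ((m - p).+1 * n.+1 <= (m - i) * n.+1)%N by rewrite leq_pmul2r //; lia.
  by rewrite mulSn; lia.
rewrite !mxy_vy !mnm0E !add0n; case: (eqVneq j z) => [e|//]; case: (eqVneq q z) => // ne _.
have -> : p = i.
  have := hz (vx p); rewrite !mxy_vx !mnm0E eqxx !add0n => /(_ ltac:(rewrite /=; lia)).
  by case: (eqVneq i p).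
rewrite ltn_add2l; have jq : (j < q)%N; last by lia.
rewrite ltnNge; apply/negP => qj; have := hz (vy q); rewrite !mxy_vy !mnm0E eqxx.
case: (eqVneq j q) => [e'|_]; first by rewrite -e' e eqxx in ne.
have pni : (q != j :> nat) by apply/eqP => /val_inj e'; rewrite e' e eqxx in ne.
have lt' : (vy q < vy z)%N by rewrite /= -e ltn_add2l ltn_neqAle pni qj.
by move=> /(_ lt').
Qed.

(** A down-closed set of indices is an initial segment given by its cardinality: the numbers [ba],
    [bb] and [lam i] arise as such cardinalities. *)
Lemma downcard (l : nat) (P : pred 'I_l) :
  (forall i j : 'I_l, (i <= j)%N -> P j -> P i) -> forall i : 'I_l, (i < #|P|)%N = P i.
Proof.
move=> hP i; have wi := ltn_ord i.
have inj (a : nat) (al : (a <= l)%N) : #|[set widen_ord al z | z in 'I_a]| = a.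
  rewrite card_imset ?card_ord // => x y /(congr1 val) /= e; exact: val_inj.
apply/idP/idP => [|Pi].
  apply: contraLR => nP; rewrite -leqNgt -[leqRHS](inj i (ltnW wi)).
  apply/subset_leq_card/fintype.subsetP => z Pz.
  have zi : (z < i)%N by rewrite ltnNge; apply/negP => /hP/(_ Pz); apply/negP.
  by apply/imsetP; exists (Ordinal zi) => //; apply: val_inj.
rewrite -[leqLHS](inj i.+1 wi); apply/subset_leq_card/fintype.subsetP => z /imsetP[y _ ->].
by apply: (hP _ i) => //; have := ltn_ord y; rewrite /= ltnS.
Qed.

Context (k : fieldType) (h : int * int -> nat).

Definition hset M : Prop := upclosed M /\ forall d, size (sset M d) = h d.

Lemma hilb_hset (K : fieldType) (I : {mpoly K[N]} -> Prop) : ideal I -> hilb I h ->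
  hset (init I).
Proof.
by move=> hI hb; split=> [|d]; [exact: init_up | have [b /(init_size hI)] := hb d].
Qed.

Lemma hset_hilb M : hset M -> ideal (monI M : {mpoly k[N]} -> Prop) /\
  hilb (monI M : {mpoly k[N]} -> Prop) h.
Proof.
case=> hu hs; split; first exact: monI_ideal.
by move=> d; exists (@sbasis m n k M d (h d)); apply: monI_basis.
Qed.

Lemma hilb_tr (I : {mpoly k[N]} -> Prop) G H : invp G H -> ideal I -> hilb I h ->
  ideal (tr I H) /\ hilb (tr I H) h.
Proof.
case=> a1 a2 a3 a4 hI hb; split; first exact: ideal_act.
move=> d; have [b hbb] := hb d; exists (fun i => act G (b i)).
by apply: basis_act => //; apply: ideal_lin.
Qed.

Hypothesis h0 : h 0 <> 0%N.
(** The form in which the Cartwright-Sturmfels property is used: a statement about monomial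
    ideals. *)
Hypothesis hrad : forall M, hset M -> forall u r, M (u *+ r)%MM -> M u.

Lemma hset0 M : hset M -> ~ M 0%MM.
Proof.
case=> hu hs M0; apply: h0; rewrite -hs; apply/eqP; rewrite size_eq0; apply/eqP.
rewrite /sset (eq_filter (a2 := pred0)) ?filter_pred0 // => u /=.
by apply/negbF/asboolP; rewrite -[u]addm0; apply: hu.
Qed.

Section Elementary.
Context (M : 'X_{1..N} -> Prop) (hM : hset M) (l l' : 'I_N).
Hypothesis (ll : (l' < l)%N).
Hypothesis (lb : bideg (U_(l)%MM : 'X_{1..N}) = bideg (U_(l')%MM : 'X_{1..N})).

Let nell : l != l'. Proof. by apply/eqP => e; move: ll; rewrite e ltnn. Qed.

Definition sheared : {mpoly k[N]} -> Prop := tr (monI M) (elem l l' (- 1)).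

Lemma sheared_hilb : ideal sheared /\ hilb sheared h.
Proof.
have [h1 h2] := hset_hilb hM.
exact: hilb_tr (elem_inv k nell lb) h1 h2.
Qed.

Lemma sheared_hset : hset (init sheared).
Proof. by have [h1 h2] := sheared_hilb; apply: hilb_hset. Qed.

Lemma sheared_act (f : {mpoly k[N]}) : monI M f -> sheared (act (elem l l' 1) f).
Proof.
by move=> hf; have [_ _ h3 _] := elem_inv k nell lb; rewrite /sheared /tr actM h3 act1.
Qed.

(** With [w] free of both variables, [x_l' w] arises only from [x_l' w] and from [x_l w], each time
    with coefficient 1; binomial coefficients, and so the characteristic, do not interfere. *)
Lemma sheared_coef (f : {mpoly k[N]}) w : w l = 0%N -> w l' = 0%N ->
  (act (elem l l' 1) f)@_(U_(l') + w)%MM = f@_(U_(l') + w)%MM + f@_(U_(l) + w)%MM.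
Proof.
move=> wl wl'; elim/mpoly_ind_X: f => [|a p q hp hq|u].
- by rewrite linear0 !mcoeff0 addr0.
- by rewrite linearP !mcoeffD !mcoeffZ hp hq mulrDr addrACA.
pose u' := (u - U_(l) *+ u l)%MM.
have eu : u = (u' + U_(l) *+ u l)%MM.
  rewrite submK //; apply/mnm_lepP => z; rewrite mulmnE mnm1E.
  by case: eqP => [<-|_]; rewrite ?mul1n ?mul0n.
have u'l : u' l = 0%N by rewrite mnmBE mulmnE mnm1E eqxx mul1n subnn.
have -> : act (elem l l' 1) 'X_[u] = \sum_(b < (u l).+1)
    'X_[u' + U_(l) *+ (u l - b) + U_(l') *+ b] *+ 'C(u l, b) :> {mpoly k[N]}.
  have hu' : act (elem l l' 1) 'X_[u'] = 'X_[u'] :> {mpoly k[N]}.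
    rewrite mpolyXE_id rmorph_prod; apply: eq_bigr => z _.
    rewrite rmorphXn /= act_elem; case: (eqVneq z l) => [->|_]; first by rewrite u'l !expr0.
    by rewrite mulr0 scale0r addr0.
  rewrite {1}eu mpolyXD rmorphM /= hu' -mpolyXn rmorphXn /= act_elem eqxx mulr1 scale1r.
  rewrite exprDn mulr_sumr; apply: eq_bigr => b _.
  by rewrite !mpolyXn -mpolyXD mulrnAr -mpolyXD addmA.
have nl : (l' == l) = false by rewrite eq_sym (negPf nell).
rewrite raddf_sum /= (bigD1 ord_max) //= big1 ?addr0; last first.
  move=> b bm; rewrite mcoeffMn mcoeffX; case: eqP => [e|]; last by rewrite mul0rn.
  have := congr1 (fun v : 'X_{1..N} => v l) e; rewrite !mnmDE !mulmnE !mnm1E eqxx nl u'l wl.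
  have : (b != u l :> nat) by apply: contraNneq bm => e'; apply/eqP; apply: val_inj.
  have := ltn_ord b; lia.
rewrite binn mulr1n subnn mulm0n addm0 !mcoeffX.
have [ul|ul] := eqVneq (u l) 0%N.
  have e1 : u' = u by rewrite [RHS]eu ul mulm0n addm0.
  rewrite e1 ul mulm0n addm0 [X in _ + X](_ : _ = 0) ?addr0 //.
  case: eqP => // e; have := congr1 (fun v : 'X_{1..N} => v l) e.
  by rewrite mnmDE mnm1E eqxx ul wl.
have -> : (u == (U_(l') + w)%MM) = false.
  by apply/eqP => e; move: ul; rewrite e mnmDE mnm1E nl wl.
rewrite add0r; congr (_%:R); congr nat_of_bool.
apply/eqP/eqP => [e|e].
  have u1 : u l = 1%N.
    have := congr1 (fun v : 'X_{1..N} => v l') e.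
    by rewrite !mnmDE mulmnE !mnm1E eqxx wl'; lia.
  rewrite eu addmC u1 mulm1n; congr (_ + _)%MM.
  by apply/(@addmI _ U_(l')%MM); rewrite -e u1 mulm1n addmC.
have u1 : u l = 1%N by rewrite e mnmDE mnm1E eqxx wl.
rewrite addmC u1 mulm1n; congr (_ + _)%MM.
by apply/(@addmI _ U_(l)%MM); rewrite -e eu u1 mulm1n addmC.
Qed.

(** The shear [x_l -> x_l + x_l'] turns [x_l x_l' w] into a form with leading monomial [x_l'^2 w].
    The initial ideal of the sheared ideal has the same Hilbert function, so it is radical and
    contains [x_l' w]; by [sheared_coef] a form with this leading monomial comes from one that
    involves [x_l' w] or [x_l w]. *)
Lemma hset_split w : w l = 0%N -> w l' = 0%N -> M (U_(l) + (U_(l') + w))%MM ->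
  M (U_(l') + w)%MM \/ M (U_(l) + w)%MM.
Proof.
move=> wl wl' hu; apply: contrapT => /not_orP[n1 n2].
pose N1 := init sheared.
have hv : N1 (U_(l') + (U_(l') + w))%MM.
  have e : act (elem l l' 1) 'X_[U_(l) + (U_(l') + w)] =
      'X_[U_(l) + (U_(l') + w)] + 'X_[U_(l') + (U_(l') + w)] :> {mpoly k[N]}.
    have hz (z : 'X_{1..N}) : z l = 0%N -> act (elem l l' 1) 'X_[z] = 'X_[z] :> {mpoly k[N]}.
      move=> zl; rewrite mpolyXE_id rmorph_prod; apply: eq_bigr => y _.
      rewrite rmorphXn /= act_elem; case: (eqVneq y l) => [->|_]; first by rewrite zl !expr0.
      by rewrite mulr0 scale0r addr0.
    rewrite mpolyXD rmorphM /= act_elem eqxx mulr1 scale1r hz; last first.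
      by rewrite mnmDE mnm1E wl eq_sym (negPf nell).
    by rewrite mulrDl -!mpolyXD.
  have lt : ((U_(l) + (U_(l') + w))%MM < (U_(l') + (U_(l') + w))%MM)%O.
    have := @shift_gt l l' (U_(l) + (U_(l') + w)) ll.
    rewrite mnmDE mnm1E eqxx => /(_ isT).
    rewrite (_ : shift l l' _ = (U_(l') + (U_(l') + w))%MM) //.
    by apply/mnmP => z; rewrite shiftE !mnmDE !mnm1E; lia.
  exists (act (elem l l' 1) 'X_[U_(l) + (U_(l') + w)]); split.
  - by apply: sheared_act; apply: monI_X.
  - have := @bihom_actX m n k (elem l l' 1) (U_(l) + (U_(l') + w))%MM (elem_blk lb 1).
    by rewrite !bidegD lb.
  - rewrite e; apply/eqP => /(congr1 (mcoeff (U_(l) + (U_(l') + w))%MM)).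
    rewrite mcoeffD !mcoeffX eqxx (gt_eqF lt) addr0 mcoeff0 => /eqP.
    by rewrite oner_eq0.
  by rewrite e addrC mleadDl ?mleadXm.
have : N1 (U_(l') + w)%MM.
  apply: (hrad sheared_hset (r := 2)).
  have -> : ((U_(l') + w) *+ 2 = w + (U_(l') + (U_(l') + w)))%MM.
    by rewrite mulmS mulm1n; apply/mnmP => z; rewrite !mnmDE; lia.
  by have [su _] := sheared_hset; apply: su.
case=> g [g1 g2 g3 g4].
have : g@_(U_(l') + w)%MM != 0 by rewrite -g4 mleadc_eq0.
have [f hf ef] : exists2 f, monI M f & g = act (elem l l' 1) f.
  exists (act (elem l l' (- 1)) g) => //.
  by have [_ _ _ h4] := elem_inv k nell lb; rewrite actM h4 act1.
by rewrite ef sheared_coef // !(proj1 (monIP _ _) hf) // addr0 eqxx.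
Qed.

Definition pos u : nat := (\sum_(z < N) u z * z)%N.
(** The total index of the variables in the low part of [M]. A shear that moves something lowers it,
    so repeated shearing ends at a stable ideal. *)
Definition pot M : nat := (\sum_(d <- D1) \sum_(u <- mons d | `[< M u >]) pos u)%N.

Lemma pos_shift u : (0 < u l)%N -> (pos (shift l l' u) < pos u)%N.
Proof.
move=> ul; rewrite /pos (bigD1 l) //= [X in (_ < X)%N](bigD1 l) //=.
rewrite (bigD1 l') /=; last by rewrite eq_sym nell.
rewrite [X in (_ < _ + X)%N](bigD1 l') /=; last by rewrite eq_sym nell.
rewrite !shiftE !eqxx (negPf nell) [l' == l]eq_sym (negPf nell).
have -> : (\sum_(i < N | (i != l) && (i != l')) shift l l' u i * i =
    \sum_(i < N | (i != l) && (i != l')) u i * i)%N.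
  apply: eq_bigr => i /andP[i1 i2]; rewrite shiftE [l == i]eq_sym (negPf i1).
  by rewrite [l' == i]eq_sym (negPf i2) subn0 addn0.
rewrite /= subn0 addn0 mulnBl mul1n addn1 mulSn.
have : (l <= u l * l)%N by rewrite leq_pmull.
set S1 := (\sum_(_ < _ | _) _)%N.
move: (u l * l)%N (u l' * l')%N S1 (l : nat) (l' : nat) ll; clear; lia.
Qed.

(** The shift of extremal set theory: replace [l] by [l'] unless the result is already in [M]. *)
Definition kap u : 'X_{1..N} :=
  if (0 < u l)%N && ~~ `[< M (shift l l' u) >] then shift l l' u else u.

Lemma kap_init u : bideg u \in D1 -> M u -> init sheared (kap u).
Proof.
move=> hd Mu; rewrite /kap.
have X0 v : 'X_[v] != 0 :> {mpoly k[N]}.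
  by apply/eqP => /(congr1 (mcoeff v)) /eqP; rewrite mcoeffX eqxx mcoeff0 oner_eq0.
have [ul|ul] := posnP (u l).
  exists 'X_[u]; split; [|exact: bihomX|exact: X0|exact: mleadXm].
  have := sheared_act (monI_X (K := k) Mu); rewrite act_elemD1 // ul mulr0 scale0r addr0; exact.
have u1 : u l = 1%N by have := D1_le1 l hd; lia.
have sd : bideg (shift l l' u) = bideg u by apply: bideg_shift.
have e1 : act (elem l l' 1) 'X_[u] = 'X_[u] + 'X_[shift l l' u] :> {mpoly k[N]}.
  by rewrite act_elemD1 // u1 mulr1 scale1r.
case: asboolP => /= [Ms|nMs].
  exists 'X_[u]; split; [|exact: bihomX|exact: X0|exact: mleadXm].
  have := @sheared_act ('X_[u] - 'X_[shift l l' u]); rewrite linearB /= e1.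
  rewrite act_elemD1 ?sd // (_ : shift l l' u l = 0%N); last first.
    by rewrite shiftE eqxx u1 eq_sym (negPf nell).
  rewrite mulr0 scale0r addr0 addrK; apply.
  apply: (@linB _ _ _ (monI M)); [|exact: monI_X|exact: monI_X].
  exact: ideal_lin (proj1 (hset_hilb hM)).
have lt := shift_gt ll ul.
exists (act (elem l l' 1) 'X_[u]); split.
- by apply: sheared_act; apply: monI_X.
- by rewrite sd; apply: bihom_actX; apply: elem_blk.
- rewrite e1; apply/eqP => /(congr1 (mcoeff u)).
  by rewrite mcoeffD !mcoeffX eqxx (gt_eqF lt) addr0 mcoeff0 => /eqP; rewrite oner_eq0.
by rewrite e1 addrC mleadDl ?mleadXm.
Qed.

Lemma kap_inj u v : bideg u \in D1 -> bideg v \in D1 -> M u -> M v -> kap u = kap v -> u = v.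
Proof.
move=> hu hv Mu Mv; rewrite /kap; case: ifP => [/andP[ul /asboolP nu]|_];
  case: ifP => [/andP[vl /asboolP nv]|_] // e.
- have /addIm e2 := e.
  have hs (x : 'X_{1..N}) : (0 < x l)%N -> (x - U_(l) + U_(l))%MM = x.
    by move=> xl; rewrite submK // lep1mP -lt0n.
  by rewrite -(hs u ul) e2 hs.
- by case: nu; rewrite e.
by case: nv; rewrite -e.
Qed.

(** The map [kap] is injective from [M] into the initial monomials of the sheared ideal, and the
    common Hilbert function makes the two sets equally large. *)
Lemma init_kap d : d \in D1 ->
  perm_eq [seq u <- mons d | `[< init sheared u >]] [seq kap u | u <- mons d & `[< M u >]].
Proof.
move=> hd; have memM u : u \in [seq u <- mons d | `[< M u >]] -> bideg u = d /\ M u.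
  by rewrite mem_filter mem_mons => /andP[/asboolP ? /eqP].
have U2 : uniq [seq kap u | u <- mons d & `[< M u >]].
  rewrite map_inj_in_uniq ?filter_uniq ?mons_uniq // => u v /memM[ud Mu] /memM[vd Mv].
  by apply: kap_inj; rewrite ?ud ?vd.
rewrite perm_sym; apply: uniq_perm => //; first exact/filter_uniq/mons_uniq.
have sz M' : hset M' -> size [seq u <- mons d | `[< M' u >]] = (size (mons d) - h d)%N.
  move=> [_ hs]; rewrite -hs /sset !size_filter.
  by rewrite -(count_predC (fun u => `[< M' u >]) (mons d)) addnK.
have sub : {subset [seq kap u | u <- mons d & `[< M u >]] <= [seq u <- mons d | `[< init sheared u >]]}.
  move=> v /mapP[u /memM[ud Mu] ->]; have hk : init sheared (kap u) by apply: kap_init => //; rewrite ud.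
  rewrite mem_filter mem_mons; apply/andP; split; first exact/asboolP.
  rewrite /kap; case: ifP => [/andP[ul _]|_]; last by rewrite ud.
  by rewrite bideg_shift ?ud.
have [] := uniq_min_size U2 sub; last by [].
by rewrite size_map (sz _ hM) (sz _ sheared_hset).
Qed.

Lemma pot_lt u : bideg u \in D1 -> M u -> (0 < u l)%N -> ~ M (shift l l' u) ->
  (pot (init sheared) < pot M)%N.
Proof.
move=> hd Mu ul ns.
have e d : d \in D1 -> (\sum_(v <- mons d | `[< init sheared v >]) pos v =
    \sum_(v <- mons d | `[< M v >]) pos (kap v))%N.
  move=> dD; rewrite -big_filter (perm_big _ (init_kap dD)) big_map big_filter.
  by [].
have le v : (pos (kap v) <= pos v)%N.
  by rewrite /kap; case: ifP => // /andP[vl _]; apply/ltnW/pos_shift.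
rewrite /pot (eq_big_seq _ e).
have leD d : (\sum_(v <- mons d | `[< M v >]) pos (kap v) <= \sum_(v <- mons d | `[< M v >]) pos v)%N.
  by apply: leq_sum.
rewrite (bigD1_seq (bideg u)) //= [X in (_ < X)%N](bigD1_seq (bideg u)) //=.
rewrite -addSn; apply: leq_add; last by apply: leq_sum.
rewrite -[X in (X < _)%N]big_filter -[X in (_ < X)%N]big_filter.
have uin : u \in [seq v <- mons (bideg u) | `[< M v >]].
  by rewrite mem_filter mem_mons eqxx andbT; apply/asboolP.
have un := filter_uniq (fun v => `[< M v >]) (mons_uniq m n (bideg u)).
rewrite (bigD1_seq u) //= [X in (_ < X)%N](bigD1_seq u) //= -addSn.
apply: leq_add; last by apply: leq_sum.
rewrite /kap ul /=; case: asboolP => // _; exact: pos_shift.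
Qed.

End Elementary.
End Generic.

(** An algebraically closed field is infinite, so ['X * Q] cannot vanish on the whole image of [k];
    the factor ['X] is what keeps [s] away from 0. *)
Lemma closed_nonroot (k : closedFieldType) (K : fieldType) (f : {rmorphism k -> K})
  (Q : {poly K}) : Q != 0 -> exists2 s : k, s != 0 & Q.[f s] != 0.
Proof.
move=> Q0; have long r : exists2 s : seq k, uniq s & size s = r.
  elim: r => [|r [s us <-]]; first by exists [::].
  have /closed_nonrootP[x] : \prod_(a <- s) ('X - a%:P) != 0.
    by rewrite monic_neq0 // monic_prod_XsubC.
  by rewrite root_prod_XsubC => xs; exists (x :: s); rewrite //= xs.
have [s us hs] := long (size ('X * Q)).
have P0 : 'X * Q != 0 by rewrite mulf_neq0 // polyX_eq0.
have /allPn[_ /mapP[x xs ->] hx] : ~~ all (root ('X * Q)) (map f s).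
  apply/negP => ha; have := max_poly_roots P0 ha.
  by rewrite map_inj_uniq ?us ?size_map ?hs ?ltnn; [move/(_ isT) | apply: fmorph_inj].
rewrite rootM rootX negb_or fmorph_eq0 in hx; have [h1 h2] := andP hx.
by exists x.
Qed.

Lemma map_mx_idfun (R : nzRingType) r s (A : 'M[R]_(r, s)) : map_mx idfun A = A.
Proof. by apply/matrixP => i j; rewrite mxE. Qed.

Lemma two_of_sum (r : nat) (f : 'I_r -> nat) : (1 < \sum_i f i)%N ->
  (exists i, (1 < f i)%N) \/ exists i j : 'I_r, [/\ (i < j)%N, (0 < f i)%N & (0 < f j)%N].
Proof.
move=> hs; have [i hi] : exists i, (0 < f i)%N.
  apply: contrapT => hn; move: hs; rewrite big1 // => i _; apply/eqP.
  by rewrite -leqn0 leqNgt; apply/negP => hi; apply: hn; exists i.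
have [i1|i1] := ltnP 1 (f i); first by left; exists i.
right; have [j [ji hj]] : exists j, j != i /\ (0 < f j)%N.
  apply: contrapT => hn; move: hs; rewrite (bigD1 i) //= big1.
    by rewrite addn0 ltnNge i1.
  move=> j ji; apply/eqP; rewrite -leqn0 leqNgt; apply/negP => hj.
  by apply: hn; exists j.
case: (ltngtP i j) => [ij|ij|e]; first by exists i, j.
  by exists j, i.
by move: ji; rewrite (val_inj e) eqxx.
Qed.

(** * Stable ideals and degeneration to the initial ideal *)

Section Gin.
Context (m n : nat).
Local Notation N := (m + n)%N.
Local Notation mons := (mons m n).
Local Notation vx := (@vx m n).
Local Notation vy := (@vy m n).
Local Notation mxy0 := (mxy (0%MM : 'X_{1..N})).
Implicit Types (u v w : 'X_{1..N}) (M : 'X_{1..N} -> Prop).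
Context (k : closedFieldType) (h : int * int -> nat).
Hypothesis h0 : h 0 <> 0%N.
Hypothesis hrad : forall M, hset h M -> forall u r, M (u *+ r)%MM -> M u.

(** Radicality removes squares and [hset_split] removes products of two variables of the same block,
    so a minimal generator has at most one variable from each block. *)
Lemma hset_gen M u : hset h M -> M u ->
  exists u0 : 'X_{1..N}, [/\ M u0, bideg u0 \in D1 & exists v, u = (v + u0)%MM].
Proof.
move=> hM; have [r] := ubnP (mdeg u); elim: r u => // r IH u ur Mu.
have red l : (0 < u l)%N -> M (u - U_(l))%MM ->
    exists u0 : 'X_{1..N}, [/\ M u0, bideg u0 \in D1 & exists v, u = (v + u0)%MM].
  move=> ul Ml; have eu : u = (u - U_(l) + U_(l))%MM by rewrite submK // lep1mP -lt0n.
  have [|u0 [h1 h2 [v hv]]] := IH _ _ Ml.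
    by move: ur; rewrite {1}eu mdegD mdeg1 addn1.
  by exists u0; split=> //; exists (v + U_(l))%MM; rewrite {1}eu hv -!addmA [(u0 + _)%MM]addmC.
have sq l : (1 < u l)%N -> exists u0 : 'X_{1..N},
    [/\ M u0, bideg u0 \in D1 & exists v, u = (v + u0)%MM].
  move=> ul; apply: (red l); first by move: ul; clear; lia.
  (* The square of [u / x_l] is a multiple of [u] when [x_l] occurs at least twice. *)
  apply: (hrad hM (r := 2)).
  rewrite (_ : _ *+ 2 = (u - U_(l) - U_(l)) + u)%MM; first by case: hM => hu _; apply: hu.
  apply/mnmP => z; rewrite mulmnE mnmDE !mnmBE mnm1E; case: eqP => [<-|_]; move: ul; clear; lia.
have dbl (l l' : 'I_N) : (l' < l)%N -> (0 < u l)%N -> (0 < u l')%N ->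
    bideg (U_(l)%MM : 'X_{1..N}) = bideg (U_(l')%MM : 'X_{1..N}) ->
    exists u0 : 'X_{1..N}, [/\ M u0, bideg u0 \in D1 & exists v, u = (v + u0)%MM].
  move=> ll ul ul' lb; have [u2|u2] := ltnP 1 (u l); first exact: sq u2.
  have [u2'|u2'] := ltnP 1 (u l'); first exact: sq u2'.
  have nl : (l == l') = false by apply/eqP => e; move: ll; rewrite e ltnn.
  pose w := (u - U_(l) - U_(l'))%MM.
  have e1 : (U_(l') + w)%MM = (u - U_(l))%MM.
    apply/mnmP => z; rewrite mnmDE !mnmBE !mnm1E; case: (eqVneq l' z) => [<-|_].
      by rewrite nl; move: ul'; clear; lia.
    by clear; lia.
  have e2 : (U_(l) + w)%MM = (u - U_(l'))%MM.
    apply/mnmP => z; rewrite mnmDE !mnmBE !mnm1E; case: (eqVneq l z) => [<-|_].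
      by rewrite eq_sym nl; move: ul; clear; lia.
    by clear; lia.
  have [|||Ml|Ml] := @hset_split m n k h h0 hrad M hM l l' ll lb w.
  - by rewrite !mnmBE !mnm1E eqxx eq_sym nl; move: u2; clear; lia.
  - by rewrite !mnmBE !mnm1E eqxx nl; move: u2'; clear; lia.
  - by rewrite e1 addmC submK // lep1mP -lt0n.
  - by rewrite e1 in Ml; apply: red Ml.
  by rewrite e2 in Ml; apply: red Ml.
have [a1|a1] := ltnP 1 (\sum_(i < m) u (vx i)).
  have [[i]|[i [j [ij hi hj]]]] := two_of_sum a1; first exact: sq.
  by apply: (dbl (vx j) (vx i)) => //; rewrite !bideg_vx.
have [b1|b1] := ltnP 1 (\sum_(i < n) u (vy i)).
  have [[i]|[i [j [ij hi hj]]]] := two_of_sum b1; first exact: sq.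
  by apply: (dbl (vy j) (vy i)) => //; rewrite ?bideg_vy //= ltn_add2l.
have hb : bideg u = ((\sum_(i < m) u (vx i))%:Z, (\sum_(i < n) u (vy i))%:Z) by [].
exists u; split=> //; last by exists 0%MM; rewrite add0m.
have u0 : (\sum_(i < m) u (vx i) + \sum_(i < n) u (vy i) != 0)%N.
  apply/eqP => e; apply: (hset0 h0 hM); rewrite -(_ : u = 0%MM) //.
  by apply/eqP; rewrite -mdeg_eq0 mdegE big_split_ord /= e.
rewrite hb; move: (\sum_(_ < m) _)%N (\sum_(_ < n) _)%N a1 b1 u0.
by move=> [|[|a]] [|[|b]].
Qed.

Definition stable M : Prop := forall u (l l' : 'I_N), bideg u \in D1 -> (l' < l)%N ->
  bideg (U_(l)%MM : 'X_{1..N}) = bideg (U_(l')%MM : 'X_{1..N}) ->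
  (0 < u l)%N -> M u -> M (shift l l' u).

Section Stable.
Context M (hM : hset h M) (st : stable M).

Let PX : pred 'I_m := fun i => `[< M U_(vx i)%MM >].
Let PY : pred 'I_n := fun j => `[< M U_(vy j)%MM >].
Let PL (i : 'I_m) : pred 'I_n := fun j => `[< M (mxy0 i j) >].

Let sM u (l l' : 'I_N) u' : M u -> bideg u \in D1 -> (l' <= l)%N -> (0 < u l)%N ->
  bideg (U_(l)%MM : 'X_{1..N}) = bideg (U_(l')%MM : 'X_{1..N}) ->
  u' = shift l l' u -> M u'.
Proof.
move=> Mu ud; rewrite leq_eqVlt => /orP[/eqP/val_inj -> ul lb ->|ll ul lb ->].
  by rewrite (_ : shift l l u = u) // /shift submK // lep1mP -lt0n.
exact: st.
Qed.

Let PX_down (i j : 'I_m) : (i <= j)%N -> PX j -> PX i.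
Proof.
move=> ij /asboolP Mj; apply/asboolP; apply: (sM (l := vx j) (l' := vx i) Mj) => //.
- by rewrite bideg_vx.
- by rewrite mnm1E eqxx.
- by rewrite !bideg_vx.
by rewrite shiftU.
Qed.

Let PY_down (i j : 'I_n) : (i <= j)%N -> PY j -> PY i.
Proof.
move=> ij /asboolP Mj; apply/asboolP; apply: (sM (l := vy j) (l' := vy i) Mj) => //.
- by rewrite bideg_vy.
- by rewrite /= leq_add2l.
- by rewrite mnm1E eqxx.
- by rewrite !bideg_vy.
by rewrite shiftU.
Qed.

Let bideg_mxy0 i j : bideg (mxy0 i j) \in D1.
Proof. by rewrite mxy0E bidegD bideg_vx bideg_vy. Qed.

Let PL_down l (i j : 'I_n) : (i <= j)%N -> PL l j -> PL l i.
Proof.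
move=> ij /asboolP Mj; apply/asboolP; apply: (sM (l := vy j) (l' := vy i) Mj) => //.
- by rewrite /= leq_add2l.
- by rewrite mxy_vy eqxx mnm0E.
- by rewrite !bideg_vy.
by apply/mnmP; rewrite !mxy0E => z; rewrite shiftE !mnmDE !mnm1E; clear; lia.
Qed.

Let PL_anti l (i j : 'I_m) : (i <= j)%N -> PL j l -> PL i l.
Proof.
move=> ij /asboolP Mj; apply/asboolP; apply: (sM (l := vx j) (l' := vx i) Mj) => //.
- by rewrite mxy_vx eqxx mnm0E.
- by rewrite !bideg_vx.
by apply/mnmP; rewrite !mxy0E => z; rewrite shiftE !mnmDE !mnm1E; clear; lia.
Qed.

Definition slam (i : nat) : nat := if insub i is Some i' then #|PL i'| else 0%N.

Let slamE (i : 'I_m) : slam i = #|PL i|.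
Proof. by rewrite /slam insubT // => hi; rewrite (_ : Sub _ _ = i) //; apply: val_inj. Qed.

Let up u v : M u -> M (v + u)%MM. Proof. by case: hM => hu _; apply: hu. Qed.

Let slam_in i (hi : (i < m)%N) : slam i = #|PL (Ordinal hi)|.
Proof. exact: (slamE (Ordinal hi)). Qed.

Lemma slam_out i : (m <= i)%N -> slam i = 0%N.
Proof. by move=> mi; rewrite /slam insubF // ltnNge mi. Qed.

Lemma slam_mono i i' : (i <= i')%N -> (slam i' <= slam i)%N.
Proof.
move=> ii; have [mi|im] := leqP m i'; first by rewrite slam_out.
rewrite (slam_in im) (slam_in (leq_ltn_trans ii im)).
by apply/subset_leq_card/fintype.subsetP => j; apply: PL_anti.
Qed.

Lemma slam_le i : (slam i <= n)%N.
Proof.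
have [mi|im] := leqP m i; first by rewrite slam_out.
by rewrite (slam_in im) -[leqRHS]card_ord max_card.
Qed.

(** Stability makes the variables of each block in [M], and the columns in each row, initial
    segments; by [hset_gen] these data determine [M]. *)
Lemma stable_borel : exists2 J : borel m n, (forall u, std J u <-> ~ M u) &
  forall d, stds J d = sset M d.
Proof.
have pxm : (#|PX| <= m)%N by rewrite -[leqRHS]card_ord max_card.
have pyn : (#|PY| <= n)%N by rewrite -[leqRHS]card_ord max_card.
have hdead i : (i < #|PX|)%N -> slam i = n.
  move=> ip; have im := leq_trans ip pxm; rewrite (slam_in im).
  rewrite -[RHS]card_ord; apply: eq_card => j; rewrite !inE; apply/asboolP.
  rewrite mxy0E addmC; apply: up; apply/asboolP.
  by rewrite -[`[< _ >]]/(PX (Ordinal im)) -(downcard PX_down).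
have hbb i : (i < m)%N -> (#|PY| <= slam i)%N.
  move=> im; rewrite (slam_in im); apply/subset_leq_card/fintype.subsetP => j /asboolP Mj.
  by apply/asboolP; rewrite mxy0E; apply: up.
pose J := Borel slam_mono slam_le hdead hbb slam_out pxm pyn.
have hJ u : std J u <-> ~ M u.
  split=> [/andP[nd nr] Mu|nM].
    have [u0 [M0 ud [v eu]]] := hset_gen hM Mu.
    move: ud; rewrite !inE => /or3P[] /eqP.
    - move=> /bideg10P[i e]; move: nd; rewrite /dead negb_or => /andP[/existsP nd _].
      case: nd; exists i; rewrite (downcard PX_down) eu mnmDE e mnm1E eqxx addn1 andbT.
      by apply/asboolP; rewrite -e.
    - move=> /bideg01P[i e]; move: nd; rewrite /dead negb_or => /andP[_ /existsP nd].
      case: nd; exists i; rewrite (downcard PY_down) eu mnmDE e mnm1E eqxx addn1 andbT.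
      by apply/asboolP; rewrite -e.
    move=> /bideg11P[i [j e]]; case/negP: nr; apply/existsP; exists i; apply/existsP; exists j.
    rewrite /redex /= slamE (downcard (@PL_down i)) eu e !mnmDE.
    apply/and3P; split; first by apply/asboolP; rewrite -e.
      by rewrite mnm0E !mnm1E eqxx addnS.
    by rewrite mnm0E !mnm1E eqxx !addnS.
  apply/andP; split.
    apply/negP => /orP[] /existsP[i /andP[]].
      rewrite (downcard PX_down) => /asboolP Mi ui; apply: nM.
      have -> : u = (u - U_(vx i) + U_(vx i))%MM by rewrite submK // lep1mP -lt0n.
      exact: up.
    rewrite (downcard PY_down) => /asboolP Mi ui; apply: nM.
    have -> : u = (u - U_(vy i) + U_(vy i))%MM by rewrite submK // lep1mP -lt0n.
    exact: up.
  apply/negP => /existsP[i /existsP[j]]; rewrite /redex /= slamE (downcard (@PL_down i)).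
  case/and3P => /asboolP Mij ui uj; apply: nM.
  have -> : u = ((u - mxy0 i j) + mxy0 i j)%MM; last exact: up.
  rewrite submK //; apply/mnm_lepP; apply: var_cases => z.
    by rewrite mxy_vx mnm0E add0n; case: eqP => [<-|].
  by rewrite mxy_vy mnm0E add0n; case: eqP => [<-|].
exists J => // d; rewrite /stds /sset; apply: eq_filter => u.
by apply/idP/idP => [/hJ/asboolPn|/asboolPn/hJ].
Qed.

End Stable.

Lemma stable_good (K : fieldType) (I : {mpoly K[N]} -> Prop) (J : borel m n) d :
  ideal I -> (forall u, std J u <-> ~ init I u) -> good J I d.
Proof.
move=> hI hJ p hp; have hl := ideal_lin hI; have [F hF] := iform_ex hI.
have [q1 q2 q3] := iform_lext hl hF hp.
have sav q : stdpoly J q <-> avoids (init I) q.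
  by split=> hq u /hq /hJ.
exists (lext F p); split; first by split=> //; apply/sav.
move=> r [/sav r1 r2 r3]; apply: subr0_eq; apply: (@avoids_uniq _ _ _ I d) => //.
- rewrite -scaleN1r addrC; exact: avoids_lin.
- exact: bihomB.
have := linB hl r3 q3; rewrite opprB addrC addrA addrNK.
by [].
Qed.

Lemma om_sum u : om u = (\sum_l u l * om (U_(l)%MM : 'X_{1..N}))%N.
Proof.
rewrite big_split_ord; congr (_ + _)%N; apply: eq_bigr => i _; congr (_ * _)%N.
  by rewrite om_vx.
by rewrite om_vy.
Qed.

(** A one-parameter torus with weights [om]. As [s] tends to 0 it degenerates an ideal to its
    initial ideal in the bidegrees of [D1]. *)
Definition dil (K : fieldType) (s : K) : 'M[K]_N :=
  diag_mx (\row_l s ^+ om (U_(l)%MM : 'X_{1..N})).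

Lemma act_dil (K : fieldType) (s : K) u : act (dil s) 'X_[u] = s ^+ om u *: 'X_[u].
Proof.
rewrite [in LHS]mpolyXE_id rmorph_prod /=.
under eq_bigr => l _.
  rewrite rmorphXn /= actX /linf (bigD1 l) //= big1 ?addr0; last first.
    by move=> j jl; rewrite !mxE eq_sym (negPf jl) mulr0n scale0r.
  rewrite !mxE eqxx mulr1n exprZn -exprM mulnC; over.
by rewrite /= scaler_prod prodrXr -om_sum -mpolyXE_id.
Qed.

Lemma dil_inv (K : fieldType) (s : K) : s != 0 -> invp (dil s) (dil s^-1).
Proof.
move=> s0; have bl (x : K) : blk (dil x).
  by move=> i j hij; rewrite !mxE; case: eqP => [e|]; [rewrite e in hij | rewrite mulr0n].
have mul (x : K) : x != 0 -> dil x *m dil x^-1 = 1%:M.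
  move=> x0; rewrite mulmx_diag -diag_const_mx; congr diag_mx.
  by apply/rowP => l; rewrite !mxE exprVn mulfV // expf_neq0.
split=> //; first exact: mul.
by rewrite -{2}[s]invrK mul // invr_eq0.
Qed.

Section Degeneration.
Context (K : fieldType) (f : {rmorphism k -> K}) (I : {mpoly K[N]} -> Prop).
Hypotheses (hI : ideal I) (hb : hilb I h).
Context (J : borel m n) (G H : 'M[k]_N).
Hypotheses (GH : invp G H) (hJ : forall d, size (stds J d) = h d).
Local Notation M := (init I).
Hypothesis gd : forall d, d \in D1 -> good J (tr (monI M : {mpoly k[N]} -> Prop) H) d.

Let hM : hset h M. Proof. exact: hilb_hset. Qed.
Let sM d : size (sset M d) = h d. Proof. by case: hM. Qed.
Let sb d : 'I_(h d) -> {mpoly K[N]} := @sbasis m n K M d (h d).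
Let c d (i : 'I_(h d)) : {mpoly k[N]} := act H 'X_[nth 0%MM (stds J d) i].

Let bihom_std d (i : 'I_(h d)) (R : comNzRingType) :
  bihom d ('X_[nth 0%MM (stds J d) i] : {mpoly R[N]}).
Proof.
apply: bihomX'; have : nth 0%MM (stds J d) i \in stds J d by rewrite mem_nth // hJ.
by rewrite mem_stds => /andP[_ /eqP].
Qed.

Let coefM d : 'M[k]_(h d) := \matrix_(i, j) (c i)@_(nth 0%MM (sset M d) j).

Let coefM_unit d : d \in D1 -> coefM d \in unitmx.
Proof.
move=> dD; have [a1 a2 a3 a4] := GH.
have hN : ideal (monI M : {mpoly k[N]} -> Prop) by case: (hset_hilb k hM).
have hl := ideal_lin hN; have hb1 := monI_basis k (proj1 hM) (sM d).
have hl' : lin (tr (monI M : {mpoly k[N]} -> Prop) H) by apply/ideal_lin/ideal_act.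
have hc i : bihom d (@c d i) by apply: bihom_act => //; apply: bihom_std.
have hb2 : basis (monI M : {mpoly k[N]} -> Prop) d (@c d).
  have := basis_act hl' a2 a1 a4 a3 (good_basis hl' (gd dD)).
  rewrite /c; move: (hJ d); rewrite /stdb; case: _ /.
  rewrite (_ : (fun p => _) = monI M :> ({mpoly k[N]} -> Prop)) //.
  apply/funext => p; apply/propext.
  by rewrite -/(tr (tr (monI M) H) G p) trM a3 tr1.
have e1 i : monI M (@c d i - mcomb (@sbasis m n k M d (h d)) (coefM d) i).
  apply/monIP => u nu; rewrite mcoeffB (_ : mcomb _ _ i =
      comb (@sbasis m n k M d (h d)) [ffun j => coefM d i j]); last first.
    by apply: eq_bigr => j _; rewrite ffunE.
  have [ud|ud] := eqVneq (bideg u) d; last first.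
    have bc := @comb_bihom m n k d _ _ [ffun j => coefM d i j] (proj1 hb1).
    rewrite (memN_msupp_eq0 (p := c i)); last by apply: contra ud => /hc ->.
    by rewrite memN_msupp_eq0 ?subr0 //; apply: contra ud => /bc ->.
  have : u \in sset M d by rewrite mem_sset ud eqxx; apply/asboolPn.
  move=> /(nthP 0%MM)[j]; rewrite sM => jh <-.
  by rewrite (sbasis_coef _ (Ordinal jh)) // ffunE mxE subrr.
have [L hL] := basis_mx hb2 (proj1 hb1).
by have [] := mulmx1_unit (basis_mx_inv hl hb2 e1 hL).
Qed.

(** Applying [act H] to the standard monomials of [J] gives a basis modulo the initial ideal, the
    fibre at [s = 0]. The determinant of their coordinates modulo the ideal dilated by [s] is a
    polynomial over [K] that does not vanish at 0, hence not at some nonzero [s] of [k] either; this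
    keeps the substitution over [k]. *)
Lemma degenerate : exists G' H' : 'M[k]_N, invp G' H' /\
  forall d, d \in D1 -> good J (tr I (map_mx f H')) d.
Proof.
have hl := ideal_lin hI; have [F hF] := iform_ex hI; have [a1 a2 a3 a4] := GH.
(* Coordinates with respect to the monomials outside the initial ideal, rescaled by the torus. The
   truncated subtraction does no harm: [om v <= om u] whenever [v] occurs in [F u]. At [s = 0] only
   the terms [u = v] remain. *)
pose B d : 'M[{poly K}]_(h d) := \matrix_(i, j) \sum_(u <- mons d)
  (f (@c d i)@_u * (F u)@_(nth 0%MM (sset M d) j))%:P *
    'X^(om u - om (nth 0%MM (sset M d) j)).
have B0 d : d \in D1 -> map_mx (horner_eval 0) (B d) = map_mx f (coefM d).
  move=> dD; apply/matrixP => i j; rewrite !mxE /horner_eval horner_sum.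
  have [ud nM] := nth_sset j (sM d); set v := nth _ _ j in ud nM *.
  rewrite (bigD1_seq v) ?mons_uniq ?mem_mons ?ud //= big_seq_cond big1 ?addr0.
    have [_ _ _ /(_ nM) -> _] := hF v.
    by rewrite subnn expr0 mulr1 hornerC mcoeffX eqxx mulr1.
  move=> u /andP[]; rewrite mem_mons => /eqP hu uv; have [_ f2 _ f4 f5] := hF u.
  have [Mu|nMu] := pselect (M u); last first.
    by rewrite f4 // mcoeffX (negPf uv) mulr0 mul0r horner0.
  have [vF|/memN_msupp_eq0 ->] := boolP (v \in msupp (F u)); last first.
    by rewrite mulr0 mul0r horner0.
  have := om_lt _ _ (f5 Mu _ vF); rewrite hu ud => /(_ dD erefl) lt.
  by rewrite hornerM hornerXn expr0n subn_eq0 leqNgt lt mulr0.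
pose Q := \prod_(d <- D1) \det (B d).
have Q0 : Q != 0.
  rewrite prodf_seq_neq0; apply/allP => d dD /=; apply/eqP => e.
  have := congr1 (horner_eval 0) e; rewrite -det_map_mx B0 // rmorph0 => /eqP.
  by rewrite det_map_mx fmorph_eq0; apply/negP; have := coefM_unit dD; rewrite unitmxE unitfE.
have [s s0 hs] := closed_nonroot f Q0.
have fs0 : f s != 0 by rewrite fmorph_eq0.
pose G' := dil s^-1 *m G; pose H' := H *m dil s.
have iGH : invp G' H'.
  apply: invpM => //; have := @dil_inv _ s^-1; rewrite invrK invr_eq0; exact.
exists G', H'; split=> // d dD.
have [b1 b2 b3 b4] := iGH.
have bm (X : 'M[k]_N) : blk X -> blk (map_mx f X) by apply: blk_map.
have c3 : map_mx f G' *m map_mx f H' = 1%:M by rewrite -map_mxM b3 map_mx1.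
have c4 : map_mx f H' *m map_mx f G' = 1%:M by rewrite -map_mxM b4 map_mx1.
pose e (i : 'I_(h d)) : {mpoly K[N]} := act (map_mx f H') 'X_[nth 0%MM (stds J d) i].
pose Bs := map_mx (horner_eval (f s)) (B d).
pose Ds : 'M[K]_(h d) := diag_mx (\row_j f s ^+ om (nth 0%MM (sset M d) j)).
have he i : bihom d (e i) by apply: bihom_act; [exact: bm|exact: bihom_std].
have hs1 : basis I d (@sb d) by apply: init_basis.
have e1 i : I (e i - mcomb (@sb d) (Bs *m Ds) i).
  have ee : e i = \sum_(u <- mons d) (f (@c d i)@_u * f s ^+ om u) *: 'X_[u].
    have hc : bihom d (@c d i) by apply: bihom_act => //; apply: bihom_std.
    have -> : e i = act (dil (f s)) (map_mpoly f (@c d i)).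
      rewrite /e /c map_act map_mpolyX actM; congr (act _ _).
      rewrite map_mxM; congr (_ *m _); apply/matrixP => x y.
      by rewrite !mxE rmorphMn rmorphXn.
    have bf : bihom d (map_mpoly f (@c d i)).
      by rewrite /c map_act map_mpolyX; apply: bihom_act; [exact: bm|exact: bihom_std].
    rewrite {1}(bihomE bf) linear_sum /=; apply: eq_bigr => u _.
    by rewrite mcoeff_map_mpoly linearZ /= act_dil scalerA.
  pose r := \sum_(u <- mons d) (f (@c d i)@_u * f s ^+ om u) *: F u.
  have hr1 : I (e i - r).
    rewrite ee /r -sumrB; apply: lin_sum => // u _; rewrite -scalerBr.
    by apply: linZ => //; have [] := hF u.
  have hr2 : avoids M r.
    rewrite /r; elim/big_rec: _ => [|u q _ hq]; first exact: avoids0.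
    by apply: avoids_lin => //; have [] := hF u.
  have hr3 : bihom d r.
    rewrite /r big_seq; apply: bihom_sum => u; rewrite mem_mons => /eqP hu.
    by apply: bihomZ; have [_ + _ _ _] := hF u; rewrite hu.
  have -> : mcomb (@sb d) (Bs *m Ds) i = r; last exact: hr1.
  rewrite [RHS](avoidsE (sM d) hr2 hr3); apply: eq_bigr => j _; congr (_ *: _).
  rewrite ffunE mul_mx_diag !mxE /horner_eval horner_sum mulr_suml raddf_sum /=.
  apply: eq_big_seq => u; rewrite mem_mons => /eqP hu.
  have [ud nM] := nth_sset j (sM d); set v := nth _ _ j in ud nM *.
  rewrite mcoeffZ hornerM hornerC hornerXn; have [_ f2 _ f4 f5] := hF u.
  have [/memN_msupp_eq0 ->|vF] := boolP (v \notin msupp (F u)); first by rewrite !mulr0 !mul0r.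
  have le : (om v <= om u)%N.
    have [Mu|nMu] := pselect (M u).
      apply/ltnW; have := om_lt _ _ (f5 Mu _ (negPn vF)); rewrite hu ud; exact.
    by move/negPn: vF; rewrite f4 // msuppX mem_seq1 => /eqP ->.
  by rewrite -mulrA -exprD subnK // -!mulrA; congr (_ * _); rewrite mulrC.
have uBD : Bs *m Ds \in unitmx.
  rewrite unitmx_mul !unitmxE det_diag; apply/andP; split.
    rewrite unitfE det_map_mx; move: hs; rewrite /Q horner_prod prodf_seq_neq0.
    by move/allP => /(_ d dD).
  by rewrite unitfE; apply/prodf_neq0 => j _; rewrite !mxE expf_neq0.
have hbe : basis I d e := basis_of_inv hl hs1 he e1 (mulVmx uBD).
have := basis_act hl (bm _ b1) (bm _ b2) c3 c4 hbe.
rewrite (_ : (fun i => act _ (e i)) = fun i => 'X_[nth 0%MM (stds J d) i]); last first.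
  by apply/funext => i; rewrite /e actM c4 act1.
move=> hbs; apply: (@basis_good m n K J _ d _).
  exact/ideal_lin/ideal_act.
by move: hbs; rewrite /stdb; move: (hJ d); case: _ /.
Qed.

End Degeneration.

Lemma init_monI M u : upclosed M -> init (monI M : {mpoly k[N]} -> Prop) u <-> M u.
Proof.
move=> hM; split=> [[p [p1 _ p2 <-]]|Mu]; first by apply: p1; apply: mlead_supp.
exists 'X_[u]; split; [exact: monI_X|exact: bihomX| |exact: mleadXm].
by apply/eqP => /(congr1 (mcoeff u)) /eqP; rewrite mcoeffX eqxx mcoeff0 oner_eq0.
Qed.

(** Induction on [pot]. A failure of stability gives a shear whose initial ideal has smaller
    potential, and [degenerate] brings the coordinates found for that initial ideal back to the
    sheared ideal. *)
Lemma gin_mon M : hset h M -> exists (J : borel m n) (G H : 'M[k]_N),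
  [/\ invp G H, forall d, size (stds J d) = h d &
      forall d, d \in D1 -> good J (tr (monI M : {mpoly k[N]} -> Prop) H) d].
Proof.
have [r] := ubnP (pot M); elim: r M => // r IH M pr hM.
have [st|] := pselect (stable M).
  have [J hJ sJ] := stable_borel hM st; exists J, 1%:M, 1%:M; split; first exact: invp1.
    by move=> d; rewrite sJ; case: hM.
  move=> d _; have [hN _] := hset_hilb k hM.
  have -> : tr (monI M : {mpoly k[N]} -> Prop) 1%:M = monI M.
    by apply/funext => p; apply/propext; rewrite tr1.
  apply: stable_good => // u; rewrite hJ init_monI //; first by case: hM.
move=> /existsNP[u /existsNP[l /existsNP[l' /not_implyP[ud /not_implyP[ll
  /not_implyP[lb /not_implyP[ul /not_implyP[Mu nM]]]]]]]].
have nl : l != l' by apply/eqP => e; move: ll; rewrite e ltnn.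
have [hI hb] := @sheared_hilb m n k h M hM l l' ll lb.
have [|J [G [H [GH hJ gd]]]] := IH _ _ (sheared_hset k hM ll lb).
  by rewrite ltnS in pr; apply: leq_trans pr; apply: (pot_lt k h0 hM ll lb ud).
have [G' [H' [GH' gd']]] := degenerate idfun hI hb GH hJ gd.
exists J, (elem l l' 1 *m G'), (H' *m elem l l' (-1)); split; last 1 first.
- move=> d dD; have := gd' d dD; rewrite map_mx_idfun.
  rewrite (_ : tr (sheared M l l') H' = tr (monI M) (H' *m elem l l' (-1))); first exact.
  by apply/funext => p; apply/propext; rewrite -trM.
- by apply: invpM; [exact: elem_inv | exact: GH'].
exact: hJ.
Qed.

(** The matrices have entries in [k] although the ideal lives over [K]. In the application [K] is a
    residue field, and constant matrices extend to a neighbourhood of the point. *)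
Theorem gin (K : fieldType) (f : {rmorphism k -> K}) (I : {mpoly K[N]} -> Prop) :
  ideal I -> hilb I h -> exists (J : borel m n) (G H : 'M[k]_N),
  [/\ invp G H, forall d, size (stds J d) = h d &
      forall d, d \in D1 -> good J (tr I (map_mx f H)) d].
Proof.
move=> hI hb; have [J [G [H [GH hJ gd]]]] := gin_mon (hilb_hset hI hb).
have [G' [H' [GH' gd']]] := degenerate f hI hb GH hJ gd.
by exists J, G', H'.
Qed.

End Gin.

(** * Families given by local charts *)
Local Open Scope classical_set_scope.
Local Open Scope ring_scope.

Section NonzeroRing.
Context (A : comPzRingType) (hA : (1 : A) != 0).
(** Polynomials are formed over nonzero rings, whereas a ring of sections may be zero. Predicates
    such as [inCI] therefore quantify over proofs of [1 != 0] and hold trivially over the zero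
    ring. *)
Definition nz : Type := A.
HB.instance Definition _ := GRing.ComPzRing.on nz.
HB.instance Definition _ := GRing.PzSemiRing_isNonZero.Build nz hA.
Definition nzr : comNzRingType := nz.
End NonzeroRing.

Section PolOfCoefs.
Context (m n : nat) (A : comNzRingType).
Local Notation N := (m + n)%N.
Implicit Types (c : 'X_{1..N} -> A) (d : int * int).

Definition pol d c : {mpoly A[N]} := \sum_(u <- mons m n d) c u *: 'X_[u].

Lemma mcoeff_pol d c u : (pol d c)@_u = if bideg u == d then c u else 0.
Proof. exact: mpoly_sum_mons. Qed.

Lemma bihom_pol d c : bihom d (pol d c).
Proof.
rewrite /pol big_seq; apply: bihom_sum => u; rewrite mem_mons => /eqP hu.
exact/bihomZ/bihomX'.
Qed.

Lemma polE d (p : {mpoly A[N]}) : bihom d p -> pol d (fun u => p@_u) = p.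
Proof. by move=> hp; rewrite [RHS](bihomE hp). Qed.

Lemma polK d c u : (forall u, bideg u <> d -> c u = 0) -> (pol d c)@_u = c u.
Proof. by move=> hc; rewrite mcoeff_pol; case: eqP => // /hc ->. Qed.

Lemma polD d c c' : pol d (fun u => c u + c' u) = pol d c + pol d c'.
Proof. by rewrite -big_split; apply: eq_bigr => u _; rewrite scalerDl. Qed.
Lemma polN d c : pol d (fun u => - c u) = - pol d c.
Proof. by rewrite -sumrN; apply: eq_bigr => u _; rewrite scaleNr. Qed.
Lemma polZ d a c : pol d (fun u => a * c u) = a *: pol d c.
Proof. by rewrite scaler_sumr; apply: eq_bigr => u _; rewrite scalerA. Qed.
Lemma pol0 d : pol d (fun=> 0) = 0.
Proof. by rewrite /pol big1 // => u _; rewrite scale0r. Qed.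
Lemma pol_sum d r (a : 'I_r -> 'X_{1..N} -> A) :
  pol d (fun u => \sum_i a i u) = \sum_i pol d (a i).
Proof. by rewrite exchange_big; apply: eq_bigr => u _; rewrite scaler_suml. Qed.

Lemma mcoeffXM v (q : {mpoly A[N]}) u : ('X_[v] * q)@_u = mulmon v (fun u => q@_u) u.
Proof.
rewrite /mulmon mulrC; have [/forallP hv|nv] := boolP [forall i, (v i <= u i)%N].
  have {1}-> : u = (v + (u - v))%MM by rewrite addmC submK //; apply/mnm_lepP.
  by rewrite mcoeffMX.
rewrite mcoeffM big1 // => i /eqP e; rewrite mcoeffX.
case: eqP => [hv|]; last by rewrite mulr0.
by case/negP: nv; apply/forallP => l; rewrite e hv mnmDE leq_addl.
Qed.

Lemma polM d v c : (forall u, bideg u <> d -> c u = 0) ->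
  pol (d + bideg v) (mulmon v c) = 'X_[v] * pol d c.
Proof.
move=> hc; apply/mpolyP => u; rewrite mcoeff_pol mcoeffXM /mulmon.
have [/forallP hv|_] := boolP [forall i, (v i <= u i)%N]; last by rewrite if_same.
rewrite polK //; have {1}-> : u = ((u - v) + v)%MM by rewrite submK //; apply/mnm_lepP.
by rewrite bidegD; case: eqP => // ne; rewrite hc // => e; apply: ne; rewrite e.
Qed.

End PolOfCoefs.

Lemma map_pol m n (A B : comNzRingType) (f : {rmorphism A -> B}) d c :
  map_mpoly f (@pol m n A d c) = pol d (fun u => f (c u)).
Proof.
apply/mpolyP => u; rewrite mcoeff_map_mpoly !mcoeff_pol.
by case: eqP => // _; rewrite raddf0.
Qed.

Lemma nz_map (A B : comPzRingType) (f : {rmorphism A -> B}) : (1 : B) != 0 -> (1 : A) != 0.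
Proof. by apply: contraNneq => e; rewrite -(rmorph1 f) e rmorph0. Qed.

Lemma datum_eq m n (A : comPzRingType) (D E : datum m n A) :
  dG D = dG E -> dH D = dH E -> dt D = dt E -> D = E.
Proof.
case: D E => [a b c ? ? ? ?] [a' b' c' ? ? ? ?] /= e1 e2 e3; subst.
by congr Datum; apply: Prop_irrelevance.
Qed.

Section CoefCharts.
Context (m n : nat) (J : borel m n).
Local Notation N := (m + n)%N.

Definition nzd (A : comPzRingType) (hA : (1 : A) != 0) (D : datum m n A) :
    datum m n (nzr hA) :=
  @Datum m n (nzr hA) (dG D) (dH D) (dt D) (dG_blk D) (dH_blk D) (dGH D) (dHG D).

Lemma nzd_map (A B : comPzRingType) (f : {rmorphism A -> B}) (hA : (1 : A) != 0)
    (hB : (1 : B) != 0) (D : datum m n A) :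
  nzd hB (map_datum f D) = map_datum (f : {rmorphism nzr hA -> nzr hB}) (nzd hA D).
Proof. exact: datum_eq. Qed.

Definition inCI (A : comPzRingType) (D : datum m n A) (d : int * int)
    (c : 'X_{1..N} -> A) : Prop :=
  forall hA : (1 : A) != 0, CI J (nzd hA D) (@pol m n (nzr hA) d c).

Definition hom0 (A : comPzRingType) (d : int * int) (c : 'X_{1..N} -> A) : Prop :=
  forall u, bideg u <> d -> c u = 0.

Section Ring.
Context (A : comPzRingType) (D : datum m n A).
Implicit Types (c : 'X_{1..N} -> A) (d : int * int).

Lemma inCI0 d : inCI D d (fun=> 0).
Proof. by move=> hA; rewrite (@pol0 m n (nzr hA)); case: (CI_ideal J (nzd hA D)). Qed.
Lemma inCID d c c' : inCI D d c -> inCI D d c' -> inCI D d (fun u => c u + c' u).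
Proof.
move=> h1 h2 hA; rewrite (@polD m n (nzr hA)); apply: linD; [exact: CI_lin|exact: h1|exact: h2].
Qed.
Lemma inCIZ d a c : inCI D d c -> inCI D d (fun u => a * c u).
Proof. by move=> h1 hA; rewrite (@polZ m n (nzr hA)); apply: linZ; [exact: CI_lin|exact: h1]. Qed.
Lemma inCIM d v c : hom0 d c -> inCI D d c -> inCI D (d + bideg v) (mulmon v c).
Proof.
move=> h0 h1 hA; rewrite (@polM m n (nzr hA)) //.
by have [_ _ hM] := CI_ideal J (nzd hA D); apply/hM/h1.
Qed.
Lemma inCI_sum d r (c : 'I_r -> 'X_{1..N} -> A) : (forall i, inCI D d (c i)) ->
  inCI D d (fun u => \sum_i c i u).
Proof.
move=> h1 hA; rewrite (@pol_sum m n (nzr hA)); apply: lin_sum; first exact: CI_lin.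
by move=> i _; apply: h1.
Qed.

End Ring.

Section Map.
Context (A B : comPzRingType) (f : {rmorphism A -> B}).
Implicit Types (D : datum m n A) (d : int * int).

Lemma inCI_map D d c : inCI D d c -> inCI (map_datum f D) d (fun u => f (c u)).
Proof.
move=> h1 hB; have hA := nz_map f hB; rewrite (nzd_map f hA).
rewrite -(@map_pol m n (nzr hA) (nzr hB) f); apply: map_CI; exact: h1.
Qed.

(** The base change of an explicit ideal is generated by the images of its generators, and these are
    bihomogeneous, so the inclusion is applied to generators alone. *)
Lemma inCI_le_map D E : (forall d c, hom0 d c -> inCI D d c -> inCI E d c) ->
  forall d c, inCI (map_datum f D) d c -> inCI (map_datum f E) d c.
Proof.
move=> h1 d c hc hB; have hA := nz_map f hB; have := hc hB; rewrite !(nzd_map f hA).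
apply: CI_gen; first exact: CI_ideal.
move=> p /map_cgen[q hq ->]; apply: map_CI; have [d' _ hd] := bihom_cgen hq.
have := h1 d' (fun u => q@_u) (proj1 (bihomP _ _) hd) _ hA; rewrite polE //; apply.
move=> hA'; have -> : hA' = hA by apply: Prop_irrelevance.
by rewrite polE //; apply: CI_cgen.
Qed.

End Map.

Definition gen_coef (A : comPzRingType) (D : datum m n A) (d : int * int) r (i : 'I_r)
    (u : 'X_{1..N}) : A :=
  if pselect ((1 : A) != 0) is left hA then
    (act (dH (nzd hA D)) ('X_[nth 0%MM (stds J d) i] : {mpoly (nzr hA)[N]}))@_u
  else 0.

Section Free.
Context (A B : comPzRingType) (D : datum m n A) (f : {rmorphism A -> B}) (d : int * int) (r : nat).
Hypothesis hr : size (stds J d) = r.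

Lemma gen_coefE hA i u : gen_coef D d i u = (act (dH (nzd hA D)) ('X_[nth 0%MM (stds J d) (i : 'I_r)] : {mpoly (nzr hA)[N]}))@_u.
Proof.
rewrite /gen_coef; case: pselect => // hA'.
by have -> : hA' = hA by apply: Prop_irrelevance.
Qed.

Lemma gen_coef_hom (i : 'I_r) : hom0 d (gen_coef D d i).
Proof.
move=> u hu; rewrite /gen_coef; case: pselect => // hA.
apply: (proj1 (@bihomP m n (nzr hA) d _) _ u hu); apply: bihom_act; first exact: dH_blk.
apply: bihomX'; have : nth 0%MM (stds J d) i \in stds J d by rewrite mem_nth // hr.
by rewrite mem_stds => /andP[_ /eqP].
Qed.

Lemma inCI_free (c : 'X_{1..N} -> B) : hom0 d c ->
  exists! a : {ffun 'I_r -> B}, inCI (map_datum f D) d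
    (fun u => c u - \sum_i a i * f (gen_coef D d i u)).
Proof.
move=> hc; have [e|hB] := eqVneq (1 : B) 0.
  exists 0; split=> [hB|a _]; first by case/eqP: hB.
  by apply/ffunP => i; rewrite -[LHS]mulr1 -[RHS]mulr1 e !mulr0.
have hA := nz_map f hB.
have key (a : {ffun 'I_r -> B}) : inCI (map_datum f D) d
    (fun u => c u - \sum_i a i * f (gen_coef D d i u)) <->
    CI J (nzd hB (map_datum f D)) (@pol m n (nzr hB) d c -
      \sum_i (a i : nzr hB) *: act (dH (nzd hB (map_datum f D)))
        ('X_[nth 0%MM (stds J d) i] : {mpoly (nzr hB)[N]})).
  have e : @pol m n (nzr hB) d (fun u => c u - \sum_i a i * f (gen_coef D d i u)) =
      @pol m n (nzr hB) d c -
      \sum_i (a i : nzr hB) *: act (dH (nzd hB (map_datum f D)))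
        ('X_[nth 0%MM (stds J d) i] : {mpoly (nzr hB)[N]}).
    rewrite (@polD m n (nzr hB)) (@polN m n (nzr hB)) (@pol_sum m n (nzr hB)).
    congr (_ - _); apply: eq_bigr => i _; rewrite (@polZ m n (nzr hB)); congr (_ *: _).
    have -> : act (dH (nzd hB (map_datum f D))) ('X_[nth 0%MM (stds J d) i] : {mpoly (nzr hB)[N]}) =
       map_mpoly (f : {rmorphism nzr hA -> nzr hB}) (act (dH (nzd hA D)) ('X_[nth 0%MM (stds J d) i] : {mpoly (nzr hA)[N]})).
      by rewrite map_act map_mpolyX.
    have hb : bihom d (act (dH (nzd hA D)) ('X_[nth 0%MM (stds J d) i] : {mpoly (nzr hA)[N]})).
      by apply/bihomP => u hu; rewrite -(gen_coefE hA); apply: gen_coef_hom.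
    rewrite -[X in map_mpoly _ X](polE hb) (@map_pol m n (nzr hA) (nzr hB) f).
    by congr pol; apply/funext => u; rewrite (gen_coefE hA).
  split=> [/(_ hB)|h1 hB']; first by rewrite e.
  by have -> : hB' = hB; [apply: Prop_irrelevance | rewrite e].
have [_ /(_ _ (@bihom_pol m n (nzr hB) d c))] := CI_basis J (nzd hB (map_datum f D)) d.
rewrite /comb /cstdb /stdb; move: (hr) key; case: _ / => key [a [h1 h2]].
by exists a; split; [apply/key | move=> a' /key; apply: h2].
Qed.

End Free.
End CoefCharts.

Section Opens.
Context (k : fieldType) (Z : scheme k).
Implicit Types (U V W : open_set Z).

Definition opI U V : open_set Z := OpenSet (openI (oset_open U) (oset_open V)).
Lemma opIl U V : opI U V `<=` U. Proof. by move=> z []. Qed.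
Lemma opIr U V : opI U V `<=` V. Proof. by move=> z []. Qed.

Lemma res_irr U V (h h' : V `<=` U) (s : sections U) : res h s = res h' s.
Proof. by rewrite (Prop_irrelevance h h'). Qed.

(** The gluing axiom for the cover by all open sets on which [s] and [t] agree; its uniqueness part
    gives the equality. *)
Lemma sec_eq U (s t : sections U) :
  (forall z, U z -> exists (V : open_set Z) (hVU : V `<=` U), V z /\ res hVU s = res hVU t) ->
  s = t.
Proof.
move=> hloc; pose T := {V : open_set Z | exists hVU : V `<=` U, res hVU s = res hVU t}.
have hT (j : T) : sval j `<=` U by case: j => V [].
have [|i j W hi hj|r [_ hr]] := @glue k Z U T (fun j => sval j) hT (fun j => res (hT j) s).
- by move=> z /hloc[V [hVU [Vz e]]]; exists (exist _ V (ex_intro _ hVU e)).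
- by rewrite !(res_comp _ _ (subset_trans hi (hT i))).
rewrite -(hr s) // -[RHS](hr t) // => j; case: (j) => V [hVU e] /=.
by rewrite (res_irr _ hVU) -e; apply: res_irr.
Qed.

End Opens.

(** * Gluing charts to a family *)

Section Glue.
Context (k : fieldType) (m n : nat) (J : borel m n) (h : int * int -> nat).
Hypothesis hJ : forall d, size (stds J d) = h d.
Local Notation N := (m + n)%N.
Local Notation coefs U := ('X_{1..N} -> sections U).

Section OnScheme.
Context (Z : scheme k).
Implicit Types (U V W : open_set Z).

Lemma inCI_local V (D : datum m n (sections V)) d (c : coefs V) :
  (forall z, V z -> exists W (hWV : W `<=` V), W z /\
     inCI J (map_datum (res hWV) D) d (fun u => res hWV (c u))) -> inCI J D d c.
Proof.
move=> hloc hV; apply/mpolyP => u; rewrite mcoeff0.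
apply: sec_eq => z /hloc[W [hWV [Wz hW]]]; exists W, hWV; split=> //.
have hW1 : (1 : sections W) != 0 by apply/eqP; have [] := scheme_local Wz.
have := hW hW1; rewrite (nzd_map (res hWV) hV) -(@map_pol m n (nzr hV) (nzr hW1)).
rewrite /CI -map_cnf => /(congr1 (mcoeff u)); rewrite mcoeff_map_mpoly mcoeff0 => ->.
by rewrite rmorph0.
Qed.

Definition charted (F : hilb_family m n h Z) V (D : datum m n (sections V)) : Prop :=
  forall W (hWV : W `<=` V) d (c : coefs W), homog_section d c ->
    (F d W c <-> inCI J (map_datum (res hWV) D) d c).

Lemma map_datum_res U V W (hVU : V `<=` U) (hWV : W `<=` V) (hWU : W `<=` U)
    (D : datum m n (sections U)) :
  map_datum (res hWV) (map_datum (res hVU) D) = map_datum (res hWU) D.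
Proof.
apply: datum_eq; rewrite /=.
- by apply/matrixP => i j; rewrite !mxE (res_comp _ _ hWU).
- by apply/matrixP => i j; rewrite !mxE (res_comp _ _ hWU).
by do 4!apply/funext => ?; rewrite (res_comp _ _ hWU).
Qed.

Lemma homog_res U V (hVU : V `<=` U) d (c : coefs U) : homog_section d c ->
  homog_section d (fun u => res hVU (c u)).
Proof. by move=> hc u /hc ->; rewrite rmorph0. Qed.

Section FromCharts.
Context (P : forall V, datum m n (sections V) -> Prop).
Hypothesis cov : forall z : Z, exists V D, V z /\ @P V D.
Hypothesis compat : forall V D V' D', @P V D -> @P V' D' ->
  forall W (hV : W `<=` V) (hV' : W `<=` V') d (c : coefs W), homog_section d c ->
    inCI J (map_datum (res hV) D) d c -> inCI J (map_datum (res hV') D') d c.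

Definition gfam d U (c : coefs U) : Prop := homog_section d c /\
  forall V D, @P V D -> forall W (hU : W `<=` U) (hV : W `<=` V),
    inCI J (map_datum (res hV) D) d (fun u => res hU (c u)).

Lemma gfam_charted V D : @P V D -> forall W (hWV : W `<=` V) d (c : coefs W),
  homog_section d c -> (gfam d c <-> inCI J (map_datum (res hWV) D) d c).
Proof.
move=> PD W hWV d c hc; split=> [[_ hg]|hD].
  have := hg _ _ PD W (fun x => id) hWV; congr (inCI _ _ _).
  by apply/funext => u; apply: res_id.
split=> // V' D' PD' W' hU hV'.
have hV2 : W' `<=` V by apply: subset_trans hU _.
refine (@compat _ _ _ _ PD PD' W' hV2 hV' d _ (homog_res hU hc) _).
by have := inCI_map (res hU) hD; rewrite (map_datum_res _ _ hV2).
Qed.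

(** Membership is tested on all charts at once; compatibility makes it readable on any single chart,
    where [inCI_free] supplies the local bases. *)
Lemma glue_family : exists F : hilb_family m n h Z, forall V D, @P V D -> charted F D.
Proof.
unshelve eexists (@HilbFamily k m n h Z (fun d U => gfam (U := U) d) _ _ _ _ _ _ _ _); last first.
  by move=> V D PD W hWV d c hc; apply: gfam_charted.
- move=> d z; have [V [D [Vz PD]]] := cov z.
  exists V, (fun i => gen_coef J D d i); split=> // [i|W hWU c hc].
    exact: gen_coef_hom (hJ d) i.
  have hs a : homog_section d (fun u => c u - \sum_i a i * res hWU (gen_coef J D d (i : 'I_(h d)) u)).
    move=> u hu; rewrite (hc _ hu) sub0r big1 ?oppr0 // => i _.
    by rewrite (gen_coef_hom D (hJ d)) // rmorph0 mulr0.
  have [a [h1 h2]] := inCI_free D (res hWU) (hJ d) hc.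
  exists a; split; first exact/(gfam_charted PD hWU)/h1/hs.
  by move=> a' /(gfam_charted PD hWU (hs a')); apply: h2.
- move=> d U c hc hloc; split=> // V D PD W hU hV; apply: inCI_local => z Wz.
  have [V' [hV'U [V'z [_ hg]]]] := hloc z (hU z Wz).
  exists (opI W V'), (@opIl _ _ W V'); split=> //.
  have h1 := subset_trans (@opIl _ _ W V') hV.
  rewrite (map_datum_res _ _ h1); have := hg _ _ PD _ (@opIr _ _ W V') h1.
  congr (inCI _ _ _); apply/funext => u.
  by rewrite !(res_comp _ _ (subset_trans (@opIl _ _ W V') hU)).
- move=> d U V hVU c [hc hg]; split; first exact: homog_res.
  move=> V' D PD W hU hV; have := hg _ _ PD W (subset_trans hU hVU) hV.
  by congr (inCI _ _ _); apply/funext => u; rewrite (res_comp _ _ (subset_trans hU hVU)).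
- move=> d U v c [hc hg]; split.
    move=> u hu; rewrite /mulmon; case: ifP => // /forallP hv; apply: hc => e; apply: hu.
    rewrite -e; have {1}-> : u = ((u - v) + v)%MM by rewrite submK //; apply/mnm_lepP.
    by rewrite bidegD.
  move=> V D PD W hU hV; have := inCIM v (homog_res hU hc) (hg _ _ PD W hU hV).
  congr (inCI _ _ _); apply/funext => u; rewrite /mulmon; case: ifP => // _.
  by rewrite rmorph0.
- move=> d U a c [hc hg]; split; first by move=> u /hc ->; rewrite mulr0.
  move=> V D PD W hU hV; have := inCIZ (res hU a) (hg _ _ PD W hU hV).
  by congr (inCI _ _ _); apply/funext => u; rewrite rmorphM.
- move=> d U c c' [hc hg] [hc' hg']; split; first by move=> u hu; rewrite hc // hc' // addr0.
  move=> V D PD W hU hV; have := inCID (hg _ _ PD W hU hV) (hg' _ _ PD W hU hV).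
  by congr (inCI _ _ _); apply/funext => u; rewrite rmorphD.
- move=> d U; split=> // V D PD W hU hV; have := inCI0 J (map_datum (res hV) D) d.
  by congr (inCI _ _ _); apply/funext => u; rewrite rmorph0.
by move=> d U c [].
Qed.

End FromCharts.
End OnScheme.
End Glue.

Section Span.
Context (m n : nat) (J : borel m n) (A B : comPzRingType) (f : {rmorphism A -> B}).
Context (D : datum m n A) (d : int * int).
Local Notation N := (m + n)%N.
Local Notation mons := (mons m n).

(* The quotient map [p |-> p - act (dH D) (cnf D p)] is a projection onto [CI D]. *)
Lemma inCI_span (c : 'X_{1..N} -> B) : hom0 d c -> inCI J (map_datum f D) d c ->
  exists g : 'I_(size (mons d)) -> 'X_{1..N} -> A,
    (forall i, hom0 d (g i) /\ inCI J D d (g i)) /\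
    forall u, c u = \sum_(i < size (mons d)) c (nth 0%MM (mons d) i) * f (g i u).
Proof.
move=> hc hCI; have [e|hB] := eqVneq (1 : B) 0.
  exists (fun _ _ => 0); split; first by move=> i; split=> //; apply: inCI0.
  by move=> u; rewrite -[LHS]mulr1 -[RHS]mulr1 e !mulr0.
have hA := nz_map f hB; pose fz := f : {rmorphism nzr hA -> nzr hB}.
pose X (R : comNzRingType) i : {mpoly R[N]} := 'X_[nth 0%MM (mons d) i].
pose q i := X (nzr hA) i - act (dH (nzd hA D)) (cnf J (nzd hA D) (X _ i)).
have ud (i : 'I_(size (mons d))) : bideg (nth 0%MM (mons d) i) = d.
  have : nth 0%MM (mons d) i \in mons d by apply: mem_nth.
  by rewrite mem_mons => /eqP.
have bq (i : 'I_(size (mons d))) : bihom d (q i).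
  have bX : bihom d (X (nzr hA) i) by apply: bihomX'.
  apply: bihomB => //; apply: bihom_act; first exact: dH_blk.
  by apply: bihom_nf; apply: bihom_act => //; apply: dG_blk.
exists (fun i u => (q i)@_u); split=> [i|u].
  split=> [u hu|hA']; first exact: (proj1 (bihomP d (q i)) (bq i) u hu).
  have -> : hA' = hA by apply: Prop_irrelevance.
  rewrite polE // /CI /q linearB /=.
  by rewrite [X in _ - X]/cnf actGH nf_idem subrr.
have hcnf := hCI hB; rewrite (nzd_map f hA) -/fz in hcnf.
set E := map_datum fz (nzd hA D) in hcnf.
have eX i : map_mpoly fz (q i) = X (nzr hB) i - act (dH E) (cnf J E (X _ i)).
  by rewrite rmorphB /= map_act map_cnf map_mpolyX.
have ep : @pol m n (nzr hB) d c = \sum_(i < size (mons d)) (c (nth 0%MM (mons d) i) : nzr hB) *: X _ i.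
  by rewrite /pol (big_nth 0%MM) big_mkord.
rewrite -[LHS](@polK m n (nzr hB) d c u hc).
have -> : @pol m n (nzr hB) d c = \sum_(i < size (mons d)) (c (nth 0%MM (mons d) i) : nzr hB) *: map_mpoly fz (q i).
  under eq_bigr => i _ do rewrite eX scalerBr.
  rewrite sumrB -ep -[LHS]subr0; congr (_ - _).
  have e0 : act (dH E) (cnf J E (@pol m n (nzr hB) d c)) = 0 by rewrite (hcnf : cnf _ _ _ = 0) linear0.
  transitivity (act (dH E) (cnf J E (@pol m n (nzr hB) d c))); first by rewrite e0.
  by rewrite ep [cnf _ _ _]linear_sum [LHS]linear_sum; apply: eq_bigr => i _; rewrite !linearZ.
rewrite raddf_sum; apply: eq_bigr => i _.
by rewrite /= mcoeffZ mcoeff_map_mpoly.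
Qed.

End Span.

(** * Pullback of charted families *)

Section Pullback.
Context (k : fieldType) (m n : nat) (J : borel m n) (h : int * int -> nat).
Hypothesis hJ : forall d, size (stds J d) = h d.
Local Notation N := (m + n)%N.
Local Notation coefs U := ('X_{1..N} -> sections U).
Local Notation chart F D := (@charted k m n J h _ F _ D).

Definition chartable (Z : scheme k) (F : hilb_family m n h Z) : Prop :=
  forall z : Z, exists V (D : datum m n (sections V)), oset V z /\ chart F D.

Section Morphism.
Context (Z X : scheme k) (f : morphism Z X).

Lemma map_datum_comor (V V' : open_set X) (W W' : open_set Z)
    (hW : W `<=` f @^-1` V) (hW' : W' `<=` f @^-1` V') (hV : V' `<=` V) (hWW : W' `<=` W)
    (D : datum m n (sections V)) :
  map_datum (res hWW) (map_datum (comor hW) D) = map_datum (comor hW') (map_datum (res hV) D).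
Proof.
apply: datum_eq; rewrite /=.
- by apply/matrixP => i j; rewrite !mxE (comor_res _ hW' hV).
- by apply/matrixP => i j; rewrite !mxE (comor_res _ hW' hV).
by do 4!apply/funext => ?; rewrite (comor_res _ hW' hV).
Qed.

Lemma map_datum_id (V : open_set X) (hV : V `<=` V) (D : datum m n (sections V)) :
  map_datum (res hV) D = D.
Proof.
apply: datum_eq; rewrite /=.
- by apply/matrixP => i j; rewrite !mxE res_id.
- by apply/matrixP => i j; rewrite !mxE res_id.
by do 4!apply/funext => ?; rewrite res_id.
Qed.

Lemma comor_irr (V : open_set X) (W : open_set Z) (h1 h2 : W `<=` f @^-1` V) (s : sections V) :
  comor h1 s = comor h2 s.
Proof. by rewrite (Prop_irrelevance h1 h2). Qed.

Lemma res_comor (V : open_set X) (W W' : open_set Z) (hW : W `<=` f @^-1` V)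
    (hWW : W' `<=` W) (hW' : W' `<=` f @^-1` V) (s : sections V) :
  res hWW (comor hW s) = comor hW' s.
Proof. by rewrite (comor_res _ hW' (fun x hx => hx)) res_id. Qed.

Lemma comor_resl (V V' : open_set X) (W : open_set Z) (hW : W `<=` f @^-1` V)
    (hW' : W `<=` f @^-1` V') (hV : V' `<=` V) (s : sections V) :
  comor hW' (res hV s) = comor hW s.
Proof. by rewrite -(comor_res hW hW' hV (fun x hx => hx)) res_id. Qed.

Lemma datum_res_comor (V : open_set X) (W W' : open_set Z) (hW : W `<=` f @^-1` V)
    (hWW : W' `<=` W) (hW' : W' `<=` f @^-1` V) (D : datum m n (sections V)) :
  map_datum (res hWW) (map_datum (comor hW) D) = map_datum (comor hW') D.
Proof. by rewrite (map_datum_comor _ hW' (fun x hx => hx)) map_datum_id. Qed.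

Lemma datum_comor_res (V V' : open_set X) (W : open_set Z) (hW : W `<=` f @^-1` V)
    (hW' : W `<=` f @^-1` V') (hV : V' `<=` V) (D : datum m n (sections V)) :
  map_datum (comor hW') (map_datum (res hV) D) = map_datum (comor hW) D.
Proof. by rewrite -(map_datum_comor hW hW' hV (fun x hx => hx)) (datum_res_comor hW _ hW). Qed.

Lemma charted_self (Y : scheme k) (F : hilb_family m n h Y) V (D : datum m n (sections V)) d
    (c : coefs V) : chart F D -> homog_section d c -> (F d V c <-> inCI J D d c).
Proof.
move=> hF hc; have := hF V (fun x hx => hx) d c hc.
rewrite (_ : map_datum _ D = D) //; apply: datum_eq; rewrite /=.
- by apply/matrixP => i j; rewrite !mxE res_id.
- by apply/matrixP => i j; rewrite !mxE res_id.
by do 4!apply/funext => ?; rewrite res_id.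
Qed.

(** By [inCI_span] a base-changed explicit ideal is spanned by images of finitely many members of
    the original one, which is the shape that [is_pullback] asks for. *)
Lemma pullback_charted (F : hilb_family m n h X) (F' : hilb_family m n h Z) :
  (forall z : Z, exists V (D : datum m n (sections V)) (W : open_set Z) (hW : W `<=` f @^-1` V),
     [/\ W z, chart F D & chart F' (map_datum (comor hW) D)]) ->
  is_pullback f F F'.
Proof.
move=> hch d W0 c; split=> [hc|[hc hloc]].
  have hom := fam_homog hc; split=> // z W0z; have [V [D [W [hW [Wz cF cF']]]]] := hch z.
  pose W1 := opI W0 W; have h1 : W1 `<=` W := @opIr _ _ W0 W.
  have h0 : W1 `<=` W0 := @opIl _ _ W0 W; have h2 : W1 `<=` f @^-1` V := subset_trans h1 hW.
  have := proj1 (cF' W1 h1 d _ (homog_res h0 hom)) (fam_res h0 hc).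
  rewrite (datum_res_comor hW h1 h2) => /(inCI_span (homog_res h0 hom))[g [g1 g2]].
  exists V, W1, h0, h2, (size (mons m n d)), (fun i => res h0 (c (nth 0%MM (mons m n d) i))), g.
  split=> // i; have [gi1 gi2] := g1 i; exact/(charted_self cF).
apply: fam_local => // z /[dup] W0z /hloc[U [V [hVW [hVU [r [a [g [Vz hg eg]]]]]]]].
have [V1 [D [W1 [hW [W1z cF cF']]]]] := hch z.
pose W2 := opI V W1; pose U2 := opI U V1.
have hl : W2 `<=` V := @opIl _ _ V W1; have hr : W2 `<=` W1 := @opIr _ _ V W1.
have h2 : W2 `<=` f @^-1` U2 by move=> x [/hVU ? /hW].
have hl' : U2 `<=` U := @opIl _ _ U V1; have hr' : U2 `<=` V1 := @opIr _ _ U V1.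
have h3 : W2 `<=` f @^-1` V1 := subset_trans hr hW.
have h4 : W2 `<=` W0 := subset_trans hl hVW.
exists W2, h4; split=> //; apply/(cF' W2 hr); first exact: homog_res.
rewrite (datum_res_comor hW hr h3) -(datum_comor_res h3 h2 hr').
have -> : (fun u => res h4 (c u)) = fun u => \sum_(i < r) res hl (a i) * comor h2 (res hl' (g i u)).
  apply/funext => u; rewrite -(res_comp hVW hl h4) eg rmorph_sum; apply: eq_bigr => i _.
  by rewrite rmorphM /= (comor_res _ h2 hl').
apply: inCI_sum => i; apply: inCIZ; apply: (inCI_map (comor h2) (c := fun u => res hl' (g i u))).
apply/(cF U2 hr'); first exact/homog_res/(fam_homog (hg i)).
exact: fam_res (hg i).
Qed.

Lemma pullback_exists (F : hilb_family m n h X) : chartable F ->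
  exists F' : hilb_family m n h Z, is_pullback f F F' /\
    forall V (D : datum m n (sections V)) (W : open_set Z) (hW : W `<=` f @^-1` V),
      chart F D -> chart F' (map_datum (comor hW) D).
Proof.
move=> hF; pose P (W : open_set Z) (D' : datum m n (sections W)) := exists V (D : datum m n (sections V))
  (hW : W `<=` f @^-1` V), chart F D /\ D' = map_datum (comor hW) D.
have cov z : exists W D', oset W z /\ @P W D'.
  have [V [D [Vz hD]]] := hF (f z).
  have oW : open (f @^-1` V) by move/continuousP: (@base_cont _ _ _ f); apply; apply: oset_open.
  pose W := OpenSet oW; have hW : W `<=` f @^-1` V by [].
  by exists W, (map_datum (comor hW) D); split=> //; exists V, D, hW.
have [F' hF'] : exists F' : hilb_family m n h Z, forall V D, @P V D -> chart F' D.
  apply: (glue_family hJ cov) => W1 _ W2 _ [V1 [D1 [hW1 [c1 ->]]]] [V2 [D2 [hW2 [c2 ->]]]].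
  move=> W h1 h2 d c hc; pose V := opI V1 V2.
  have hV1 : V `<=` V1 := @opIl _ _ V1 V2; have hV2 : V `<=` V2 := @opIr _ _ V1 V2.
  have hW : W `<=` f @^-1` V by move=> x hx; split; [apply: hW1 (h1 _ hx) | apply: hW2 (h2 _ hx)].
  rewrite (map_datum_comor hW1 hW hV1) (map_datum_comor hW2 hW hV2).
  by apply: inCI_le_map => d' c' hc' /(c1 _ _ _ _ hc') /(c2 _ _ _ _ hc').
exists F'; split=> [|V D W hW cD]; last by apply: hF'; exists V, D, hW.
apply: pullback_charted => z; have [V [D [Vz cD]]] := hF (f z).
have oW : open (f @^-1` V) by move/continuousP: (@base_cont _ _ _ f); apply; apply: oset_open.
have hW : OpenSet oW `<=` f @^-1` V by [].
by exists V, D, (OpenSet oW), hW; split=> //; apply: hF'; exists V, D, hW.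
Qed.

(** Any two pullbacks have the same members, so the one built from charts can stand for the given
    one. *)
Lemma pull_charted (F : hilb_family m n h X) (F' : hilb_family m n h Z) V
    (D : datum m n (sections V)) (W : open_set Z) (hW : W `<=` f @^-1` V) :
  chartable F -> is_pullback f F F' -> chart F D -> chart F' (map_datum (comor hW) D).
Proof.
move=> hF hp cD; have [F2 [p2 /(_ _ _ _ hW cD) c2]] := pullback_exists hF.
by move=> W' hW' d c hc; rewrite -c2 //; split=> [/hp /p2|/p2 /hp].
Qed.

Lemma pull_chartable (F : hilb_family m n h X) (F' : hilb_family m n h Z) :
  chartable F -> is_pullback f F F' -> chartable F'.
Proof.
move=> hF hp z; have [V [D [Vz cD]]] := hF (f z).
have oW : open (f @^-1` V) by move/continuousP: (@base_cont _ _ _ f); apply; apply: oset_open.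
have hW : OpenSet oW `<=` f @^-1` V by [].
by exists (OpenSet oW), (map_datum (comor hW) D); split=> //; apply: pull_charted hF hp cD.
Qed.

End Morphism.
End Pullback.

Section Composition.
Context (k : fieldType) (Y Z X : scheme k) (g : morphism Z X) (f : morphism Y Z).

Definition preim_open (V : open_set X) : open_set Z :=
  OpenSet ((proj1 (continuousP _)) (@base_cont _ _ _ g) _ (oset_open V)).

Lemma preim_sub (V : open_set X) : preim_open V `<=` g @^-1` V. Proof. by []. Qed.

(** The full preimage of [U] serves as intermediate open set; [compm_comorE] permits any other. *)
Definition compm_comor (U : open_set X) (W : open_set Y) (hW : W `<=` (g \o f) @^-1` U) :
    {rmorphism sections U -> sections W} :=
  [the {rmorphism sections U -> sections W} of
    @comor _ _ _ f (preim_open U) W hW \o comor (@preim_sub U)].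

Lemma compm_comorE (U : open_set X) (W : open_set Y) (hW : W `<=` (g \o f) @^-1` U)
    (V : open_set Z) (hV : V `<=` g @^-1` U) (hW' : W `<=` f @^-1` V) s :
  @compm_comor U W hW s = comor hW' (comor hV s).
Proof. by rewrite /= -(res_comor (@preim_sub U) hV hV) (comor_resl _ hW'). Qed.

Lemma compm_cont : continuous (g \o f).
Proof. by move=> y; apply: continuous_comp; apply: base_cont. Qed.

Definition compm : morphism Y X.
Proof.
refine (@Morphism k Y X (g \o f) compm_cont compm_comor _ _ _).
- move=> U U' W W' hW hW' hU hWW s; rewrite /=.
  have hP : preim_open U' `<=` preim_open U by move=> x hx; apply: hU hx.
  rewrite (comor_res _ (hW' : W' `<=` f @^-1` preim_open U') hP).
  by rewrite (comor_res _ (@preim_sub U') hU).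
- by move=> U W hW a; rewrite /= !comor_scalar.
move=> U W hW y s Wy /(comor_local Wy) h1.
exact: (comor_local (hW _ Wy : preim_open U (f y))) h1.
Defined.

End Composition.

Lemma comp_pullback (k : fieldType) (m n : nat) (J : borel m n) (h : int * int -> nat)
    (Y Z X : scheme k) (g : morphism Z X) (f : morphism Y Z) (F : hilb_family m n h X)
    (F1 : hilb_family m n h Z) (F2 : hilb_family m n h Y) :
  (forall d, size (stds J d) = h d) -> chartable J F ->
  is_pullback g F F1 -> is_pullback f F1 F2 -> is_pullback (compm g f) F F2.
Proof.
move=> hJ hF p1 p2; apply: (@pullback_charted k m n J) => y.
have [V [D [Vy cD]]] := hF (g (f y)); have hF1 := pull_chartable hJ hF p1.
pose W := preim_open f (preim_open g V).
have hW : W `<=` compm g f @^-1` V by [].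
exists V, D, W, hW; split=> //.
have c1 := pull_charted hJ (@preim_sub _ _ _ g V) hF p1 cD.
have := pull_charted hJ (@preim_sub _ _ _ f (preim_open g V)) hF1 p2 c1.
have -> : map_datum (comor hW) D = map_datum (comor (@preim_sub _ _ _ f (preim_open g V)))
    (map_datum (comor (@preim_sub _ _ _ g V)) D); last exact.
apply: datum_eq.
- by apply/matrixP => i j; rewrite !mxE; apply: comor_irr.
- by apply/matrixP => i j; rewrite !mxE; apply: comor_irr.
by do 4!apply/funext => ?; apply: comor_irr.
Qed.

(** * Residue fields *)

Section Residue.
Context (k : fieldType) (Z : scheme k) (z : Z).
Implicit Types (U V W : open_set Z).

Lemma unit_res U V (hVU : V `<=` U) (s : sections U) : oset V z ->
  unit_at z (res hVU s) <-> unit_at z s.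
Proof.
move=> Vz; split=> [[W [hW [t [Wz e]]]]|[W [hW [t [Wz e]]]]].
  exists W, (subset_trans hW hVU), t; split=> //.
  by rewrite -(res_comp hVU hW).
exists (opI V W), (@opIl _ _ V W), (res (@opIr _ _ V W) t); split; first by [].
have hT := subset_trans (@opIr _ _ V W) hW.
by rewrite (res_comp hVU _ hT) -(res_comp hW (@opIr _ _ V W) hT) -rmorphM e rmorph1.
Qed.

Definition vanish U (s : sections U) : Prop := ~ unit_at z s.

Lemma vanish0 U : vanish (0 : sections U).
Proof.
case=> V [hV [t [Vz]]]; rewrite rmorph0 mul0r => e.
by have [] := scheme_local Vz; rewrite e.
Qed.

Lemma vanish1 U : oset U z -> ~ vanish (1 : sections U).
Proof. by move=> Uz; apply; exists U, (fun x hx => hx), 1; split=> //; rewrite rmorph1 mulr1. Qed.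

Lemma vanishD U (s t : sections U) : oset U z -> vanish s -> vanish t -> vanish (s + t).
Proof. by move=> Uz hs ht /(proj2 (scheme_local Uz))[]. Qed.

Lemma vanishM U (a s : sections U) : vanish s -> vanish (a * s).
Proof.
move=> hs [V [hV [t [Vz e]]]]; apply: hs; exists V, hV, (res hV a * t); split=> //.
by rewrite mulrA [res hV s * _]mulrC -rmorphM.
Qed.

Lemma vanishN U (s : sections U) : vanish s -> vanish (- s).
Proof. by move=> hs; rewrite -mulN1r; apply: vanishM. Qed.

Record germ := Germ { gU : open_set Z; gz : oset gU z; gs : sections gU }.

Definition geq (g g' : germ) : Prop :=
  exists W (h : W `<=` gU g) (h' : W `<=` gU g'),
    oset W z /\ vanish (res h (gs g) - res h' (gs g')).

Lemma geq_refl g : geq g g.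
Proof. by exists (gU g), (fun x hx => hx), (fun x hx => hx); rewrite subrr; split; [exact: gz | exact: vanish0]. Qed.

Lemma geq_sym g g' : geq g g' -> geq g' g.
Proof. by case=> W [h [h' [Wz /vanishN hv]]]; exists W, h', h; rewrite opprB in hv. Qed.

Lemma geq_trans g1 g2 g3 : geq g1 g2 -> geq g2 g3 -> geq g1 g3.
Proof.
move=> [W [h1 [h2 [Wz v1]]]] [W' [h2' [h3 [W'z v2]]]].
pose T := opI W W'; have hl : T `<=` W := @opIl _ _ W W'; have hr : T `<=` W' := @opIr _ _ W W'.
have Tz : oset T z by [].
exists T, (subset_trans hl h1), (subset_trans hr h3); split=> //.
have v1' : vanish (res hl (res h1 (gs g1) - res h2 (gs g2))) by move/(unit_res hl _ Tz).
have v2' : vanish (res hr (res h2' (gs g2) - res h3 (gs g3))) by move/(unit_res hr _ Tz).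
have := vanishD Tz v1' v2'; rewrite !rmorphB !(res_comp _ hl (subset_trans hl h1)).
rewrite (res_comp _ hr (subset_trans hr h3)) (res_comp h2 hl (subset_trans hl h2)).
by rewrite (res_comp h2' hr (subset_trans hl h2)) addrA subrK.
Qed.

(* The residue field at [z], as classes of germs modulo vanishing at [z]. *)
Definition resf : Type := {P : germ -> Prop | exists g, P = geq g}.
HB.instance Definition _ := gen_eqMixin resf.
HB.instance Definition _ := gen_choiceMixin resf.

Definition ev U (Uz : oset U z) (s : sections U) : resf :=
  exist _ (geq (Germ Uz s)) (ex_intro _ _ erefl).

Lemma evP U (Uz : oset U z) s V (Vz : oset V z) t :
  ev Uz s = ev Vz t <-> geq (Germ Uz s) (Germ Vz t).
Proof.
split=> [[e]|e]; first by rewrite e; apply: geq_refl.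
apply: eq_exist; apply/funext => g; apply/propext; split; last exact: geq_trans.
exact/geq_trans/geq_sym.
Qed.

Lemma ev_surj x : exists U (Uz : oset U z) s, x = ev Uz s.
Proof.
case: x => P [[U Uz s] eP]; exists U, Uz, s; apply: eq_exist; exact: eP.
Qed.

Lemma ev_res U V (Uz : oset U z) (Vz : oset V z) (hVU : V `<=` U) s :
  ev Vz (res hVU s) = ev Uz s.
Proof.
apply/evP; exists V, (fun x hx => hx), hVU; split=> //=.
by rewrite res_id subrr; apply: vanish0.
Qed.

Lemma ev_vanish U (Uz : oset U z) s t : ev Uz s = ev Uz t <-> vanish (s - t).
Proof.
rewrite evP; split=> [[W [/= h [h' [Wz]]]]|hv].
  by rewrite (res_irr h' h) -rmorphB => hv /(unit_res h _ Wz).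
by exists U, (fun x hx => hx), (fun x hx => hx); rewrite /= !res_id.
Qed.

Lemma ev_surj2 x y : exists U (Uz : oset U z) s t, x = ev Uz s /\ y = ev Uz t.
Proof.
have [U [Uz [s ->]]] := ev_surj x; have [V [Vz [t ->]]] := ev_surj y.
pose W := opI U V; have Wz : oset W z by [].
by exists W, Wz, (res (@opIl _ _ U V) s), (res (@opIr _ _ U V) t); rewrite !(ev_res Uz) !(ev_res Vz).
Qed.

Lemma ev_surj3 x y w : exists U (Uz : oset U z) s t r, [/\ x = ev Uz s, y = ev Uz t & w = ev Uz r].
Proof.
have [U [Uz [s [t [-> ->]]]]] := ev_surj2 x y; have [V [Vz [r ->]]] := ev_surj w.
pose W := opI U V; have Wz : oset W z by [].
exists W, Wz, (res (@opIl _ _ U V) s), (res (@opIl _ _ U V) t), (res (@opIr _ _ U V) r).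
by rewrite !(ev_res Uz) !(ev_res Vz).
Qed.

(** Both classes are represented over one common open set, by choice; [lift_opE] shows that the
    choice does not matter. *)
Definition lift_op (op : forall U, sections U -> sections U -> sections U) (x y : resf) : resf :=
  let: exist U h := cid (ev_surj2 x y) in let: exist Uz h := cid h in
  let: exist s h := cid h in let: exist t _ := cid h in ev Uz (op U s t).

Lemma lift_opE (op : forall U, sections U -> sections U -> sections U) :
  (forall U V (h : V `<=` U) s t, res h (op U s t) = op V (res h s) (res h t)) ->
  (forall U (s s' t t' : sections U), oset U z -> vanish (s - s') -> vanish (t - t') ->
     vanish (op U s t - op U s' t')) ->
  forall U (Uz : oset U z) s t, lift_op op (ev Uz s) (ev Uz t) = ev Uz (op U s t).
Proof.
move=> h1 h2 U Uz s t; rewrite /lift_op.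
case: cid => V h; case: cid => Vz h'; case: cid => s' h''; case: cid => t' [e1 e2].
pose W := opI U V; have Wz : oset W z by [].
rewrite -(ev_res Uz Wz (@opIl _ _ U V)) -(ev_res Vz Wz (@opIr _ _ U V)) !h1.
apply/ev_vanish/h2 => //; apply/ev_vanish.
  by rewrite !(ev_res Uz) !(ev_res Vz).
by rewrite !(ev_res Uz) !(ev_res Vz).
Qed.

Definition radd := lift_op (fun U s t => s + t).
Definition rmul := lift_op (fun U s t => s * t).

Lemma raddE U (Uz : oset U z) s t : radd (ev Uz s) (ev Uz t) = ev Uz (s + t).
Proof.
apply: (lift_opE (op := fun U s t => s + t)) => [U' V h s' t'|U' s1 s2 t1 t2 U'z h1 h2].
  exact: rmorphD.
by rewrite opprD addrACA; apply: vanishD.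
Qed.

Lemma rmulE U (Uz : oset U z) s t : rmul (ev Uz s) (ev Uz t) = ev Uz (s * t).
Proof.
apply: (lift_opE (op := fun U s t => s * t)) => [U' V h s' t'|U' s1 s2 t1 t2 U'z h1 h2].
  exact: rmorphM.
have -> : s1 * t1 - s2 * t2 = t1 * (s1 - s2) + s2 * (t1 - t2) by ring.
by apply: vanishD => //; apply: vanishM.
Qed.

Let zT : oset (open_setT Z) z := I.
Definition ropp x := rmul (ev zT (-1)) x.

Lemma evT U (Uz : oset U z) (a : forall U, sections U) :
  (forall U V (h : V `<=` U), res h (a U) = a V) -> ev zT (a _) = ev Uz (a _).
Proof. by move=> h; rewrite -(ev_res zT Uz (fun x _ => I)) h. Qed.

Lemma ev0 U (Uz : oset U z) : ev zT 0 = ev Uz 0.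
Proof. by apply: (@evT U Uz (fun U => 0)) => *; rewrite rmorph0. Qed.
Lemma ev1 U (Uz : oset U z) : ev zT 1 = ev Uz 1.
Proof. by apply: (@evT U Uz (fun U => 1)) => *; rewrite rmorph1. Qed.
Lemma evN1 U (Uz : oset U z) : ev zT (-1) = ev Uz (-1).
Proof. by apply: (@evT U Uz (fun U => -1)) => *; rewrite rmorphN1. Qed.

Lemma raddA : associative radd.
Proof. by move=> x y w; have [U [Uz [s [t [r [-> -> ->]]]]]] := ev_surj3 x y w; rewrite !raddE addrA. Qed.
Lemma raddC : commutative radd.
Proof. by move=> x y; have [U [Uz [s [t [-> ->]]]]] := ev_surj2 x y; rewrite !raddE addrC. Qed.
Lemma radd0 : left_id (ev zT 0) radd.
Proof. by move=> x; have [U [Uz [s ->]]] := ev_surj x; rewrite (ev0 Uz) raddE add0r. Qed.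
Lemma raddN : left_inverse (ev zT 0) ropp radd.
Proof.
move=> x; have [U [Uz [s ->]]] := ev_surj x.
by rewrite /ropp (evN1 Uz) (ev0 Uz) rmulE raddE mulN1r addNr.
Qed.
HB.instance Definition _ := GRing.isZmodule.Build resf raddA raddC radd0 raddN.

Lemma rmulA : associative rmul.
Proof. by move=> x y w; have [U [Uz [s [t [r [-> -> ->]]]]]] := ev_surj3 x y w; rewrite !rmulE mulrA. Qed.
Lemma rmulC : commutative rmul.
Proof. by move=> x y; have [U [Uz [s [t [-> ->]]]]] := ev_surj2 x y; rewrite !rmulE mulrC. Qed.
Lemma rmul1 : left_id (ev zT 1) rmul.
Proof. by move=> x; have [U [Uz [s ->]]] := ev_surj x; rewrite (ev1 Uz) rmulE mul1r. Qed.
Lemma rmulD : left_distributive rmul radd.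
Proof.
move=> x y w; have [U [Uz [s [t [r [-> -> ->]]]]]] := ev_surj3 x y w.
by rewrite raddE !rmulE raddE mulrDl.
Qed.
Lemma rone_neq0 : ev zT 1 != 0.
Proof. by apply/eqP => /ev_vanish; rewrite subr0; apply: vanish1. Qed.
HB.instance Definition _ :=
  GRing.Zmodule_isComNzRing.Build resf rmulA rmulC rmul1 rmulD rone_neq0.

Definition rinv (x : resf) : resf :=
  if pselect (exists y, rmul y x = 1) is left h then sval (cid h) else 0.

Lemma rmulV x : x != 0 -> rinv x * x = 1.
Proof.
move=> x0; rewrite /rinv; case: pselect => [h|]; first exact: svalP (cid h).
case; have [U [Uz [s ex]]] := ev_surj x.
have : unit_at z s.
  apply: contrapT => hs; case/eqP: x0; rewrite ex.
  by apply: etrans (esym (ev0 Uz)); apply/ev_vanish; rewrite subr0.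
case=> V [hV [t [Vz e]]]; exists (ev Vz t).
by rewrite ex -(ev_res Uz Vz hV) rmulE mulrC e; apply/esym/ev1.
Qed.

Lemma rinv0 : rinv 0 = 0.
Proof.
rewrite /rinv; case: pselect => // -[y hy]; case/eqP: rone_neq0.
by have := hy; rewrite -[rmul y 0]/(y * 0) mulr0.
Qed.
HB.instance Definition _ := GRing.ComNzRing_isField.Build resf rmulV rinv0.

Section Evaluation.
Context U (Uz : oset U z).
Lemma ev_is_zmod : zmod_morphism (ev Uz).
Proof.
move=> s t; rewrite -mulN1r -raddE -rmulE; congr radd.
by rewrite -(evN1 Uz).
Qed.
Lemma ev_is_monoid : monoid_morphism (ev Uz).
Proof. by split=> [|s t]; [apply/esym/ev1 | rewrite -rmulE]. Qed.
HB.instance Definition _ := GRing.isZmodMorphism.Build (sections U) resf (ev Uz) ev_is_zmod.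
HB.instance Definition _ := GRing.isMonoidMorphism.Build (sections U) resf (ev Uz) ev_is_monoid.

Definition evm : {rmorphism sections U -> resf} := [the {rmorphism _ -> _} of ev Uz].

Lemma ev_eq0 (s : sections U) : evm s = 0 <-> ~ unit_at z s.
Proof. by rewrite -[0](rmorph0 evm) ev_vanish subr0. Qed.
End Evaluation.

Definition resf_scalar : {rmorphism k -> resf} :=
  [the {rmorphism k -> resf} of evm zT \o scalar (open_setT Z)].

Lemma ev_scalar U (Uz : oset U z) a : evm Uz (scalar U a) = resf_scalar a.
Proof. by rewrite /= -(ev_res zT Uz (fun x _ => I)) res_scalar. Qed.

Lemma lift_seq (T : eqType) (L : seq T) (c : T -> resf) :
  exists U (Uz : oset U z) (s : T -> sections U), forall x, x \in L -> evm Uz (s x) = c x.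
Proof.
elim: L => [|x L [U [Uz [s hs]]]]; first by exists (open_setT Z), zT, (fun=> 0).
have [V [Vz [t et]]] := ev_surj (c x); pose W := opI U V; have Wz : oset W z by [].
exists W, Wz, (fun y => if y == x then res (@opIr _ _ U V) t else res (@opIl _ _ U V) (s y)).
move=> y; rewrite inE; case: eqP => [->|_] /=; first by rewrite (ev_res Vz).
by move=> yL; rewrite (ev_res Uz) -hs.
Qed.

End Residue.

(** * Charts near a point *)

Section LocalChart.
Context (m n : nat) (k : closedFieldType) (h : int * int -> nat).
Local Notation N := (m + n)%N.
Local Notation mons := (mons m n).
Local Notation coefs U := ('X_{1..N} -> sections U).
Context (Z : scheme k) (F : hilb_family m n h Z).
Implicit Types (U V W : open_set Z) (d : int * int).

Lemma fam_sum (T : Type) (s : seq T) d U (c : T -> coefs U) :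
  (forall t, F d U (c t)) -> F d U (fun u => \sum_(t <- s) c t u).
Proof.
move=> hc; elim: s => [|t s IH].
  by have := fam0 F d U; congr (F d U _); apply/funext => u; rewrite big_nil.
by have := famD (hc t) IH; congr (F d U _); apply/funext => u; rewrite big_cons.
Qed.

Section SectionIdeal.
Context W (hW : (1 : sections W) != 0).
Local Notation R := (nzr hW).

Definition secI (p : {mpoly R[N]}) : Prop :=
  forall d, F d W (fun u => if bideg u == d then p@_u : sections W else 0).

Lemma secI_pol d (c : coefs W) : homog_section d c -> secI (@pol m n R d c) <-> F d W c.
Proof.
move=> hc; split=> [/(_ d)|hF d'].
  congr (F d W _); apply/funext => u; rewrite mcoeff_pol.
  by case: eqP => // /hc ->.
have [->|ne] := eqVneq d' d.
  move: hF; congr (F d W _); apply/funext => u; rewrite mcoeff_pol.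
  by case: eqP => // /hc ->.
have := fam0 F d' W; congr (F d' W _); apply/funext => u; rewrite mcoeff_pol.
by case: (eqVneq (bideg u) d') => // ->; rewrite (negPf ne).
Qed.

Lemma secI_bihom d p : bihom d p -> secI p <-> F d W (fun u => p@_u).
Proof.
move=> hp; rewrite -secI_pol; last by move=> u hu; apply: (proj1 (bihomP d p) hp u hu).
by rewrite polE.
Qed.

Lemma secI_ideal : ideal secI.
Proof.
have I0 : secI 0.
  move=> d; have := fam0 F d W; congr (F d W _); apply/funext => u.
  by rewrite mcoeff0 if_same.
have ID p q : secI p -> secI q -> secI (p + q).
  move=> hp hq d; have := famD (hp d) (hq d); congr (F d W _); apply/funext => u.
  by rewrite mcoeffD; case: ifP; rewrite ?addr0.
split=> // p q hq; elim/mpoly_ind_X: p => [|a p p' h1 h2|v]; first by rewrite mul0r.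
  rewrite mulrDl; apply: ID => //; rewrite -scalerAl => d.
  have := famZ (a : sections W) (h1 d); congr (F d W _); apply/funext => u.
  by rewrite mcoeffZ; case: ifP; rewrite ?mulr0.
move=> d; have := famM v (hq (d - bideg v)); rewrite subrK.
congr (F d W _); apply/funext => u; rewrite mcoeffXM /mulmon.
have [/forallP hv|_] := boolP [forall i, (v i <= u i)%N]; last by rewrite if_same.
have e : u = ((u - v) + v)%MM by rewrite submK //; apply/mnm_lepP.
have -> : bideg (u - v)%MM = bideg u - bideg v by rewrite {2}e bidegD addrK.
by rewrite (can_eq (addrNK _)) || rewrite (inj_eq (addIr _)).
Qed.

Lemma secI_basis d U (hWU : W `<=` U) (b : 'I_(h d) -> coefs U) :
  (forall i, homog_section d (b i)) ->
  (forall (c : coefs W), homog_section d c -> exists! a : {ffun 'I_(h d) -> sections W},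
     F d W (fun u => c u - \sum_i a i * res hWU (b i u))) ->
  basis secI d (fun i => @pol m n R d (fun u => res hWU (b i u))).
Proof.
move=> hb hfree; split=> [i|p hp]; first exact: bihom_pol.
have hc : homog_section d (fun u => p@_u : sections W).
  by move=> u hu; apply: (proj1 (bihomP d p) hp u hu).
have key (a : {ffun 'I_(h d) -> sections W}) :
    F d W (fun u => (p@_u : sections W) - \sum_i a i * res hWU (b i u)) <->
    secI (p - comb (fun i => @pol m n R d (fun u => res hWU (b i u))) a).
  rewrite -[X in secI (X - _)](polE hp).
  have -> : comb (fun i => @pol m n R d (fun u => res hWU (b i u))) a =
      @pol m n R d (fun u => \sum_i a i * res hWU (b i u)).
    by rewrite pol_sum; apply: eq_bigr => i _; rewrite (@polZ m n R).
  rewrite -polN -(@polD m n R) secI_pol //.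
  move=> u hu; rewrite hc // sub0r big1 ?oppr0 // => i _.
  by rewrite hb // rmorph0 mulr0.
by have [a [/key h1 h2]] := hfree _ hc; exists a; split=> // a' /key; apply: h2.
Qed.

End SectionIdeal.

Lemma secI_res U V (hVU : V `<=` U) (hU : (1 : sections U) != 0) (hV : (1 : sections V) != 0)
    (p : {mpoly (nzr hU)[N]}) :
  secI p -> secI (map_mpoly (res hVU : {rmorphism nzr hU -> nzr hV}) p).
Proof.
move=> hp d; have := fam_res hVU (hp d); congr (F d V _); apply/funext => u.
by rewrite mcoeff_map_mpoly; case: ifP => // _; rewrite rmorph0.
Qed.

Lemma sec_nz (z : Z) U : oset U z -> (1 : sections U) != 0.
Proof. by move=> Uz; apply/eqP; have [] := scheme_local Uz. Qed.

Section AtPoint.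
(** Of the residue field only these properties matter: evaluation commutes with restriction, and
    finitely many elements lift over one neighbourhood. *)
Context (z : Z) (K : fieldType) (evm : forall U, oset U z -> {rmorphism sections U -> K}).
Hypothesis ev_res : forall U V (Uz : oset U z) (Vz : oset V z) (hVU : V `<=` U) s,
  evm Vz (res hVU s) = evm Uz s.
Hypothesis lift_seq : forall (T : eqType) (L : seq T) (c : T -> K),
  exists U (Uz : oset U z) (s : T -> sections U), forall x, x \in L -> evm Uz (s x) = c x.

Lemma ev_surj' a : exists U (Uz : oset U z) s, a = evm Uz s.
Proof.
have [U [Uz [s hs]]] := lift_seq [:: tt] (fun=> a).
by exists U, Uz, (s tt); rewrite hs ?inE.
Qed.

Lemma evz_sig U (Uz : oset U z) :
  {f : {rmorphism nzr (sec_nz Uz) -> K} | forall s, f s = evm Uz s}.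
Proof. by exists (evm Uz). Qed.

Definition evz U (Uz : oset U z) : {rmorphism nzr (sec_nz Uz) -> K} := sval (evz_sig Uz).
Lemma evzE U (Uz : oset U z) s : evz Uz s = evm Uz s. Proof. exact: svalP (evz_sig Uz) s. Qed.
Lemma mcoeff_evz U (Uz : oset U z) (p : {mpoly (nzr (sec_nz Uz))[N]}) u : (map_mpoly (evz Uz) p)@_u = evm Uz (p@_u).
Proof. by rewrite mcoeff_map_mpoly; apply: evzE. Qed.

(** The fibre of the family at [z]. *)
Definition ptI (p : {mpoly K[N]}) : Prop :=
  forall d, exists U (Uz : oset U z) (c : coefs U),
    F d U c /\ forall u, bideg u = d -> p@_u = evm Uz (c u).

Lemma ptI_map U (Uz : oset U z) p : secI p -> ptI (map_mpoly (evz Uz) p).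
Proof.
move=> hp d; exists U, Uz, (fun u => if bideg u == d then p@_u : sections U else 0).
by split=> // u /eqP hu; rewrite mcoeff_evz hu.
Qed.

Lemma ptI_ideal : ideal ptI.
Proof.
have I0 : ptI 0.
  by move=> d; exists (open_setT Z), I, (fun=> 0); split=> [|u _]; [exact: fam0 | rewrite mcoeff0 rmorph0].
have ID p q : ptI p -> ptI q -> ptI (p + q).
  move=> hp hq d; have [U [Uz [c [c1 c2]]]] := hp d; have [V [Vz [c' [c1' c2']]]] := hq d.
  pose W := opI U V; have Wz : oset W z by [].
  exists W, Wz, (fun u => res (@opIl _ _ U V) (c u) + res (@opIr _ _ U V) (c' u)); split.
    by apply: famD; [apply: fam_res c1 | apply: fam_res c1'].
  move=> u hu; rewrite mcoeffD c2 // c2' // rmorphD /=.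
  by rewrite (ev_res Uz) (ev_res Vz).
split=> // p q hq; elim/mpoly_ind_X: p => [|a p p' h1 h2|v]; first by rewrite mul0r.
  rewrite mulrDl; apply: ID; last exact: h2.
  rewrite -scalerAl => d; have [U [Uz [c [c1 c2]]]] := h1 d.
  have [V [Vz [s ea]]] := ev_surj' a; pose W := opI U V; have Wz : oset W z by [].
  exists W, Wz, (fun u => res (@opIr _ _ U V) s * res (@opIl _ _ U V) (c u)); split.
    exact/famZ/fam_res.
  by move=> u hu; rewrite mcoeffZ c2 // ea rmorphM /= (ev_res Uz) (ev_res Vz).
move=> d; have [U [Uz [c [c1 c2]]]] := hq (d - bideg v).
exists U, Uz, (mulmon v c); split; first by rewrite -[d](subrK (bideg v)); apply: famM.
move=> u hu; rewrite mcoeffXM /mulmon.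
have [/forallP hv|_] := boolP [forall i, (v i <= u i)%N]; last by rewrite rmorph0.
apply: c2; rewrite -hu; have {2}-> : u = ((u - v) + v)%MM by rewrite submK //; apply/mnm_lepP.
by rewrite bidegD addrK.
Qed.

Lemma ptI_bihom d p : bihom d p -> ptI p -> exists U (Uz : oset U z) (q : {mpoly (nzr (sec_nz Uz))[N]}),
  [/\ bihom d q, secI q & p = map_mpoly (evz Uz) q].
Proof.
move=> hp /(_ d)[U [Uz [c [c1 c2]]]]; have hc := fam_homog c1.
exists U, Uz, (@pol m n (nzr (sec_nz Uz)) d c); split; first exact: bihom_pol.
  exact/secI_pol.
apply/mpolyP => u; rewrite mcoeff_evz (@polK m n (nzr (sec_nz Uz))) //.
have [/c2 //|hu] := eqVneq (bideg u) d.
by move/eqP in hu; rewrite (proj1 (bihomP d p) hp u hu) (hc u hu); apply/esym/(rmorph0 (evm Uz)).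
Qed.

Lemma lift_bihom d p : bihom d p -> exists U (Uz : oset U z) (q : {mpoly (nzr (sec_nz Uz))[N]}),
  bihom d q /\ p = map_mpoly (evz Uz) q.
Proof.
move=> hp; have [U [Uz [s hs]]] := lift_seq (mons d) (fun u => p@_u).
exists U, Uz, (@pol m n (nzr (sec_nz Uz)) d s); split; first exact: bihom_pol.
apply/mpolyP => u; rewrite mcoeff_evz mcoeff_pol; case: eqP => hu.
  by rewrite hs // mem_mons hu.
by rewrite (proj1 (bihomP d p) hp) //; apply/esym/(rmorph0 (evm Uz)).
Qed.

Lemma evz_res U V (hVU : V `<=` U) (Uz : oset U z) (Vz : oset V z) (p : {mpoly (nzr (sec_nz Uz))[N]}) :
  map_mpoly (evz Vz) (map_mpoly (res hVU : {rmorphism nzr (sec_nz Uz) -> nzr (sec_nz Vz)}) p) =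
  map_mpoly (evz Uz) p.
Proof. by apply/mpolyP => u; rewrite !mcoeff_evz mcoeff_map_mpoly; apply: ev_res. Qed.

Definition ptpol U (Uz : oset U z) d (c : coefs U) : {mpoly K[N]} :=
  map_mpoly (evz Uz) (@pol m n (nzr (sec_nz Uz)) d c).

Lemma bihom_ptpol U (Uz : oset U z) d (c : coefs U) : bihom d (ptpol Uz d c).
Proof.
apply/bihomP => u /eqP/negPf hu; rewrite mcoeff_evz mcoeff_pol hu.
exact: (rmorph0 (evm Uz)).
Qed.

(* Nakayama at [z]: a relation at [z] lifts to one whose coefficients vanish
   there, and expanding the error term in the basis shows that its coefficients
   vanish at [z]. *)
Lemma pt_basis d U (Uz : oset U z) (b : 'I_(h d) -> coefs U) :
  (forall i, homog_section d (b i)) ->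
  (forall W (hWU : W `<=` U) (c : coefs W), homog_section d c ->
     exists! a : {ffun 'I_(h d) -> sections W},
       F d W (fun u => c u - \sum_i a i * res hWU (b i u))) ->
  basis ptI d (fun i => ptpol Uz d (b i)).
Proof.
move=> hb hfree; have hl := ideal_lin ptI_ideal.
have bW W (hWU : W `<=` U) (Wz : oset W z) := secI_basis (sec_nz Wz) hb (hfree W hWU).
have eb W (hWU : W `<=` U) (Wz : oset W z) i :
    map_mpoly (evz Wz) (@pol m n (nzr (sec_nz Wz)) d (fun u => res hWU (b i u))) =
    ptpol Uz d (b i).
  rewrite /ptpol -(evz_res hWU Wz); congr (map_mpoly _ _).
  by rewrite (@map_pol m n (nzr (sec_nz Uz)) (nzr (sec_nz Wz))).
have ec W (hWU : W `<=` U) (Wz : oset W z) (a : {ffun 'I_(h d) -> sections W}) :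
    map_mpoly (evz Wz) (comb (fun i => @pol m n (nzr (sec_nz Wz)) d (fun u => res hWU (b i u))) a) =
    comb (fun i => ptpol Uz d (b i)) [ffun i => evm Wz (a i)].
  rewrite /comb rmorph_sum; apply: eq_bigr => i _.
  by rewrite /= -(eb W hWU Wz) ffunE; apply/mpolyP => u; rewrite mcoeffZ !mcoeff_evz mcoeffZ; apply: (rmorphM (evm Wz)).
apply: basisI => // [i|p hp|a ha].
- exact: bihom_ptpol.
- have [V [Vz [q [q1 ->]]]] := lift_bihom hp; pose W := opI U V; have Wz : oset W z by [].
  have hVW : W `<=` V := @opIr _ _ U V; have hUW : W `<=` U := @opIl _ _ U V.
  pose q' := map_mpoly (res hVW : {rmorphism nzr (sec_nz Vz) -> nzr (sec_nz Wz)}) q.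
  have bq : bihom d q'.
    apply/bihomP => u hu; rewrite mcoeff_map_mpoly (proj1 (bihomP d q) q1) //; exact: rmorph0.
  have [_ /(_ q' bq)[a [ha _]]] := bW W hUW Wz.
  exists [ffun i => evm Wz (a i)]; rewrite -(ec W hUW Wz) -(evz_res hVW Wz) -rmorphB.
  exact: ptI_map.
have bc : bihom d (comb (fun i => ptpol Uz d (b i)) a).
  by apply: comb_bihom => i; apply: bihom_ptpol.
have [V [Vz [q [q1 q2 eq]]]] := ptI_bihom bc ha.
have [V' [V'z [s hs]]] := lift_seq (index_enum 'I_(h d)) a.
pose W := opI U (opI V V'); have Wz : oset W z by [].
have hU : W `<=` U := @opIl _ _ U _.
have hV : W `<=` V := subset_trans (@opIr _ _ U (opI V V')) (@opIl _ _ V V').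
have hV' : W `<=` V' := subset_trans (@opIr _ _ U (opI V V')) (@opIr _ _ V V').
pose s' : {ffun 'I_(h d) -> sections W} := [ffun i => res hV' (s i)].
pose q' := map_mpoly (res hV : {rmorphism nzr (sec_nz Vz) -> nzr (sec_nz Wz)}) q.
have hq' : secI q' by apply: secI_res.
pose bw i := @pol m n (nzr (sec_nz Wz)) d (fun u => res hU (b i u)).
pose e := comb bw s' - q'.
have es : [ffun i => evm Wz (s' i)] = a.
  by apply/ffunP => i; rewrite !ffunE /= (ev_res V'z) hs // mem_index_enum.
have e0 : map_mpoly (evz Wz) e = 0.
  rewrite rmorphB /= (ec W hU Wz) es eq /q' (evz_res hV Wz).
  exact: subrr.
have hbw := bW W hU Wz; have hlW := ideal_lin (secI_ideal (sec_nz Wz)).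
have be : bihom d e.
  apply: bihomB; first by apply: comb_bihom => i; apply: bihom_pol.
  by apply/bihomP => u hu; rewrite mcoeff_map_mpoly (proj1 (bihomP d q) q1) //; exact: rmorph0.
have /choice[t ht] : forall u, exists a' : {ffun 'I_(h d) -> nzr (sec_nz Wz)},
    bideg u = d -> secI ('X_[u] - comb bw a').
  move=> u; have [hu|hu] := eqVneq (bideg u) d; last by exists 0 => e'; case/eqP: hu.
  by have [_ /(_ _ (bihomX' hu))[a' [ha' _]]] := hbw; exists a'.
pose r : {ffun 'I_(h d) -> nzr (sec_nz Wz)} := [ffun i => \sum_(u <- mons d) e@_u * t u i].
have hr : secI (e - comb bw r).
  have -> : comb bw r = \sum_(u <- mons d) e@_u *: comb bw (t u).
    under [RHS]eq_bigr => u _ do rewrite scaler_sumr.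
    rewrite exchange_big; apply: eq_bigr => i _; rewrite ffunE scaler_suml.
    by apply: eq_bigr => u _; rewrite scalerA.
  rewrite {1}(bihomE be) -sumrB big_seq; apply: lin_sum => // u; rewrite mem_mons => /eqP hu.
  by rewrite -scalerBr; apply: (linZ _ hlW); apply: ht.
have hsr : secI (comb bw (s' - r)).
  rewrite combB -[comb bw s'](subrK q') -/e addrAC.
  exact: (linD hlW hr hq').
have /ffunP sr := basis0 hlW hbw hsr.
apply/ffunP => i; rewrite -es !ffunE; have := sr i; rewrite !ffunE => /subr0_eq ->.
rewrite rmorph_sum big1 // => u _; rewrite rmorphM.
have := congr1 (mcoeff u) e0; rewrite mcoeff_evz mcoeff0 => ->.
exact: mul0r.
Qed.

Lemma pt_hilb : hilb ptI h.
Proof.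
move=> d; have [U [b [Uz b1 b2]]] := fam_locally_free F d z.
exists (fun i => ptpol Uz d (b i)); exact: pt_basis.
Qed.

Context (io : {rmorphism k -> K}) (J : borel m n) (G H : 'M[k]_N).
Hypothesis ev_scalar : forall U (Uz : oset U z) a, evm Uz (scalar U a) = io a.
Hypothesis ev_unit : forall U (Uz : oset U z) s, evm Uz s != 0 -> unit_at z s.
Hypotheses (GH : invp G H) (hJ : forall d, size (stds J d) = h d).
Hypothesis gd : forall d, d \in D1 -> good J (tr ptI (map_mx io H)) d.

Let X (R : comNzRingType) d (i : 'I_(h d)) : {mpoly R[N]} := 'X_[nth 0%MM (stds J d) i].
Let bihom_X (R : comNzRingType) d i : bihom d (@X R d i).
Proof.
apply: bihomX'; have : nth 0%MM (stds J d) i \in stds J d by rewrite mem_nth // hJ.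
by rewrite mem_stds => /andP[_ /eqP].
Qed.

Let sc W (hW : (1 : sections W) != 0) : {rmorphism k -> nzr hW} := scalar W.
Let GW W (hW : (1 : sections W) != 0) : 'M[nzr hW]_N := map_mx (sc hW) G.
Let HW W (hW : (1 : sections W) != 0) : 'M[nzr hW]_N := map_mx (sc hW) H.

Let GHW W (hW : (1 : sections W) != 0) : invp (GW hW) (HW hW).
Proof.
have [a1 a2 a3 a4] := GH; split; try exact: blk_map.
  by rewrite -map_mxM a3 map_mx1.
by rewrite -map_mxM a4 map_mx1.
Qed.

Let HW_res U W (hWU : W `<=` U) (hU : (1 : sections U) != 0) (hW : (1 : sections W) != 0) :
  map_mx (res hWU : {rmorphism nzr hU -> nzr hW}) (HW hU) = HW hW.
Proof. by apply/matrixP => i j; rewrite !mxE; apply: res_scalar. Qed.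

Let HW_ev U (Uz : oset U z) : map_mx (evz Uz) (HW (sec_nz Uz)) = map_mx io H.
Proof. by apply/matrixP => i j; rewrite !mxE -(ev_scalar Uz); apply: evzE. Qed.

(* A basis at [z] is a basis nearby, as the determinant of its coordinates is
   invertible at [z]. *)
Lemma std_basis_near d : d \in D1 -> exists2 U : open_set Z, oset U z &
  forall W (hWU : W `<=` U) (Wz : oset W z),
    basis (tr (secI (hW := sec_nz Wz)) (HW (sec_nz Wz))) d (@X (nzr (sec_nz Wz)) d).
Proof.
move=> dD; have [U [b [Uz b1 b2]]] := fam_locally_free F d z.
have hl := ideal_lin ptI_ideal; have idU : U `<=` U by [].
have bU := secI_basis (sec_nz Uz) b1 (b2 U idU).
have [a1 a2 a3 a4] := GHW (sec_nz Uz); have [c1 c2 c3 c4] := GH.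
have bc i : bihom d (act (HW (sec_nz Uz)) (@X _ d i)) by apply: bihom_act.
have [M hM] := basis_mx bU bc.
have hMz i : ptI (act (map_mx io H) (@X K d i) -
    mcomb (fun i => ptpol Uz d (b i)) (map_mx (evz Uz) M) i).
  have := ptI_map (hM i); rewrite rmorphB /= map_act map_mpolyX HW_ev.
  congr (ptI (_ - _)); rewrite /mcomb rmorph_sum; apply: eq_bigr => j _ /=.
  rewrite mxE; apply/mpolyP => u; rewrite mcoeffZ !mcoeff_evz mcoeffZ.
  rewrite [in RHS]evzE -rmorphM; congr (evm Uz (_ * _)).
  by rewrite !mcoeff_pol; case: ifP => // _; rewrite res_id.
have iGH : invp (map_mx io G) (map_mx io H).
  split; try exact: blk_map; first by rewrite -map_mxM c3 map_mx1.
  by rewrite -map_mxM c4 map_mx1.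
have [i1 i2 i3 i4] := iGH.
have bz := pt_basis Uz b1 b2.
have bs : basis ptI d (fun i => act (map_mx io H) (@X K d i)).
  have hl' : lin (tr ptI (map_mx io H)) by apply/ideal_lin/ideal_act/ptI_ideal.
  have := basis_act hl' i2 i1 i4 i3 (good_basis hl' (gd dD)).
  rewrite /X; move: (hJ d); rewrite /stdb; case: _ /.
  rewrite (_ : (fun p => _) = ptI :> ({mpoly K[N]} -> Prop)) //.
  by apply/funext => p; apply/propext; rewrite -/(tr (tr ptI _) _ p) trM i3 tr1.
have [L hL] := basis_mx bs (proj1 bz).
have /mulmx1_unit[uM _] := basis_mx_inv hl bs hMz hL.
have [V [hVU [t [Vz et]]]] : unit_at z (\det M : sections U).
  apply: (ev_unit (Uz := Uz)); have := uM; rewrite unitmxE unitfE det_map_mx.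
  by have -> : evz Uz (\det M) = evm Uz (\det M) by exact: evzE.
exists V => // W hWV Wz; have hWU : W `<=` U := subset_trans hWV hVU.
pose rW : {rmorphism nzr (sec_nz Uz) -> nzr (sec_nz Wz)} := res hWU.
have [w1 w2 w3 w4] := GHW (sec_nz Wz).
have hlW := ideal_lin (secI_ideal (sec_nz Wz)).
have bW := secI_basis (sec_nz Wz) b1 (b2 W hWU).
have hMW i : secI (act (HW (sec_nz Wz)) (@X _ d i) -
    mcomb (fun i => @pol m n (nzr (sec_nz Wz)) d (fun u => res hWU (b i u))) (map_mx rW M) i).
  have := secI_res hWU (sec_nz Wz) (hM i); rewrite rmorphB /= map_act map_mpolyX HW_res.
  congr (secI (_ - _)); rewrite /mcomb rmorph_sum; apply: eq_bigr => j _ /=.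
  rewrite mxE; apply/mpolyP => u; rewrite mcoeff_map_mpoly !mcoeffZ !mcoeff_pol.
  case: ifP => _; last by rewrite !mulr0; apply: (rmorph0 (res hWU)).
  by rewrite res_id; apply: (rmorphM (res hWU)).
have uW : ((res hWV t : nzr (sec_nz Wz)) *: \adj (map_mx rW M)) *m map_mx rW M = 1%:M.
  rewrite -scalemxAl mul_adj_mx scale_scalar_mx det_map_mx; congr (_%:M).
  have := congr1 (res hWV) et; rewrite rmorph1 rmorphM mulrC => <-.
  by congr (_ * _); apply/esym/res_comp.
have bcW i : bihom d (act (HW (sec_nz Wz)) (@X _ d i)) by apply: bihom_act.
have := basis_act hlW w1 w2 w3 w4 (basis_of_inv hlW bW bcW hMW uW).
congr basis; last by apply/funext => i; rewrite actM w4 act1.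
Qed.

Lemma nb_inter (P : open_set Z -> int * int -> Prop) (L : seq (int * int)) :
  (forall d, d \in L -> exists2 U : open_set Z, oset U z &
     forall W, W `<=` U -> oset W z -> P W d) ->
  exists2 U : open_set Z, oset U z & forall W, W `<=` U -> oset W z -> forall d, d \in L -> P W d.
Proof.
elim: L => [|d L IH] hL; first by exists (open_setT Z).
have [U Uz hU] := hL d (mem_head _ _).
have [|V Vz hV] := IH; first by move=> d' h'; apply: hL; rewrite inE h' orbT.
exists (opI U V) => // W hW Wz d'; rewrite inE => /predU1P[->|].
  by apply: hU => //; apply: subset_trans hW (@opIl _ _ U V).
by apply: hV => //; apply: subset_trans hW (@opIr _ _ U V).
Qed.

(** In [D1] the standard bases spread out from the fibre; in the rest of [D2] local freeness gives
    the rank. As [D1] and [D2] are finite, one neighbourhood serves all conditions of [near], and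
    [near_datum] applies. *)
Lemma near_chart : exists V (Vz : oset V z) (D : datum m n (sections V)),
  forall p, CI J (nzd (sec_nz Vz) D) p -> secI p.
Proof.
have [U1 U1z h1] : exists2 U : open_set Z, oset U z & forall W, W `<=` U -> oset W z ->
    forall d, d \in D1 -> forall Wz : oset W z,
      basis (tr (secI (hW := sec_nz Wz)) (HW (sec_nz Wz))) d (@X (nzr (sec_nz Wz)) d).
  apply: nb_inter => d /std_basis_near[U Uz hU]; exists U => // W hW _ Wz; exact: hU.
have [U2 U2z h2] : exists2 U : open_set Z, oset U z & forall W, W `<=` U -> oset W z ->
    forall d, d \in D2 -> forall Wz : oset W z,
      exists b : 'I_(h d) -> _, basis (secI (hW := sec_nz Wz)) d b.
  apply: nb_inter => d _; have [U [b [Uz b1 b2]]] := fam_locally_free F d z.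
  exists U => // W hW _ Wz; eexists; exact: (secI_basis (sec_nz Wz) b1 (b2 W hW)).
pose V := opI U1 U2; have Vz : oset V z by [].
have [v1 v2 v3 v4] := GHW (sec_nz Vz); have hl := ideal_lin (secI_ideal (sec_nz Vz)).
have hn : near J (tr (secI (hW := sec_nz Vz)) (HW (sec_nz Vz))).
  split; first exact/ideal_act/secI_ideal.
    move=> d dD; have [b hb] := h2 V (@opIr _ _ U1 U2) Vz d dD Vz.
    by rewrite hJ; eexists; exact: (basis_act hl v1 v2 v3 v4 hb).
  move=> d dD; apply: basis_good; first exact/ideal_lin/ideal_act/secI_ideal.
  have := h1 V (@opIl _ _ U1 U2) Vz d dD Vz; rewrite /X /stdb.
  by move: (hJ d); case: _ /.
have [D hD] := near_datum hn; have [d1 d2 d3 d4] := invpM (GHW (sec_nz Vz)) (And4 (dG_blk D) (dH_blk D) (dGH D) (dHG D)).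
pose D' : datum m n (sections V) := @Datum m n (sections V) (GW (sec_nz Vz) *m dG D)
  (dH D *m HW (sec_nz Vz)) (dt D) d1 d2 d3 d4.
exists V, Vz, D' => p hp.
have : tr (secI (hW := sec_nz Vz)) (HW (sec_nz Vz)) (act (GW (sec_nz Vz)) p).
  apply: (CI_gen _ hD); first exact/ideal_act/secI_ideal.
  by move: hp; rewrite /CI /cnf actM.
by rewrite /tr actM v3 act1.
Qed.

(** On [V] only the inclusion of the explicit ideal in the family is known. Near each point of [V]
    both quotients are free of rank [h d], so [basis_sub] gives equality, in every bidegree. *)
Lemma chart_at : exists V (D : datum m n (sections V)), oset V z /\ charted J F D.
Proof.
have [V [Vz [D hD]]] := near_chart; exists V, D; split=> // W hWV d c hc.
have le W' (hW' : W' `<=` V) (c' : coefs W') : homog_section d c' ->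
    inCI J (map_datum (res hW') D) d c' -> F d W' c'.
  move=> hc' /(inCI_span hc')[g [g1 g2]].
  have -> : c' = fun u => \sum_(i < size (mons d)) c' (nth 0%MM (mons d) i) * res hW' (g i u).
    by apply/funext.
  apply: fam_sum => i; apply/famZ/fam_res; have [gi1 gi2] := g1 i.
  apply/(secI_pol (sec_nz Vz) gi1)/hD; exact: gi2.
split=> [Fc|]; last exact: le.
apply: inCI_local => x Wx; have [U [b [Ux b1 b2]]] := fam_locally_free F d x.
pose W' := opI W U; have W'x : oset W' x by [].
have hW'W : W' `<=` W := @opIl _ _ W U; have hW'U : W' `<=` U := @opIr _ _ W U.
have hW'V := subset_trans hW'W hWV.
exists W', hW'W; split=> //; rewrite (map_datum_res _ _ hW'V) => hA.
have hA1 : (1 : sections W') != 0 by apply/eqP; have [] := scheme_local W'x.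
have -> : hA = hA1 by apply: Prop_irrelevance.
have bI := secI_basis hA1 b1 (b2 W' hW'U).
have bC := CI_basis J (nzd hA1 (map_datum (res hW'V) D)) d.
have [bb hbb] : exists bb : 'I_(size (stds J d)) -> _, basis (secI (hW := hA1)) d bb.
  by rewrite hJ; eexists; exact: bI.
apply: (basis_sub _ _ bC hbb).
- exact: CI_lin.
- exact/ideal_lin/secI_ideal.
- move=> p hp hCI; apply/(secI_bihom hp); apply: (le W' hW'V).
    by move=> u hu; apply: (proj1 (bihomP d p) hp u hu).
  move=> hA'; have -> : hA' = hA1 by apply: Prop_irrelevance.
  by rewrite polE.
- exact: bihom_pol.
by apply/secI_pol; [exact: homog_res | exact: fam_res].
Qed.

End AtPoint.

Hypothesis h0 : h 0 <> 0%N.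
Hypothesis hrad : forall M : 'X_{1..N} -> Prop, hset h M -> forall u r, M (u *+ r)%MM -> M u.

Theorem local_chart (z : Z) : exists J : borel m n, (forall d, size (stds J d) = h d) /\
  exists V (D : datum m n (sections V)), oset V z /\ charted J F D.
Proof.
have lift (T : eqType) (L : seq T) (c : T -> resf z) := lift_seq L c.
have hb := pt_hilb (@ev_res k Z z) lift; have hI := ptI_ideal (@ev_res k Z z) lift.
have [J [G [H [GH hJ gd]]]] := gin h0 hrad (resf_scalar z) hI hb.
exists J; split=> //.
apply: (chart_at (@ev_res k Z z) lift (@ev_scalar k Z z) _ GH hJ gd) => U Uz s /eqP hs.
by apply: contrapT => /ev_eq0.
Qed.

End LocalChart.

(** * Recovering the diagram from the Hilbert function *)

Section CountY.
Context (m n : nat).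
Local Notation N := (m + n)%N.
Local Notation mons := (mons m n).
Local Notation vx := (@vx m n).
Local Notation vy := (@vy m n).
Implicit Types (u w : 'X_{1..N}) (a b v : nat).

(** The monomials of degree [v] in the variables [y_a, ..., y_(n-1)]. Times [x_i], they are what a
    live row with [lam i = a] contributes to the standard monomials of bidegree (1, v). *)
Definition ymons (a v : nat) : seq 'X_{1..N} :=
  [seq u : 'X_{1..N} <- mons (0, v%:Z) | [forall j : 'I_n, (0 < u (vy j)) ==> (a <= j)]%N].

Lemma bidegE u (a b : nat) : (bideg u == (a%:Z, b%:Z)) =
  ((\sum_i u (vx i))%N == a) && ((\sum_j u (vy j))%N == b).
Proof. by []. Qed.

Lemma mem_ymons a v u : reflect
  [/\ (forall i, u (vx i) = 0%N), (\sum_j u (vy j))%N = v &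
      forall j : 'I_n, (0 < u (vy j))%N -> (a <= j)%N] (u \in ymons a v).
Proof.
rewrite mem_filter mem_mons bidegE; apply: (iffP and3P).
  case=> /forallP h1 /eqP h2 /eqP h3; split=> // [i|j hj].
    apply/eqP; rewrite -leqn0 -h2 (bigD1 i) //= leq_addr //.
  by have := h1 j; rewrite hj.
case=> h1 h2 h3; split; [apply/forallP => j; apply/implyP; exact: h3| |exact/eqP].
by rewrite big1.
Qed.

Lemma ymons_uniq a v : uniq (ymons a v). Proof. exact/filter_uniq/mons_uniq. Qed.

Lemma ymons_anti a b v : (a <= b)%N -> (size (ymons b v) <= size (ymons a v))%N.
Proof.
move=> ab; apply: uniq_leq_size (ymons_uniq b v) _ => u /mem_ymons[h1 h2 h3].
by apply/mem_ymons; split=> // j /h3; apply: leq_trans.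
Qed.

Lemma size_ymons0 a : size (ymons a 0) = 1%N.
Proof.
have/perm_size -> // : perm_eq (ymons a 0) [:: 0%MM].
apply: uniq_perm => //; first exact: ymons_uniq.
move=> u; rewrite inE; apply/mem_ymons/eqP => [[h1 h2 h3]|->]; last first.
  by split=> [i||j]; rewrite ?mnm0E // big1 // => j _; rewrite mnm0E.
apply/mnmP; apply: var_cases => i; rewrite mnm0E; first exact: h1.
by apply/eqP; rewrite -leqn0 -h2 (bigD1 i) //= leq_addr.
Qed.

Lemma size_ymons_n v : size (ymons n v.+1) = 0%N.
Proof.
case e : (ymons n v.+1) => [//|u s].
have /mem_ymons[_ h2 h3] : u \in ymons n v.+1 by rewrite e mem_head.
move: h2; rewrite big1 // => j _; apply/eqP; rewrite -leqn0 leqNgt.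
by apply/negP => /h3; rewrite leqNgt ltn_ord.
Qed.

Lemma size_ymonsS (a : 'I_n) v :
  size (ymons a v.+1) = (size (ymons a.+1 v.+1) + size (ymons a v))%N.
Proof.
have -> : size (ymons a v) = size [seq (w + U_(vy a))%MM | w <- ymons a v] by rewrite size_map.
rewrite -size_cat; apply: perm_size; apply: uniq_perm; first exact: ymons_uniq.
  rewrite cat_uniq ymons_uniq map_inj_uniq ?ymons_uniq ?andbT; last by move=> x y /addIm.
  apply/hasPn => _ /mapP[w _ ->]; apply/negP => /mem_ymons[_ _ /(_ a)].
  by rewrite mnmDE mnm1E eqxx addn1 ltnn => /(_ isT).
have sU (w : 'X_{1..N}) : (\sum_j (w + U_(vy a))%MM (vy j) = (\sum_j w (vy j)).+1)%N.
  under eq_bigr => j _ do rewrite mnmDE mnm1E eq_rshift.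
  rewrite big_split /= -addn1; congr (_ + _)%N; rewrite (bigD1 a) //= eqxx big1 //.
  by move=> j ja; rewrite eq_sym (negPf ja).
move=> u; rewrite mem_cat; apply/mem_ymons/orP => [[h1 h2 h3]|[/mem_ymons[h1 h2 h3]|/mapP[w /mem_ymons[h1 h2 h3] ->]]].
- have [u0|upos] := posnP (u (vy a)).
    left; apply/mem_ymons; split=> // j hj; rewrite ltn_neqAle h3 // andbT.
    by apply: contraTneq hj => /val_inj <-; rewrite u0.
  have eu : u = (u - U_(vy a) + U_(vy a))%MM by rewrite submK // lep1mP -lt0n.
  right; apply/mapP; exists (u - U_(vy a))%MM => //; apply/mem_ymons; split.
  - by move=> i; rewrite mnmBE h1.
  - by apply: succn_inj; rewrite -sU -eu.
  by move=> j; rewrite mnmBE => hj; apply: h3; move: hj; clear; lia.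
- by split=> // j /h3; apply: ltnW.
split=> [i||j].
- by rewrite mnmDE h1 mnm1E eq_rlshift.
- by rewrite sU h2.
rewrite mnmDE mnm1E eq_rshift; case: (eqVneq a j) => [->//|_].
by rewrite addn0; apply: h3.
Qed.

Lemma size_ymonsE b v : (b <= n)%N -> size (ymons (n - b) v) = 'C((b + v).-1, v).
Proof.
elim: b v => [v _|b IH v bn].
  rewrite subn0; case: v => [|v]; first by rewrite size_ymons0.
  by rewrite size_ymons_n bin_small.
elim: v => [|v IHv]; first by rewrite size_ymons0 bin0.
have lt : (n - b.+1 < n)%N by move: bn; clear; lia.
rewrite (size_ymonsS (Ordinal lt)) /= IHv.
have -> : (n - b.+1).+1 = (n - b)%N by move: bn; clear; lia.
by rewrite IH 1?ltnW // addnS /= binS.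
Qed.

(** With [b > 0] variables after [y_a], adding [y_a] multiplies the number of monomials of degree
    [v] by [(b + v) / b], which exceeds [r] at [v = r * b + 1]. For [b = 0] there are no monomials
    of positive degree without [y_a]. *)
Lemma ymons_growth r a : (a < n)%N ->
  exists v, (r * size (ymons a.+1 v) < size (ymons a v))%N.
Proof.
move=> an; pose b := (n - a.+1)%N; have eb : (b.+1 <= n)%N by rewrite /b; move: an; clear; lia.
have e1 : a = (n - b.+1)%N by rewrite /b; move: an; clear; lia.
have e2 : a.+1 = (n - b)%N by rewrite /b; move: an; clear; lia.
exists (r * b).+1; rewrite e2 [in X in (_ < X)%N]e1 !size_ymonsE //; last by rewrite ltnW.
rewrite addSn /=; set v := (r * b).+1.
have := mul_bin_down (b + v) v; rewrite addnK.
have : (0 < 'C(b + v, v))%N by rewrite bin_gt0 leq_addl.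
move: 'C(b + v, v) 'C((b + v).-1, v) => c c' c0 e.
have [b0|b0] := posnP b.
  have : c' = 0%N by move: e; rewrite b0 mul0n => /eqP; rewrite muln_eq0 => /orP[|/eqP].
  by move=> ->; rewrite muln0.
have [->|c'0] := posnP c'; first by rewrite muln0.
rewrite -(ltn_pmul2l b0) -e mulnA ltn_pmul2r // /v [(b * r)%N]mulnC; clear; lia.
Qed.

End CountY.

Section BorelUnique.
Context (m n : nat).
Local Notation N := (m + n)%N.
Local Notation mons := (mons m n).
Local Notation vx := (@vx m n).
Local Notation vy := (@vy m n).
Local Notation ymons := (ymons m n).
Implicit Types (u w : 'X_{1..N}) (v : nat) (J : borel m n).

Lemma stds_0v J v : size (stds J (0, v%:Z)) = size (ymons (bb J) v).
Proof.
apply/perm_size/uniq_perm; [exact: stds_uniq|exact: ymons_uniq|move=> u].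
rewrite mem_stds bidegE; apply/and3P/mem_ymons => [[su /eqP h1 /eqP h2]|[h1 h2 h3]].
  split=> // [i|j uj]; first by apply/eqP; rewrite -leqn0 -h1 (bigD1 i) //= leq_addr.
  rewrite leqNgt; apply/negP => jb; case/andP: su => /negP[]; apply/orP; right.
  by apply/existsP; exists j; rewrite jb.
split; [|by rewrite big1|exact/eqP]; apply/andP; split.
  apply/negP => /orP[] /existsP[i /andP[ib]]; first by rewrite h1.
  by move/h3; rewrite leqNgt ib.
by apply/negP => /existsP[i /existsP[j /and3P[_]]]; rewrite h1.
Qed.

Lemma stds_1v J v : size (stds J (1, v%:Z)) =
  (\sum_(i < m | ba J <= i) size (ymons (lam J i) v))%N.
Proof.
pose L := flatten [seq [seq (w + U_(vx i))%MM | w <- ymons (lam J i) v] | i : 'I_m <- [seq i : 'I_m <- enum 'I_m | (ba J <= i)%N]].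
have -> : (\sum_(i < m | ba J <= i) size (ymons (lam J i) v) = size L)%N.
  rewrite size_flatten /shape -map_comp sumnE big_map big_filter big_enum_cond /=.
  by apply: eq_bigr => i _; rewrite size_map.
have sU (w : 'X_{1..N}) i : (forall i', w (vx i') = 0%N) -> forall i', (w + U_(vx i))%MM (vx i') = (i == i').
  by move=> hw i'; rewrite mnmDE hw mnm1E eq_lshift.
have UL : uniq L.
  rewrite /L; have := filter_uniq (fun i : 'I_m => (ba J <= i)%N) (enum_uniq 'I_m).
  elim: [seq _ <- _ | _] => //= i s IH /andP[ni /IH us].
  rewrite cat_uniq us map_inj_uniq ?ymons_uniq ?andbT /=; last by move=> x y /addIm.
  apply/hasPn => x /flatten_mapP[i' i's /mapP[w /mem_ymons[h1 _ _] ->]].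
  apply/negP => /mapP[w' /mem_ymons[h1' _ _]] /(congr1 (fun x : 'X_{1..N} => x (vx i'))).
  rewrite !sU // eqxx; case: (eqVneq i i') => // e; by rewrite e i's in ni.
apply/perm_size/uniq_perm; [exact: stds_uniq|exact: UL|move=> u].
rewrite mem_stds -[1]/(1%N%:Z) bidegE; apply/and3P/flatten_mapP.
  case=> su /eqP h1 /eqP h2.
  have [i ui] : exists i, (0 < u (vx i))%N.
    apply: contrapT => hn; move: h1; rewrite big1 // => i _; apply/eqP.
    by rewrite -leqn0 leqNgt; apply/negP => hi; apply: hn; exists i.
  have eu : u = (u - U_(vx i) + U_(vx i))%MM by rewrite submK // lep1mP -lt0n.
  have nd : (ba J <= i)%N.
    rewrite leqNgt; apply/negP => ib; case/andP: su => /negP[]; apply/orP; left.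
    by apply/existsP; exists i; rewrite ib.
  exists i; first by rewrite mem_filter nd mem_enum.
  apply/mapP; exists (u - U_(vx i))%MM => //; apply/mem_ymons; split.
  - move=> i'; rewrite mnmBE mnm1E eq_lshift; case: (eqVneq i i') => [<-|ne].
      by move: h1; rewrite (bigD1 i) //=; move: ui; clear; lia.
    by move: h1; rewrite (bigD1 i) //= (bigD1 i') 1?eq_sym //=; move: ui; clear; lia.
  - by rewrite -h2; apply: eq_bigr => j _; rewrite mnmBE mnm1E eq_lrshift subn0.
  move=> j; rewrite mnmBE mnm1E eq_lrshift subn0 => uj; rewrite leqNgt; apply/negP => jl.
  case/andP: su => _ /negP[]; apply/existsP; exists i; apply/existsP; exists j.
  exact/and3P.
case=> i; rewrite mem_filter => /andP[bi _] /mapP[w /mem_ymons[h1 h2 h3] ->].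
have wy j : (w + U_(vx i))%MM (vy j) = w (vy j) by rewrite mnmDE mnm1E eq_lrshift addn0.
split; last by apply/eqP; rewrite -h2; apply: eq_bigr.
  apply/andP; split.
    apply/negP => /orP[] /existsP[l /andP[lb]].
      by rewrite sU // lt0b => /eqP e; rewrite -e ltnNge bi in lb.
    rewrite wy => /h3; rewrite leqNgt => /negP[].
    by apply: leq_trans lb (lam_bb J (ltn_ord i)).
  apply/negP => /existsP[i' /existsP[j /and3P[jl]]]; rewrite sU // lt0b wy => /eqP ei /h3.
  by rewrite ei leqNgt jl.
by rewrite (eq_bigr (fun i' => nat_of_bool (i == i'))) => [|i' _]; rewrite ?sU // (bigD1 i) //= eqxx big1 // => i'; rewrite eq_sym => /negPf ->.
Qed.

Section Pair.
Context (J J' : borel m n).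
Hypothesis e : forall d, size (stds J d) = size (stds J' d).

Lemma bb_unique : bb J = bb J'.
Proof.
have hP (K : borel m n) : size (stds K (0, 1)) = (n - bb K)%N.
  rewrite (stds_0v K 1) -{1}(subKn (bb_le K)) size_ymonsE ?leq_subr //.
  by rewrite addn1 bin1.
have := e (0, 1); rewrite !hP; have := bb_le J; have := bb_le J'; clear; lia.
Qed.

Lemma ba_unique : ba J = ba J'.
Proof.
have hP (K : borel m n) : size (stds K (1, 0)) = (m - ba K)%N.
  rewrite (stds_1v K 0); under eq_bigr => i _ do rewrite size_ymons0.
  rewrite sum1_card -[RHS](card_ord (m - ba K)).
  have lt (i : 'I_(m - ba K)) : (i + ba K < m)%N by have := ltn_ord i; have := ba_le K; clear; lia.
  rewrite -(card_imset (f := fun i => Ordinal (lt i))); last first.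
    by move=> x y /(congr1 val) /= /addIn /val_inj.
  apply: eq_card => i; rewrite -[LHS]/(ba K <= i)%N; apply/idP/imsetP => [bi|[j _ ->]]; last by rewrite /= leq_addl.
  have il : (i - ba K < m - ba K)%N by have := ltn_ord i; move: bi; clear; lia.
  by exists (Ordinal il) => //; apply: val_inj; rewrite /= subnK.
have := e (1, 0); rewrite !hP; have := ba_le J; have := ba_le J'; clear; lia.
Qed.

(* At the last difference, the side with the larger block of y-variables wins
   for large degrees, whatever the number of smaller blocks on the other side. *)
Lemma lam_step (i : 'I_m) : (ba J <= i)%N ->
  (forall i' : 'I_m, (i < i')%N -> lam J i' = lam J' i') -> (lam J i <= lam J' i)%N.
Proof.
move=> bi heq; rewrite leqNgt; apply/negP => lt.
have ln : (lam J' i < n)%N by apply: leq_trans lt (lam_le J i).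
have [v hv] := ymons_growth m m ln.
have := e (1, v%:Z); rewrite !stds_1v -ba_unique.
rewrite (bigID (fun i' : 'I_m => (i' <= i)%N)) /= [RHS](bigID (fun i' : 'I_m => (i' <= i)%N)) /=.
have -> : (\sum_(i0 < m | (ba J <= i0) && ~~ (i0 <= i)) size (ymons (lam J i0) v) =
    \sum_(i0 < m | (ba J <= i0) && ~~ (i0 <= i)) size (ymons (lam J' i0) v))%N.
  by apply: eq_bigr => i' /andP[_]; rewrite -ltnNge => /heq ->.
move/addIn; apply/eqP; rewrite ltn_eqF //.
apply: (@leq_ltn_trans (m * size (ymons (lam J' i).+1 v))).
  have -> : (m * size (ymons (lam J' i).+1 v) = \sum_(j < m) size (ymons (lam J' i).+1 v))%N.
    by rewrite sum_nat_const card_ord.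
  rewrite [leqRHS](bigID (fun i' : 'I_m => (ba J <= i') && (i' <= i))%N) /=.
  apply: leq_trans (leq_addr _ _); apply: leq_sum => i' /andP[_ ii].
  by apply/ymons_anti/(leq_trans lt)/lam_mono.
apply: leq_trans hv _; rewrite (bigD1 i) /=; last by rewrite bi leqnn.
exact: leq_addr.
Qed.

End Pair.

Lemma lam_unique J J' (i : nat) : (forall d, size (stds J d) = size (stds J' d)) ->
  lam J i = lam J' i.
Proof.
move=> e; have [mi|im] := leqP m i; first by rewrite !lam_out.
have e' d : size (stds J' d) = size (stds J d) by [].
have [ib|bi] := ltnP i (ba J); first by rewrite !lam_dead // -(ba_unique e).
rewrite -[i]/(nat_of_ord (Ordinal im)) in bi *; move: (Ordinal im) bi => {im}i.
have [r] := ubnP (m - i); elim: r i => // r IH i ir bi.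
have heq (i' : 'I_m) : (i < i')%N -> lam J i' = lam J' i'.
  move=> ii; apply: IH; last by apply: leq_trans bi (ltnW ii).
  by have := ltn_ord i'; have := ltn_ord i; move: ir ii; clear; lia.
apply/eqP; rewrite eqn_leq !lam_step // -?(ba_unique e) // => i' ii.
by rewrite heq.
Qed.

Theorem borel_unique J J' : (forall d, size (stds J d) = size (stds J' d)) -> J = J'.
Proof.
move=> e; have e1 := ba_unique e; have e2 := bb_unique e.
have e3 : lam J = lam J' by apply/funext => i; apply: lam_unique.
case: J J' e1 e2 e3 {e} => a b l p1 p2 p3 p4 p5 p6 p7 [a' b' l' q1 q2 q3 q4 q5 q6 q7] /= e1 e2 e3.
by subst; congr Borel; apply: Prop_irrelevance.
Qed.

End BorelUnique.

(** * Affine opens, spectra and local sections *)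

Section PrimeAvoidance.
Context (A : comPzRingType) (I : set A) (s : A).
Hypotheses (I0 : I 0) (ID : forall a b, I a -> I b -> I (a + b)).
Hypotheses (IM : forall a b, I b -> I (a * b)) (Is : forall r, ~ I (s ^+ r)).

Let avoid (Q : set A) : Prop := [/\ Q 0, (forall a b, Q a -> Q b -> Q (a + b)),
  (forall a b, Q b -> Q (a * b)), I `<=` Q & forall r, ~ Q (s ^+ r)].

Lemma prime_avoid : exists P : set A, [/\ prime_ideal P, I `<=` P & forall r, ~ P (s ^+ r)].
Proof.
pose T := {Q : set A | avoid Q}.
have [|x y z|[x hx] [y hy] /= h1 h2|C hC|t0 Pmax] := @Zorn T (fun x y => `[< sval x `<=` sval y >]).
- by move=> t; apply/asboolP.
- by move=> /asboolP h1 /asboolP h2; apply/asboolP; apply: subset_trans h2.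
- by move: h1 h2 => /asboolP /= h1 /asboolP /= h2; apply: eq_exist; apply/seteqP.
- have [[t0 Ct0]|nC] := pselect (exists t, C t); last first.
    have a0 : avoid I by split.
    by exists (exist _ I a0) => t Ct; case: nC; exists t.
  pose Q : set A := fun a => exists2 t, C t & sval t a.
  have aQ : avoid Q.
    split=> [|a b [t Ct ta] [u Cu ub]|a b [t Ct tb]|a Ia|r [t Ct]].
    - by exists t0 => //; case: (svalP t0).
    - have [/asboolP tu|/asboolP ut] := hC t u Ct Cu.
        by exists u => //; case: (svalP u) => _ D _ _ _; apply: D => //; apply: tu.
      by exists t => //; case: (svalP t) => _ D _ _ _; apply: D => //; apply: ut.
    - by exists t => //; case: (svalP t) => _ _ M _ _; apply: M.
    - by exists t0 => //; case: (svalP t0) => _ _ _ S _; apply: S.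
    by case: (svalP t) => _ _ _ _; apply.
  by exists (exist _ Q aQ) => t Ct; apply/asboolP => a ta; exists t.
pose P := sval t0; have [P0 PD PM IP Ps] : avoid P := svalP t0.
exists P; split=> //.
pose E a : set A := fun x => exists p c, P p /\ x = p + c * a.
have hE a : ~ P a -> exists r, E a (s ^+ r).
  move=> nPa; apply: contrapT => /forallNP nE.
  have aE : avoid (E a).
    split=> [|_ _ [p [c [Pp ->]]] [q [d [Pq ->]]]|b _ [p [c [Pp ->]]]|x Ix|r]; last exact: nE.
    - by exists 0, 0; rewrite mul0r addr0.
    - by exists (p + q), (c + d); split; [exact: PD | rewrite mulrDl addrACA].
    - by exists (b * p), (b * c); split; [exact: PM | rewrite mulrDr mulrA].
    by exists x, 0; split; [exact: IP | rewrite mul0r addr0].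
  have sub : P `<=` E a by move=> x Px; exists x, 0; rewrite mul0r addr0.
  have := Pmax (exist _ (E a) aE) (introT (asboolP _) sub) => /(congr1 sval) /= e; apply: nPa; rewrite /P -e.
  by exists 0, 1; rewrite mul1r add0r.
split=> // [P1|a b Pab]; first by apply: (Ps 0%N); rewrite expr0.
apply: contrapT => /not_orP[/hE[i [p [c [Pp ei]]]] /hE[j [q [d [Pq ej]]]]].
apply: (Ps (i + j)%N); rewrite exprD ei ej.
have -> : (p + c * a) * (q + d * b) = (q + d * b) * p + (c * a) * q + (c * d) * (a * b) by ring.
by apply: (PD); [apply: (PD)|]; apply: (PM).
Qed.

End PrimeAvoidance.

Section AffineOpens.
Context (k : fieldType) (X : scheme k).
Implicit Types (U V W : open_set X).

Lemma unit_atM x U (s t : sections U) : unit_at x (s * t) -> unit_at x s.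
Proof. by rewrite mulrC => h; apply: contrapT => n; exact: (@vanishM k X x U t s n h). Qed.

Lemma unit_atMM x U (s t : sections U) : oset U x -> unit_at x s -> unit_at x t -> unit_at x (s * t).
Proof.
move=> Ux hs ht; apply: contrapT => n.
have : ~ unit_at x t; last by apply.
have [V [hV [r [Vx e]]]] := hs; move=> /(unit_res hV _ Vx) ht'.
apply: n; apply/(unit_res hV _ Vx); rewrite rmorphM.
have [W [hW [q [Wx e']]]] := ht'; exists W, hW, (res hW r * q); split=> //.
by rewrite rmorphM mulrACA -rmorphM e rmorph1 mul1r.
Qed.

Lemma unit_atX x U (s : sections U) r : oset U x -> unit_at x s -> unit_at x (s ^+ r).
Proof.
move=> Ux hs; elim: r => [|r IH]; last by rewrite exprS; apply: unit_atMM.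
by apply: contrapT; apply: vanish1.
Qed.

Lemma unit_at_inv x U (s t : sections U) : oset U x -> s * t = 1 -> unit_at x s.
Proof. by move=> Ux e; exists U, (fun x h => h), t; rewrite res_id. Qed.

Lemma unit_at_open U (s : sections U) : open [set x | U x /\ unit_at x s].
Proof.
rewrite openE => x [Ux [V [hV [t [Vx e]]]]]; rewrite /interior /=.
apply: (@filterS _ _ _ (oset V)); last by apply: open_nbhs_nbhs; split; [exact: oset_open|].
by move=> y Vy; split; [exact: (hV y Vy) | exists V, hV, t].
Qed.

Definition basic U (s : sections U) : open_set X := OpenSet (unit_at_open s).
Lemma basic_sub U (s : sections U) : basic s `<=` U. Proof. by move=> x []. Qed.

Lemma basic_loc U (s : sections U) : affine_open U -> is_localization (res (@basic_sub U s)) s.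
Proof. by case=> _ _ _; apply=> x Ux; split=> [[]|]. Qed.

Lemma open_set_eq U V : (forall x, U x <-> V x) -> U = V.
Proof.
case: U V => U oU [V oV] h; have e : U = V by apply/funext => x; apply/propext; apply: h.
by subst V; congr OpenSet; apply: Prop_irrelevance.
Qed.

Lemma affine_basic U W (hW : W `<=` U) (s : sections U) : affine_open U ->
  (forall x, U x -> (W x <-> unit_at x s)) -> affine_open W.
Proof.
case=> a1 a2 a3 a4 hs; have [[si esi] l2 l3] := a4 s W hW hs; split.
- move=> x y Wx Wy h; apply: a1; [exact: (hW _ Wx)|exact: (hW _ Wy)|move=> t].
  by rewrite -(unit_res hW t Wx) -(unit_res hW t Wy).
- move=> P [P0 PD PM P1 PP].
  have prQ : prime_ideal (fun a => P (res hW a)).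
    split=> [|a b|a b|/=|a b] /=; rewrite ?rmorph0 ?rmorphD ?rmorphM ?rmorph1 //.
    - exact: (PD).
    - exact: (PM).
    exact: (PP).
  have [x Ux hx] := a2 _ prQ.
  exists x => [|t].
    apply/(hs x Ux); apply: contrapT => /hx Ps; apply: P1.
    by rewrite -esi mulrC; apply: PM.
  have Wx : W x.
    apply/(hs x Ux); apply: contrapT => /hx Ps; apply: P1.
    by rewrite -esi mulrC; apply: PM.
  have us r : unit_at x (res hW s ^+ r) by apply: unit_atX => //; apply: unit_at_inv esi.
  have [a [r e]] := l2 t.
  have nPs r' : ~ P (res hW s ^+ r').
    move=> h; apply: P1; rewrite -(expr1n _ r') -esi exprMn mulrC.
    exact: PM.
  split=> [Pt ut|nt].
    have := unit_atMM Wx ut (us r); rewrite e => /(unit_res hW _ Wx).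
    by apply/hx; rewrite -e mulrC; apply: PM.
  have : P (t * res hW s ^+ r).
    rewrite e; apply/hx => /(unit_res hW _ Wx); rewrite -e => /unit_atM; exact: nt.
  by case/PP => // /nPs.
- move=> x V Wx Vx; have [s' us' hs'] := a3 x (opI V W) (hW x Wx) (conj Vx Wx).
  exists (res hW s'); first exact/unit_res.
  by move=> y Wy /(unit_res hW _ Wy) /(hs' y (hW y Wy)) [].
move=> t W' hW' ht; have [a [q ea]] := l2 t.
(* As [t = a / s^q], the set [W'] is the basic open set of [a * s] inside [U], and the localisation
   property of [U] can be used for it. *)
have hW'U := subset_trans hW' hW.
have hW'P x : U x -> (W' x <-> unit_at x (a * s)).
  move=> Ux; split=> [W'x|u].
    have Wx := hW' x W'x; apply: unit_atMM => //; last exact/(hs x Ux).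
    apply/(unit_res hW _ Wx); rewrite -ea; apply: unit_atMM => //; first exact/(ht x Wx).
    by apply: unit_atX => //; apply: unit_at_inv esi.
  have Wx : W x by apply/(hs x Ux); apply: (unit_atM (t := a)); rewrite mulrC.
  apply/(ht x Wx); apply: (unit_atM (t := res hW s ^+ q)); rewrite ea.
  exact/(unit_res hW _ Wx)/(unit_atM u).
have [[u eu] m2 m3] := a4 (a * s) W' hW'U hW'P.
have eas : res hW (a * s) = t * res hW s ^+ q.+1 by rewrite rmorphM -ea exprSr mulrA.
have eas' : res hW'U (a * s) = res hW' t * res hW' (res hW s) ^+ q.+1.
  by rewrite -(res_comp hW hW' hW'U) eas rmorphM rmorphXn.
have esiX r : res hW s ^+ r * si ^+ r = 1 by rewrite -exprMn esi expr1n.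
split.
- exists (res hW' (res hW s) ^+ q.+1 * u); by rewrite mulrA -eas'.
- move=> b; have [c [r ec]] := m2 b; exists (res hW c * si ^+ (q.+1 * r)), r.
  rewrite rmorphM (res_comp hW hW' hW'U) -ec eas' exprMn -exprM -mulrA; congr (_ * _).
  have es : res hW' (res hW s) ^+ (q.+1 * r) * res hW' (si ^+ (q.+1 * r)) = 1.
    by rewrite -rmorphXn -rmorphM esiX rmorph1.
  by rewrite -?mulrA es mulr1.
move=> b; have [b' [p eb]] := l2 b => rb0.
have [r er] : exists r, (a * s) ^+ r * b' = 0.
  by apply: m3; rewrite -(res_comp hW hW' hW'U) -eb rmorphM rb0 mul0r.
exists r; have := congr1 (res hW) er; rewrite rmorph0 rmorphM rmorphXn eas -eb exprMn -exprM.
move/(congr1 (fun x => x * (si ^+ (q.+1 * r) * si ^+ p))); rewrite mul0r => <-.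
rewrite -[LHS]mulr1 -[in LHS](esiX (q.+1 * r)%N) -[LHS]mulr1 -[in LHS](esiX p).
by ring.
Qed.

Lemma affine_nbhd (x : X) V : V x -> exists U, [/\ U x, U `<=` V & affine_open U].
Proof.
move=> Vx; have [U Ux aU] := scheme_affine x; have [_ _ a3 _] := aU.
have [s us hs] := a3 x V Ux Vx.
exists (basic s); split=> // [y [Uy uy]|]; first exact: hs.
by apply: (affine_basic (@basic_sub U s) (s := s)) => // y Uy; split=> [[]|].
Qed.

End AffineOpens.

(** * The spectrum of a localised domain *)

Section Spectrum.
Context (k : fieldType) (R : idomainType) (cst : {rmorphism k -> R}).
Context (F : fieldType) (fr : {rmorphism R -> F}) (delta : R).
Hypothesis fr_eq0 : forall a, fr a = 0 -> a = 0.
Hypothesis delta0 : delta != 0.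

(** The points of the spectrum of [R[1/delta]], without forming the localisation. As [R] is a
    domain, all sections can be taken in one field [F] containing it, and restriction between
    nonempty open sets is the identity of [F]. *)
Definition spt : Type := {P : set R | prime_ideal P /\ ~ P delta}.
HB.instance Definition _ := gen_eqMixin spt.
HB.instance Definition _ := gen_choiceMixin spt.
Implicit Types (x y : spt).

Lemma spt_eq x y : sval x = sval y -> x = y.
Proof. by case: x y => s hs [t ht] /= e; apply: eq_exist. Qed.

Definition sopen (U : set spt) : Prop := forall x, U x ->
  exists2 f, ~ sval x f & forall y, ~ sval y f -> U y.

Lemma spt0 x : sval x 0. Proof. by case: (svalP x) => -[]. Qed.
Lemma sptD x a b : sval x a -> sval x b -> sval x (a + b).
Proof. by case: (svalP x) => -[_ + _ _ _] _; apply. Qed.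
Lemma sptMl x a b : sval x b -> sval x (a * b).
Proof. by case: (svalP x) => -[_ _ + _ _] _; apply. Qed.
Lemma sptMr x a b : sval x a -> sval x (a * b).
Proof. by rewrite mulrC; apply: sptMl. Qed.
Lemma spt1 x : ~ sval x 1. Proof. by case: (svalP x) => -[]. Qed.
Lemma sptM x a b : ~ sval x a -> ~ sval x b -> ~ sval x (a * b).
Proof. by case: (svalP x) => -[_ _ _ _ hM] _ ha hb /hM []. Qed.
Lemma sptX x a r : ~ sval x a -> ~ sval x (a ^+ r).
Proof. by move=> ha; elim: r => [|r IH]; [exact: spt1 | rewrite exprS; apply: sptM]. Qed.
Lemma spt_delta x : ~ sval x delta. Proof. by case: (svalP x). Qed.
Lemma spt_neq0 x a : ~ sval x a -> a != 0.
Proof. by move=> ha; apply/eqP => e; apply: ha; rewrite e; apply: spt0. Qed.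

Lemma sopenT : sopen setT. Proof. by move=> x _; exists 1 => //; apply: spt1. Qed.
Lemma sopenI : setI_closed sopen.
Proof.
move=> U V hU hV x [/hU[f xf fU] /hV[g xg gV]]; exists (f * g); first exact: sptM.
move=> y yfg; split; [apply: fU|apply: gV] => h; apply: yfg; [exact: sptMr|exact: sptMl].
Qed.
Lemma sopen_bigU (I : Type) (f : I -> set spt) : (forall i, sopen (f i)) -> sopen (\bigcup_i f i).
Proof. by move=> hf x [i _ /hf[g xg gf]]; exists g => // y /gf ?; exists i. Qed.
HB.instance Definition _ := isOpenTopological.Build spt sopenT sopenI sopen_bigU.

Lemma sopenE (U : open_set spt) x : U x -> exists2 f, ~ sval x f & forall y, ~ sval y f -> U y.
Proof. by move: x; apply: (oset_open U). Qed.

Lemma eta_prime : prime_ideal [set a : R | a = 0] /\ ~ [set a : R | a = 0] delta.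
Proof.
split; last by apply/eqP.
split=> /= [//|a b -> ->|a b ->|/eqP|a b /eqP]; rewrite ?addr0 ?mulr0 ?oner_eq0 //.
by rewrite mulf_eq0 => /orP[/eqP|/eqP]; [left|right].
Qed.
Definition eta : spt := exist _ _ eta_prime.

Implicit Types (U V W : open_set spt).

Lemma eta_in U x : U x -> U eta.
Proof. by move=> /sopenE[f /spt_neq0 f0]; apply; apply/eqP. Qed.

Definition sreg U (g : F) : Prop :=
  (forall x, U x -> exists a b, ~ sval x b /\ g * fr b = fr a) /\ (~ U eta -> g = 0).

Lemma fr_neq0 a : a != 0 -> fr a != 0.
Proof. by apply: contraNneq => /fr_eq0 ->. Qed.

Definition ssec U : Type := {g : F | sreg U g}.
HB.instance Definition _ U := gen_eqMixin (ssec U).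
HB.instance Definition _ U := gen_choiceMixin (ssec U).

Lemma ssec_eq U (s t : ssec U) : sval s = sval t -> s = t.
Proof. by case: s t => s hs [t ht] /= e; apply: eq_exist. Qed.

Lemma sregD U g h : sreg U g -> sreg U h -> sreg U (g + h).
Proof.
move=> [g1 g2] [h1 h2]; split=> [x /[dup] /g1[a [b [xb e]]] /h1[a' [b' [xb' e']]]|n].
  exists (a * b' + a' * b), (b * b'); split; first exact: sptM.
  by rewrite rmorphD !rmorphM -e -e'; ring.
by rewrite g2 // h2 // addr0.
Qed.
Lemma sregM U g h : sreg U g -> sreg U h -> sreg U (g * h).
Proof.
move=> [g1 g2] [h1 h2]; split=> [x /[dup] /g1[a [b [xb e]]] /h1[a' [b' [xb' e']]]|n].
  exists (a * a'), (b * b'); split; first exact: sptM.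
  by rewrite !rmorphM -e -e'; ring.
by rewrite g2 // mul0r.
Qed.
Lemma sregN U g : sreg U g -> sreg U (- g).
Proof.
move=> [g1 g2]; split=> [x /g1[a [b [xb e]]]|n]; last by rewrite g2 // oppr0.
by exists (- a), b; rewrite rmorphN -e mulNr.
Qed.
Lemma sreg0 U : sreg U 0.
Proof. by split=> // x _; exists 0, 1; split; [exact: spt1 | rewrite mul0r rmorph0]. Qed.

(* The ring of the empty set must be zero, hence the truncation. *)
Definition scut U (g : F) : F := if pselect (U eta) then g else 0.
Lemma scut_in U g : U eta -> scut U g = g. Proof. by rewrite /scut; case: pselect. Qed.
Lemma scut_out U g : ~ U eta -> scut U g = 0. Proof. by rewrite /scut; case: pselect. Qed.
Lemma scutB U g h : scut U (g - h) = scut U g - scut U h.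
Proof. by have [h1|h1] := pselect (U eta); [rewrite !scut_in|rewrite !scut_out // subr0]. Qed.
Lemma scutM U g h : scut U (g * h) = scut U g * scut U h.
Proof. by have [h1|h1] := pselect (U eta); [rewrite !scut_in|rewrite !scut_out // mul0r]. Qed.

Lemma sreg_cut U V g : V `<=` U -> sreg U g -> sreg V (scut V g).
Proof.
move=> VU [g1 g2]; split=> [x Vx|n]; last by rewrite scut_out.
by rewrite scut_in; [apply: g1; apply: VU | apply: eta_in Vx].
Qed.
Lemma sreg_fr U a : sreg U (scut U (fr a)).
Proof.
split=> [x Ux|n]; last by rewrite scut_out.
by exists a, 1; split; [exact: spt1|rewrite rmorph1 mulr1 scut_in //; apply: eta_in Ux].
Qed.
Lemma sreg_sub U (s : ssec U) g : ~ U eta -> sval s = g -> g = 0.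
Proof. by move=> n <-; case: (svalP s) => _; apply. Qed.

Definition ssec0 U : ssec U := exist _ 0 (sreg0 U).
Definition ssecD U (s t : ssec U) : ssec U := exist _ _ (sregD (svalP s) (svalP t)).
Definition ssecN U (s : ssec U) : ssec U := exist _ _ (sregN (svalP s)).
Definition ssecM U (s t : ssec U) : ssec U := exist _ _ (sregM (svalP s) (svalP t)).
Definition sfr U (a : R) : ssec U := exist _ _ (sreg_fr U a).

Lemma ssecDA U : associative (@ssecD U). Proof. by move=> s t r; apply: ssec_eq; apply: addrA. Qed.
Lemma ssecDC U : commutative (@ssecD U). Proof. by move=> s t; apply: ssec_eq; apply: addrC. Qed.
Lemma ssecD0 U : left_id (ssec0 U) (@ssecD U). Proof. by move=> s; apply: ssec_eq; apply: add0r. Qed.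
Lemma ssecDN U : left_inverse (ssec0 U) (@ssecN U) (@ssecD U).
Proof. by move=> s; apply: ssec_eq; apply: addNr. Qed.
HB.instance Definition _ U := GRing.isZmodule.Build (ssec U) (@ssecDA U) (@ssecDC U) (@ssecD0 U) (@ssecDN U).
Lemma ssecMA U : associative (@ssecM U). Proof. by move=> s t r; apply: ssec_eq; apply: mulrA. Qed.
Lemma ssecMC U : commutative (@ssecM U). Proof. by move=> s t; apply: ssec_eq; apply: mulrC. Qed.
Lemma ssecM1 U : left_id (sfr U 1) (@ssecM U).
Proof.
move=> s; apply: ssec_eq; rewrite /= rmorph1; have [h1|n] := pselect (U eta).
  by rewrite scut_in // mul1r.
by rewrite scut_out // mul0r; apply/esym/(sreg_sub n).
Qed.
Lemma ssecMD U : left_distributive (@ssecM U) (@ssecD U).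
Proof. by move=> s t r; apply: ssec_eq; apply: mulrDl. Qed.
HB.instance Definition _ U := GRing.Zmodule_isComPzRing.Build (ssec U) (@ssecMA U) (@ssecMC U) (@ssecM1 U) (@ssecMD U).

Definition sres U V (hVU : V `<=` U) (s : ssec U) : ssec V :=
  exist _ _ (sreg_cut hVU (svalP s)).
Lemma sres_zmod U V (hVU : V `<=` U) : zmod_morphism (sres hVU).
Proof. by move=> s t; apply: ssec_eq; apply: scutB. Qed.
Lemma sres_monoid U V (hVU : V `<=` U) : monoid_morphism (sres hVU).
Proof.
split=> [|s t]; apply: ssec_eq; last exact: scutM.
by rewrite /=; have [h1|h1] := pselect (V eta); [rewrite !scut_in //; apply: hVU|rewrite !(scut_out _ h1)].
Qed.
HB.instance Definition _ U V (hVU : V `<=` U) :=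
  GRing.isZmodMorphism.Build (ssec U) (ssec V) (sres hVU) (sres_zmod hVU).
HB.instance Definition _ U V (hVU : V `<=` U) :=
  GRing.isMonoidMorphism.Build (ssec U) (ssec V) (sres hVU) (sres_monoid hVU).

Lemma sfr_zmod U : zmod_morphism (sfr U).
Proof. by move=> s t; apply: ssec_eq; rewrite /= rmorphB scutB. Qed.
Lemma sfr_monoid U : monoid_morphism (sfr U).
Proof. by split=> // s t; apply: ssec_eq; rewrite /= rmorphM scutM. Qed.
HB.instance Definition _ U := GRing.isZmodMorphism.Build R (ssec U) (sfr U) (sfr_zmod U).
HB.instance Definition _ U := GRing.isMonoidMorphism.Build R (ssec U) (sfr U) (sfr_monoid U).

Definition sscal U : {rmorphism k -> ssec U} := [the {rmorphism k -> ssec U} of sfr U \o cst].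

Lemma scut_cut U V g : V `<=` U -> scut V (scut U g) = scut V g.
Proof.
by move=> VU; have [h1|h1] := pselect (V eta); [rewrite !scut_in //; apply: VU|rewrite !(scut_out _ h1)].
Qed.

Lemma sglue U (J : Type) (V : J -> open_set spt) (hV : forall j, V j `<=` U) (s : forall j, ssec (V j)) :
  (forall x, U x -> exists j, V j x) ->
  (forall i j W (hi : W `<=` V i) (hj : W `<=` V j), sres hi (s i) = sres hj (s j)) ->
  exists! t : ssec U, forall j, sres (hV j) t = s j.
Proof.
move=> cov cmp; have [Uh|n] := pselect (U eta); last first.
  exists (ssec0 U); split=> [j|t _].
    have nj : ~ V j eta by move/(hV j).
    by apply: ssec_eq; rewrite /= scut_out //; apply/esym/(sreg_sub nj).
  by apply: ssec_eq; apply/esym/(sreg_sub n).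
have [j0 Vh] := cov _ Uh.
have same j : V j eta -> sval (s j) = sval (s j0).
  move=> Vjh; pose W := OpenSet (openI (oset_open (V j)) (oset_open (V j0))).
  have Wh : W eta by [].
  have hi : W `<=` V j by move=> x []. have hj : W `<=` V j0 by move=> x [].
  by have := congr1 sval (cmp j j0 W hi hj); rewrite /= !scut_in.
have rg : sreg U (sval (s j0)).
  split=> // x /cov[j Vjx]; rewrite -(same j (eta_in Vjx)).
  by case: (svalP (s j)) => + _; apply.
exists (exist _ _ rg); split=> [j|t ht]; last first.
  by apply: ssec_eq; have := congr1 sval (ht j0); rewrite /= scut_in.
apply: ssec_eq; rewrite /=; have [Vjh|nj] := pselect (V j eta); first by rewrite scut_in // same.
by rewrite scut_out //; apply/esym/(sreg_sub nj).
Qed.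

Definition spec_ringed : ringed_space k.
Proof.
refine (@RingedSpace k spt ssec (fun U V hVU => [the {rmorphism _ -> _} of sres hVU]) sscal _ _ _ _).
- move=> U hU s; apply: ssec_eq; rewrite /=; have [h1|n] := pselect (U eta); first by rewrite scut_in.
  by rewrite scut_out //; apply/esym/(sreg_sub n).
- by move=> U V W hVU hWV hWU s; apply: ssec_eq; apply: scut_cut.
- by move=> U V hVU a; apply: ssec_eq; apply: scut_cut.
exact: sglue.
Defined.

Lemma ssec_rep U x (s : ssec U) : U x -> exists a b, ~ sval x b /\ sval s * fr b = fr a.
Proof. by case: (svalP s) => + _; apply. Qed.

Lemma open_D (f : R) : open [set x : spt | ~ sval x f].
Proof. by move=> x xf; exists f. Qed.
Definition DD f : open_set spt := OpenSet (@open_D f).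

Lemma spec_unit U x (s : ssec U) a b : U x -> ~ sval x b -> sval s * fr b = fr a ->
  @unit_at k spec_ringed x U s <-> ~ sval x a.
Proof.
move=> Ux xb e; split=> [[V [hVU [t [Vx]]]]|xa].
  move=> /(congr1 sval) /= ; rewrite rmorph1 !scut_in; try exact: eta_in Vx.
  have [c [d [xd et]]] := ssec_rep t Vx => h xa.
  have : sval x (a * c) by apply: sptMr.
  have -> : a * c = b * d.
    apply/eqP; rewrite -subr_eq0; apply/eqP/fr_eq0.
    by rewrite rmorphB !rmorphM -e -et mulrACA h mul1r subrr.
  exact: sptM.
pose V := OpenSet (openI (oset_open U) (oset_open (DD (a * b)))).
have Vx : V x by split=> //; apply: sptM.
have hV : V `<=` U by move=> y [].
have a0 := fr_neq0 (spt_neq0 xa).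
have rt : sreg V (fr b / fr a).
  split=> [y [_ yab]|n]; last by case: n; apply: eta_in Vx.
  by exists b, a; split; [move=> ya; apply: yab; apply: sptMr | rewrite divfK].
exists V, hV, (exist _ _ rt); split=> //; apply: ssec_eq; rewrite /= rmorph1 !scut_in; try exact: eta_in Vx.
by rewrite mulrA e divff.
Qed.

Lemma spec_local : locally_ringed spec_ringed.
Proof.
move=> x U Ux; split.
  move=> /(congr1 sval) /=; rewrite rmorph1 scut_in; last exact: eta_in Ux.
  by move/eqP; rewrite oner_eq0.
move=> s t; have [a [b [xb e]]] := ssec_rep s Ux; have [c [d [xd e']]] := ssec_rep t Ux.
have est : sval (s + t) * fr (b * d) = fr (a * d + c * b).
  by rewrite rmorphD !rmorphM -e -e' /=; ring.
rewrite (spec_unit Ux (sptM xb xd) est) (spec_unit Ux xb e) (spec_unit Ux xd e') => h.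
apply: contrapT => /not_orP[/contrapT xa /contrapT xc]; apply: h.
by apply: sptD; apply: sptMr.
Qed.

Local Notation T := (open_setT spt).

(** The denominators of [g] form an ideal. If it contained no power of [f * delta], a prime
    containing it and avoiding these powers would be a point of [D(f)] at which [g] is not
    regular. *)
Lemma spec_denominators (g : F) f : (forall x, ~ sval x f -> exists a b, ~ sval x b /\ g * fr b = fr a) ->
  exists r a, g * fr ((f * delta) ^+ r) = fr a.
Proof.
move=> hg; apply: contrapT => hn.
have [|||r [a]|P [pP IP nP]] := @prime_avoid R (fun b => exists a, g * fr b = fr a) (f * delta).
- by exists 0; rewrite rmorph0 mulr0.
- by move=> b b' [a e] [a' e']; exists (a + a'); rewrite !rmorphD mulrDr e e'.
- by move=> c b [a e]; exists (c * a); rewrite !rmorphM -e; ring.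
- by move=> e; apply: hn; exists r, a.
have [_ _ PM _ _] := pP.
have Pd : ~ P delta by move=> h; apply: (nP 1%N); rewrite expr1; apply: PM.
have [h|a [b [h e]]] := hg (exist _ P (conj pP Pd)).
  by apply: (nP 1%N); rewrite expr1 mulrC; apply: PM.
by apply: h; apply: IP; exists a.
Qed.

Lemma spec_affine : @affine_open k spec_ringed T.
Proof.
have uf x f : @unit_at k spec_ringed x T (sfr T f) <-> ~ sval x f.
  by apply: (@spec_unit T x (sfr T f) f 1); [|exact: spt1|rewrite /= scut_in // rmorph1 mulr1].
split.
- move=> x y _ _ h; apply: spt_eq; apply/funext => f; apply/propext.
  have := h (sfr T f); rewrite !uf => hf.
  by split=> h'; apply: contrapT => /hf.
- move=> P [P0 PD PM P1 PP]; pose Q : set R := fun f => P (sfr T f).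
  have rd : sreg T (fr delta)^-1.
    split=> [x _|n]; last by case: n.
    exists 1, delta; split; first exact: spt_delta.
    by rewrite mulVf ?rmorph1 // fr_neq0.
  have Qd : ~ Q delta.
    move=> h; apply: P1; have -> : 1 = (exist _ _ rd : ssec T) * sfr T delta.
      by apply: ssec_eq; rewrite /= !scut_in // rmorph1 mulVf // fr_neq0.
    exact: (PM).
  have pQ : prime_ideal Q.
    split=> [|a b|a b||a b]; rewrite /Q ?rmorph0 ?rmorphD ?rmorphM ?rmorph1 //.
    - exact: (PD).
    - exact: (PM).
    exact: (PP).
  pose x : spt := exist _ Q (conj pQ Qd); exists x => // s.
  have [a [b [xb e]]] := ssec_rep s (I : T x).
  rewrite (spec_unit (I : T x) xb e).
  have es : sfr T b * s = sfr T a by apply: ssec_eq; rewrite /= !scut_in // mulrC.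
  split=> [Ps|/contrapT]; first by apply; rewrite /= /Q -es; apply: (PM).
  by rewrite /= {1}/Q -es => /PP[/xb|].
- move=> x V _ /sopenE[f xf fV]; exists (sfr T f); first exact/uf.
  by move=> y _ /uf /fV.
move=> s W hW hs; have [q [f ef]] : exists r a, sval s * fr ((1 * delta) ^+ r) = fr a.
  by apply: spec_denominators => x _; apply: ssec_rep.
rewrite mul1r in ef.
have hWf x : W x <-> ~ sval x f.
  by rewrite hs // (spec_unit (I : T x) (sptX (r := q) (@spt_delta x)) ef).
have dq0 r : fr delta ^+ r != 0 by rewrite expf_neq0 // fr_neq0.
(* A [W] that misses the generic point is empty; its ring of sections is zero and [s = 0], so the
   localisation property is trivial. *)
have [Wh|nW] := pselect (W eta); last first.
  have z (b : ssec W) : b = 0 by apply: ssec_eq; apply: (sreg_sub nW).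
  have f0 : f = 0 by apply: contrapT => f0; apply: nW; apply/hWf.
  have s0 : s = 0.
    apply: ssec_eq; apply/eqP; have := ef; rewrite f0 rmorph0 rmorphXn => /eqP.
    by rewrite mulf_eq0 (negPf (dq0 q)) orbF.
  split; [by exists 0; rewrite [LHS]z [RHS]z|by move=> b; exists 0, 0%N; rewrite [LHS]z [RHS]z|].
  by move=> a _; exists 1%N; rewrite s0 expr1 mul0r.
have f0 : f != 0 by apply/eqP; exact: (proj1 (hWf eta) Wh).
have s0 : sval s != 0.
  by apply/eqP => e; move: ef; rewrite e mul0r => /esym/fr_eq0/eqP; rewrite (negPf f0).
split.
- have rs : sreg W (sval s)^-1.
    split=> [x /hWf xf|n]; last by case: (n Wh).
    exists (delta ^+ q), f; split=> //.
    by rewrite -ef mulrA mulVf // mul1r.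
  by exists (exist _ _ rs); apply: ssec_eq; rewrite /= !scut_in // rmorph1 mulfV.
- move=> b; have [r [a ea]] := @spec_denominators (sval b) f (fun x xf => ssec_rep b (proj2 (hWf x) xf)).
  have sX : forall r (s : ssec T), sval (s ^+ r) = sval s ^+ r.
    by elim=> [|r' IH] s'; [rewrite /= scut_in // rmorph1 | rewrite !exprS -IH].
  (* Since [s * delta^q = f], the factor [s^r] absorbs the power of [f] in the denominator of [b];
     only powers of [delta] are left, and these vanish nowhere. *)
  have ra : sreg T (sval b * sval s ^+ r).
    split=> [x _|n]; last by case: n.
    exists a, (delta ^+ r * (delta ^+ q) ^+ r); split.
      by apply: sptM; [|rewrite -exprM]; apply: sptX; apply: spt_delta.
    rewrite -ea exprMn !rmorphM !rmorphXn -ef rmorphXn exprMn /=; ring.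
  exists (exist _ _ ra), r; apply: ssec_eq; rewrite /= scut_in //; congr (_ * _).
  have -> : (sres hW s) ^+ r = sres hW (s ^+ r) by rewrite rmorphXn.
  by rewrite /= scut_in // sX.
move=> a /(congr1 sval) /=; rewrite scut_in // => a0; exists 0%N.
by apply: ssec_eq; rewrite expr0 mul1r.
Qed.

Definition specD : scheme k.
Proof.
refine (@Scheme k spec_ringed spec_local _) => x.
by exists T => //; apply: spec_affine.
Defined.

End Spectrum.

(** * Open subschemes *)

Section OpenSubscheme.
Context (k : fieldType) (X : scheme k) (V : open_set X).

Definition subpt : Type := {x : X | V x}.
HB.instance Definition _ := gen_eqMixin subpt.
HB.instance Definition _ := gen_choiceMixin subpt.

Definition img (U : set subpt) : set X := [set x | exists2 y : subpt, U y & sval y = x].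

Lemma subpt_eq (x y : subpt) : sval x = sval y -> x = y.
Proof. by case: x y => s hs [t ht] /= e; apply: eq_exist. Qed.

Lemma img_in U (y : subpt) : img U (sval y) -> U y.
Proof. by case=> y' Uy' /subpt_eq <-. Qed.

Definition subopen (U : set subpt) : Prop := open (img U).
Lemma subopenT : subopen setT.
Proof.
rewrite /subopen (_ : img setT = V); first exact: oset_open.
by apply/seteqP; split=> [x [[y Vy] _ <-]|x Vx] //; exists (exist _ x Vx).
Qed.
Lemma subopenI : setI_closed subopen.
Proof.
move=> A B oA oB; rewrite /subopen (_ : img (A `&` B) = img A `&` img B); first exact: openI.
apply/seteqP; split=> [x [y [Ay By] <-]|x [[y Ay <-] /img_in By]]; last by exists y.
by split; exists y.
Qed.
Lemma subopen_bigU (I : Type) (f : I -> set subpt) : (forall i, subopen (f i)) -> subopen (\bigcup_i f i).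
Proof.
move=> hf; rewrite /subopen (_ : img (\bigcup_i f i) = \bigcup_i img (f i)).
  by apply: bigcup_open => i _; apply: hf.
apply/seteqP; split=> [x [y [i _ fy] <-]|x [i _ [y fy <-]]]; first by exists i => //; exists y.
by exists y => //; exists i.
Qed.
HB.instance Definition _ := isOpenTopological.Build subpt subopenT subopenI subopen_bigU.

Definition io (U : open_set subpt) : open_set X := OpenSet (oset_open U : open (img U)).
Lemma io_sub (U W : open_set subpt) : W `<=` U -> io W `<=` io U.
Proof. by move=> h x [y /h Uy <-]; exists y. Qed.
Lemma io_V U : io U `<=` V. Proof. by move=> x [[y Vy] _ <-]. Qed.

Lemma pre_openP (A : open_set X) : open [set y : subpt | A (sval y)].
Proof.
change (open (img [set y : subpt | A (sval y)])).
rewrite (_ : img _ = A `&` V); first by apply: openI; apply: oset_open.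
apply/seteqP; split=> [x [[y Vy] Ay <-]|x [Ax Vx]] //; by exists (exist _ x Vx).
Qed.
Definition pre (A : open_set X) : open_set subpt := OpenSet (pre_openP A).
Lemma io_pre A : io (pre A) `<=` A. Proof. by move=> x [y Ay <-]. Qed.
Lemma sub_io_pre (A : open_set X) : A `<=` V -> A `<=` io (pre A).
Proof. by move=> h x Ax; exists (exist _ x (h x Ax)). Qed.

Lemma sub_glue (U : open_set subpt) (J : Type) (W : J -> open_set subpt)
    (hW : forall j, W j `<=` U) (s : forall j, sections (io (W j))) :
  (forall x, U x -> exists j, W j x) ->
  (forall i j (T : open_set subpt) (hi : T `<=` W i) (hj : T `<=` W j), res (io_sub hi) (s i) = res (io_sub hj) (s j)) ->
  exists! t : sections (io U), forall j, res (io_sub (hW j)) t = s j.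
Proof.
move=> cov cmp; apply: glue => [x [y /cov[j Wy] <-]|i j T hi hj]; first by exists j, y.
have hT : T `<=` V := subset_trans hi (@io_V (W i)).
have pi' : pre T `<=` W i by move=> y /hi /img_in.
have pj : pre T `<=` W j by move=> y /hj /img_in.
have := congr1 (res (sub_io_pre hT)) (cmp i j (pre T) pi' pj).
by rewrite (res_comp _ _ hi) (res_comp _ _ hj).
Qed.

Definition sub_ringed : ringed_space k.
Proof.
refine (@RingedSpace k subpt (fun U => sections (io U)) (fun U W h => res (io_sub h))
  (fun U => scalar (io U)) _ _ _ sub_glue).
- by move=> U hU s; apply: res_id.
- by move=> U W T h1 h2 h3 s; apply: res_comp.
by move=> U W h a; apply: res_scalar.
Defined.

Lemma sub_unit (y : subpt) (U : open_set subpt) (s : sections (io U)) : U y ->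
  @unit_at k sub_ringed y U s <-> unit_at (sval y) s.
Proof.
move=> Uy; split=> [[W [hW [t [Wy e]]]]|[W [hW [t [Wy e]]]]].
  by exists (io W), (io_sub hW), t; split=> //; exists y.
have hp : pre W `<=` U by move=> z /hW /img_in.
exists (pre W), hp, (res (@io_pre W) t); split=> //.
rewrite -[LHS]/(res (io_sub hp) s * res (@io_pre W) t).
by rewrite -(res_comp hW (@io_pre W)) -rmorphM e rmorph1.
Qed.

Lemma sub_local : locally_ringed sub_ringed.
Proof.
move=> y U Uy; have Iy : io U (sval y) by exists y.
have [h1 h2] := scheme_local Iy; split=> [|s t]; first exact: h1.
by rewrite !(sub_unit _ Uy); apply: h2.
Qed.

Lemma sub_affine (U : open_set subpt) : affine_open (io U) -> @affine_open k sub_ringed U.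
Proof.
case=> a1 a2 a3 a4; split.
- move=> x y Ux Uy h; apply/subpt_eq/a1; [by exists x|by exists y|move=> s].
  by rewrite -(sub_unit s Ux) -(sub_unit s Uy).
- move=> P pP; have [_ [y Uy <-] hy] := a2 P pP; exists y => // s.
  by rewrite sub_unit.
- move=> x W Ux Wx; have [||s s1 s2] := a3 (sval x) (io W); [by exists x|by exists x|].
  exists s; first exact/sub_unit.
  by move=> y Uy /(sub_unit s Uy) hy; apply: img_in; apply: s2 => //; exists y.
move=> s W hW hs; apply: a4 => x [y Uy <-]; rewrite -(sub_unit s Uy) -hs //.
by split=> [/img_in|Wy] //; exists y.
Qed.

Definition subscheme : scheme k.
Proof.
refine (@Scheme k sub_ringed sub_local _) => y.
have [U [Uy UV aU]] := affine_nbhd (svalP y : V (sval y)).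
exists (pre U) => //; apply: sub_affine; suff -> : io (pre U) = U by [].
by apply: open_set_eq => x; split=> [/io_pre|] //; apply: sub_io_pre.
Defined.

Lemma sub_incl_cont : continuous (sval : subscheme -> X).
Proof. by apply/continuousP => A oA; apply: (pre_openP (OpenSet oA)). Qed.

Lemma sub_incl_sub (U : open_set X) (W : open_set subscheme) :
  W `<=` (sval : subscheme -> X) @^-1` U -> io W `<=` U.
Proof. by move=> h x [y /h Uy <-]. Qed.

Definition sub_incl : morphism subscheme X.
Proof.
refine (@Morphism k subscheme X sval sub_incl_cont (fun U W h => res (sub_incl_sub h)) _ _ _).
- move=> U U' W W' h1 h2 h3 h4 s.
  by rewrite -[LHS]/(res (io_sub h4) (res (sub_incl_sub h1) s)) !(res_comp _ _ (subset_trans (sub_incl_sub h2) h3)).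
- by move=> U W h a; exact: (res_scalar (sub_incl_sub h) a).
move=> U W h z s Wz /(sub_unit (res (sub_incl_sub h) s) Wz) /(unit_res (sub_incl_sub h) s) hu.
by apply: hu; exists z.
Defined.

End OpenSubscheme.

(** * Morphisms to a spectrum from ring maps *)

Section MorphismToSpectrum.
Context (k : fieldType) (R : idomainType) (cst : {rmorphism k -> R}).
Context (F : fieldType) (fr : {rmorphism R -> F}) (delta : R).
Hypothesis fr_eq0 : forall a, fr a = 0 -> a = 0.
Hypothesis delta0 : delta != 0.
Context (X : scheme k) (g : {rmorphism R -> sections (open_setT X)}).
Hypothesis g_cst : forall a, g (cst a) = scalar (open_setT X) a.
Hypothesis g_delta : exists t, g delta * t = 1.
Local Notation Z := (specD cst fr_eq0 delta0).
Implicit Types (W : open_set X) (U : open_set Z).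

Lemma subT W : W `<=` open_setT X. Proof. by []. Qed.
Definition gr W : {rmorphism R -> sections W} := [the {rmorphism _ -> _} of res (@subT W) \o g].

Lemma gr_res W W' (h : W' `<=` W) a : res h (gr W a) = gr W' a.
Proof. exact: res_comp. Qed.
Lemma gr_unit W x a : W x -> unit_at x (gr W a) <-> unit_at x (g a).
Proof. exact: unit_res. Qed.

Lemma point_prime (x : X) : prime_ideal [set a | ~ unit_at x (g a)] /\ ~ [set a | ~ unit_at x (g a)] delta.
Proof.
have Tx : open_setT X x by [].
split=> /=; last by case: g_delta => t /(unit_at_inv Tx) hu; apply.
split=> /= [|a b ha hb|a b hb|h|a b].
- by rewrite rmorph0; apply: vanish0.
- by rewrite rmorphD; apply: vanishD.
- by rewrite rmorphM; apply: vanishM.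
- by apply: h; rewrite rmorph1; apply: contrapT; apply: vanish1.
rewrite rmorphM => h; apply: contrapT => /not_orP[/contrapT ha /contrapT hb].
exact/h/unit_atMM.
Qed.
Definition to_spec (x : X) : Z := exist _ _ (point_prime x).

Lemma to_spec_cont : continuous to_spec.
Proof.
apply/continuousP => A oA; rewrite openE => x /= Ax.
have [f xf fA] := oA _ Ax; have uf : unit_at x (g f) by apply: contrapT.
rewrite /interior /=; apply: (@filterS _ _ _ [set y | open_setT X y /\ unit_at y (g f)]).
  by move=> y [_ uy]; apply: fA => /= h; apply: h.
by apply: open_nbhs_nbhs; split; [exact: unit_at_open | split].
Qed.

(** [t] is to be the image of the fraction [s]. All representations [a / b] are quantified over,
    with no condition on the zeros of [b], which makes the relation stable under restriction;
    [cleared_local] reduces it to one good fraction near each point. *)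
Definition cleared U W (s : sections U) (t : sections W) : Prop :=
  forall a b, sval s * fr b = fr a -> gr W b * t = gr W a.

Lemma cancel_unit W (c : R) (t t' : sections W) : (forall x, W x -> unit_at x (g c)) ->
  gr W c * t = gr W c * t' -> t = t'.
Proof.
move=> hc e; apply: sec_eq => x Wx; have /(gr_unit c Wx)[V [hV [u [Vx eu]]]] := hc x Wx.
exists V, hV; split=> //; rewrite -[LHS]mul1r -[RHS]mul1r -eu ![_ * u]mulrC -!mulrA.
by rewrite -!rmorphM e.
Qed.

Lemma cleared_local U W (hW : W `<=` to_spec @^-1` U) (s : sections U) (t : sections W) :
  (forall x, W x -> exists a b (V : open_set X) (hV : V `<=` W),
     [/\ V x, ~ sval (to_spec x) b, sval s * fr b = fr a & gr V b * res hV t = gr V a]) ->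
  cleared s t.
Proof.
move=> hloc a b e; apply: sec_eq => x Wx; have [a0 [b0 [V [hV [Vx xb e0 et]]]]] := hloc x Wx.
have ub : unit_at x (g b0) by apply: contrapT.
pose V' := opI V (basic (g b0)); have hV' : V' `<=` V := @opIl _ _ V _.
exists V', (subset_trans hV' hV); split=> //.
apply: (@cancel_unit V' b0); first by move=> y [_ []].
rewrite -(res_comp hV hV') -[in RHS](res_comp hV hV') -!(gr_res hV') -!rmorphM !gr_res; congr (res _ _).
rewrite rmorphM gr_res mulrCA et -!rmorphM; congr (gr V _).
by apply/eqP; rewrite -subr_eq0; apply/eqP/fr_eq0; rewrite rmorphB !rmorphM -e -e0; ring.
Qed.

Lemma cleared_rep U W (hW : W `<=` to_spec @^-1` U) (s : sections U) x : W x ->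
  exists a b, ~ sval (to_spec x) b /\ sval s * fr b = fr a.
Proof. by move=> /hW; apply: ssec_rep. Qed.

Lemma cleared_uniq U W (hW : W `<=` to_spec @^-1` U) (s : sections U) (t t' : sections W) :
  cleared s t -> cleared s t' -> t = t'.
Proof.
move=> h h'; apply: sec_eq => x Wx; have [a [b [xb e]]] := cleared_rep hW s Wx.
have ub : unit_at x (g b) by apply: contrapT.
pose V := opI W (basic (g b)); have hV : V `<=` W := @opIl _ _ W _.
exists V, hV; split=> //; apply: (@cancel_unit V b); first by move=> y [_ []].
by rewrite -!(gr_res hV) -!rmorphM (h _ _ e) (h' _ _ e).
Qed.

Lemma cleared_quot U W (s : sections U) a b (u : sections W) :
  sval s * fr b = fr a -> gr W b * u = 1 -> cleared s (u * gr W a).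
Proof.
move=> e eu a' b' e'; transitivity (u * gr W (b' * a)); first by rewrite rmorphM mulrCA.
have -> : b' * a = a' * b.
  by apply/eqP; rewrite -subr_eq0; apply/eqP/fr_eq0; rewrite rmorphB !rmorphM -e -e'; ring.
by rewrite rmorphM mulrCA [u * _]mulrC eu mulr1.
Qed.

Lemma cleared_ex U W (hW : W `<=` to_spec @^-1` U) (s : sections U) :
  exists t : sections W, cleared s t.
Proof.
(* The cover consists of all open sets that carry a cleared section, together with that section;
   [cleared_uniq] gives the gluing condition. *)
pose T := {V : open_set X & {hV : V `<=` W & {t : sections V | cleared s t}}}.
pose V (j : T) := projT1 j; pose hV (j : T) : V j `<=` W := projT1 (projT2 j).
pose t (j : T) : sections (V j) := sval (projT2 (projT2 j)).
have ct j : cleared s (t j) := svalP (projT2 (projT2 j)).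
have res_c (V1 V2 : open_set X) (h : V2 `<=` V1) (t1 : sections V1) : cleared s t1 -> cleared s (res h t1).
  by move=> h1 a b e; rewrite -!(gr_res h) -rmorphM (h1 a b e).
have [x Wx|i j W' hi hj|r [hr _]] := @glue _ _ W T V hV t.
- have [a [b [xb e]]] := cleared_rep hW s Wx.
  have /(gr_unit b Wx)[V0 [hV0 [u [V0x eu]]]] : unit_at x (g b) by apply: contrapT.
  rewrite gr_res in eu; have cu := cleared_quot e eu.
  by exists (existT _ V0 (existT _ hV0 (exist _ _ cu))).
- have hW' : W' `<=` to_spec @^-1` U by move=> y /hi /hV; apply: hW.
  by apply: (@cleared_uniq U W' hW' s); apply: res_c; apply: ct.
exists r => a b e; apply: sec_eq => x Wx; have [a0 [b0 [xb e0]]] := cleared_rep hW s Wx.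
have /(gr_unit b0 Wx)[V0 [hV0 [u [V0x eu]]]] : unit_at x (g b0) by apply: contrapT.
rewrite gr_res in eu; have cu := cleared_quot e0 eu.
pose j : T := existT _ V0 (existT _ hV0 (exist _ _ cu)).
exists V0, hV0; split=> //; rewrite rmorphM !(gr_res hV0) (hr j : res hV0 r = _).
exact: (cu a b e).
Qed.

Definition spec_map U W (hW : W `<=` to_spec @^-1` U) (s : sections U) : sections W :=
  sval (cid (cleared_ex hW s)).
Lemma spec_mapP U W (hW : W `<=` to_spec @^-1` U) s : cleared s (spec_map hW s).
Proof. exact: svalP (cid _). Qed.

Lemma spec_map_zmod U W (hW : W `<=` to_spec @^-1` U) : zmod_morphism (spec_map hW).
Proof.
move=> s t; apply: (@cleared_uniq U W hW (s - t)); first exact: spec_mapP.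
apply: (cleared_local hW) => x Wx; have [a [b [xb e]]] := cleared_rep hW s Wx.
have [a' [b' [xb' e']]] := cleared_rep hW t Wx.
exists (a * b' - a' * b), (b * b'), W, (fun y h => h); split=> //; first exact: sptM.
  by rewrite rmorphB !rmorphM -e -e' /=; ring.
rewrite res_id rmorphB !rmorphM -(@spec_mapP _ _ hW _ _ _ e) -(@spec_mapP _ _ hW _ _ _ e'); ring.
Qed.
Lemma spec_map_monoid U W (hW : W `<=` to_spec @^-1` U) : monoid_morphism (spec_map hW).
Proof.
split=> [|s t].
  apply: (@cleared_uniq U W hW 1); first exact: spec_mapP.
  apply: (cleared_local hW) => x Wx; have Ux : U (to_spec x) := hW x Wx.
  exists 1, 1, W, (fun y h => h); split=> //; first exact: spt1.
    by rewrite /= scut_in ?rmorph1 ?mul1r //; apply: eta_in Ux.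
  by rewrite rmorph1 rmorph1 mulr1.
apply: (@cleared_uniq U W hW (s * t)); first exact: spec_mapP.
apply: (cleared_local hW) => x Wx; have [a [b [xb e]]] := cleared_rep hW s Wx.
have [a' [b' [xb' e']]] := cleared_rep hW t Wx.
exists (a * a'), (b * b'), W, (fun y h => h); split=> //; first exact: sptM.
  by rewrite !rmorphM -e -e' /=; ring.
rewrite res_id !rmorphM -(@spec_mapP _ _ hW _ _ _ e) -(@spec_mapP _ _ hW _ _ _ e'); ring.
Qed.
HB.instance Definition _ U W (hW : W `<=` to_spec @^-1` U) :=
  GRing.isZmodMorphism.Build (sections U) (sections W) (spec_map hW) (spec_map_zmod hW).
HB.instance Definition _ U W (hW : W `<=` to_spec @^-1` U) :=
  GRing.isMonoidMorphism.Build (sections U) (sections W) (spec_map hW) (spec_map_monoid hW).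

Lemma spec_map_fr U W (hW : W `<=` to_spec @^-1` U) a : spec_map hW (sfr fr delta0 U a) = gr W a.
Proof.
apply: sec_eq => x Wx; exists W, (fun y h => h); split=> //; congr (res _ _).
have := @spec_mapP U W hW (sfr fr delta0 U a) a 1; rewrite !rmorph1 mul1r; apply.
by rewrite /= mulr1 scut_in //; apply: eta_in (hW x Wx).
Qed.

Definition spec_morphism : morphism X Z.
Proof.
refine (@Morphism k X Z to_spec to_spec_cont (fun U W hW => [the {rmorphism _ -> _} of spec_map hW]) _ _ _).
- move=> U U' W W' hW hW' hU hWW s /=.
  apply: (@cleared_uniq U' W' hW' (sres hU s)); last exact: spec_mapP.
  apply: (cleared_local hW') => x Wx; have [a [b [xb e]]] := cleared_rep hW s (hWW x Wx).
  exists a, b, W', (fun y h => h); split=> //.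
    by rewrite /= scut_in //; apply: eta_in (hW' x Wx).
  by rewrite res_id -!(gr_res hWW) -rmorphM (@spec_mapP _ _ hW _ _ _ e).
- by move=> U W hW a; rewrite -[LHS]/(spec_map hW (sfr fr delta0 U (cst a))) spec_map_fr /= g_cst res_scalar.
move=> U W hW x s Wx; have [a [b [xb e]]] := cleared_rep hW s Wx.
move=> us; apply/(@spec_unit k R cst F fr delta fr_eq0 delta0 U _ s a b (hW x Wx) xb e) => /=; apply.
apply/(gr_unit a Wx); rewrite -(@spec_mapP _ _ hW _ _ _ e); apply: unit_atMM => //.
by apply/(gr_unit b Wx); apply: contrapT.
Defined.

End MorphismToSpectrum.

(** * The parameter space and its universal family *)

Section Box.
Context (m n : nat) (J : borel m n).
Local Notation B := (m + n).+1.

Lemma tau_box (A : comPzRingType) (t t' : nat -> nat -> nat -> nat -> A) :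
  (forall a b c d : 'I_B, t a b c d = t' a b c d) ->
  forall (i : 'I_m) j (p : 'I_m) (q : 'I_n), tau J t i j p q = tau J t' i j p q.
Proof.
move=> e i j p q; apply: eq_bigr => s _; rewrite /tcoef; case: ifP => // _.
have im := ltn_ord i; have pm := ltn_ord p; have qn := ltn_ord q.
have sl : (s < n)%N by have := ltn_ord s; have := lam_le J i; clear; lia.
set p' := if _ then _ else _; set q' := if _ then _ else _.
have h1 : (i + s < B)%N by move: im sl; clear; lia.
have h2 : (lam J i - s.+1 < B)%N by have := lam_le J i; clear; lia.
have h3 : (p' < B)%N by rewrite /p'; case: ifP => _; move: im sl pm; clear; lia.
have h4 : (q' < B)%N by rewrite /q'; case: ifP => _; have := lam_le J i; move: qn; clear; lia.
exact: (e (Ordinal h1) (Ordinal h2) (Ordinal h3) (Ordinal h4)).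
Qed.

(** The rows and columns met along a staircase have index at most [m + n], so finitely many
    parameters determine the ideal and the parameter ring is a polynomial ring in finitely many
    variables. *)
Lemma nf_box (A : comNzRingType) (t t' : nat -> nat -> nat -> nat -> A) p :
  (forall a b c d : 'I_B, t a b c d = t' a b c d) -> nf J t p = nf J t' p.
Proof.
move=> e; have key w u : nfk J t w u = nfk J t' w u.
  elim: w u => [//|w IH] u /=; case: ifP => // _; case: pickP => // -[i j] _.
  apply: eq_bigr => a _; apply: eq_bigr => b _; rewrite IH; congr (_ *: _).
  exact: tau_box.
by rewrite /nf /lext; apply: eq_bigr => u _; rewrite /nfu key.
Qed.

Lemma inCI_box (A : comPzRingType) (D E : datum m n A) d c : dG D = dG E ->
  (forall a b c d : 'I_B, dt D a b c d = dt E a b c d) -> inCI J D d c -> inCI J E d c.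
Proof.
move=> eG et h hA; have := h hA; rewrite /CI /cnf /= eG => e.
by rewrite -[LHS](nf_box (A := nzr hA) (t := dt D)).
Qed.

End Box.

Section Universal.
Context (m n : nat) (J : borel m n) (k : fieldType).
Local Notation N := (m + n)%N.
Local Notation B := (m + n).+1.

Definition param : finType := (('I_m * 'I_m) + ('I_n * 'I_n) + ('I_B * 'I_B * 'I_B * 'I_B))%type.
Definition pring : idomainType := {mpoly k[#|param|]}.
Definition pcst : {rmorphism k -> pring} := [the {rmorphism k -> pring} of @mpolyC #|param| k].
Definition pvar (t : param) : pring := 'X_(enum_rank t).

Definition pgx : 'M[pring]_m := \matrix_(i, j) pvar (inl (inl (i, j))).
Definition pgy : 'M[pring]_n := \matrix_(i, j) pvar (inl (inr (i, j))).
Definition pdelta : pring := \det pgx * \det pgy.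

Section Values.
Context (A : comNzRingType) (s : {rmorphism k -> A}) (v : param -> A).
Definition pval : {rmorphism pring -> A} :=
  [the {rmorphism pring -> A} of @mmap #|param| k A s (fun i => v (enum_val i))].
Lemma pval_var t : pval (pvar t) = v t.
Proof. by rewrite /= mmapX mmap1U enum_rankK. Qed.
Lemma pval_cst a : pval (pcst a) = s a.
Proof. exact: mmapC. Qed.
End Values.

Lemma pdelta0 : pdelta != 0.
Proof.
pose v (t : param) : k := match t with
  | inl (inl (i, j)) => (i == j)%:R | inl (inr (i, j)) => (i == j)%:R | inr _ => 0 end.
pose e := pval idfun v.
have e1 : map_mx e pgx = 1%:M by apply/matrixP => i j; rewrite !mxE pval_var.
have e2 : map_mx e pgy = 1%:M by apply/matrixP => i j; rewrite !mxE pval_var.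
apply/eqP => /(congr1 e); rewrite rmorphM rmorph0 -!det_map_mx e1 e2 !det1 mulr1 => /eqP.
by rewrite oner_eq0.
Qed.

Lemma blk_block (A : pzRingType) (a : 'M[A]_m) (b : 'M[A]_n) : blk (block_mx a 0 0 b).
Proof.
move=> i j; move: i j; apply: var_cases => i; apply: var_cases => j; rewrite ?bideg_vx ?bideg_vy // => _.
  by rewrite block_mxEur mxE.
by rewrite block_mxEdl mxE.
Qed.

Lemma blk_split (A : pzRingType) (G : 'M[A]_N) : blk G -> G = block_mx (ulsubmx G) 0 0 (drsubmx G).
Proof.
move=> bG; rewrite -[LHS]submxK; congr block_mx; apply/matrixP => i j; rewrite !mxE.
  by apply: (bG (vx n i) (vy m j)); rewrite bideg_vx bideg_vy.
by apply: (bG (vy m i) (vx n j)); rewrite bideg_vx bideg_vy.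
Qed.

(** Multiplying each adjugate by the determinant of the other block gives the inverse a single
    common denominator [pdelta]. *)
Lemma param_datum (A : comPzRingType) (f : {rmorphism pring -> A}) (u : A) :
  f pdelta * u = 1 -> exists D : datum m n A,
  [/\ dG D = map_mx f (block_mx pgx 0 0 pgy) &
      forall a b c d : 'I_B, dt D a b c d = f (pvar (inr (a, b, c, d)))].
Proof.
move=> hu; pose G := map_mx f (block_mx pgx 0 0 pgy).
pose H := u *: map_mx f (block_mx (\det pgy *: \adj pgx) 0 0 (\det pgx *: \adj pgy)).
have e1 : (block_mx pgx 0 0 pgy) *m block_mx (\det pgy *: \adj pgx) 0 0 (\det pgx *: \adj pgy) = pdelta%:M.
  rewrite mulmx_block !mulmx0 !mul0mx !addr0 !add0r -!scalemxAr !mul_mx_adj !scale_scalar_mx.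
  by rewrite [\det pgy * _]mulrC scalar_mx_block.
have e2 : block_mx (\det pgy *: \adj pgx) 0 0 (\det pgx *: \adj pgy) *m (block_mx pgx 0 0 pgy) = pdelta%:M.
  rewrite mulmx_block !mulmx0 !mul0mx !addr0 !add0r -!scalemxAl !mul_adj_mx !scale_scalar_mx.
  by rewrite [\det pgy * _]mulrC scalar_mx_block.
have GH : G *m H = 1%:M.
  by rewrite /G /H -scalemxAr -map_mxM e1 map_scalar_mx scale_scalar_mx mulrC hu.
have HG : H *m G = 1%:M.
  by rewrite /G /H -scalemxAl -map_mxM e2 map_scalar_mx scale_scalar_mx mulrC hu.
have bG : blk G by rewrite /G map_block_mx !map_mx0; apply: blk_block.
have bH : blk H.
  move=> i j /(@blk_block pring (\det pgy *: \adj pgx) (\det pgx *: \adj pgy)) e.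
  by rewrite /H mxE mxE e rmorph0 mulr0.
pose t a b c d : A := if insub a is Some a' then if insub b is Some b' then
  if insub c is Some c' then if insub d is Some d' then
    f (pvar (inr (a', b', c', d'))) else 0 else 0 else 0 else 0.
exists (@Datum m n A G H t bG bH GH HG); split=> // a b c d.
by rewrite /= /t !valK.
Qed.

End Universal.

Section LocalSection.
Context (m n : nat) (J : borel m n) (k : fieldType) (h : int * int -> nat).
Hypothesis hJ : forall d, size (stds J d) = h d.
Local Notation B := (m + n).+1.
Local Notation R := (pring m n k).
Local Notation delta := (pdelta m n k).
Local Notation F := {fraction R}.
Definition tofr : {rmorphism R -> F} := [the {rmorphism R -> F} of @tofrac R].
Lemma tofr_eq0 a : tofr a = 0 -> a = 0.
Proof. by move/eqP; rewrite tofrac_eq0 => /eqP. Qed.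
Definition Z0 : scheme k := specD (pcst m n k) tofr_eq0 (pdelta0 m n k).
Definition z0fr : {rmorphism R -> sections (open_setT Z0)} :=
  [the {rmorphism _ -> _} of sfr tofr (pdelta0 m n k) (open_setT Z0)].

Lemma z0_unit : exists u, z0fr delta * u = 1.
Proof.
have d0 : tofr delta != 0 by apply/eqP => /tofr_eq0/eqP; rewrite (negPf (pdelta0 m n k)).
have rd : sreg tofr (pdelta0 m n k) (open_setT Z0) (tofr delta)^-1.
  split=> [x _|n0]; last by case: n0.
  by exists 1, delta; split; [exact: spt_delta | rewrite mulVf ?rmorph1].
exists (exist _ _ rd); apply: ssec_eq.
by rewrite /= !scut_in // rmorph1 mulfV.
Qed.

Lemma universal_family : exists (F0 : hilb_family m n h Z0) (D : datum m n (sections (open_setT Z0))),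
  [/\ charted J F0 D, dG D = map_mx z0fr (block_mx (pgx m n k) 0 0 (pgy m n k)) &
      forall a b c d : 'I_B, dt D a b c d = z0fr (pvar k (inr (a, b, c, d)))].
Proof.
have [u hu] := z0_unit; have [D [eG et]] := param_datum hu.
pose P (V : open_set Z0) (E : datum m n (sections V)) :=
  exists hV : V `<=` open_setT Z0, E = map_datum (res hV) D.
have hT : open_setT Z0 `<=` open_setT Z0 by [].
have DT : map_datum (res hT) D = D by apply: map_datum_id.
have [F0 hF0] : exists F0 : hilb_family m n h Z0, forall V D, @P V D -> charted J F0 D.
  apply: (glue_family hJ) => [z|V _ V' _ [hV ->] [hV' ->] W h1 h2 d c hc].
    by exists (open_setT Z0), (map_datum (res hT) D); split=> //; exists hT.
  have hW : W `<=` open_setT Z0 by [].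
  by rewrite !(map_datum_res _ _ hW).
exists F0, D; split=> //; rewrite -DT; apply: hF0; by exists hT.
Qed.

Context (H : scheme k) (I : hilb_family m n h H).
Hypothesis univ : forall (Z : scheme k) (K : hilb_family m n h Z), exists f : morphism Z H,
  is_pullback f I K /\ forall g : morphism Z H, is_pullback g I K -> same_morphism f g.
Hypothesis hI : chartable J I.

(** A chart on [V] is a ring map from the parameter ring, hence a morphism [tau] along which the
    universal family pulls back to the restriction of [I]. Uniqueness of classifying morphisms
    identifies [phi] after [tau] with the inclusion. *)
Theorem local_sections : exists phi : morphism Z0 H, forall x : H,
  exists (V : open_set H) (tau : morphism (subscheme V) Z0), V x /\ is_comp phi tau (sub_incl V).
Proof.
have [F0 [DU [cU eG et]]] := universal_family.
have [phi [hphi _]] := univ F0; exists phi => x; have [V [D [Vx cD]]] := hI x.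
exists V; pose X := subscheme V; pose j := sub_incl V; pose y : X := exist _ x Vx.
have hT : open_setT X `<=` j @^-1` V by case=> z Vz _; exact: Vz.
pose D0 := map_datum (comor hT) D.
have Ty : open_setT X y by [].
have hA : (1 : sections (open_setT X)) != 0 by apply/eqP; have [] := scheme_local Ty.
pose v (t : param m n) : nzr hA := match t with
  | inl (inl (i, i')) => dG D0 (lshift n i) (lshift n i')
  | inl (inr (i, i')) => dG D0 (rshift m i) (rshift m i')
  | inr (a, b, c, d) => dt D0 a b c d end.
pose g : {rmorphism R -> sections (open_setT X)} :=
  pval (scalar (open_setT X) : {rmorphism k -> nzr hA}) v.
have gv t : g (pvar k t) = v t by apply: (pval_var (A := nzr hA)).
have ex : map_mx g (pgx m n k) = ulsubmx (dG D0).
  by apply/matrixP => i i'; rewrite [LHS]mxE [X in g X]mxE gv /= [RHS]mxE [RHS]mxE.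
have ey : map_mx g (pgy m n k) = drsubmx (dG D0).
  by apply/matrixP => i i'; rewrite [LHS]mxE [X in g X]mxE gv /= [RHS]mxE [RHS]mxE.
have eGg : map_mx g (block_mx (pgx m n k) 0 0 (pgy m n k)) = dG D0.
  by rewrite map_block_mx !map_mx0 ex ey -blk_split //; apply: dG_blk.
have ginv : exists t, g delta * t = 1.
  exists (\det (dH D0)); rewrite rmorphM -!det_map_mx ex ey.
  rewrite -(det_ublock (ulsubmx (dG D0)) 0 (drsubmx (dG D0))) -blk_split; last exact: dG_blk.
  by rewrite -det_mulmx dGH det1.
have gc a : g (pcst m n k a) = scalar (open_setT X) a by apply: (pval_cst (A := nzr hA)).
pose tau : morphism X Z0 := spec_morphism tofr_eq0 (pdelta0 m n k) gc ginv.
exists tau; split=> //.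
have ch0 : chartable J F0 by move=> z; exists (open_setT Z0), DU.
have hTT : open_setT X `<=` tau @^-1` open_setT Z0 by [].
have [F1 [p1 /(_ _ _ _ hTT cU) c1]] := pullback_exists hJ tau ch0.
have c2 : charted J F1 D0.
  move=> W hW d c hc; rewrite (c1 W hW d c hc).
  set E := map_datum _ (map_datum _ _).
  have eg a : comor hTT (z0fr a) = g a.
    by rewrite [LHS]spec_map_fr; apply: res_id.
  have key (M : 'M[R]_(m + n)) : map_mx (comor hTT) (map_mx z0fr M) = map_mx g M.
    by apply/matrixP => i i'; rewrite mxE mxE [RHS]mxE; apply: eg.
  have e1 : dG E = dG (map_datum (res hW) D0).
    rewrite -[LHS]/(map_mx (res hW) (map_mx (comor hTT) (dG DU))).
    rewrite -[RHS]/(map_mx (res hW) (dG D0)) -eGg eG; congr (map_mx _ _); exact: key.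
  have e2 (a b c' d' : 'I_B) : dt E a b c' d' = dt (map_datum (res hW) D0) a b c' d'.
    by rewrite -[LHS]/(res hW (comor _ (dt DU a b c' d'))) et eg gv.
  by split; apply: inCI_box => // *; rewrite e2.
have pj : is_pullback j I F1.
  apply: (pullback_charted (J := J)) => z; exists V, D, (open_setT X), hT; split=> //.
have pc : is_pullback (compm phi tau) I F1 := comp_pullback hJ hI hphi p1.
have [f [_ uf]] := univ F1; have [a1 a2] := uf _ pj; have [b1 b2] := uf _ pc.
split=> [z|U V' W hg hf he s]; first by rewrite -[LHS]b1 a1.
have hc : W `<=` compm phi tau @^-1` U by move=> z /hf /hg.
have hff : W `<=` f @^-1` U by move=> z /he; rewrite /preimage /= a1.
by rewrite -(a2 _ _ hff he) (b2 _ _ hff hc) [RHS](compm_comorE (g := phi) (f := tau) hc hg hf).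
Qed.

End LocalSection.

(** * Finite presentation of retracts *)

Lemma mpoly_closed (k : fieldType) r (Q : {mpoly k[r]} -> Prop) : (forall a, Q a%:MP) ->
  (forall i, Q 'X_i) -> (forall p q, Q p -> Q q -> Q (p + q)) ->
  (forall p q, Q p -> Q q -> Q (p * q)) -> forall p, Q p.
Proof.
move=> hC hX hD hM; have Q1 : Q 1 by rewrite -mpolyC1; apply: hC.
elim/mpolyind => [|a m p _ _ IH]; first by rewrite -mpolyC0; apply: hC.
apply: (hD) => //; rewrite -mul_mpolyC; apply: (hM) => //; rewrite mpolyXE_id.
elim/big_rec: _ => // i q _ hq; apply: (hM) => //.
by elim: (m i) => [|c IHc]; rewrite ?expr0 // exprS; apply: (hM).
Qed.

Lemma mpoly_hom_ext (k : fieldType) r (A : comNzRingType) (f g : {rmorphism {mpoly k[r]} -> A}) :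
  (forall a, f a%:MP = g a%:MP) -> (forall i, f 'X_i = g 'X_i) -> f =1 g.
Proof.
move=> hc hX; elim/mpoly_closed => // p q hp hq; first by rewrite !rmorphD hp hq.
by rewrite !rmorphM hp hq.
Qed.

(* A retract [C] of the localisation [B] of a polynomial ring: the kernel of the
   retraction is generated by the differences [b - alpha (beta b)], [b] running
   over generators of [B]. *)
Lemma retract_fp (k : fieldType) (v : nat) (B C : comNzRingType) (sB : {rmorphism k -> B})
    (sC : {rmorphism k -> C}) (rho : {rmorphism {mpoly k[v]} -> B}) (G : {mpoly k[v]}) (u : B)
    (alpha : {rmorphism C -> B}) (beta : {rmorphism B -> C}) :
  (forall q, rho q = 0 -> q = 0) -> (forall a, rho a%:MP = sB a) -> rho G * u = 1 ->
  (forall b, exists r a, b * rho G ^+ r = rho a) ->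
  cancel alpha beta -> (forall a, alpha (sC a) = sB a) -> finitely_presented (sC : {rmorphism k -> C}).
Proof.
move=> rho0 rhoC Gu den ab aC; have bC a : beta (sB a) = sC a by rewrite -aC ab.
pose P : comNzRingType := {mpoly k[v.+1]}.
(* The last variable is the additional one and stands for the inverse of [G]. *)
pose tB (i : 'I_v.+1) : B := if unlift ord_max i is Some i' then rho 'X_i' else u.
pose evB : {rmorphism P -> B} := [the {rmorphism P -> B} of mmap sB tB].
pose iota : {rmorphism {mpoly k[v]} -> P} :=
  [the {rmorphism _ -> _} of mmap (@mpolyC v.+1 k) (fun i => 'X_(lift ord_max i) : P)].
pose Y : P := 'X_(@ord_max v).
have evC' a : evB (a%:MP : P) = sB a by rewrite /= mmapC.
have evX i : evB ('X_i : P) = tB i by rewrite /= mmapX mmap1U.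
have ei : forall q, evB (iota q) = rho q.
  apply: (mpoly_hom_ext (f := [the {rmorphism _ -> _} of evB \o iota])) => [a|i].
    by rewrite /= mmapC -[mmap _ _ _]/(evB _) evC' rhoC.
  by rewrite /= mmapX mmap1U -[mmap _ _ _]/(evB _) evX /tB liftK.
have eY : evB Y = u by rewrite evX /tB unlift_none.
have surj b : exists p : P, evB p = b.
  have [r [a e]] := den b; exists (iota a * Y ^+ r).
  by rewrite rmorphM rmorphXn ei eY -e -mulrA -exprMn Gu expr1n mulr1.
have /choice[E hE] : forall i, exists p : P, evB p = alpha (beta (tB i)) by move=> i; apply: surj.
pose g0 : P := iota G * Y - 1.
pose g (j : 'I_v.+2) : P := if unlift ord_max j is Some i then 'X_i - E i else g0.
pose I (p : P) := exists d : 'I_v.+2 -> P, p = \sum_j d j * g j.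
have I0 : I 0 by exists (fun=> 0); rewrite big1 // => j _; rewrite mul0r.
have ID p q : I p -> I q -> I (p + q).
  move=> [d ->] [d' ->]; exists (fun j => d j + d' j); rewrite -big_split.
  by apply: eq_bigr => j _; rewrite mulrDl.
have IM a p : I p -> I (a * p).
  move=> [d ->]; exists (fun j => a * d j); rewrite mulr_sumr.
  by apply: eq_bigr => j _; rewrite mulrA.
have Ig j : I (g j).
  exists (fun j' => (j' == j)%:R); rewrite (bigD1 j) //= eqxx mul1r big1 ?addr0 // => j' /negPf ->.
  by rewrite mul0r.
have Ig0 p : I (p * g0) by apply: IM; have := Ig ord_max; rewrite /g unlift_none.
have IX i : I ('X_i - E i) by have := Ig (lift ord_max i); rewrite /g liftK.
pose psi : {rmorphism P -> P} := [the {rmorphism _ -> _} of mmap (@mpolyC v.+1 k) E].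
have psiX i : psi ('X_i) = E i by rewrite /= mmapX mmap1U.
have psiC a : psi (a%:MP) = a%:MP by rewrite /= mmapC.
have Imul p q : I (p - psi p) -> I (q - psi q) -> I (p * q - psi (p * q)).
  move=> hp hq; rewrite rmorphM.
  have -> : p * q - psi p * psi q = q * (p - psi p) + psi p * (q - psi q) by ring.
  by apply: ID; apply: IM.
have Ipsi p : I (p - psi p).
  elim/mpoly_closed: p => [a|i|p q hp hq|p q]; last exact: Imul.
  - by rewrite psiC subrr.
  - by rewrite psiX.
  by rewrite rmorphD opprD addrACA; apply: ID.
have epsi : forall p, evB (psi p) = alpha (beta (evB p)).
  apply: (mpoly_hom_ext (f := [the {rmorphism _ -> _} of evB \o psi])
    (g := [the {rmorphism _ -> _} of alpha \o (beta \o evB)])) => [a|i] /=.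
    by rewrite mmapC -[mmap _ _ _]/(evB _) evC' bC aC.
  by rewrite -[mmap sB tB 'X_i]/(evB _) evX mmapX mmap1U -[mmap _ _ _]/(evB _) hE.
(* Modulo [g0 = G Y - 1], multiplication by a power of [G] removes the additional variable. *)
have clear_den p : exists r q w, iota G ^+ r * p = iota q + w * g0.
  elim/mpoly_closed: p => [a|i|p q [r [a [w e]]] [r' [a' [w' e']]]|p q [r [a [w e]]] [r' [a' [w' e']]]].
  - by exists 0%N, a%:MP, 0; rewrite expr0 mul1r mul0r addr0 /= mmapC.
  - case: (unliftP ord_max i) => [i' ->|->].
      by exists 0%N, 'X_i', 0; rewrite expr0 mul1r mul0r addr0 /= mmapX mmap1U.
    by exists 1%N, 1, 1; rewrite expr1 rmorph1 mul1r /g0 addrC subrK.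
  - exists (r + r')%N, (G ^+ r' * a + G ^+ r * a'), (iota G ^+ r' * w + iota G ^+ r * w').
    rewrite rmorphD !rmorphM !rmorphXn exprD mulrDr.
    have -> : iota G ^+ r * iota G ^+ r' * p = iota G ^+ r' * (iota G ^+ r * p) by ring.
    have -> : iota G ^+ r * iota G ^+ r' * q = iota G ^+ r * (iota G ^+ r' * q) by ring.
    by rewrite e e'; ring.
  exists (r + r')%N, (a * a'), (w * (iota a' + w' * g0) + iota a * w').
  have -> : iota G ^+ (r + r') * (p * q) = (iota G ^+ r * p) * (iota G ^+ r' * q) by rewrite exprD; ring.
  by rewrite e e' rmorphM; ring.
have eg0 : evB g0 = 0 by rewrite rmorphB rmorphM ei eY Gu rmorph1 subrr.
have kerB p : evB p = 0 -> I p.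
  move=> ep; have [r [q [w e]]] := clear_den p.
  have q0 : q = 0.
    apply: rho0; rewrite -ei; have := congr1 evB e.
    by rewrite rmorphM ep mulr0 rmorphD rmorphM eg0 mulr0 addr0 => <-.
  (* [G Y] is 1 modulo [g0], and so are its powers; this cancels the power of [G] brought in by
     [clear_den]. *)
  have h1 : exists w', 1 = (iota G * Y) ^+ r + w' * g0.
    elim: r {e} => [|r [w' e']]; first by exists 0; rewrite expr0 mul0r addr0.
    exists (w' * (iota G * Y) - 1); rewrite exprS {1}[1](_ : 1 = iota G * Y - g0); last by rewrite /g0; ring.
    have -> : (iota G * Y) ^+ r = 1 - w' * g0 by rewrite e'; ring.
    by rewrite /g0; ring.
  have [w' e1] := h1.
  have -> : p = Y ^+ r * w * g0 + w' * p * g0.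
    rewrite -[LHS]mul1r {1}e1 exprMn mulrDl; congr (_ + _); last by ring.
    by rewrite mulrAC e q0 rmorph0 add0r; ring.
  by apply: ID; apply: Ig0.
pose tC i := beta (tB i).
have evCE p : peval sC tC p = beta (evB p).
  rewrite /= /mmap rmorph_sum; apply: eq_bigr => m _; rewrite rmorphM bC; congr (_ * _).
  by rewrite /mmap1 rmorph_prod; apply: eq_bigr => i _; rewrite rmorphXn.
exists v.+1, tC; split.
  by move=> c; have [p e] := surj (alpha c); exists p; rewrite evCE e ab.
have eg j : beta (evB (g j)) = 0.
  rewrite /g; case: (unliftP ord_max j) => [i _|_]; last by rewrite eg0 rmorph0.
  by rewrite rmorphB rmorphB evX hE ab subrr.
exists v.+2, g => p; rewrite evCE; split=> [e|[d ->]].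
  have [d ed] : I p; last by exists d.
  rewrite -[p](subrK (psi p)); apply: ID => //; apply: kerB.
  by rewrite epsi e rmorph0.
elim/big_rec: _ => [|j q _ hq]; first by rewrite rmorph0 rmorph0.
by rewrite rmorphD rmorphD hq rmorphM rmorphM eg mulr0 addr0.
Qed.

Lemma comor_unit (k : fieldType) (Z X : scheme k) (f : morphism Z X) (U : open_set X)
    (W : open_set Z) (hW : W `<=` f @^-1` U) z (s : sections U) : W z ->
  unit_at z (comor hW s) <-> unit_at (f z) s.
Proof.
move=> Wz; split; first exact: comor_local.
case=> V [hV [t [Vfz e]]]; pose T := opI W (preim_open f V).
have hT : T `<=` W := @opIl _ _ W _; have hT' : T `<=` f @^-1` V := @opIr _ _ W _.
exists T, hT, (comor hT' t); split=> //.
by rewrite (comor_res hW hT' hV) -rmorphM e rmorph1.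
Qed.

Section FinitePresentation.
Context (m n : nat) (k : fieldType) (H : scheme k) (phi : morphism (Z0 m n k) H).
Hypothesis hphi : forall x : H, exists (V : open_set H) (tau : morphism (subscheme V) (Z0 m n k)),
  V x /\ is_comp phi tau (sub_incl V).
Local Notation R := (pring m n k).
Local Notation delta := (pdelta m n k).
Local Notation d0 := (pdelta0 m n k).
Local Notation fr := (tofr m n k).
Local Notation fr0 := (@tofr_eq0 m n k).
Local Notation Z := (Z0 m n k).

(** Both sides have to be shrunk together. [U'] is cut out of [U] by the pullback of [f] along
    [tau], and [D'] is the part of [D(f)] over [U']; then [tau] maps [U'] into [D'] and [phi] maps
    [D'] into [U']. As [phi] after [tau] is the inclusion, the ring of [U'] is a retract of the ring
    of [D']. *)
Lemma fp_of_sections : locally_finitely_presented H.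
Proof.
move=> x; have [V [tau [Vx [c1 c2]]]] := hphi x.
have [U [Ux UV aU]] := affine_nbhd Vx; pose X := subscheme V.
pose y : X := exist _ x Vx.
have Uty : oset (preim_open phi U) (tau y) by rewrite /= c1.
have [f yf fU] := sopenE (U := preim_open phi U) Uty.
pose Uz : open_set X := pre V U.
pose DDf : open_set Z := @DD R delta f.
have hDU : DDf `<=` phi @^-1` U by move=> z /fU.
have hTT : Uz `<=` tau @^-1` open_setT Z by [].
have hUio : U `<=` io Uz := sub_io_pre UV.
pose sU : sections U := res hUio (comor hTT (sfr fr d0 (open_setT Z) f)).
have usU (w : X) : U (sval w) -> unit_at (sval w) sU <-> ~ sval (tau w) f.
  move=> Uw; have Uzw : Uz w by [].
  rewrite /sU (unit_res hUio _ Uw) -(sub_unit _ Uzw) (comor_unit hTT _ Uzw).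
  apply: (@spec_unit k R (pcst m n k) _ fr delta fr0 d0 (open_setT Z) (tau w) _ f 1).
  - by [].
  - exact: spt1.
  by rewrite /= scut_in // rmorph1 mulr1.
pose U' := basic sU; have hU'U : U' `<=` U := @basic_sub _ _ U sU.
have U'x : U' x by split=> //; apply/(usU y).
exists U'; split=> //; first by apply: (affine_basic hU'U (s := sU)) => // w Uw; split=> [[]|].
pose D' := opI DDf (preim_open phi U').
have D'y : oset D' (tau y) by split=> //=; rewrite c1.
have D'eta : D' (eta d0) := eta_in d0 D'y.
pose b : sections DDf := comor hDU sU.
(* On [D(f)] the function [b] is a fraction with numerator [a] and invertible denominator, so [D']
   is the basic open set of [f * a]. *)
have [r [a ea]] := @spec_denominators R _ fr delta (sval b) f
  (fun z (zf : ~ sval z f) => ssec_rep (U := DDf) b zf).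
have hD' z : D' z <-> ~ sval z f /\ ~ sval z a.
  have zX : ~ sval z f -> ~ sval z ((f * delta) ^+ r).
    by move=> zf; apply: sptX; apply: sptM => //; apply: spt_delta.
  split=> [[zf [Uz' uz]]|[zf za]].
    split=> //; apply/(@spec_unit k R (pcst m n k) _ fr delta fr0 d0 DDf z b a _ zf (zX zf) ea).
    exact/(comor_unit hDU sU (z := z)).
  split=> //; split; first by apply: (hDU z).
  apply/(comor_unit hDU sU (z := z)) => //.
  exact/(@spec_unit k R (pcst m n k) _ fr delta fr0 d0 DDf z b a _ zf (zX zf) ea).
pose G := f * a * delta.
have G0 : fr G != 0.
  apply/eqP => /fr0; apply/eqP; have [ef ea'] := proj1 (hD' _) D'eta.
  by apply: mulf_neq0; [apply: mulf_neq0; apply/eqP|apply: (pdelta0 m n k)].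
have ru : sreg fr d0 D' (fr G)^-1.
  split=> [z /hD' [zf za]|n0]; last by case: (n0 D'eta).
  exists 1, G; split; last by rewrite mulVf ?rmorph1.
  by apply: sptM; [apply: sptM|apply: spt_delta].
pose u : sections D' := exist _ _ ru.
have hB : (1 : sections D') != 0 by apply/eqP; have [] := scheme_local D'y.
have hC : (1 : sections U') != 0 by apply/eqP; have [] := scheme_local U'x.
have hDp : D' `<=` phi @^-1` U' by move=> z [].
have hpt : pre V U' `<=` tau @^-1` D'.
  move=> w U'w; have Uw : U (sval w) := hU'U _ U'w; split; first exact/(usU w)/(proj2 U'w).
  by rewrite /= c1.
have hUp : U' `<=` io (pre V U') by apply: sub_io_pre; apply: subset_trans hU'U UV.
pose alpha : {rmorphism sections U' -> sections D'} := comor hDp.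
pose beta : {rmorphism sections D' -> sections U'} :=
  [the {rmorphism _ -> _} of res hUp \o (@comor k X Z tau D' (pre V U' : open_set X) hpt : {rmorphism sections D' -> sections (io (pre V U'))})].
have ab : cancel alpha beta.
  move=> s; have hj : pre V U' `<=` sub_incl V @^-1` U' by move=> w.
  rewrite /= (c2 _ _ _ hDp hpt hj) /= (res_comp _ _ (fun w hw => hw)); exact: res_id.
pose rho : {rmorphism R -> sections D'} := [the {rmorphism _ -> _} of sfr fr d0 D'].
apply: (@retract_fp k #|param m n| (nzr hB) (nzr hC) (scalar D') (scalar U') rho G u alpha beta).
- by move=> q /(congr1 sval) /=; rewrite scut_in // => /fr0.
- by [].
- by apply: ssec_eq; rewrite /= !scut_in // rmorph1 mulfV.
- move=> c; have hc (z : Z) : ~ sval z (f * a) -> exists a' b', ~ sval z b' /\ sval (c : sections D') * fr b' = fr a'.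
    move=> zfa; apply: (ssec_rep (U := D')); apply/hD'; split=> h; apply: zfa.
      exact: sptMr.
    exact: sptMl.
  have [q [a' e]] := @spec_denominators R _ fr delta (sval c) (f * a) hc.
  exists q, a'; apply: ssec_eq; rewrite /= [RHS]scut_in // -e; congr (_ * _).
  have -> : (rho G : sections D') ^+ q = rho (G ^+ q) by rewrite rmorphXn.
  by rewrite /= scut_in.
- exact: ab.
by move=> c; apply: comor_scalar.
Qed.

End FinitePresentation.
(** * Formal smoothness *)

Section SquareZero.
Context (R : pzRingType) (N : R -> Prop).
Hypotheses (ND : forall a b, N a -> N b -> N (a + b)).
Hypotheses (Nl : forall a b, N b -> N (a * b)) (Nr : forall a b, N a -> N (a * b)).
Hypothesis NN : forall a b, N a -> N b -> a * b = 0.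
Implicit Types b p q x f : R.

(** The Newton step [3 b^2 - 2 b^3], written as [b + g] with [g = e - 2 b e] and [e = b^2 - b]. *)
Lemma idempotent_lift b : N (b * b - b) -> exists p, p * p = p /\ N (p - b).
Proof.
set e := b * b - b => Ne; have bb : b * b = b + e by rewrite addrC subrK.
have eb : e * b = b * e by rewrite /e mulrBl mulrBr mulrA.
clearbody e; have e2 : e * e = 0 by apply: NN.
have bbe : b * (b * e) = b * e by rewrite mulrA bb mulrDl e2 addr0.
have be2 : b * e * e = 0 by rewrite -mulrA e2 mulr0.
have ebe : e * (b * e) = 0 by rewrite mulrA eb be2.
set g := e - (b * e + b * e).
have Ng : N g by have -> : g = (1 - (b + b)) * e; [rewrite mulrBl mul1r mulrDl|exact: (Nl _ Ne)].
exists (b + g); split; last by rewrite addrC addKr.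
have gg : g * g = 0 by apply: (NN).
have eg : g = e - (b * e + b * e) by []; clearbody g.
have bg : b * g = - (b * e).
  by rewrite eg mulrBr mulrDr bbe opprD addrA subrr add0r.
have gb : g * b = - (b * e).
  by rewrite eg mulrBl mulrDl eb -mulrA eb bbe opprD addrA subrr add0r.
by rewrite mulrDl !mulrDr gg addr0 bb bg gb eg opprD -!addrA.
Qed.

Section Local.
Variables (p f : R).
Hypotheses (pp : p * p = p) (ff : f * f = f).
Hypotheses (fp : N (f * (1 - p))) (pf : N (p * (1 - f))).

(** The correction that moves the image of [p] onto that of [f]: by [fix_image] and [in_image] each
    of [f] and [p + w] fixes the other from the right. *)
Let w := p * f * (1 - p).

Let Nw : N w. Proof. by rewrite /w -mulrA; apply: Nl. Qed.
Let pw : p * w = w. Proof. by rewrite /w !mulrA pp. Qed.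
Let wp : w * p = 0. Proof. by rewrite /w -mulrA mulrBl mul1r pp subrr mulr0. Qed.

Lemma fix_image : f * (p + w) = f.
Proof.
have e1 : f * p = f - f * (1 - p) by rewrite mulrBr mulr1 opprB addrC subrK.
have e2 : f * w = f * (1 - p).
  by rewrite /w -[p * f * (1 - p)]mulrA mulrA e1 mulrBl (NN fp fp) subr0 mulrA ff.
by rewrite mulrDr e2 e1 subrK.
Qed.

Lemma in_image : (p + w) * f = p + w.
Proof.
have e : p + w = p * f + p * (1 - f) * p.
  by rewrite /w mulrBr mulr1 mulrBr mulr1 mulrBl pp [RHS]addrCA addrA.
rewrite e mulrDl -mulrA ff; congr (_ + _).
by have := NN pf pf; rewrite mulrA mulrBr mulr1 => /subr0_eq <-.
Qed.

(* If the image of [f] is stable under [x], then [p + w] has the same image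
   as [f]. *)
Lemma local_solution x : f * x * f = f * x ->
  [/\ N w, p * w = w, w * p = 0 & p * x * (1 - p) + w * x * (1 - p) - p * x * w = 0].
Proof.
move=> hx; split=> //; set M := p + w.
have e1 : M * x * (1 - M) = 0.
  have eM : M * f = M := in_image; have fM : f * M = f := fix_image.
  have -> : M * x * (1 - M) = M * (f * x * (1 - M)) by rewrite !mulrA eM.
  have -> : f * x * (1 - M) = f * x * (f * (1 - M)) by rewrite mulrA hx.
  by rewrite [f * (1 - M)]mulrBr mulr1 fM subrr !mulr0.
have e2 : w * x * w = 0 by apply: NN => //; apply: Nr.
rewrite -e1 /M opprD addrA !mulrDr !mulrDl !mulrN e2 oppr0 addr0.
by rewrite addrACA.
Qed.

End Local.

Lemma global_solution p w x : p * p = p -> N w -> p * w = w -> w * p = 0 ->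
  p * x * (1 - p) + w * x * (1 - p) - p * x * w = 0 ->
  (p + w) * (p + w) = p + w /\ (p + w) * x * (1 - (p + w)) = 0.
Proof.
move=> pp Nw pw wp e; split.
  by rewrite mulrDl !mulrDr pp pw wp (NN Nw Nw) !addr0.
have e2 : w * x * w = 0 by apply: NN => //; apply: Nr.
rewrite -[RHS]e opprD addrA !mulrDr !mulrDl !mulrN e2 oppr0 addr0.
by rewrite addrACA.
Qed.

End SquareZero.

Section Projector.
Context (m n : nat) (J : borel m n) (A : comPzRingType) (D : datum m n A).
Local Notation N := (m + n)%N.

(** The projection behind [inCI_span], now with one choice of coefficients over [A] that serves all
    ring maps out of [A]. *)
Lemma inCI_projector : exists g : 'X_{1..N} -> 'X_{1..N} -> A,
  (forall u, hom0 (bideg u) (g u) /\ inCI J D (bideg u) (g u)) /\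
  forall (B : comPzRingType) (f : {rmorphism A -> B}) d c, hom0 d c -> inCI J (map_datum f D) d c ->
    forall w, c w = \sum_(u <- mons m n d) c u * f (g u w).
Proof.
have [e|hA] := eqVneq (1 : A) 0.
  exists (fun _ _ => 0); split; first by move=> u; split=> //; apply: inCI0.
  move=> B f d c _ _ w; have eB : (1 : B) = 0 by rewrite -(rmorph1 f) e rmorph0.
  by rewrite -[LHS]mulr1 -[RHS]mulr1 eB !mulr0.
pose q (u : 'X_{1..N}) : {mpoly (nzr hA)[N]} :=
  'X_[u] - act (dH (nzd hA D)) (cnf J (nzd hA D) 'X_[u]).
have hq u : bihom (bideg u) (q u).
  apply: bihomB; first exact: bihomX'.
  apply: bihom_act; first exact: dH_blk.
  by apply/bihom_nf/bihom_act; [exact: dG_blk|exact: bihomX'].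
exists (fun u w => (q u)@_w); split=> [u|B f d c hc hCI w].
  split=> [w hw|hA']; first exact: (proj1 (bihomP _ _) (hq u) w hw).
  have -> : hA' = hA by apply: Prop_irrelevance.
  rewrite polE // /CI /q linearB /=.
  by rewrite [X in _ - X]/cnf actGH nf_idem subrr.
have [e|hB] := eqVneq (1 : B) 0; first by rewrite -[LHS]mulr1 -[RHS]mulr1 e !mulr0.
pose fz := f : {rmorphism nzr hA -> nzr hB}.
have hcnf := hCI hB; rewrite (nzd_map f hA) -/fz in hcnf.
set E := map_datum fz (nzd hA D) in hcnf.
have eX u : map_mpoly fz (q u) = 'X_[u] - act (dH E) (cnf J E 'X_[u]).
  by rewrite rmorphB /= map_act map_cnf map_mpolyX.
rewrite -[LHS](@polK m n (nzr hB) d c w hc).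
have -> : @pol m n (nzr hB) d c = \sum_(u <- mons m n d) (c u : nzr hB) *: map_mpoly fz (q u).
  under eq_bigr => u _ do rewrite eX scalerBr.
  rewrite sumrB -[LHS]subr0; congr (_ - _).
  transitivity (act (dH E) (cnf J E (@pol m n (nzr hB) d c))).
    by rewrite (hcnf : cnf _ _ _ = 0) linear0.
  by rewrite [cnf _ _ _]linear_sum [LHS]linear_sum; apply: eq_bigr => u _; rewrite !linearZ.
by rewrite raddf_sum; apply: eq_bigr => u _; rewrite /= mcoeffZ mcoeff_map_mpoly.
Qed.

End Projector.

(** Arbitrary lifts of the parameters will do. Only the inverse matrix has to be corrected, by the
    Newton step [H1 + H1 (1 - G H1)], which is exact because the kernel has square zero. *)
Lemma lift_datum (m n : nat) (A B : comPzRingType) (f : {rmorphism A -> B}) (D0 : datum m n B) :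
  (forall b, exists a, f a = b) -> (forall a b, f a = 0 -> f b = 0 -> a * b = 0) ->
  exists D : datum m n A, map_datum f D = D0.
Proof.
(* Lifting 0 to 0 preserves the block shape of the matrices. *)
move=> /choice[g0 hg0] sq; pose g b := if b == 0 then 0 else g0 b.
have hg b : f (g b) = b by rewrite /g; case: eqP => [->|_]; rewrite ?rmorph0.
have g00 : g 0 = 0 by rewrite /g eqxx.
pose G := map_mx g (dG D0); pose H1 := map_mx g (dH D0).
have mG : map_mx f G = dG D0 by apply/matrixP => i j; rewrite !mxE hg.
have mH : map_mx f H1 = dH D0 by apply/matrixP => i j; rewrite !mxE hg.
have bG : blk G by move=> i j ne; rewrite mxE (dG_blk D0).
have bH : blk H1 by move=> i j ne; rewrite mxE (dH_blk D0).
have bM (P Q : 'M[A]_(m + n)) : blk P -> blk Q -> blk (P *m Q).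
  move=> bP bQ i j ne; rewrite mxE big1 // => l _.
  have [e|/eqP ne'] := eqVneq (bideg (U_(i)%MM : 'X_{1..m + n})) (bideg (U_(l)%MM : 'X_{1..m + n})).
    by rewrite bQ ?mulr0 // -e.
  by rewrite bP ?mul0r.
have MM (P Q : 'M[A]_(m + n)) : map_mx f P = 0 -> map_mx f Q = 0 -> P *m Q = 0.
  move=> hP hQ; apply/matrixP => i j; rewrite !mxE big1 // => l _; apply: sq.
    by have := congr1 (fun M : 'M_(_, _) => M i l) hP; rewrite !mxE.
  by have := congr1 (fun M : 'M_(_, _) => M l j) hQ; rewrite !mxE.
pose H := H1 + H1 *m (1%:M - G *m H1).
have e0 : map_mx f (1%:M - G *m H1) = 0 by rewrite map_mxB map_mx1 map_mxM mG mH dGH subrr.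
have e0' : map_mx f (1%:M - H1 *m G) = 0 by rewrite map_mxB map_mx1 map_mxM mG mH dHG subrr.
have HE : H = H1 + (1%:M - H1 *m G) *m H1 by rewrite /H mulmxBr mulmxBl mulmx1 mul1mx mulmxA.
have bD (P Q : 'M[A]_(m + n)) : blk P -> blk Q -> blk (P + Q).
  by move=> bP bQ i j ne; rewrite mxE bP // bQ // addr0.
have bN (P : 'M[A]_(m + n)) : blk P -> blk (- P) by move=> bP i j ne; rewrite mxE bP // oppr0.
have bHH : blk H.
  rewrite /H mulmxBr mulmx1; apply: (bD) => //; apply: (bD) => //; apply: (bN).
  by apply: (bM) => //; apply: (bM).
have GH : G *m H = 1%:M.
  have e : (1%:M - G *m H1) *m (1%:M - G *m H1) = 0 by apply: (MM).
  rewrite /H mulmxDr mulmxA -[RHS]subr0 -[in RHS]e mulmxBl mul1mx.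
  by rewrite -addrA -opprD subKr.
have HG : H *m G = 1%:M.
  have e : (1%:M - H1 *m G) *m (1%:M - H1 *m G) = 0 by apply: (MM).
  rewrite HE mulmxDl -mulmxA -[RHS]subr0 -[in RHS]e [in RHS]mulmxBr mulmx1.
  by rewrite -addrA -opprD subKr.
exists (@Datum m n A G H (fun a b c d => g (dt D0 a b c d)) bG bHH GH HG).
apply: datum_eq; rewrite /= ?mG //.
  by rewrite /H map_mxD map_mxM e0 mulmx0 addr0 mH.
by do 4!apply/funext => ?; rewrite hg.
Qed.

Lemma fin_exponent (T : finType) (P : T -> nat -> Prop) :
  (forall t r s, (r <= s)%N -> P t r -> P t s) -> (forall t, exists r, P t r) ->
  exists r, forall t, P t r.
Proof.
move=> mono /choice[f hf]; exists (\max_t f t)%N => t.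
by apply: mono (hf t); apply: leq_bigmax.
Qed.

(** * Partitions of unity and denominators *)

Section AffineInduction.
Context (k : fieldType) (X : scheme k) (aX : affine X).
Local Notation A := (sections (open_setT X)).
Implicit Types (a b : A).

(** A partition of unity as an induction principle: the elements satisfying [P] form an ideal, and
    an ideal that no prime contains has 1 as a member. *)
Lemma affine_ind (P : A -> Prop) : P 0 -> (forall a b, P a -> P b -> P (a + b)) ->
  (forall a b, P b -> P (a * b)) -> (forall x : X, exists2 a, unit_at x a & P a) -> P 1.
Proof.
move=> P0 PD PM cov; apply: contrapT => n1.
have [|Q [pQ sub _]] := @prime_avoid A P 1 P0 PD PM; first by move=> r; rewrite expr1n.
have [_ a2 _ _] := aX; have [x _ hx] := a2 Q pQ; have [a ua Pa] := cov x.
by have /hx := sub a Pa; apply.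
Qed.

Lemma basicD a b (x : X) : basic (a + b) x -> basic a x \/ basic b x.
Proof.
move=> [_ u]; have [_ /(_ a b u)[h|h]] := @scheme_local k X x (open_setT X) Logic.I.
  by left; split.
by right; split.
Qed.

Lemma basicM a b : basic (a * b) `<=` basic b.
Proof. by move=> x [_ u]; split=> //; apply: (unit_atM (t := a)); rewrite mulrC. Qed.

End AffineInduction.

Section AffineDenominators.
Context (k : fieldType) (X : scheme k) (U : open_set X) (aU : affine_open U).
Local Notation A := (sections U).
Implicit Types (a b : A).

Let loc a := basic_loc a aU.
Local Notation rs a := (res (@basic_sub k X U a)).

Lemma clear_mx a p q (Q : 'M[sections (basic a)]_(p, q)) :
  exists r Q', map_mx (rs a) Q' = rs a a ^+ r *: Q.
Proof.
have [_ l2 _] := loc a.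
have [|ij|r hr] := @fin_exponent ('I_p * 'I_q)%type
  (fun ij r => exists x, rs a x = rs a a ^+ r * Q ij.1 ij.2).
- move=> ij r s rs' [x ex]; exists (a ^+ (s - r) * x).
  by rewrite rmorphM ex rmorphXn mulrA -exprD subnK.
- by have [x [r e]] := l2 (Q ij.1 ij.2); exists r, x; rewrite -e mulrC.
have /choice[f hf] := hr; exists r, (\matrix_(i, j) f (i, j)).
by apply/matrixP => i j; rewrite !mxE hf.
Qed.

Lemma kill_mx a p q (Q : 'M[A]_(p, q)) : map_mx (rs a) Q = 0 -> exists r, a ^+ r *: Q = 0.
Proof.
move=> e; have [_ _ l3] := loc a.
have [|ij|r hr] := @fin_exponent ('I_p * 'I_q)%type (fun ij r => a ^+ r * Q ij.1 ij.2 = 0).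
- by move=> ij r s rs' ex; rewrite -(subnK rs') exprD -mulrA ex mulr0.
- by apply: l3; have := congr1 (fun M : 'M_(_, _) => M ij.1 ij.2) e; rewrite !mxE.
by exists r; apply/matrixP => i j; rewrite !mxE (hr (i, j)).
Qed.

Lemma unit_basic a : exists u, rs a a * u = 1.
Proof. by have [] := loc a. Qed.

Lemma affine_basic' a : affine_open (basic a).
Proof. by apply: (affine_basic (@basic_sub k X U a) (s := a)) => // x Ux; split=> [[]|]. Qed.

End AffineDenominators.

(** * Truncated ideals as row spaces *)

Section BoundedRows.
Context (m n : nat).
Local Notation N := (m + n)%N.

(** The box has to contain every monomial with bidegree in [D2]; these have degree at most 3. *)
Definition nbx := #|{: 'X_{1..N < 5}}|.
Definition mon (i : 'I_nbx) : 'X_{1..N} := val (enum_val i).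

Lemma mon_inj : injective mon.
Proof. by move=> i j /val_inj/enum_val_inj. Qed.

Lemma mon_lt i : (mdeg (mon i) < 5)%N.
Proof. exact: (valP (enum_val i)). Qed.

Lemma mon_surj u : (mdeg u < 5)%N -> exists i, mon i = u.
Proof. by move=> h; exists (enum_rank (BMultinom h)); rewrite /mon enum_rankK. Qed.

Lemma mdeg_bideg (u w : 'X_{1..N}) : bideg u = bideg w -> mdeg u = mdeg w.
Proof.
have e x : mdeg x = (\sum_(i < m) x (lshift n i) + \sum_(j < n) x (rshift m j))%N.
  by rewrite mdegE big_split_ord.
by move=> [e1 e2]; rewrite !e e1 e2.
Qed.

Section Rows.
Context (A : comPzRingType).
Implicit Types (r : 'rV[A]_nbx) (M : 'M[A]_nbx).

Definition rc r : 'X_{1..N} -> A := fun u => \sum_(i | mon i == u) r 0 i.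
Definition cr (c : 'X_{1..N} -> A) : 'rV[A]_nbx := \row_i c (mon i).
Definition cut d (c : 'X_{1..N} -> A) : 'X_{1..N} -> A :=
  fun u => if bideg u == d then c u else 0.

Lemma rc_mon r i : rc r (mon i) = r 0 i.
Proof. by rewrite /rc (big_pred1 i) // => j; rewrite (inj_eq mon_inj). Qed.

Lemma rc_out r u : ~ (mdeg u < 5)%N -> rc r u = 0.
Proof. by move=> h; rewrite /rc big_pred0 // => i; apply/eqP => e; apply: h; rewrite -e mon_lt. Qed.

Lemma rc_cr c u : (mdeg u < 5)%N -> rc (cr c) u = c u.
Proof. by move=> /mon_surj[i <-]; rewrite rc_mon mxE. Qed.

Lemma rcD r r' u : rc (r + r') u = rc r u + rc r' u.
Proof. by rewrite -big_split; apply: eq_bigr => i _; rewrite mxE. Qed.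

Lemma rc_mul r M u : rc (r *m M) u = \sum_i r 0 i * rc (row i M) u.
Proof.
rewrite /rc; under [RHS]eq_bigr => i _ do rewrite mulr_sumr.
by rewrite exchange_big; apply: eq_bigr => j _; rewrite mxE; apply: eq_bigr => i _; rewrite mxE.
Qed.

Lemma cut_hom d c : hom0 d (cut d c).
Proof. by move=> u /eqP/negPf h; rewrite /cut h. Qed.

(** The operators that preserve a truncated bihomogeneous ideal: multiplication by a variable, with
    terms leaving the box dropped, and projection to a bidegree, which is named by a monomial having
    it. *)
Definition op (o : 'I_N + 'I_nbx) : 'M[A]_nbx := match o with
  | inl v => \matrix_(i, j) (mon j == mon i + U_(v))%MM%:R
  | inr l => \matrix_(i, j) ((i == j) && (bideg (mon i) == bideg (mon l)))%:R end.

Lemma rc_opX r v u : (mdeg u < 5)%N -> rc (r *m op (inl v)) u = mulmon U_(v)%MM (rc r) u.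
Proof.
move=> /[dup] hu /mon_surj[j ej]; rewrite -ej rc_mon mxE /mulmon.
have [/forallP h|h] := boolP [forall i, (U_(v)%MM i <= mon j i)%N].
  have e : (mon j - U_(v) + U_(v) = mon j)%MM by rewrite submK //; apply/mnm_lepP.
  have : (mdeg (mon j - U_(v))%MM < 5)%N.
    by apply: leq_ltn_trans (mon_lt j); rewrite -{2}e mdegD leq_addr.
  case/mon_surj => i ei; rewrite -ei rc_mon (bigD1 i) //= mxE ei e eqxx mulr1.
  rewrite big1 ?addr0 // => i' ne; rewrite mxE; case: eqP => [e'|_]; last by rewrite mulr0.
  by case/eqP: ne; apply: mon_inj; rewrite ei e' addmK.
rewrite big1 // => i _; rewrite mxE; case: eqP => [e|_]; last by rewrite mulr0.
by case/negP: h; apply/forallP => l; rewrite e mnmDE leq_addl.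
Qed.

Lemma rc_opE r l u : rc (r *m op (inr l)) u = cut (bideg (mon l)) (rc r) u.
Proof.
rewrite /cut; have [/mon_surj[j <-]|h] := boolP (mdeg u < 5)%N; last first.
  by rewrite !rc_out ?if_same //; apply/negP.
rewrite !rc_mon mxE (bigD1 j) //= mxE eqxx /= big1 => [|i ne].
  by rewrite addr0; case: ifP; rewrite ?mulr1 ?mulr0.
by rewrite mxE (negPf ne) mulr0.
Qed.

Lemma cut_op (G : int * int -> ('X_{1..N} -> A) -> Prop) r o : (forall d, G d (fun=> 0)) ->
  (forall d v c, hom0 d c -> G d c -> G (d + bideg v) (mulmon v c)) ->
  (forall d, G d (cut d (rc r))) -> forall d, G d (cut d (rc (r *m op o))).
Proof.
move=> G0 GM hr d; case: o => [v|l]; last first.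
  have := hr d; have [->|ne] := eqVneq d (bideg (mon l)).
    congr (G _ _); apply/funext => u; rewrite /cut; case: ifP => // e.
    by rewrite rc_opE /cut e.
  move=> _; have := G0 d; congr (G d _); apply/funext => u; rewrite /cut.
  by case: eqP => // e; rewrite rc_opE /cut e (negPf ne).
have [[w [ew hw]]|nw] := pselect (exists w : 'X_{1..m + n}, bideg w = d /\ (mdeg w < 5)%N); last first.
  have := G0 d; congr (G d _); apply/funext => u; rewrite /cut; case: eqP => // e.
  by rewrite rc_out // => hu; apply: nw; exists u.
have := GM _ U_(v)%MM _ (@cut_hom _ (rc r)) (hr (d - bideg (U_(v)%MM : 'X_{1..m + n}))); rewrite subrK.
congr (G d _); apply/funext => u; rewrite {2}/cut; case: eqP => [eu|ne].
  rewrite rc_opX; last by rewrite (mdeg_bideg (etrans eu (esym ew))).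
  rewrite /mulmon; case: ifP => // /forallP hv; rewrite /cut.
  have e : u = ((u - U_(v)) + U_(v))%MM by rewrite submK //; apply/mnm_lepP.
  by rewrite -eu {2}e bidegD addrK eqxx.
rewrite /mulmon; case: ifP => // /forallP hv; rewrite /cut; case: eqP => // e'.
case: ne; have -> : u = ((u - U_(v)) + U_(v))%MM by rewrite submK //; apply/mnm_lepP.
by rewrite bidegD e' subrK.
Qed.

End Rows.

Lemma map_op (A B : comPzRingType) (f : {rmorphism A -> B}) o : map_mx f (op A o) = op B o.
Proof. by case: o => v; apply/matrixP => i j; rewrite !mxE rmorph_nat. Qed.

Lemma rc_map (A B : comPzRingType) (f : {rmorphism A -> B}) (r : 'rV[A]_nbx) u :
  rc (map_mx f r) u = f (rc r u).
Proof. by rewrite /rc rmorph_sum; apply: eq_bigr => i _; rewrite mxE. Qed.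

Lemma cut_map (A B : comPzRingType) (f : {rmorphism A -> B}) d (r : 'rV[A]_nbx) :
  cut d (rc (map_mx f r)) = fun u => f (cut d (rc r) u).
Proof. by apply/funext => u; rewrite /cut rc_map; case: ifP => // _; rewrite rmorph0. Qed.

Lemma uniq_mons d : uniq (mons m n d).
Proof. by rewrite map_inj_uniq; [apply/filter_uniq/enum_uniq|apply: val_inj]. Qed.

Section DatumRows.
Context (J : borel m n).

Definition KI (A : comPzRingType) (D : datum m n A) (r : 'rV[A]_nbx) : Prop :=
  forall d, inCI J D d (cut d (rc r)).

Context (A : comPzRingType) (D : datum m n A).

Lemma KI_cr d c : hom0 d c -> inCI J D d c -> KI D (cr c).
Proof.
move=> hc hCI d'; have [ed|ne] := eqVneq d' d.
  rewrite ed; have [[u [eu hu]]|nu] := pselect (exists u : 'X_{1..N}, bideg u = d /\ (mdeg u < 5)%N).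
    suff -> : cut d (rc (cr c)) = c by [].
    apply/funext => w; rewrite /cut; case: eqP => [ew|/hc //].
    by apply: rc_cr; rewrite (mdeg_bideg (etrans ew (esym eu))).
  suff -> : cut d (rc (cr c)) = fun=> 0 by apply: inCI0.
  apply/funext => w; rewrite /cut; case: eqP => // ew.
  by apply: rc_out => hw; apply: nu; exists w.
suff -> : cut d' (rc (cr c)) = fun=> 0 by apply: inCI0.
apply/funext => w; rewrite /cut; case: eqP => // ew.
have [hw|hw] := boolP (mdeg w < 5)%N; last by apply: rc_out; apply/negP.
by rewrite rc_cr // hc // ew; apply/eqP.
Qed.

Lemma datum_projector : exists P : 'M[A]_nbx,
  (forall i, KI D (row i P)) /\
  forall (B : comPzRingType) (f : {rmorphism A -> B}) r, KI (map_datum f D) r -> r *m map_mx f P = r.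
Proof.
have [g [g1 g2]] := inCI_projector J D; exists (\matrix_(i, j) g (mon i) (mon j)); split.
  move=> i; have [h1 h2] := g1 (mon i).
  have -> : row i (\matrix_(i, j) g (mon i) (mon j)) = cr (g (mon i)) by apply/rowP => j; rewrite !mxE.
  exact: KI_cr h1 h2.
move=> B f r hr; apply/rowP => j; set d := bideg (mon j).
have e0 : cut d (rc r) (mon j) = r 0 j by rewrite /cut eqxx rc_mon.
rewrite -e0 (g2 B f d _ (@cut_hom B d (rc r)) (hr d)) mxE.
transitivity (\sum_(u <- [seq mon i | i <- enum 'I_nbx] | bideg u == d) cut d (rc r) u * f (g u (mon j))).
  rewrite big_map big_enum_cond /= (bigID (fun i => bideg (mon i) == d)) /= [X in _ + X]big1 ?addr0.
    by apply: eq_bigr => i hi; rewrite !mxE /cut hi rc_mon.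
  move=> i /eqP hi; rewrite !mxE (proj1 (g1 (mon i))) ?rmorph0 ?mulr0 // => e; apply: hi.
  by rewrite -e.
rewrite -big_filter; apply: perm_big; apply: uniq_perm.
- by rewrite filter_uniq // map_inj_uniq ?enum_uniq //; apply: mon_inj.
- exact: uniq_mons.
move=> u; rewrite mem_filter mem_mons; case: eqP => //= eu.
have hu : (mdeg u < 5)%N by rewrite (mdeg_bideg eu) mon_lt.
by have [i <-] := mon_surj hu; rewrite map_f ?mem_enum.
Qed.

Lemma KI_map (B : comPzRingType) (f : {rmorphism A -> B}) r : KI D r -> KI (map_datum f D) (map_mx f r).
Proof. by move=> hr d; rewrite cut_map; apply: inCI_map. Qed.

Lemma map_datum_idfun : map_datum idfun D = D.
Proof. by apply: datum_eq => //=; apply/matrixP => i j; rewrite mxE. Qed.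

Lemma KI_op r o : KI D r -> KI D (r *m op _ o).
Proof. by move=> hr; apply: cut_op => // [d|d v c]; [apply: inCI0|apply: inCIM]. Qed.

End DatumRows.
End BoundedRows.

Section FamilyRows.
Context (m n : nat) (k : closedFieldType) (h : int * int -> nat).
Context (Z : scheme k) (F : hilb_family m n h Z).
Implicit Types (U V W : open_set Z).

Definition KF W (r : 'rV[sections W]_(nbx m n)) : Prop := forall d, F d W (cut d (rc r)).

Lemma KF_mul W (r : 'rV[sections W]_(nbx m n)) M : (forall i, KF (row i M)) -> KF (r *m M).
Proof.
move=> hM d; have := @fam_sum m n k h Z F 'I_(nbx m n) (index_enum _) d W
  (fun i u => r 0 i * cut d (rc (row i M)) u) (fun i => famZ (r 0 i) (hM i d)).
congr (F d W _); apply/funext => u; rewrite /cut; case: ifP => _; first by rewrite rc_mul.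
by rewrite big1 // => i _; rewrite mulr0.
Qed.

Lemma KFD W (r r' : 'rV[sections W]_(nbx m n)) : KF r -> KF r' -> KF (r + r').
Proof.
move=> h1 h2 d; have := famD (h1 d) (h2 d); congr (F d W _); apply/funext => u.
by rewrite /cut; case: ifP; rewrite ?addr0 // rcD.
Qed.

Lemma KFZ W a (r : 'rV[sections W]_(nbx m n)) : KF r -> KF (a *: r).
Proof.
move=> h1 d; have := famZ a (h1 d); congr (F d W _); apply/funext => u.
rewrite /cut; case: ifP; rewrite ?mulr0 // => _.
by rewrite /rc mulr_sumr; apply: eq_bigr => i _; rewrite mxE.
Qed.

Lemma KF0 W : KF (0 : 'rV[sections W]_(nbx m n)).
Proof.
move=> d; have := fam0 F d W; congr (F d W _); apply/funext => u.
by rewrite /cut /rc big1 ?if_same // => i _; rewrite mxE.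
Qed.

Lemma KF_res W W' (hW : W' `<=` W) (r : 'rV[sections W]_(nbx m n)) : KF r -> KF (map_mx (res hW) r).
Proof. by move=> hr d; rewrite cut_map; apply: fam_res. Qed.

Lemma KF_local W (r : 'rV[sections W]_(nbx m n)) : (forall z, oset W z -> exists W' (hW : W' `<=` W),
  oset W' z /\ KF (map_mx (res hW) r)) -> KF r.
Proof.
move=> hloc d; apply: fam_local; first exact: cut_hom.
move=> z /hloc[W' [hW [W'z hr]]]; exists W', hW; split=> //.
by have := hr d; rewrite cut_map.
Qed.

Lemma KF_charted (J : borel m n) V (D : datum m n (sections V)) : charted J F D ->
  forall W (hW : W `<=` V) (r : 'rV[sections W]_(nbx m n)), KF r <-> KI J (map_datum (res hW) D) r.
Proof.
by move=> cD W hW r; split=> hr d; apply/(cD W hW d) => //; apply: cut_hom.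
Qed.

Lemma KF_charted_self (J : borel m n) V (D : datum m n (sections V)) : charted J F D ->
  forall (r : 'rV[sections V]_(nbx m n)), KF r <-> KI J D r.
Proof.
move=> cD r; have hV : V `<=` V by []; rewrite (KF_charted cD hV).
suff -> : map_datum (res hV) D = D by [].
apply: datum_eq; rewrite /=; try by apply/matrixP => i j; rewrite !mxE res_id.
by do 4!apply/funext => ?; rewrite res_id.
Qed.

End FamilyRows.

Lemma rowD (A : comPzRingType) p q (P Q : 'M[A]_(p, q)) i : row i (P + Q) = row i P + row i Q.
Proof. by apply/rowP => j; rewrite !mxE. Qed.

Lemma rowZ (A : comPzRingType) p q a (P : 'M[A]_(p, q)) i : row i (a *: P) = a *: row i P.
Proof. by apply/rowP => j; rewrite !mxE. Qed.

Section MatrixRows.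
Context (A B : comPzRingType) (f : {rmorphism A -> B}) (t : nat).
Implicit Types (P Q : 'M[A]_t).

Lemma mapM P Q : map_mx f (P * Q) = map_mx f P * map_mx f Q.
Proof. exact: map_mxM. Qed.
Lemma map1 : map_mx f (1 : 'M[A]_t) = 1.
Proof. exact: map_mx1. Qed.
Lemma map1B P : map_mx f (1 - P) = 1 - map_mx f P.
Proof. by rewrite map_mxB map1. Qed.

Lemma rowsP P Q : (forall i, row i P *m Q = row i P) <-> P * Q = P.
Proof.
split=> [h|h i]; last by rewrite -row_mul -[P *m Q]/(P * Q) h.
by apply/row_matrixP => i; rewrite -[RHS]h -row_mul.
Qed.

Lemma map0_mul p q s (P : 'M[A]_(p, q)) (Q : 'M[A]_(q, s)) :
  (forall a b, f a = 0 -> f b = 0 -> a * b = 0) ->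
  map_mx f P = 0 -> map_mx f Q = 0 -> P *m Q = 0.
Proof.
move=> sq hP hQ; apply/matrixP => i j; rewrite !mxE big1 // => l _; apply: sq.
  by have := congr1 (fun M : 'M_(_, _) => M i l) hP; rewrite !mxE.
by have := congr1 (fun M : 'M_(_, _) => M l j) hQ; rewrite !mxE.
Qed.

End MatrixRows.

Lemma unit_at0 (k : fieldType) (X : scheme k) (x : X) (U : open_set X) : ~ unit_at x (0 : sections U).
Proof.
by move=> [V [hV [t [Vx]]]]; rewrite rmorph0 mul0r => e; have [/(_ (esym e))] := scheme_local Vx.
Qed.

(** * A global projector onto a family over an affine base *)

Section FamilyProjector.
Context (k : closedFieldType) (m n : nat) (J : borel m n) (h : int * int -> nat).
Context (Z : scheme k) (aZ : affine Z) (F : hilb_family m n h Z) (hF : chartable J F).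
Local Notation T := (open_setT Z).
Local Notation A := (sections T).
Local Notation rT W := (res (fun (x : Z) (_ : oset W x) => Logic.I : oset T x)).
Local Notation t := (nbx m n).

Lemma resK (U V W : open_set Z) (hVU : V `<=` U) (hWV : W `<=` V) (hWU : W `<=` U) p q (Q : 'M[sections U]_(p, q)) :
  map_mx (res hWV) (map_mx (res hVU) Q) = map_mx (res hWU) Q.
Proof. by apply/matrixP => i j; rewrite !mxE (res_comp _ _ hWU). Qed.

Lemma resI (U : open_set Z) (hU : U `<=` U) p q (Q : 'M[sections U]_(p, q)) : map_mx (res hU) Q = Q.
Proof. by apply/matrixP => i j; rewrite !mxE res_id. Qed.

Lemma mx_local (U : open_set Z) p q (Q : 'M[sections U]_(p, q)) : (forall z, oset U z ->
  exists (V : open_set Z) (hV : V `<=` U), oset V z /\ map_mx (res hV) Q = 0) -> Q = 0.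
Proof.
move=> hl; apply/matrixP => i j; rewrite mxE; apply: sec_eq => z /hl[V [hV [Vz e]]].
exists V, hV; split=> //; have := congr1 (fun M : 'M_(_, _) => M i j) e.
by rewrite !mxE rmorph0.
Qed.

Lemma chart_projector (z : Z) : exists b : A, unit_at z b /\
  exists (D : datum m n (sections (basic b))) (P : 'M[sections (basic b)]_t),
  [/\ charted J F D, forall i, KI J D (row i P), forall i, KF F (row i P) &
      forall (W : open_set Z) (hW : W `<=` basic b) (r : 'rV_t), KF F r -> r *m map_mx (res hW) P = r].
Proof.
have [V [D [Vz cD]]] := hF z; have [_ _ a3 _] := aZ.
have [b ub hb] := a3 z V Logic.I Vz; exists b; split=> //.
have hV : basic b `<=` V by move=> y [_ uy]; apply: hb.
have cD' : charted J F (map_datum (res hV) D).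
  move=> W hW d c hc; have hWV := subset_trans hW hV.
  by rewrite (map_datum_res _ _ hWV); apply: cD.
have [P [P1 P2]] := datum_projector J (map_datum (res hV) D).
exists (map_datum (res hV) D), P; split=> // [i|W hW r /(KF_charted cD' hW)]; last exact: P2.
have hI : basic b `<=` basic b by [].
apply/(KF_charted cD' hI); have -> // : map_datum (res hI) (map_datum (res hV) D) = map_datum (res hV) D.
by apply: datum_eq; rewrite /= ?resI //; do 4!apply/funext => ?; rewrite res_id.
Qed.

(** On a chart, membership means being fixed by the local projector [Q], so the defect [r - r Q]
    vanishes on [D(a)] and is killed by a power of [a]. [affine_ind] makes the exponent uniform. *)
Lemma KF_quasicoherent a (r : 'rV[A]_t) : KF F (map_mx (res (@basic_sub k Z T a)) r) ->
  exists s, KF F (a ^+ s *: r).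
Proof.
move=> hr; pose P b := exists s, KF F (map_mx (res (@basic_sub k Z T b)) (a ^+ s *: r)).
have mono b s s' : (s <= s')%N -> KF F (map_mx (res (@basic_sub k Z T b)) (a ^+ s *: r)) ->
    KF F (map_mx (res (@basic_sub k Z T b)) (a ^+ s' *: r)).
  by move=> le hs; rewrite -(subnK le) exprD -scalerA map_mxZ; apply: KFZ.
have sub b c s (W : open_set Z) (hW : W `<=` T) : W `<=` basic b -> c = a ^+ s *: r ->
    KF F (map_mx (res (@basic_sub k Z T b)) c) -> KF F (map_mx (res hW) c).
  by move=> hWb _ /(KF_res hWb); rewrite (resK _ _ hW).
have : P 1.
  apply: (affine_ind aZ).
  - by exists 0%N; apply: KF_local => z [_ /unit_at0].
  - move=> b c [s hs] [s' hs']; exists (s + s')%N; apply: KF_local => z hz.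
    have hT (W : open_set Z) : W `<=` T by [].
    have [bz|cz] := basicD hz.
      exists (opI (basic (b + c)) (basic b)), (@opIl _ _ _ _); split=> //; rewrite (resK _ _ (hT _)).
      exact: sub (@opIr _ _ _ _) erefl (mono _ _ _ (leq_addr _ _) hs).
    exists (opI (basic (b + c)) (basic c)), (@opIl _ _ _ _); split=> //; rewrite (resK _ _ (hT _)).
    exact: sub (@opIr _ _ _ _) erefl (mono _ _ _ (leq_addl _ _) hs').
  - by move=> b c [s hs]; exists s; apply: sub (@basicM _ _ _ _) erefl hs.
  move=> z; have [b [ub [D [Q [cD Q1 Q2 Q3]]]]] := chart_projector z; exists b => //.
  pose rb := res (@basic_sub k Z T b); pose r' := map_mx rb r; pose q := r' - r' *m Q.
  have q0 : map_mx (res (@basic_sub k Z (basic b) (rb a))) q = 0.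
    have hb : basic (rb a) `<=` basic b := @basic_sub k Z (basic b) (rb a).
    have hT : basic (rb a) `<=` T by [].
    have ha : basic (rb a) `<=` basic a.
      by move=> y [by_ uy]; split=> //; apply/(unit_res (@basic_sub k Z T b) a by_).
    rewrite map_mxB map_mxM Q3 ?subrr //.
    by have := KF_res ha hr; rewrite /r' (resK _ _ hT) (resK _ _ hT).
  have [s es] := kill_mx (affine_basic' aZ b) q0; exists s.
  have -> : map_mx rb (a ^+ s *: r) = (rb a ^+ s *: r') *m Q.
    apply/subr0_eq; rewrite map_mxZ rmorphXn -scalemxAl -scalerBr; exact: es.
  exact: KF_mul.
move=> [s hs]; exists s; apply: KF_local => z _.
exists (basic 1), (@basic_sub k Z T 1); split=> //; split=> //.
by exists T, (fun _ x => x), 1; rewrite rmorph1 mulr1.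
Qed.

(** [G a] asks for a matrix that has its rows in the family and acts on rows of the family as
    multiplication by [a]. Such [a] form an ideal, and local projectors with cleared denominators
    put a power of each [b] in it; [a = 1] is the claim. *)
Lemma family_projector : exists P : 'M[A]_t, (forall i, KF F (row i P)) /\
  forall (W : open_set Z) (hW : W `<=` T) (r : 'rV_t), KF F r -> r *m map_mx (res hW) P = r.
Proof.
pose G a := exists P : 'M[A]_t, (forall i, KF F (row i P)) /\
  forall (W : open_set Z) (hW : W `<=` T) (r : 'rV_t), KF F r -> r *m map_mx (res hW) P = res hW a *: r.
have [|a b [P [P1 P2]] [Q [Q1 Q2]]|a b [P [P1 P2]]|z|P [P1 P2]] := affine_ind aZ (P := G).
- exists 0; split=> [i|W hW r _]; first by rewrite row0; apply: KF0.
  by rewrite map_mx0 mulmx0 rmorph0 scale0r.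
- exists (P + Q); split=> [i|W hW r hr]; first by rewrite rowD; apply: KFD.
  by rewrite map_mxD mulmxDr P2 // Q2 // rmorphD scalerDl.
- exists (a *: P); split=> [i|W hW r hr]; first by rewrite rowZ; apply: KFZ.
  by rewrite map_mxZ -scalemxAr P2 // rmorphM scalerA.
- have [b [ub [D [Q [cD Q1 Q2 Q3]]]]] := chart_projector z.
  pose rb := res (@basic_sub k Z T b).
  have [r [B eB]] := clear_mx aZ Q; have uT : T z by [].
  have [||s hs] := @fin_exponent 'I_t (fun i s => KF F (b ^+ s *: row i B)).
  + by move=> i s s' le hs; rewrite -(subnK le) exprD -scalerA; apply: KFZ.
  + move=> i; apply: KF_quasicoherent; rewrite map_row eB rowZ; exact: KFZ.
  pose B1 := b ^+ s *: B.
  have eB1 : map_mx rb B1 = rb b ^+ (s + r) *: Q.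
    by rewrite /B1 map_mxZ rmorphXn eB scalerA exprD.
  have kB1 i : KF F (row i B1) by rewrite rowZ.
  clearbody B1.
  (* One exponent [q] has to serve all open sets [W] and all rows [v] at once; a second use of
     [affine_ind] provides it. *)
  pose K (c : A) := exists q, forall (W : open_set Z) (hW : W `<=` basic c) (hT : W `<=` T) (v : 'rV_t), KF F v ->
    res hT b ^+ q *: (v *m map_mx (res hT) B1 - res hT b ^+ (s + r) *: v) = 0.
  have [q hq] : K 1.
    apply: (affine_ind aZ).
    * exists 0%N => W hW hT v _; apply: mx_local => y /hW[_ /unit_at0] //.
    * move=> c c' [q hq] [q' hq']; exists (q + q')%N => W hW hT v hv; apply: mx_local => y Wy.
      have resT (V : open_set Z) (hV : V `<=` W) (hVT : V `<=` T) q0 : map_mx (res hV) (res hT b ^+ q0 *: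
          (v *m map_mx (res hT) B1 - res hT b ^+ (s + r) *: v)) =
          res hVT b ^+ q0 *: (map_mx (res hV) v *m map_mx (res hVT) B1 -
            res hVT b ^+ (s + r) *: map_mx (res hV) v).
        rewrite map_mxZ map_mxB map_mxM map_mxZ !rmorphXn (resK _ _ hVT).
        by rewrite !(res_comp _ _ hVT).
      have hVT (V : open_set Z) : V `<=` T by [].
      have [cy|cy] := basicD (hW _ Wy).
        exists (opI W (basic c)), (@opIl _ _ _ _); split=> //; rewrite (resT _ _ (hVT _)).
        rewrite addnC exprD -scalerA hq ?scaler0 //; [exact: opIr | exact: KF_res].
      exists (opI W (basic c')), (@opIl _ _ _ _); split=> //; rewrite (resT _ _ (hVT _)).
      rewrite exprD -scalerA hq' ?scaler0 //; [exact: opIr | exact: KF_res].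
    * move=> c c' [q hq]; exists q => W hW; apply: hq; apply: subset_trans hW _; exact: basicM.
    move=> y; have [c [uc [D' [Q' [cD' Q1' Q2' Q3']]]]] := chart_projector y; exists c => //.
    pose rc := res (@basic_sub k Z T c); pose C := Q' *m map_mx rc B1 - rc b ^+ (s + r) *: Q'.
    have C0 : map_mx (res (@basic_sub k Z (basic c) (rc b))) C = 0.
      set V := basic (rc b); have hVT : V `<=` T by [].
      have hVb : V `<=` basic b.
        by move=> x [cx ux]; split=> //; apply/(unit_res (@basic_sub k Z T c) b cx).
      set hVc : V `<=` basic c := @basic_sub k Z (basic c) (rc b).
      rewrite map_mxB map_mxM map_mxZ rmorphXn (resK _ _ hVT) -(resK (@basic_sub k Z T b) hVb hVT) eB1.
      rewrite map_mxZ rmorphXn !(res_comp _ _ hVT) -scalemxAr -scalerBr.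
      have -> : map_mx (res hVc) Q' *m map_mx (res hVb) Q = map_mx (res hVc) Q'.
        by apply/row_matrixP => i; rewrite row_mul -map_row Q3 //; apply: KF_res.
      by rewrite subrr scaler0.
    have [q eq] := kill_mx (affine_basic' aZ c) C0; exists q => W hW hT v hv.
    have ev := Q3' W hW v hv; rewrite -[in LHS]ev.
    have := congr1 (fun M => v *m map_mx (res hW) M) eq.
    rewrite map_mx0 mulmx0 map_mxZ map_mxB map_mxM map_mxZ !rmorphXn (resK _ _ hT) !(res_comp _ _ hT).
    by rewrite -scalemxAr mulmxBr mulmxA -scalemxAr.
  exists (b ^+ (q + (s + r))); first exact: unit_atX.
  exists (b ^+ q *: B1); split=> [i|W hW v hv].
    by rewrite rowZ; apply: KFZ.
  rewrite map_mxZ -scalemxAr rmorphXn; apply/subr0_eq.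
  rewrite rmorphXn exprD -scalerA -scalerBr; apply: hq hv.
  move=> x Wx; split=> //; exists T, (fun _ y => y), 1; by rewrite rmorph1 mulr1.
by exists P; split=> // W hW r /P2 ->; rewrite rmorph1 scale1r.
Qed.

End FamilyProjector.

(** * Lifting the projector across a square-zero thickening *)

Section Thickening.
Context (k : closedFieldType) (m n : nat) (J : borel m n) (h : int * int -> nat).
Context (Y0 Y : scheme k) (i : morphism Y0 Y) (ti : affine_thickening i).
Local Notation T := (open_setT Y).
Local Notation A := (sections (open_setT Y)).
Local Notation A0 := (sections (open_setT Y0)).
Local Notation t := (nbx m n).
Local Notation ic := (comorT i).
Local Notation rs a := (res (@basic_sub k Y (open_setT Y) a)).

Let aY0 : affine Y0. Proof. by case: ti. Qed.
Let aY : affine Y. Proof. by case: ti. Qed.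
Let isurj s : exists r, ic r = s. Proof. by case: ti. Qed.
Let isq a b : ic a = 0 -> ic b = 0 -> a * b = 0. Proof. by case: ti => _ _ _; apply. Qed.

Lemma basic_pre a : basic (ic a) `<=` i @^-1` basic a.
Proof. by move=> y [_ u]; split=> //; apply: comor_local u. Qed.

Definition fa a : {rmorphism sections (basic a) -> sections (basic (ic a))} := comor (@basic_pre a).

Lemma fa_res a s : fa a (rs a s) = res (@basic_sub k Y0 (open_setT Y0) (ic a)) (ic s).
Proof. by apply/esym/comor_res. Qed.

Lemma fa_res_mx a p q (Q : 'M[A]_(p, q)) :
  map_mx (fa a) (map_mx (rs a) Q) = map_mx (res (@basic_sub k Y0 (open_setT Y0) (ic a))) (map_mx ic Q).
Proof. by apply/matrixP => x y; rewrite !mxE fa_res. Qed.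

Lemma fa_surj a b0 : exists b, fa a b = b0.
Proof.
have [_ l2 _] := basic_loc (ic a) aY0; have [x0 [r e]] := l2 b0.
have [x ex] := isurj x0; have [u eu] := unit_basic aY a; exists (rs a x * u ^+ r).
by rewrite rmorphM rmorphXn fa_res ex -e -mulrA -exprMn -fa_res -rmorphM eu rmorph1 expr1n mulr1.
Qed.

(** Up to powers of [a], the kernel over a basic open set comes from the global kernel; hence its
    square is zero too. *)
Lemma fa_ker a p q (Q : 'M[sections (basic a)]_(p, q)) : map_mx (fa a) Q = 0 ->
  exists r Q', map_mx ic Q' = 0 /\ map_mx (rs a) Q' = rs a a ^+ r *: Q.
Proof.
move=> hQ; have [r [Q' e]] := clear_mx aY Q.
have [|s es] := kill_mx aY0 (a := ic a) (Q := map_mx ic Q').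
  by rewrite -fa_res_mx e map_mxZ hQ scaler0.
exists (s + r)%N, (a ^+ s *: Q'); split; first by rewrite map_mxZ rmorphXn es.
by rewrite map_mxZ rmorphXn e scalerA -exprD.
Qed.

Lemma fa_sq_mx a p q s (P : 'M[sections (basic a)]_(p, q)) (Q : 'M[sections (basic a)]_(q, s)) :
  map_mx (fa a) P = 0 -> map_mx (fa a) Q = 0 -> P *m Q = 0.
Proof.
move=> /fa_ker[r [P' [p0 eP]]] /fa_ker[r' [Q' [q0 eQ]]].
have := map0_mul isq p0 q0 => /(congr1 (map_mx (rs a))).
rewrite map_mx0 map_mxM eP eQ -scalemxAl -scalemxAr scalerA -exprD => e.
have [u eu] := unit_basic aY a; have := congr1 ( *:%R (u ^+ (r + r'))) e.
by rewrite scaler0 scalerA -exprMn [u * _]mulrC eu expr1n scale1r.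
Qed.

Lemma fa_sq a b b' : fa a b = 0 -> fa a b' = 0 -> b * b' = 0.
Proof.
move=> hb hb'; have c0 x : fa a x = 0 -> map_mx (fa a) (const_mx x : 'M_1) = 0.
  by move=> hx; apply/matrixP => u v; rewrite !mxE.
have := fa_sq_mx (c0 _ hb) (c0 _ hb') => /(congr1 (fun M : 'M_1 => M 0 0)).
by rewrite !mxE big_ord1 !mxE.
Qed.

Context (F0 : hilb_family m n h Y0) (hF0 : chartable J F0).

Definition projects (P0 : 'M[A0]_t) : Prop := (forall j, KF F0 (row j P0)) /\
  forall (W : open_set Y0) (hW : W `<=` open_setT Y0) (r : 'rV_t), KF F0 r -> r *m map_mx (res hW) P0 = r.

Lemma lifted_idempotent : exists p : 'M[A]_t, p * p = p /\ projects (map_mx ic p).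
Proof.
have [P0 [h1 h2]] := family_projector aY0 hF0; have /choice[g hg] := isurj.
pose B := \matrix_(u, v) g (P0 u v); have eB : map_mx ic B = P0 by apply/matrixP => u v; rewrite !mxE.
have PP : P0 * P0 = P0.
  by apply/rowsP => j; have := h2 _ (fun x h => h) _ (h1 j); rewrite resI.
have [|||p [pp ep]] := @idempotent_lift 'M[A]_t (fun Q => map_mx ic Q = 0) _ _ B.
- by move=> a b eb; rewrite mapM eb mulr0.
- by move=> a b; apply: map0_mul.
- by rewrite map_mxB mapM eB PP subrr.
exists p; split=> //; have -> // : map_mx ic p = P0.
by apply/subr0_eq; rewrite -eB -map_mxB.
Qed.

Lemma local_lift (y0 : Y0) : exists a, unit_at y0 (ic a) /\
  exists (D : datum m n (sections (basic a))) (Q : 'M[sections (basic a)]_t),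
  [/\ charted J F0 (map_datum (fa a) D), forall j, KI J D (row j Q) &
    forall (B : comPzRingType) (f : {rmorphism sections (basic a) -> B}) r,
      KI J (map_datum f D) r -> r *m map_mx f Q = r].
Proof.
have [b [ub [D0 [_ [cD _ _ _]]]]] := chart_projector aY0 hF0 y0.
have [a ea] := isurj b; rewrite -ea in ub D0 cD *; exists a; split=> //.
have [D eD] := lift_datum D0 (@fa_surj a) (@fa_sq a).
have [Q [Q1 Q2]] := datum_projector J D; exists D, Q; split=> //.
by rewrite eD.
Qed.

Section LocalProjector.
Context (p : 'M[A]_t) (hp : projects (map_mx ic p)) (a : A).
Context (D : datum m n (sections (basic a))) (Q : 'M[sections (basic a)]_t).
Hypotheses (cD : charted J F0 (map_datum (fa a) D)) (Q1 : forall j, KI J D (row j Q)).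
Hypothesis Q2 : forall (B : comPzRingType) (f : {rmorphism sections (basic a) -> B}) r,
  KI J (map_datum f D) r -> r *m map_mx f Q = r.

Lemma chart_row r : KI J D r -> r *m Q = r.
Proof.
move=> hr; have := @Q2 _ idfun r; rewrite map_datum_idfun => /(_ hr).
by have -> : map_mx idfun Q = Q by apply/matrixP => u v; rewrite mxE.
Qed.

Lemma chart_idem : Q * Q = Q. Proof. by apply/rowsP => j; apply: chart_row. Qed.

Lemma chart_op o : Q * op _ o * Q = Q * op _ o.
Proof. by apply/rowsP => j; apply: chart_row; rewrite row_mul; apply: KI_op. Qed.

(** Modulo the kernel, [Q] and [p] project onto the same rows, those of [F0]; this lemma and
    [chart_near2] are the two inclusions. *)
Lemma chart_near1 : map_mx (fa a) (Q * (1 - map_mx (rs a) p)) = 0.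
Proof.
rewrite mapM map1B fa_res_mx mulrBr mulr1; apply/eqP; rewrite subr_eq0 eq_sym; apply/eqP.
apply/rowsP => j; have [_ h2] := hp; apply: h2; apply/(KF_charted_self cD).
by rewrite -map_row; apply: KI_map.
Qed.

Lemma chart_near2 : map_mx (fa a) (map_mx (rs a) p * (1 - Q)) = 0.
Proof.
rewrite mapM map1B fa_res_mx mulrBr mulr1; apply/eqP; rewrite subr_eq0 eq_sym; apply/eqP.
apply/rowsP => j; have [h1 _] := hp; apply: Q2; apply/(KF_charted_self cD).
by rewrite -map_row; apply: KF_res.
Qed.

End LocalProjector.

Lemma scl (R : comPzRingType) b (P Q : 'M[R]_t) : (b *: P) * Q = b *: (P * Q).
Proof. exact/esym/scalemxAl. Qed.
Lemma scr (R : comPzRingType) b (P Q : 'M[R]_t) : P * (b *: Q) = b *: (P * Q).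
Proof. exact/esym/scalemxAr. Qed.

(** A scalar [c] in front of the constant term makes the linear equation for [w] homogeneous, so its
    solutions [(c, w)] form a module. The scalars that occur, taken modulo the kernel, form an ideal
    to which [affine_ind] applies; locally, [wB] solves the equation with scalar 1. *)
Theorem lifted_projector : exists M : 'M[A]_t,
  [/\ M * M = M, forall o, M * op _ o * (1 - M) = 0 & projects (map_mx ic M)].
Proof.
have [p [pp hp]] := lifted_idempotent.
pose E c w o := c *: (p * op _ o * (1 - p)) + w * op _ o * (1 - p) - p * op _ o * w.
have ED c c' w w' o : E (c + c') (w + w') o = E c w o + E c' w' o.
  rewrite /E scalerDl [(w + w') * _]mulrDl [(w * _ + _) * _]mulrDl [p * _ * (w + w')]mulrDr opprD.
  by rewrite (addrACA (c *: _)) [LHS]addrACA.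
have EZ b c w o : E (b * c) (b *: w) o = b *: E c w o.
  by rewrite /E -scalerA !scl scr -scalerDr -scalerBr.
pose G (c : A0) := exists a w, [/\ ic a = c, map_mx ic w = 0, p * w = w, w * p = 0 & forall o, E a w o = 0].
have [||||a [w [ea w0 pw wp Ew]]] := affine_ind aY0 (P := G).
- exists 0, 0; rewrite rmorph0 map_mx0 mulr0 mul0r; split=> // o.
  by rewrite /E scale0r !mul0r mulr0 addr0 subr0.
- move=> c c' [a [w [h1 h2 h3 h4 h5]]] [a' [w' [g1 g2 g3 g4 g5]]]; exists (a + a'), (w + w').
  split.
  + by rewrite rmorphD h1 g1.
  + by rewrite map_mxD h2 g2 addr0.
  + by rewrite mulrDr h3 g3.
  + by rewrite mulrDl h4 g4 addr0.
  by move=> o; rewrite ED h5 g5 addr0.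
- move=> c c' [a [w [h1 h2 h3 h4 h5]]]; have [b eb] := isurj c; exists (b * a), (b *: w).
  split.
  + by rewrite rmorphM eb h1.
  + by rewrite map_mxZ h2 scaler0.
  + by rewrite scr h3.
  + by rewrite scl h4 scaler0.
  by move=> o; rewrite EZ h5 scaler0.
- move=> y0; have [a [ua [D [Q [cD Q1 Q2]]]]] := local_lift y0.
  pose pa := map_mx (rs a) p; pose wB := pa * Q * (1 - pa).
  have ppa : pa * pa = pa by rewrite /pa -mapM pp.
  have n1 := chart_near1 hp cD Q1; have n2 := chart_near2 hp cD Q2; have co := chart_op Q1 Q2.
  have ci := chart_idem Q1 Q2.
  have sol o : [/\ map_mx (fa a) wB = 0, pa * wB = wB, wB * pa = 0 &
      pa * op _ o * (1 - pa) + wB * op _ o * (1 - pa) - pa * op _ o * wB = 0].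
    have Nl (u v : 'M[sections (basic a)]_t) : map_mx (fa a) v = 0 -> map_mx (fa a) (u * v) = 0 by move=> ev; rewrite mapM ev mulr0.
    have Nr (u v : 'M[sections (basic a)]_t) : map_mx (fa a) u = 0 -> map_mx (fa a) (u * v) = 0 by move=> eu; rewrite mapM eu mul0r.
    exact (@local_solution 'M[sections (basic a)]_t (fun P => map_mx (fa a) P = 0) Nl Nr
      (@fa_sq_mx a t t t) pa Q ppa ci n1 n2 _ (co o)).
  (* The identities in [sol] that do not mention [o] still need some operator to be extracted; over
     an empty index set all matrices coincide. *)
  have [[j0]|no] := pselect (inhabited 'I_t); last first.
    exists 1; first by exists (open_setT Y0), (fun _ h => h), 1; rewrite rmorph1 mulr1.
    exists 1, 0; rewrite rmorph1 map_mx0 mulr0 mul0r; split=> // o.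
    by apply/matrixP => j; case: no; exists.
  have [wB0 pwB wBp _] := sol (inr j0).
  have [r [w [w0 ew]]] := fa_ker wB0.
  have kill (C : 'M[A]_t) : map_mx (rs a) C = 0 -> exists s, a ^+ s *: C = 0 by apply: kill_mx.
  have mono s s' (C : 'M[A]_t) : (s <= s')%N -> a ^+ s *: C = 0 -> a ^+ s' *: C = 0.
    by move=> le e; rewrite -(subnK le) exprD -scalerA e scaler0.
  have [|s1 e1] := kill (p * w - w).
    by rewrite map_mxB mapM ew -/pa scr pwB subrr.
  have [|s2 e2] := kill (w * p); first by rewrite mapM ew -/pa scl wBp scaler0.
  have [||s3 e3] := @fin_exponent _ (fun o s => a ^+ s *: E (a ^+ r) w o = 0).
  + by move=> o s s' le; apply: mono.
  + move=> o; apply: kill; have [_ _ _ eo] := sol o.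
    rewrite /E map_mxB map_mxD map_mxZ !mapM !map1B map_op ew -/pa rmorphXn !scl scr.
    by rewrite -scalerDr -scalerBr eo scaler0.
  pose s := (s1 + s2 + s3)%N; exists (ic (a ^+ s * a ^+ r)).
    by rewrite rmorphM !rmorphXn -exprD; apply: unit_atX.
  exists (a ^+ s * a ^+ r), (a ^+ s *: w); split=> //.
  + by rewrite map_mxZ w0 scaler0.
  + apply/subr0_eq; rewrite scr -scalerBr; apply: mono e1; by rewrite /s -addnA leq_addr.
  + by rewrite scl; apply: mono e2; rewrite /s addnAC leq_addl.
  by move=> o; rewrite EZ; apply: mono (e3 o); apply: leq_addl.
(* As [a] lifts 1, it is invertible with inverse [2 - a]; rescaling [w] by this inverse turns the
   homogeneous equation into the required one. *)
have e1 : (a - 1) * (a - 1) = 0 by apply: isq; rewrite rmorphB ea rmorph1 subrr.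
pose u := 1 + 1 - a; have ua : u * a = 1 by rewrite /u -[RHS]subr0 -e1; ring.
pose w1 := u *: w; have Ew1 o : E 1 w1 o = 0 by rewrite -ua EZ Ew scaler0.
have sol o : (p + w1) * (p + w1) = p + w1 /\ (p + w1) * op _ o * (1 - (p + w1)) = 0.
  apply: (@global_solution 'M[A]_t (fun P => map_mx ic P = 0)) => //.
  - by move=> x y ex; rewrite mapM ex mul0r.
  - by move=> x y; apply: map0_mul.
  - by rewrite map_mxZ w0 scaler0.
  - by rewrite scr pw.
  - by rewrite scl wp scaler0.
  by have := Ew1 o; rewrite /E scale1r.
exists (p + w1); split.
- have [[j0]|no] := pselect (inhabited 'I_t); first by have [] := sol (inr j0).
  by apply/matrixP => j; case: no; exists.
- by move=> o; have [] := sol o.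
by rewrite map_mxD map_mxZ w0 scaler0 addr0.
Qed.

(** Elements of the kernel square to zero and are units nowhere, so being a unit at [y] depends only
    on the image in the ring of [Y0]; the images of the non-units form the prime that gives [y0]. *)
Lemma thickening_surj (y : Y) : exists y0 : Y0, i y0 = y.
Proof.
pose Q (s : A0) := exists2 r, ic r = s & ~ unit_at y r.
have Ty : T y by [].
have nilp r : ic r = 0 -> ~ unit_at y r.
  by move=> e u; have := unit_atMM Ty u u; rewrite isq // => /unit_at0.
have indep r r' : ic r = ic r' -> unit_at y r -> unit_at y r'.
  move=> e u; have e0 : ic (r - r') = 0 by rewrite rmorphB e subrr.
  have [_ /(_ (r - r') r')] := @scheme_local k Y y T Ty.
  by rewrite subrK => /(_ u)[/(nilp _ e0)|].
have QE r : Q (ic r) <-> ~ unit_at y r.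
  by split=> [[r' e nu] u|nu]; [apply: nu; apply: indep u|exists r].
have pQ : prime_ideal Q.
  split.
  - by exists 0; [rewrite rmorph0|apply: unit_at0].
  - move=> _ _ [r <- nr] [r' <- nr']; rewrite -rmorphD; apply/QE => u.
    by have [_ /(_ r r' u)[/nr|/nr']] := @scheme_local k Y y T Ty.
  - move=> c _ [r <- nr]; have [b <-] := isurj c; rewrite -rmorphM; apply/QE.
    by rewrite mulrC => /unit_atM.
  - by rewrite -(rmorph1 ic) => /QE; apply; exists T, (fun _ h => h), 1; rewrite rmorph1 mulr1.
  move=> c c'; have [b <-] := isurj c; have [b' <-] := isurj c'; rewrite -rmorphM => /QE nb.
  apply: contrapT => /not_orP[/QE /contrapT u /QE /contrapT u'].
  by apply: nb; apply: unit_atMM.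
have [_ a2 _ _] := aY0; have [y0 _ hy] := a2 Q pQ; exists y0.
have [a1 _ _ _] := aY; apply: a1 => // s.
have e1 : unit_at (i y0) s <-> unit_at y0 (ic s).
  exact: (iff_sym (@comor_unit k Y0 Y i T (open_setT Y0) (fun _ _ => Logic.I) y0 s Logic.I)).
apply: (iff_trans e1); have [q1 q2] := hy (ic s); have [r1 r2] := QE s.
by split=> u; apply: contrapT => nu; [apply: (q1 (r2 nu) u)|apply: (r1 (q2 nu) u)].
Qed.

End Thickening.

Lemma mulmx_one (A : comPzRingType) s t (v : 'M[A]_(s, t)) : v *m (1 : 'M[A]_t) = v.
Proof. exact: mulmx1. Qed.

(** * Explicit charts for the lifted projector *)

Section NearAlgebra.
Context (m n : nat) (J : borel m n) (B : comPzRingType) (hB : (1 : B) != 0).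
Local Notation N := (m + n)%N.
Local Notation R := (nzr hB).
Local Notation t := (nbx m n).

Definition rw (p : {mpoly R[N]}) : 'rV[B]_t := cr (fun u => p@_u : B).

Lemma rwD p q : rw (p + q) = rw p + rw q.
Proof. by apply/rowP => j; rewrite !mxE mcoeffD. Qed.
Lemma rwN p : rw (- p) = - rw p.
Proof. by apply/rowP => j; rewrite !mxE mcoeffN. Qed.
Lemma rwZ a p : rw (a *: p) = (a : B) *: rw p.
Proof. by apply/rowP => j; rewrite !mxE mcoeffZ. Qed.

Lemma rwX v p : rw ('X_v * p) = rw p *m op _ (inl v).
Proof.
apply/rowP => j; rewrite mxE -[RHS]rc_mon rc_opX ?mon_lt // (@mcoeffXM m n R) /mulmon.
case: ifP => // /forallP hv; rewrite rc_cr //; apply: leq_ltn_trans (mon_lt j).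
have e : (mon j - U_(v) + U_(v) = mon j)%MM by apply: submK; apply/mnm_lepP.
by rewrite -{2}e mdegD leq_addr.
Qed.

Lemma rw_pol (l : 'I_t) (r : 'rV[B]_t) : rw (@pol m n R (bideg (mon l)) (rc r)) = r *m op _ (inr l).
Proof. by apply/rowP => j; rewrite mxE (@mcoeff_pol m n R) -[RHS]rc_mon rc_opE /cut. Qed.

Lemma pol_rw (l : 'I_t) p : bihom (bideg (mon l)) p -> @pol m n R (bideg (mon l)) (rc (rw p)) = p.
Proof.
move=> hp; apply/mpolyP => u; rewrite mcoeff_pol; case: eqP => e.
  by rewrite rc_cr // (mdeg_bideg e) mon_lt.
by rewrite (proj1 (bihomP _ _) hp).
Qed.

Section BoxIdeal.
Context (M : 'M[B]_t) (Mop : forall o, M * op _ o * (1 - M) = 0).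

(** Polynomials with all terms outside the box belong to it, since their row is 0; it reflects [M]
    only in bidegrees inside the box. *)
Definition boxI (p : {mpoly R[N]}) : Prop := rw p *m M = rw p.

Lemma op_stable o (r : 'rV[B]_t) : r *m M = r -> r *m op _ o *m M = r *m op _ o.
Proof.
move=> hr; have := Mop o; rewrite mulrBr mulr1 => /subr0_eq e.
by rewrite -hr -!mulmxA; congr (_ *m _); rewrite mulmxA; apply/esym.
Qed.

Lemma boxI_ideal : ideal boxI.
Proof.
have I0 : boxI 0.
  by rewrite /boxI (_ : rw 0 = 0) ?mul0mx //; apply/rowP => j; rewrite !mxE mcoeff0.
have ID p q : boxI p -> boxI q -> boxI (p + q).
  by rewrite /boxI rwD mulmxDl => -> ->.
split=> // p; elim/mpoly_ind_X: p => [|a p p' h1 h2|v] q hq; first by rewrite mul0r.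
  rewrite mulrDl; apply: ID; last exact: h2.
  by rewrite -scalerAl /boxI rwZ -scalemxAl (h1 q hq).
pose C (p : {mpoly R[N]}) := forall q, boxI q -> boxI (p * q).
suff : C 'X_[v] by apply.
rewrite mpolyXE_id; elim/big_ind: _ => [q' hq'|x y hx hy q' hq'|l _].
- by rewrite mul1r.
- by rewrite -mulrA; apply/hx/hy.
elim: (v l) => [|r IH] q' hq'; first by rewrite expr0 mul1r.
by rewrite exprS -mulrA /boxI rwX; apply/op_stable/IH.
Qed.

End BoxIdeal.

Lemma KI_mul (D : datum m n B) (r : 'rV[B]_t) P : (forall j, KI J D (row j P)) -> KI J D (r *m P).
Proof.
move=> hP d hA; have -> : hA = hB by apply: Prop_irrelevance.
have -> : @pol m n R d (cut d (rc (r *m P))) = \sum_i (r 0 i : R) *: @pol m n R d (cut d (rc (row i P))).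
  apply/mpolyP => u; rewrite mcoeff_pol raddf_sum /=; case: eqP => e.
    rewrite /cut e eqxx rc_mul; apply: eq_bigr => i _.
    by rewrite mcoeffZ mcoeff_pol e eqxx.
  by rewrite big1 // => i _; rewrite mcoeffZ mcoeff_pol; case: eqP => // _; rewrite mulr0.
apply: lin_sum; first exact: CI_lin.
by move=> i _; apply: linZ; [exact: CI_lin|apply: hP].
Qed.

Lemma KI_rw (D : datum m n B) (l : 'I_t) p : bihom (bideg (mon l)) p -> KI J D (rw p) -> CI J (nzd hB D) p.
Proof.
move=> hp /(_ (bideg (mon l)) hB).
suff -> : @pol m n R (bideg (mon l)) (cut (bideg (mon l)) (rc (rw p))) = p by [].
rewrite -[RHS](pol_rw hp); apply/mpolyP => u; rewrite !mcoeff_pol.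
by case: eqP => // e; rewrite /cut e eqxx.
Qed.

Context (R0 : comPzRingType) (f : {rmorphism B -> R0}).
Hypothesis sq : forall a b, f a = 0 -> f b = 0 -> a * b = 0.
Context (D : datum m n B) (M Q : 'M[B]_t).
Hypotheses (MM : M * M = M) (Mop : forall o, M * op _ o * (1 - M) = 0).
Hypotheses (Q1 : forall j, KI J D (row j Q)) (Q2 : forall r, KI J D r -> r *m Q = r).
Hypotheses (QM : map_mx f (Q * (1 - M)) = 0) (MQ : map_mx f (M * (1 - Q)) = 0).

Local Notation E := (nzd hB D).
Let hI := boxI_ideal Mop.
Let lI := ideal_lin hI.
Let lC := @CI_lin m n J R E.

Lemma CI_rw (l : 'I_t) p : bihom (bideg (mon l)) p -> CI J E p <-> rw p *m Q = rw p.
Proof.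
move=> hp; split=> h.
  apply: Q2; apply: (KI_cr (d := bideg (mon l))); first exact: (proj1 (bihomP _ _) hp).
  move=> hA; have -> : hA = hB by apply: Prop_irrelevance.
  by rewrite polE.
by apply: (KI_rw hp); rewrite -h; apply: KI_mul.
Qed.

Lemma small_coords (l : 'I_t) (r : 'rV[B]_t) : map_mx f r = 0 ->
  exists a : {ffun 'I_(size (stds J (bideg (mon l)))) -> R}, (forall i, f (a i) = 0) /\
    CI J E (@pol m n R (bideg (mon l)) (rc r) - comb (cstdb (J := J) E (d := bideg (mon l))) a).
Proof.
move=> hr; set d := bideg (mon l); have [hb hspan] := CI_basis J E d.
have /choice[al hal] : forall u, exists a : {ffun 'I_(size (stds J d)) -> R},
    bideg u = d -> CI J E ('X_[u] - comb (cstdb (J := J) E (d := d)) a).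
  move=> u; have [e|ne] := eqVneq (bideg u) d; last by exists 0 => /eqP; rewrite (negPf ne).
  by have [a [ha _]] := hspan 'X_[u] (bihomX' e); exists a.
have fr u : f (rc r u) = 0.
  by rewrite -rc_map hr /rc big1 // => j _; rewrite mxE.
exists [ffun i => \sum_(u <- mons m n d) (rc r u : R) * al u i]; split=> [i|].
  by rewrite ffunE rmorph_sum big1 // => u _; rewrite rmorphM fr mul0r.
have -> : comb (cstdb (J := J) E (d := d)) [ffun i => \sum_(u <- mons m n d) (rc r u : R) * al u i] =
    \sum_(u <- mons m n d) (rc r u : R) *: comb (cstdb (J := J) E (d := d)) (al u).
  under [RHS]eq_bigr => u _ do rewrite scaler_sumr.
  rewrite exchange_big; apply: eq_bigr => j _; rewrite ffunE scaler_suml.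
  by apply: eq_bigr => u _; rewrite scalerA.
rewrite /pol -sumrB big_seq; apply: lin_sum => // u; rewrite mem_mons => /eqP hu.
by rewrite -scalerBr; apply: linZ => //; apply: hal.
Qed.

Lemma small_comb d (b : 'I_(size (stds J d)) -> {mpoly R[N]}) (a : {ffun 'I_(size (stds J d)) -> R}) :
  (forall i, f (a i) = 0) -> map_mx f (rw (comb b a)) = 0.
Proof.
move=> ha; apply/rowP => j; rewrite !mxE /comb raddf_sum rmorph_sum big1 // => i _.
by rewrite /= mcoeffZ rmorphM ha mul0r.
Qed.

(** Modulo the kernel of [f], [M] and [Q] have the same image. Passing from one ideal to the other
    costs an error with coordinates in the kernel, and products of two such errors vanish, so a
    basis for the quotient by one ideal is a basis for the other. *)
Lemma near_basis (l : 'I_t) : basis (boxI M) (bideg (mon l)) (cstdb (J := J) E (d := bideg (mon l))).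
Proof.
set d := bideg (mon l); set b := (cstdb (J := J) E (d := d)); have [hb hspan] := CI_basis J E d.
have r0 (r : 'rV[B]_t) (P P' : 'M[B]_t) : map_mx f r = 0 -> map_mx f (P * P') = 0 -> r *m P *m P' = 0.
  by move=> h1 h2; rewrite -mulmxA; apply: (map0_mul sq h1); exact: h2.
apply: basisI => // [p hp|a ha].
  have [a [ha _]] := hspan p hp; set p1 := p - comb b a in ha.
  have hp1 : bihom d p1 by apply: bihomB => //; apply: comb_bihom.
  have c1 := proj1 (CI_rw hp1) ha; set c := rw p1 in c1.
  (* [c] is fixed by [Q], so its defect [e] with respect to [M] vanishes under [f]. Expanding [e] in
     the basis leaves a remainder [k1] that vanishes under [f] as well and lies in both ideals. *)
  pose e := c *m (1 - M) *m op _ (inr l).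
  have fe : map_mx f e = 0.
    have ce : c *m (1 - M) = c *m (Q *m (1 - M)) by rewrite mulmxA c1.
    by rewrite /e ce map_mxM map_mxM (QM : map_mx f (Q *m (1 - M)) = 0) mulmx0 mul0mx.
  have [a1 [fa1 ca1]] := small_coords l fe; rewrite -/d -/b in a1 fa1 ca1.
  exists (a + a1); set k1 := pol _ _ - _ in ca1.
  have hk1 : bihom d k1 by apply: bihomB; [exact: bihom_pol|apply: comb_bihom].
  have k1Q := proj1 (CI_rw hk1) ca1.
  have fk1 : map_mx f (rw k1) = 0.
    by rewrite /k1 rwD rwN rw_pol map_mxB map_mxM (small_comb _ fa1) subr0 fe mul0mx.
  have k1I : boxI M k1.
    have := r0 _ _ _ fk1 QM; rewrite k1Q mulmxBr mulmx_one => /subr0_eq e1.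
    by rewrite /boxI -e1.
  have c2 : boxI M (@pol m n R d (rc (c *m M))).
    by rewrite /boxI rw_pol; apply: op_stable => //; rewrite -mulmxA -[M *m M]/(M * M) MM.
  have -> : p - comb b (a + a1) = @pol m n R d (rc (c *m M)) + k1.
    have -> : comb b (a + a1) = comb b a + comb b a1.
      by rewrite -big_split; apply: eq_bigr => i _; rewrite !ffunE scalerDl.
    rewrite opprD addrA -/p1 /k1 addrA; congr (_ - _); rewrite -[LHS](pol_rw hp1) -/c.
    apply/mpolyP => u; rewrite mcoeffD !(@mcoeff_pol m n R) -/d; case: eqP => [eu|]; last by rewrite addr0.
    have -> : rc e u = rc (c *m (1 - M)) u by rewrite /e rc_opE /cut eu eqxx.
    by rewrite -rcD -mulmxDr addrCA subrr addr0 mulmx_one.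
  exact: linD.
have hba : bihom d (comb b a) by apply: comb_bihom.
set r := rw (comb b a); have hr : r *m M = r := ha.
pose v := r *m (1 - Q) *m op _ (inr l).
have fv : map_mx f v = 0.
  have rv : r *m (1 - Q) = r *m (M *m (1 - Q)) by rewrite mulmxA hr.
  by rewrite /v rv map_mxM map_mxM (MQ : map_mx f (M *m (1 - Q)) = 0) mulmx0 mul0mx.
have [a1 [fa1 ca1]] := small_coords l fv; rewrite -/d -/b in a1 fa1 ca1.
have eq1 : @pol m n R d (rc (r *m Q)) = comb b a - @pol m n R d (rc v).
  rewrite -[comb b a](pol_rw hba) -/r; apply/mpolyP => u; rewrite mcoeffB !(@mcoeff_pol m n R) -/d.
  case: eqP => [eu|]; last by rewrite subr0.
  have -> : rc v u = rc (r *m (1 - Q)) u by rewrite /v rc_opE /cut eu eqxx.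
  have -> : rc r u = rc (r *m Q) u + rc (r *m (1 - Q)) u.
    by rewrite -rcD -mulmxDr addrCA subrr addr0 mulmx_one.
  by rewrite addrK.
have CQ : CI J E (@pol m n R d (rc (r *m Q))).
  have hq : bihom d (@pol m n R d (rc (r *m Q))) by apply: bihom_pol.
  apply: (proj2 (CI_rw hq)); rewrite rw_pol; apply: Q2; apply: KI_op; exact: KI_mul.
have aa : a - a1 = 0.
  apply: (basis0 lC (CI_basis J E d)); rewrite combB -/b.
  have -> : comb b a - comb b a1 = @pol m n R d (rc (r *m Q)) + (@pol m n R d (rc v) - comb b a1).
    by rewrite eq1 addrA subrK.
  exact: linD.
have fr : map_mx f r = 0.
  apply: small_comb => i; have /ffunP/(_ i) := aa; rewrite !ffunE => /subr0_eq ->; exact: fa1.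
have rQ : r *m Q = r.
  by have := r0 _ _ _ fr MQ; rewrite hr mulmxBr mulmx_one => /subr0_eq.
by apply: (basis0 lC (CI_basis J E d)); apply/(CI_rw hba).
Qed.

Lemma box_or d : d \in D2 -> (exists l : 'I_t, bideg (mon l) = d) \/ forall u : 'X_{1..N}, bideg u <> d.
Proof.
move=> dD; have [[u eu]|nu] := pselect (exists u : 'X_{1..N}, bideg u = d); last first.
  by right=> u eu; apply: nu; exists u.
left; have hu : (mdeg u < 5)%N.
  have -> : mdeg u = (`|d.1| + `|d.2|)%N by rewrite -eu mdegE big_split_ord.
  have /allP/(_ d dD) // : all (fun d : int * int => (`|d.1| + `|d.2| < 5)%N) D2 by [].
by have [l el] := mon_surj hu; exists l; rewrite el.
Qed.

Lemma near_basis2 d : d \in D2 -> basis (boxI M) d (cstdb (J := J) E (d := d)).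
Proof.
case/box_or => [[l <-]|nu]; first exact: near_basis.
have [hb _] := CI_basis J E d; apply: basisI => // [p hp|a _].
  exists 0; rewrite comb0 subr0 (bihomE hp) big_seq big1 => [|u]; first by case: lI.
  by rewrite mem_mons => /eqP/nu.
apply/ffunP => i; have : nth 0%MM (stds J d) i \in stds J d by apply: mem_nth.
by rewrite mem_stds => /andP[_ /eqP/nu].
Qed.

(** In coordinates of the chart [D], the ideal cut out by [M] satisfies [near], so [near_datum] puts
    an explicit ideal inside it, and equality of ranks does the rest. *)
Theorem near_lift : exists D' : datum m n B, forall (l : 'I_t) p, bihom (bideg (mon l)) p ->
  (boxI M p <-> CI J (nzd hB D') p).
Proof.
have v : invp (dG E) (dH E) by split; [exact: dG_blk|exact: dH_blk|exact: dGH|exact: dHG].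
have [v1 v2 v3 v4] := v.
have hn : near J (tr (boxI M) (dH E)).
  split; first exact: ideal_act.
    by move=> d dD; eexists; apply: (basis_act lI v1 v2 v3 v4 (near_basis2 dD)).
  move=> d dD; have dD2 : d \in D2 by rewrite mem_cat dD.
  apply: basis_good; first exact/ideal_lin/ideal_act.
  have := basis_act lI v1 v2 v3 v4 (near_basis2 dD2).
  by congr basis; apply/funext => j; rewrite /cstdb actM v4 act1.
have [D1' hD] := near_datum hn.
have [d1 d2 d3 d4] := invpM v (And4 (dG_blk D1') (dH_blk D1') (dGH D1') (dHG D1')).
pose D' : datum m n B := @Datum m n B (dG E *m dG D1') (dH D1' *m dH E) (dt D1') d1 d2 d3 d4.
have le p : CI J (nzd hB D') p -> boxI M p.
  move=> hp; have : tr (boxI M) (dH E) (act (dG E) p).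
    apply: (CI_gen _ hD); first exact: ideal_act.
    by move: hp; rewrite /CI /cnf actM.
  by rewrite /tr actM v3 act1.
exists D' => l p hp; split; last exact: le.
exact: (basis_sub (@CI_lin m n J R _) lI (CI_basis J (nzd hB D') _) (near_basis l) (fun q _ => @le q) hp).
Qed.

End NearAlgebra.

(** * The lifted family *)

Section LiftFamily.
Context (k : closedFieldType) (m n : nat) (J : borel m n) (h : int * int -> nat).
Hypothesis hJ : forall d, size (stds J d) = h d.
Context (Y0 Y : scheme k) (i : morphism Y0 Y) (ti : affine_thickening i).
Context (F0 : hilb_family m n h Y0) (hF0 : chartable J F0).
Local Notation T := (open_setT Y).
Local Notation A := (sections (open_setT Y)).
Local Notation t := (nbx m n).
Local Notation ic := (comorT i).
Local Notation rT V := (res (fun (x : Y) (_ : oset V x) => Logic.I : oset T x)).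
Context (M : 'M[A]_t) (MM : M * M = M) (Mop : forall o, M * op _ o * (1 - M) = 0).
Hypothesis hM : projects F0 (map_mx ic M).
Implicit Types V W : open_set Y.

(** The explicit ideal of [D] is the image of [M] in the bidegrees of the box. The generators live
    there, so two such charts agree in all bidegrees, which is [lchart_compat]. *)
Definition lchart V (D : datum m n (sections V)) : Prop :=
  forall (l : 'I_t) (c : 'X_{1..m + n} -> sections V), hom0 (bideg (mon l)) c ->
    (inCI J D (bideg (mon l)) c <-> cr c *m map_mx (rT V) M = cr c).

Lemma Mop_res V o : map_mx (rT V) M * op _ o * (1 - map_mx (rT V) M) = 0.
Proof. by have := congr1 (map_mx (rT V)) (Mop o); rewrite map_mx0 !mapM map1B map_op. Qed.

Lemma cr_cut (B : comPzRingType) (r : 'rV[B]_t) (l : 'I_t) :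
  cr (cut (bideg (mon l)) (rc r)) = r *m op _ (inr l).
Proof. by apply/rowP => j; rewrite mxE -[RHS]rc_mon rc_opE. Qed.

Lemma rw_pol_cr (B : comPzRingType) (hB : (1 : B) != 0) d c : hom0 d c -> rw (@pol m n (nzr hB) d c) = cr c.
Proof. by move=> hc; apply/rowP => j; rewrite !mxE (@polK m n (nzr hB)). Qed.

Lemma rw_map (B B' : comPzRingType) (hB : (1 : B) != 0) (hB' : (1 : B') != 0) (f : {rmorphism B -> B'})
    (q : {mpoly (nzr hB)[m + n]}) :
  rw (map_mpoly (f : {rmorphism nzr hB -> nzr hB'}) q) = map_mx f (rw q).
Proof. by apply/rowP => j; rewrite /rw /cr [LHS]mxE mcoeff_map_mpoly [RHS]mxE [in RHS]mxE. Qed.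

Lemma inCI_iff (B : comPzRingType) (hB : (1 : B) != 0) (D : datum m n B) d c :
  inCI J D d c <-> CI J (nzd hB D) (@pol m n (nzr hB) d c).
Proof.
by split=> [|hc hA]; [apply|have -> : hA = hB by apply: Prop_irrelevance].
Qed.

Lemma lchart_res V W (hWV : W `<=` V) (D : datum m n (sections V)) : lchart D ->
  forall (l : 'I_t) c, hom0 (bideg (mon l)) c -> cr c *m map_mx (rT W) M = cr c ->
    inCI J (map_datum (res hWV) D) (bideg (mon l)) c.
Proof.
move=> hD l c hc ec; set d := bideg (mon l); set MV := map_mx (rT V) M.
have MMV : MV * MV = MV by rewrite /MV -mapM MM.
have hg j : inCI J D d (cut d (rc (row j MV))).
  apply/hD; first exact: cut_hom.
  rewrite cr_cut; apply: op_stable; first exact: Mop_res.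
  by rewrite -row_mul -[MV *m MV]/(MV * MV) MMV.
have eMV : map_mx (res hWV) MV = map_mx (rT W) M := resK _ hWV _ M.
move=> hA; set R := nzr hA.
have -> : @pol m n R d c = \sum_j (cr c 0 j : R) *: @pol m n R d (fun u => res hWV (cut d (rc (row j MV)) u)).
  apply/mpolyP => u; rewrite mcoeff_pol raddf_sum /=; case: eqP => e; last first.
    by rewrite big1 // => j _; rewrite mcoeffZ mcoeff_pol; case: eqP => // _; rewrite mulr0.
  have hu : (mdeg u < 5)%N by rewrite (mdeg_bideg e) mon_lt.
  rewrite -(rc_cr c hu) -ec rc_mul ec; apply: eq_bigr => j _.
  by rewrite mcoeffZ mcoeff_pol e eqxx /cut e eqxx -rc_map map_row eMV.
apply: lin_sum; first exact: CI_lin.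
move=> j _; apply: linZ; first exact: CI_lin.
exact: (inCI_map (res hWV) (hg j)).
Qed.

Lemma cgen_row (B : comPzRingType) (hB : (1 : B) != 0) (D : datum m n B) q : cgen J (nzd hB D) q ->
  q = 0 \/ exists l : 'I_t, bihom (bideg (mon l)) q.
Proof.
move=> /bihom_cgen[d dD hd]; have dD2 : d \in D2 by rewrite mem_cat dD.
have [[l el]|nu] := box_or m n dD2; first by right; exists l; rewrite el.
left; rewrite (bihomE hd) big_seq big1 // => u; by rewrite mem_mons => /eqP/nu.
Qed.

Lemma lchart_cgen V (hV : (1 : sections V) != 0) (D : datum m n (sections V)) q (l : 'I_t) : lchart D ->
  cgen J (nzd hV D) q -> bihom (bideg (mon l)) q -> rw q *m map_mx (rT V) M = rw q.
Proof.
move=> hD hq hl; have hc : hom0 (bideg (mon l)) (fun u => q@_u : sections V).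
  exact: (proj1 (bihomP _ _) hl).
apply/(hD l _ hc)/(inCI_iff hV); rewrite polE //; exact: CI_cgen.
Qed.

Lemma lchart_compat V (D : datum m n (sections V)) V' (D' : datum m n (sections V')) : lchart D -> lchart D' ->
  forall W (hV : W `<=` V) (hV' : W `<=` V') d (c : 'X_{1..m + n} -> sections W), homog_section d c ->
    inCI J (map_datum (res hV) D) d c -> inCI J (map_datum (res hV') D') d c.
Proof.
move=> hD hD' W hV hV' d c _ hc hA; have h1 := nz_map (res hV) hA.
apply: CI_gen (hc hA); first exact: CI_ideal.
move=> p; rewrite (nzd_map (res hV) h1) => /map_cgen[q hq ->].
have [->|[l hl]] := cgen_row hq; first by rewrite rmorph0; have [] := CI_ideal J (nzd hA (map_datum (res hV') D')).
have eq := lchart_cgen hD hq hl.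
pose rV : {rmorphism nzr h1 -> nzr hA} := res hV.
have hl' : bihom (bideg (mon l)) (map_mpoly rV q).
  apply/bihomP => u hu; rewrite mcoeff_map_mpoly (proj1 (bihomP _ _) hl) //; exact: rmorph0.
rewrite -(polE hl'); apply/(inCI_iff hA)/lchart_res => //; first exact: (proj1 (bihomP _ _) hl').
have eM : map_mx (res hV) (map_mx (rT V) M) = map_mx (rT W) M := resK _ hV _ M.
have -> : cr (fun u => (map_mpoly rV q)@_u : sections W) = map_mx (res hV) (rw q) := rw_map hA (res hV) q.
by rewrite -[in RHS]eq map_mxM eM.
Qed.

Lemma lchart_exists (y0 : Y0) : exists a (D : datum m n (sections (basic a))),
  [/\ unit_at y0 (ic a), lchart D & charted J F0 (map_datum (fa i a) D)].
Proof.
have [a [ua [D [Q [cD Q1 Q2]]]]] := local_lift ti hF0 y0.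
have By0 : basic (ic a) y0 by split.
have hB0 : (1 : sections (basic (ic a))) != 0 by apply/eqP; have [] := scheme_local By0.
have hB := nz_map (fa i a) hB0.
have Q2' := chart_row Q2.
set Ma := map_mx (res (@basic_sub k Y T a)) M.
have eMa : map_mx (rT (basic a)) M = Ma by apply/matrixP => u v; rewrite !mxE; apply: res_irr.
have MMa : Ma * Ma = Ma by rewrite -mapM MM.
have Mopa o : Ma * op _ o * (1 - Ma) = 0 by rewrite -eMa; apply: Mop_res.
have [D' hD'] := near_lift hB (fa_sq ti (a := a)) MMa Mopa Q1 Q2'
  (chart_near1 hM cD Q1) (chart_near2 hM cD Q2).
have lD' : lchart D'.
  move=> l c hc; rewrite (inCI_iff hB) -(hD' l); last exact: bihom_pol.
  by rewrite /boxI rw_pol_cr // eMa.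
exists a, D'; split=> //; set B0 := sections (basic (ic a)).
pose fz : {rmorphism nzr hB -> nzr hB0} := fa i a.
have le p : CI J (nzd hB0 (map_datum (fa i a) D')) p -> CI J (nzd hB0 (map_datum (fa i a) D)) p.
  apply: CI_gen; first exact: CI_ideal.
  move=> p'; rewrite (nzd_map (fa i a) hB) => /map_cgen[q hq ->].
  have [->|[l hl]] := cgen_row hq; first by rewrite rmorph0; have [] := CI_ideal J (nzd hB0 (map_datum (fa i a) D)).
  have eq := lchart_cgen lD' hq hl.
  have hl' : bihom (bideg (mon l)) (map_mpoly fz q).
    apply/bihomP => u hu; rewrite mcoeff_map_mpoly (proj1 (bihomP _ _) hl) //; exact: rmorph0.
  apply: (KI_rw hl'); apply/(KF_charted_self cD).
  have -> : rw (map_mpoly fz q) = map_mx (fa i a) (rw q) := rw_map hB0 (fa i a) q.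
  rewrite eMa in eq; rewrite -eq map_mxM fa_res_mx; apply: KF_mul => j; rewrite -map_row; apply: KF_res.
  by have [h1 _] := hM; apply: h1.
have ge d p : bihom d p -> CI J (nzd hB0 (map_datum (fa i a) D)) p -> CI J (nzd hB0 (map_datum (fa i a) D')) p.
  exact: (basis_sub (@CI_lin m n J _ _) (@CI_lin m n J _ _) (CI_basis J _ d) (CI_basis J _ d) (fun q _ => @le q)).
have eqv d c : inCI J (map_datum (fa i a) D) d c <-> inCI J (map_datum (fa i a) D') d c.
  by rewrite !(inCI_iff hB0); split=> [|/le //]; apply: ge; apply: bihom_pol.
move=> W hW d c hc; apply: (iff_trans (cD W hW d c hc)); split.
  exact (@inCI_le_map m n J _ _ (res hW) _ _ (fun d' c' _ => proj1 (eqv d' c')) d c).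
exact (@inCI_le_map m n J _ _ (res hW) _ _ (fun d' c' _ => proj2 (eqv d' c')) d c).
Qed.

Theorem lift_family : exists F : hilb_family m n h Y, is_pullback i F F0.
Proof.
have cov (y : Y) : exists V (D : datum m n (sections V)), oset V y /\ lchart D.
  have [y0 <-] := thickening_surj ti y; have [a [D [ua hD _]]] := lchart_exists y0.
  by exists (basic a), D; split=> //; apply: (@basic_pre k Y0 Y i a); split.
have [F hF] := glue_family hJ cov lchart_compat; exists F.
apply: (pullback_charted (J := J)) => y0; have [a [D [ua hD cD]]] := lchart_exists y0.
exists (basic a), D, (basic (ic a)), (@basic_pre k Y0 Y i a); split=> //; exact: hF.
Qed.

End LiftFamily.

(** The classifying morphism of the lifted family is the required extension; it restricts to [f0]
    because classifying morphisms are unique. *)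
Theorem hilbert_formally_smooth (k : closedFieldType) (m n : nat) (J : borel m n) (h : int * int -> nat)
    (H : scheme k) (I : hilb_family m n h H) : (forall d, size (stds J d) = h d) ->
  (forall (Z : scheme k) (K : hilb_family m n h Z), exists f : morphism Z H,
    is_pullback f I K /\ forall g : morphism Z H, is_pullback g I K -> same_morphism f g) ->
  chartable J I -> formally_smooth H.
Proof.
move=> hJ univ hI Y0 Y i f0 ti.
have [F0 [p0 _]] := pullback_exists hJ f0 hI; have hF0 := pull_chartable hJ hI p0.
have [M [MM Mop hM]] := lifted_projector ti hF0.
have [F hF] := lift_family hJ ti hF0 MM Mop hM.
have [f [hf _]] := univ Y F; exists f.
have [g [_ ug]] := univ Y0 F0; have [a1 a2] := ug _ p0.
have [b1 b2] := ug _ (comp_pullback hJ hI hf hF).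
split=> [y|U V W hg hff he s]; first by rewrite -[LHS]b1 a1.
have hc : W `<=` compm f i @^-1` U by move=> z /hff /hg.
have hgg : W `<=` g @^-1` U by move=> z /he; rewrite /preimage /= a1.
by rewrite -(a2 _ _ hgg he) (b2 _ _ hgg hc) [RHS](compm_comorE (g := f) (f := i) hc hg hff).
Qed.

(** * Irreducibility, and the case of the unit ideal *)

Lemma is_comp_of_same (k : fieldType) (Y Z X : scheme k) (f : morphism Z X) (i : morphism Y Z)
    (e g : morphism Y X) : same_morphism g e -> same_morphism g (compm f i) -> is_comp f i e.
Proof.
move=> [a1 a2] [b1 b2]; split=> [y|U V W hg hff he s]; first by rewrite -[LHS]b1 a1.
have hc : W `<=` compm f i @^-1` U by move=> z /hff /hg.
have hgg : W `<=` g @^-1` U by move=> z /he; rewrite /preimage /= a1.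
by rewrite -(a2 _ _ hgg he) (b2 _ _ hgg hc) [RHS](compm_comorE (g := f) (f := i) hc hg hff).
Qed.

(** A local section shows that the preimage under [phi] of a nonempty open set is nonempty, hence
    contains the generic point [eta]. So the image of [eta] lies in every nonempty open set of
    [H]. *)
Lemma sections_irreducible (k : fieldType) (m n : nat) (H : scheme k) (phi : morphism (Z0 m n k) H) :
  (forall x : H, exists (V : open_set H) (tau : morphism (subscheme V) (Z0 m n k)),
    V x /\ is_comp phi tau (sub_incl V)) ->
  [set: H] !=set0 -> irreducible_space H.
Proof.
move=> hphi ne; split=> // U V oU oV [x Ux] [y Vy].
have key (O : open_set H) (z : H) : O z -> O (phi (eta (pdelta0 m n k))).
  move=> Oz; have [W [tau [Wz [c1 _]]]] := hphi z.
  have hz : preim_open phi O (tau (exist _ z Wz : subscheme W)).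
    by have := c1 (exist _ z Wz : subscheme W); rewrite /preim_open /= /preimage /= => ->.
  exact: (eta_in (pdelta0 m n k) hz).
exists (phi (eta (pdelta0 m n k))); split; first exact: (key (OpenSet oU) x).
exact: (key (OpenSet oV) y).
Qed.

Lemma cartwright_sturmfels_radical (k : fieldType) (m n : nat) (h : int * int -> nat) :
  cartwright_sturmfels k m n h ->
  forall M : 'X_{1..m + n} -> Prop, hset h M -> forall u r, M (u *+ r)%MM -> M u.
Proof.
move=> cs M [up hM] u r Mur; pose I : set {mpoly k[m + n]} := monI M.
have hI : homogeneous_ideal I.
  split; first split.
  - by move=> w; rewrite msupp0.
  - by move=> f g hf hg w /msuppD_le; rewrite mem_cat => /orP[/hf|/hg].
  - move=> f g hg w /msuppM_le/allpairsP[[v1 v2] /= [_ h2 ->]]; apply: up; exact: hg.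
  move=> f d hf w hw; apply: hf; move: hw; apply: contraTT; rewrite !mcoeff_msupp !negbK => /eqP e.
  rewrite /component raddf_sum /= big1_seq // => v /andP[_ hv].
  rewrite mcoeffZ mcoeffX; case: eqP => [ev|_]; last by rewrite mulr0.
  by rewrite ev e mul0r.
have hh : has_hilbert_function I h by move=> d; exists (sbasis k M d (r := h d)); apply: monI_basis.
have rad := cs I hI hh 'X_[u] r.
apply: rad; last by rewrite msuppX inE.
by move=> w; rewrite mpolyXn msuppX inE => /eqP ->.
Qed.

(* The case [h 0 = 0], where [h = 0] and the unit ideal is the only one: [H]
   represents the functor with one element. *)
Section UnitIdeal.
Context (k : closedFieldType) (m n : nat) (h : int * int -> nat) (h0 : h 0 = 0%N).
Local Notation N := (m + n)%N.

Lemma no_ord (j : 'I_(h 0)) : False.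
Proof. by case: j => j; rewrite h0. Qed.

Lemma bideg_mnm0 : bideg (0%MM : 'X_{1..N}) = 0.
Proof. by rewrite /bideg !big1 // => i _; rewrite mnm0E. Qed.

Lemma delta_sum (A : comPzRingType) d (c : 'X_{1..N} -> A) u : (forall w, bideg w <> d -> c w = 0) ->
  c u = \sum_(t <- mons m n d) c t * (u == t)%:R.
Proof.
move=> hc; have [e|ne] := eqVneq (bideg u) d.
  rewrite (bigD1_seq u) ?uniq_mons ?mem_mons ?e //= eqxx mulr1 big1 ?addr0 // => t ne.
  by rewrite eq_sym (negPf ne) mulr0.
rewrite hc; last exact/eqP.
rewrite big_seq big1 // => t; rewrite mem_mons => /eqP et; case: eqP => [eu|_]; last by rewrite mulr0.
by case/eqP: ne; rewrite eu.
Qed.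

Lemma mulmon_one (A : comPzRingType) (t u : 'X_{1..N}) :
  mulmon t (fun w : 'X_{1..N} => (w == 0%MM)%:R : A) u = (u == t)%:R.
Proof.
rewrite /mulmon; have [/forallP ht|nt] := boolP [forall i, (t i <= u i)%N].
  have e : u = ((u - t) + t)%MM by rewrite submK //; apply/mnm_lepP.
  have -> // : ((u - t)%MM == 0%MM) = (u == t).
  apply/eqP/eqP => [e0|->]; first by rewrite e e0 add0m.
  by apply/mnmP => i; rewrite mnmBE subnn mnm0E.
by case: eqP => // e; case/negP: nt; apply/forallP => i; rewrite e.
Qed.

(** Rank 0 in bidegree 0 puts the constant 1 in the family locally, and with it all monomials. *)
Lemma fam_full (Z : scheme k) (F : hilb_family m n h Z) d (W : open_set Z)
    (c : 'X_{1..N} -> sections W) : homog_section d c -> F d W c.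
Proof.
move=> hc; apply: (fam_local hc) => z Wz.
have [U [b [Uz b1 b2]]] := fam_locally_free F 0 z.
pose W' := opI W U; have hW : W' `<=` W := @opIl _ _ W U; have hU : W' `<=` U := @opIr _ _ W U.
exists W', hW; split=> //.
pose one (u : 'X_{1..N}) : sections W' := (u == 0%MM)%:R.
have hone : homog_section 0 one.
  by move=> u hu; rewrite /one; case: eqP => // e; case: hu; rewrite e bideg_mnm0.
have [a [ha _]] := b2 W' hU one hone.
have Fone : F 0 W' one.
  by move: ha; congr (F 0 W' _); apply/funext => u; rewrite big1 ?subr0 // => j; case: (no_ord j).
have : F d W' (fun u => \sum_(t <- mons m n d) (if bideg t == d then res hW (c t) * mulmon t one u else 0)).
  apply: fam_sum => t; case: eqP => [et|_]; last exact: fam0.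
  by have := famZ (res hW (c t)) (famM t Fone); rewrite add0r et.
congr (F d W' _); apply/funext => u; rewrite [RHS](delta_sum u (homog_res hW hc)).
rewrite [LHS]big_seq [RHS]big_seq; apply: eq_bigr => t; rewrite mem_mons => ->.
by rewrite mulmon_one.
Qed.

(** As every section belongs to the family, the coordinate vectors 0 and 1 represent the same
    element; their uniqueness would give [1 = 0] near [z] if [h d] were positive. *)
Lemma hilbert_zero (Z : scheme k) (F : hilb_family m n h Z) (z : Z) d : h d = 0%N.
Proof.
apply/eqP; rewrite -leqn0 leqNgt; apply/negP => hd.
have [U [b [Uz b1 b2]]] := fam_locally_free F d z; have hU : U `<=` U by [].
have [a [_ ua]] := b2 U hU (fun=> 0) (fun _ _ => erefl).
have full (a' : {ffun 'I_(h d) -> sections U}) : F d U (fun u => 0 - \sum_i a' i * res hU (b i u)).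
  by apply: fam_full => u hu; rewrite big1 ?subr0 // => j _; rewrite b1 // rmorph0 mulr0.
have e1 := ua 0 (full _); have e2 := ua [ffun=> 1] (full _).
have /ffunP/(_ (Ordinal hd)) : 0 = [ffun=> 1] :> {ffun 'I_(h d) -> sections U} by rewrite -e1 -e2.
by rewrite !ffunE => e; have [/(_ (esym e))] := scheme_local Uz.
Qed.

Lemma full_family (Z : scheme k) : (forall d, h d = 0%N) -> hilb_family m n h Z.
Proof.
move=> hz; refine (@HilbFamily k m n h Z (fun d U c => homog_section d c) _ _ _ _ _ _ _ _) => //.
- by move=> d U c c' hc hc' u hu; rewrite hc // hc' // addr0.
- by move=> d U a c hc u hu; rewrite hc // mulr0.
- move=> d U v c hc u hu; rewrite /mulmon; case: ifP => // /forallP hv; apply: hc => e; apply: hu.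
  have -> : u = ((u - v) + v)%MM by rewrite submK //; apply/mnm_lepP.
  by rewrite bidegD e.
- by move=> d U V hVU c hc; apply: homog_res.
move=> d z; exists (open_setT Z), (fun _ _ => 0); split=> // W hW c hc.
have no (j : 'I_(h d)) : False by case: j => j; rewrite hz.
exists 0; split=> [u hu|a _]; last by apply/ffunP => j; case: (no j).
by rewrite hc // big1 ?subr0 // => j; case: (no j).
Qed.

Lemma pullback_full (Z X : scheme k) (f : morphism Z X) (I : hilb_family m n h X) (K : hilb_family m n h Z) :
  is_pullback f I K.
Proof.
move=> d W c; split=> [hc|[hc _]]; last exact: fam_full.
split; first exact: fam_homog hc.
move=> z Wz; exists (open_setT X), W, (fun _ x => x), (fun _ _ => Logic.I), (size (mons m n d)).
exists (fun i => c (nth 0%MM (mons m n d) i)), (fun i u => (u == nth 0%MM (mons m n d) i)%:R).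
split=> // [i|u].
  apply: fam_full => u hu; case: eqP => // e; case: hu; rewrite e.
  by apply/eqP; rewrite -mem_mons mem_nth.
rewrite res_id [LHS](delta_sum u (fam_homog hc)) (big_nth 0%MM) big_mkord.
by apply: eq_bigr => i _; rewrite rmorph_nat.
Qed.

Context (H : scheme k) (I : hilb_family m n h H) (x0 : H).
Hypothesis univ : forall (Z : scheme k) (K : hilb_family m n h Z), exists f : morphism Z H,
  is_pullback f I K /\ forall g : morphism Z H, is_pullback g I K -> same_morphism f g.

Let full (Z : scheme k) : hilb_family m n h Z := full_family Z (hilbert_zero I x0).

Lemma unit_formally_smooth : formally_smooth H.
Proof.
move=> Y0 Y i f0 _; have [f _] := univ (full Y); exists f.
have [g [_ ug]] := univ (full Y0).
by apply: (@is_comp_of_same _ _ _ _ _ _ _ g); apply/ug/pullback_full.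
Qed.

(** Any two morphisms from the same scheme to [H] coincide, so every morphism to [H] has sections as
    soon as there are morphisms backwards. The parameter space for [m = n = 0] is a convenient
    source, as [pdelta] is 1 there. *)
Lemma unit_sections : exists phi : morphism (Z0 0 0 k) H, forall x : H,
  exists (V : open_set H) (tau : morphism (subscheme V) (Z0 0 0 k)), V x /\ is_comp phi tau (sub_incl V).
Proof.
have [phi _] := univ (full (Z0 0 0 k)); exists phi => x; pose V := open_setT H; exists V.
pose X := subscheme V; pose y : X := exist _ x Logic.I.
have Ty : open_setT X y by [].
have hA : (1 : sections (open_setT X)) != 0 by apply/eqP; have [] := scheme_local Ty.
pose g : {rmorphism pring 0 0 k -> sections (open_setT X)} :=
  @pval 0 0 k (nzr hA) (scalar (open_setT X) : {rmorphism k -> nzr hA}) (fun=> 0).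
have gc a : g (pcst 0 0 k a) = scalar (open_setT X) a by apply: (pval_cst (A := nzr hA)).
have gd : exists t, g (pdelta 0 0 k) * t = 1.
  by exists 1; rewrite /pdelta !det_mx00 !mulr1 rmorph1.
exists (spec_morphism (@tofr_eq0 0 0 k) (pdelta0 0 0 k) gc gd); split=> //.
have [f [_ uf]] := univ (full X).
by apply: (@is_comp_of_same _ _ _ _ _ _ _ f); apply/uf/pullback_full.
Qed.

End UnitIdeal.

Local Open Scope classical_set_scope.

Theorem theorem1p2 (k : closedFieldType) (m n : nat) (h : int * int -> nat)
    (H : scheme k) :
  multigraded_hilbert_scheme m n h H ->
  [set: H] !=set0 ->
  cartwright_sturmfels k m n h ->
  smooth H /\ irreducible_space H.
Proof.
move=> [I univ] ne cs; have [x0 _] := ne.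
(* The monomial 1 is standard for every diagram [J], so the unit ideal is outside the scope of the
   charts and is treated apart. *)
have [e0|/eqP n0] := eqVneq (h 0) 0%N.
  have [phi hphi] := unit_sections e0 x0 univ.
  split; last exact: (sections_irreducible hphi ne).
  split; [exact: (fp_of_sections hphi)|exact: (unit_formally_smooth e0 x0 univ)].
have hrad := cartwright_sturmfels_radical cs.
have [J [hJ _]] := local_chart I n0 hrad x0.
have hI : chartable J I.
  move=> z; have [J' [hJ' hz]] := local_chart I n0 hrad z.
  (* The diagrams at [x0] and at [z] have the same Hilbert function and hence coincide, so all
     charts belong to one parameter space. *)
  by have -> : J = J' by apply: borel_unique => d; rewrite hJ hJ'.
have [phi hphi] := local_sections hJ univ hI.
split; last exact: (sections_irreducible hphi ne).
split; [exact: (fp_of_sections hphi)|exact: (hilbert_formally_smooth hJ univ hI)].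
Qed.
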